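(* There is an explicit genus-preserving and equivalence-preserving one-to-one correspondence between (a) open hyperelliptic graphs up to isomorphism, (b) open BY trees up to isomorphism, (c) cluster pictures up to isomorphism. Explicitly, the constructions $G\mapsto\underline{T}(G)$, $T\mapsto\underline{G}(T)$ induce mutually inverse bijections between (a) and (b), and $\Sigma\mapsto\underline{T}(\Sigma)$, $T\mapsto\underline{\Sigma}(T)$ induce mutually inverse bijections between (c) and (b). Corresponding objects have the same genus, and two objects are equivalent if and only if the objects corresponding to them are equivalent.
   Context: **Graphs.** Graphs are finite topological graphs with a chosen vertex set; loops and multiple edges are allowed, a loop counts twice in the degree. Isomorphisms of graphs are homotopy classes of homeomorphisms preserving vertices and edges (equivalently, incidence-preserving bijections of vertices and half-edges). An open edge is a half-open edge with only one endpoint in the graph (it ''goes off to $\infty$''); it counts in degrees. **Hyperelliptic graphs.** A (closed) hyperelliptic graph is a connected graph $G$ with a genus function $g:V(G)\to\mathbb{Z}_{\ge0}$ and a graph isomorphism $\iota:G\to G$, $\iota^2=1$, such that (1) vertices of non-zero genus are $\iota$-invariant; (2) genus $0$ vertices have degree $\ge3$; (3) $2g(v)+2\ge\#\{\iota\text{-invariant edges at }v\}$ for every vertex $v$; (4) the topological quotient $G/\langle\iota\rangle$ is a tree. An edge is $\iota$-invariant if $\iota$ fixes it pointwise, and $\iota$-anti-invariant if $\iota$ maps it to itself reversing its direction. Two exceptions violating (2) are also declared hyperelliptic graphs: a single genus $0$ vertex without edges, and the circle with two $\iota$-fixed genus $0$ vertices and two edges swapped by $\iota$. An open hyperelliptic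 graph is a connected graph with at least one open edge, with $g,\iota$ satisfying (1)–(3), such that $G/\langle\iota\rangle$ is a tree with a unique open edge (so $G$ has one open edge or a pair swapped by $\iota$); in addition a single genus $0$ vertex with one open edge, or with two open edges swapped by $\iota$, is declared an open hyperelliptic graph. The genus is $g(G)=\mathrm{rk}\,H_1(G,\mathbb{Z})+\sum_v g(v)$. Isomorphisms preserve vertices, edges and genera and commute with $\iota$. A closed hyperelliptic subgraph $H$ of $G$ is a closed hyperelliptic graph that as a space is an $\iota$-stable closed union of vertices and edges of $G$, whose vertices are the vertices of $G$ in $H$ except those of genus $0$ and degree $2$ in $H$ (these become interior points of edges; if $H$ is the exceptional circle, its two $\iota$-invariant points are its vertices), with genera and $\iota$ as in $G$ (the one-vertex genus $0$ exception is admitted only if $g(G)=0$). The core $\tilde G$ of an open $G$ is its unique maximal closed hyperelliptic subgraph. Two open hyperelliptic graphs are equivalent if their cores are isomorphic. **BY trees.** A (closed) BY tree is a finite tree $T$ with $g:V(T)\to\mathbb{Z}_{\ge0}$ and a colouring of vertices and edges blue/yellow such that (1) yellow vertices have genus $0$, degree $\ge3$ and only yellow edges; (2) blue vertices of genus $0$ have at least one yellow edge; (3) $2g(v)+2\ge\#\{\text{blue edges at }v\}$ for every vertex. An open BY tree is a finite tree with a unique open edge satisfying the same conditions. Genus $0$ exceptions to (2): a single blue genus $0$ vertex without edges is a BY tree, and a single blue genus $0$ vertex with a blue open edge is an open BY tree. $T_b\subset T$ is the closed blue part, $T_y=T\setminus T_b$. The genus is $g(T)=\mathrm{rk}\,H_1(T,T_b)+\sum_v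 g(v)$. Isomorphic means: homeomorphic preserving vertices, edges, genera and colours. A closed BY subtree $T'$ of $T$ is a closed BY tree that as a space is a closed union of vertices and edges of $T$, whose vertices are the vertices of $T$ in $T'$ except those of genus $0$ that in $T'$ have degree $2$ with both edges of the same colour as the vertex (these become interior points of edges), with genera as in $T$ (the one-vertex genus $0$ exception is admitted only if $g(T)=0$). The core $\tilde T$ of an open BY tree is its unique maximal closed BY subtree. Two open BY trees are equivalent if their cores are isomorphic. **Cluster pictures.** A cluster picture is a finite set $X$ with a collection $\Sigma$ of non-empty subsets (clusters) such that $X$ and every singleton are clusters, and any two clusters are disjoint or nested. It has genus $g$ if $|X|\in\{2g+1,2g+2\}$. Isomorphisms are bijections $X\to X'$ taking $\Sigma$ to $\Sigma'$. $\mathfrak{s}'<\mathfrak{s}$ (''child'') means $\mathfrak{s}'$ is a maximal cluster strictly contained in $\mathfrak{s}$. A cluster is proper if $|\mathfrak{s}|>1$ or $|\mathfrak{s}|=|X|=1$; odd/even according to its size; a proper cluster is übereven if it has no odd children (if $|X|=1$, $X$ is regarded as non-übereven of genus $0$). A non-übereven proper cluster has genus $g(\mathfrak{s})=g$ if it has $2g+1$ or $2g+2$ odd children; übereven clusters have genus $0$. Two cluster pictures are equivalent if one is isomorphic to a picture obtained from the other by finitely many moves $(X,\Sigma)\to(X',\Sigma')$ ($g$ being the genus): (i) $X'=X$, $\Sigma'=\Sigma\cup\{X\setminus\mathfrak{s}\}$ for some $\mathfrak{s}<X$, $|X|=2g+2$; (ii) $X'=X$, $\Sigma'=\Sigma\setminus\{\mathfrak{s}\}$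 for some $\mathfrak{s}<X$ with $|\mathfrak{s}|\ge2$, when $X$ has exactly two children and $|X|=2g+2$; (iii) $X'=X\sqcup\{r\}$, $\Sigma'=\Sigma\cup\{X',\{r\}\}$, when $|X|=2g+1$; (iv) $X=X'\sqcup\{r\}$, $\Sigma=\Sigma'\cup\{X,\{r\}\}$, when $|X|=2g+2$. **$\underline{T}(G)$.** $T=G/\langle\iota\rangle$; points with one preimage are blue, those with two preimages yellow. Each $\iota$-invariant vertex gives a blue vertex of the same genus, each swapped pair of vertices a yellow vertex of genus $0$, each $\iota$-invariant edge a blue edge, each swapped pair of edges a yellow edge (open edges included), and each $\iota$-anti-invariant edge from $v$ to $\iota(v)$ (possibly a loop) a yellow edge from the image of $v$ to an extra blue genus $0$ leaf (image of the midpoint). **$\underline{G}(T)$.** Glue two copies $T^\pm$ of $T$ along $T_b$; $\iota$ swaps the copies. The vertices are the preimages of the vertices of $T$ that are not genus $0$ leaves (genus $0$, degree $1$): a blue vertex has one preimage, of the same genus; a yellow one has two, of genus $0$. (So the edge from a genus $0$ leaf to $w$ yields an $\iota$-anti-invariant edge joining the preimages of $w$.) Exception: if $T$ has a single vertex, its preimage is a vertex. **$\underline{T}(\Sigma)$.** The open BY tree with one vertex $v_{\mathfrak{s}}$ for every proper cluster $\mathfrak{s}$, yellow if $\mathfrak{s}$ is übereven and blue otherwise, of genus $g(\mathfrak{s})$; for each $\mathfrak{s}'<\mathfrak{s}$ with $\mathfrak{s}'$ proper, an edge $v_{\mathfrak{s}'}v_{\mathfrak{s}}$, yellow if $\mathfrak{s}'$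 is even and blue otherwise; and an open edge at $v_X$, yellow if $X$ is even and blue otherwise. **$\underline{\Sigma}(T)$.** For vertices of an open BY tree write $v\preceq v'$ if $v'$ lies on the shortest path from $v$ to $\infty$. For each blue vertex $v$ let $X_v$ be a set of $m_v=2g(v)+2-\#\{\text{blue edges at }v\}$ elements, all these sets disjoint. Put $X=\bigcup_v X_v$, $\mathfrak{s}_v=\bigcup_{v'\preceq v,\ v'\text{ blue}}X_{v'}$ for every vertex $v$, and $\Sigma=\{\mathfrak{s}_v\}_{v}\cup\{\{x\}\}_{x\in X}$. *)

(* Defs.v *)
From mathcomp Require Import all_boot all_algebra.

Set Implicit Arguments.
Unset Strict Implicit.
Unset Printing Implicit Defensive.

(* A graph is given by its vertices, its half-edges, the endpoint [src d] of a
  half-edge [d] and the opposite half-edge [opp d].  An edge with two ends is a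
  pair {d, opp d} with [opp d != d] (a loop when [src (opp d) = src d]); an open
  edge is a half-edge with [opp d = d].  That [opp] is an involution is not a
  field of the record: it is required by [hyp_wf] and [by_wf] below, so that
  the constructions on graphs carry no proof obligations. *)

Record graph := Graph {
  vert : finType;
  half : finType;
  src : half -> vert;
  opp : half -> half }.

Arguments src {g} _.
Arguments opp {g} _.

Definition is_open (G : graph) (d : half G) : bool := opp d == d.

(* A loop has two half-edges at its vertex, an open edge has one. *)
Definition degree (G : graph) (v : vert G) : nat :=
  #|[set d : half G | src d == v]|.

(* A union of vertices and edges, by its vertices and half-edges. *)
Definition subspace (G : graph) : Type := ({set vert G} * {set half G})%type.

Definition whole (G : graph) : subspace G := (setT, setT).

Definition sub_le (G : graph) (H H' : subspace G) : Prop :=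
  H.1 \subset H'.1 /\ H.2 \subset H'.2.

(* A closed union of vertices and of edges none of which is open. *)
Definition closed_union (G : graph) (H : subspace G) : Prop :=
  forall d, d \in H.2 -> [/\ src d \in H.1, opp d \in H.2 & ~~ is_open d].

Definition degree_in (G : graph) (H : subspace G) (v : vert G) : nat :=
  #|[set d in H.2 | src d == v]|.

Definition connected_in (G : graph) (H : subspace G) : Prop :=
  H.1 != set0 /\
  {in H.1 &, forall u v,
    connect [rel x y | [exists d in H.2, (src d == x) && (src (opp d) == y)]]
      u v}.

Definition connected (G : graph) : Prop := connected_in (whole G).

(* [c] lists the half-edges [d] leaving the successive vertices [src d] of a
   simple closed path; the last condition rules out backtracking, which matters
   only for paths of length 2. *)
Definition simple_cycle (G : graph) (c : seq (half G)) : bool :=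
  [&& c != [::], uniq (map src c), all (fun d => ~~ is_open d) c
    & cycle [rel d e | (src (opp d) == src e) && (e != opp d)] c].

Definition is_tree (G : graph) : Prop :=
  connected G /\ forall c : seq (half G), ~~ simple_cycle c.

(* The rank of the relative homology group H_1(G, B), for the subgraph B with
   vertices [BV] and half-edges [BH], as the dimension of H_1(G, B; Q).
   A cellular 1-chain is a function [c] on half-edges with
   [c (opp d) = - c d] (hence [c d = 0] on an open edge, which is contractible
   onto its endpoint), taken modulo chains on B, i.e. with [c d = 0] for [d] in
   [BH]; it is a relative cycle when for each vertex [v] not in [BV] the sum of
   [c d] over the half-edges at [v] vanishes.  As a row vector, [c] is a
   relative cycle iff it is killed by the following matrix. *)
Definition rkH1 (G : graph) (BV : pred (vert G)) (BH : pred (half G)) : nat :=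
  let antisym : 'M[rat]_(#|half G|, #|half G|) :=
    (\matrix_(i, j) ((enum_val i == enum_val j)%:R
       + (~~ BH (enum_val j) && (opp (enum_val i) == enum_val j))%:R))%R in
  let boundary : 'M[rat]_(#|half G|, #|vert G|) :=
    (\matrix_(i, j)
       (~~ BV (enum_val j) && (src (enum_val i) == enum_val j))%:R)%R in
  \rank (kermx (row_mx antisym boundary)).

(* [smooth H K] is the graph on the space [H] with vertices those in [K]; it is
  meaningful when every vertex of [H] outside [K] has degree 2 in [H].  To find
  the other end of the edge starting with [d], one goes to [opp d] and, as long
  as the endpoint is not in [K], passes to the opposite of the other half-edge
  there; a simple path is exhausted after #|half G| steps. *)

Definition other_half (G : graph) (H : subspace G) (d : half G) : half G :=
  odflt d [pick e in H.2 | (src e == src d) && (e != d)].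

Definition far_end (G : graph) (H : subspace G) (K : pred (vert G))
    (d : half G) : half G :=
  iter #|half G|
    (fun e => if K (src e) then e else opp (other_half H e)) (opp d).

Definition smooth_half (G : graph) (H : subspace G) (K : pred (vert G)) :
    finType :=
  {d : half G | (d \in H.2) && K (src d)}.

Definition smooth_src (G : graph) (H : subspace G) (K : pred (vert G))
    (d : smooth_half H K) : {v : vert G | K v} :=
  Sub (src (val d)) (proj2 (andP (valP d))).

Definition smooth (G : graph) (H : subspace G) (K : pred (vert G)) : graph :=
  {| vert := {v : vert G | K v};
     half := smooth_half H K;
     src := @smooth_src G H K;
     opp := fun d => insubd d (far_end H K (val d)) |}.

Record hgraph := HGraph {
  hg_graph :> graph;
  hg_gen : vert hg_graph -> nat;
  iotaV : vert hg_graph -> vert hg_graph;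
  iotaH : half hg_graph -> half hg_graph }.

Arguments hg_gen {h} _.
Arguments iotaV {h} _.
Arguments iotaH {h} _.

Definition hg_iso (G G' : hgraph) : Prop :=
  exists (fV : vert G -> vert G') (fH : half G -> half G'),
    [/\ bijective fV /\ bijective fH,
        forall d, src (fH d) = fV (src d),
        forall d, opp (fH d) = fH (opp d),
        forall v, hg_gen (fV v) = hg_gen v
      & (forall v, iotaV (fV v) = fV (iotaV v)) /\
        (forall d, iotaH (fH d) = fH (iotaH d))].

Definition hg_genus (G : hgraph) : nat :=
  rkH1 (pred0 : pred (vert G)) (pred0 : pred (half G))
  + \sum_(v : vert G) hg_gen v.

Definition anti_inv (G : hgraph) (d : half G) : bool :=
  ~~ is_open d && (iotaH d == opp d).

(* [halve G] is [G] with the midpoints of its anti-invariant edges added as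
  vertices of genus 0.  An anti-invariant edge {d, opp d} becomes two edges: its
  midpoint is [inr {d, opp d}], and for [e] in {d, opp d} the half-edge at the
  midpoint opposite to [inl e] is [inr e].  The topological quotient of [G] is
  then the graph of orbits of [halve G]. *)

Definition anti_half (G : hgraph) : finType := {d : half G | anti_inv d}.

Definition anti_edge (G : hgraph) (a : anti_half G) : {set half G} :=
  [set val a; opp (val a)].

Definition midpoint (G : hgraph) : finType :=
  {e : {set half G} | e \in codom (@anti_edge G)}.

Definition mid (G : hgraph) (a : anti_half G) : midpoint G :=
  Sub (anti_edge a) (codom_f (@anti_edge G) a).

Definition halve_graph (G : hgraph) : graph :=
  {| vert := (vert G + midpoint G)%type;
     half := (half G + anti_half G)%type;
     src := fun x => match x with
                     | inl d => inl (src d)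
                     | inr a => inr (mid a)
                     end;
     opp := fun x => match x with
                     | inl d => if insub d is Some a then inr a
                                else inl (opp d)
                     | inr a => inl (val a)
                     end |}.

Definition halve (G : hgraph) : hgraph :=
  {| hg_graph := halve_graph G;
     hg_gen := fun x : vert (halve_graph G) =>
                 if x is inl v then hg_gen v else 0;
     iotaV := fun x : vert (halve_graph G) =>
                match x with inl v => inl (iotaV v) | inr m => inr m end;
     iotaH := fun x : half (halve_graph G) =>
                match x with
                | inl d => inl (iotaH d)
                | inr a => inr (insubd a (opp (val a)))
                end |}.

Definition fibre (T : finType) (i : T -> T) (x : T) : {set T} := [set x; i x].

Definition orb (T : finType) (i : T -> T) : finType :=
  {o : {set T} | o \in codom (fibre i)}.

Definition to_orb (T : finType) (i : T -> T) (x : T) : orb i :=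
  Sub (fibre i x) (codom_f (fibre i) x).

Definition orb_rep (T : finType) (i : T -> T) (o : orb i) : T :=
  iinv (valP o).

Definition orbit_graph (G : hgraph) : graph :=
  {| vert := orb (@iotaV G);
     half := orb (@iotaH G);
     src := fun o => to_orb iotaV (src (orb_rep o));
     opp := fun o => to_orb iotaH (opp (orb_rep o)) |}.

Definition top_quotient (G : hgraph) : graph := orbit_graph (halve G).

Definition hyp_wf (G : hgraph) : Prop :=
  [/\ involutive (@opp G),
      involutive (@iotaV G),
      involutive (@iotaH G),
      forall d : half G, src (iotaH d) = iotaV (src d)
    & forall d : half G, opp (iotaH d) = iotaH (opp d)].

Definition hyp_cond1 (G : hgraph) : Prop :=
  forall v : vert G, hg_gen v != 0 -> iotaV v = v.

Definition hyp_cond2 (G : hgraph) : Prop :=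
  forall v : vert G, hg_gen v = 0 -> 3 <= degree v.

(* Counting half-edges at [v] amounts to counting edges, since an invariant loop
   would give a loop in the quotient, which is required to be a tree. *)
Definition hyp_cond3 (G : hgraph) : Prop :=
  forall v : vert G,
    #|[set d : half G | (src d == v) && (iotaH d == d)]| <= 2 * hg_gen v + 2.

Definition lone_vertex (G : hgraph) : Prop :=
  [/\ #|vert G| = 1, #|half G| = 0 & forall v : vert G, hg_gen v = 0].

(* To be used for connected graphs. *)
Definition exceptional_circle (G : hgraph) : Prop :=
  [/\ #|vert G| = 2,
      #|half G| = 4,
      forall v : vert G, [/\ hg_gen v = 0, iotaV v = v & degree v = 2]
    & forall d : half G,
        [/\ ~~ is_open d, iotaH d <> d & iotaH d <> opp d]].

Definition closed_hyp (G : hgraph) : Prop :=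
  [/\ hyp_wf G /\ connected G,
      forall d : half G, ~~ is_open d,
      hyp_cond1 G /\ hyp_cond3 G,
      is_tree (top_quotient G)
    & [\/ hyp_cond2 G, lone_vertex G | exceptional_circle G]].

Definition open_exception (G : hgraph) : Prop :=
  [/\ #|vert G| = 1,
      forall v : vert G, hg_gen v = 0,
      forall d : half G, is_open d
    & #|half G| = 1 \/ #|half G| = 2 /\ forall d : half G, iotaH d <> d].

Definition open_hyp (G : hgraph) : Prop :=
  [/\ hyp_wf G /\ connected G,
      exists d : half G, is_open d,
      hyp_cond1 G /\ hyp_cond3 G,
      is_tree (top_quotient G) /\
      #|[set o : half (top_quotient G) | is_open o]| = 1
    & hyp_cond2 G \/ open_exception G].

(* A union of vertices and edges of [G], seen in [halve G]. *)
Definition hg_lift (G : hgraph) (H : subspace G) : subspace (halve G) :=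
  ([set x : vert (halve G) | match x with
                             | inl v => v \in H.1
                             | inr m => val m \subset H.2
                             end],
   [set x : half (halve G) | match x with
                             | inl d => d \in H.2
                             | inr a => val a \in H.2
                             end]).

Definition hg_removable (G : hgraph) (H : subspace G) (v : vert G) : bool :=
  (hg_gen v == 0) && (degree_in H v == 2).

(* For connected [H], all vertices are removable iff [H] is a circle. *)
Definition hg_kept (G : hgraph) (H : subspace G) (v : vert G) : bool :=
  (v \in H.1) &&
  (if [forall u in H.1, hg_removable H u] then iotaV v == v
   else ~~ hg_removable H v).

Definition hg_smooth (G : hgraph) (H : subspace G) : hgraph :=
  {| hg_graph := smooth H (hg_kept H);
     hg_gen := fun v : vert (smooth H (hg_kept H)) => hg_gen (val v);
     iotaV := fun v : vert (smooth H (hg_kept H)) => insubd v (iotaV (val v));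
     iotaH := fun d : half (smooth H (hg_kept H)) =>
                insubd d (iotaH (val d)) |}.

(* The hyperelliptic graph carried by [H].  The detour through [halve G] only
   affects circles, whose invariant points may be midpoints of anti-invariant
   edges; otherwise the midpoints are removable. *)
Definition hg_sub (G : hgraph) (H : subspace G) : hgraph :=
  hg_smooth (hg_lift H).

Definition closed_hyp_subgraph (G : hgraph) (H : subspace G) : Prop :=
  [/\ closed_union H /\ connected_in H,
      {in H.1, forall v, iotaV v \in H.1},
      {in H.2, forall d, iotaH d \in H.2},
      closed_hyp (hg_sub H)
    & lone_vertex (hg_sub H) -> hg_genus G = 0].

Definition maximal_sub (G : graph) (P : subspace G -> Prop) (H : subspace G) :
    Prop :=
  P H /\ forall H', P H' -> sub_le H H' -> H' = H.

Definition hg_core (G : hgraph) (H : subspace G) : Prop :=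
  maximal_sub (@closed_hyp_subgraph G) H /\
  forall H', maximal_sub (@closed_hyp_subgraph G) H' -> H' = H.

Definition hg_equiv (G G' : hgraph) : Prop :=
  exists (H : subspace G) (H' : subspace G'),
    [/\ hg_core H, hg_core H' & hg_iso (hg_sub H) (hg_sub H')].

(* [true] is blue, [false] is yellow. *)
Record bytree := BYTree {
  by_graph :> graph;
  by_gen : vert by_graph -> nat;
  blueV : vert by_graph -> bool;
  blueH : half by_graph -> bool }.

Arguments by_gen {b} _.
Arguments blueV {b} _.
Arguments blueH {b} _.

Definition by_iso (T T' : bytree) : Prop :=
  exists (fV : vert T -> vert T') (fH : half T -> half T'),
    [/\ bijective fV /\ bijective fH,
        forall d, src (fH d) = fV (src d),
        forall d, opp (fH d) = fH (opp d),
        forall v, by_gen (fV v) = by_gen v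
      & (forall v, blueV (fV v) = blueV v) /\
        (forall d, blueH (fH d) = blueH d)].

Definition by_genus (T : bytree) : nat :=
  rkH1 (@blueV T) (@blueH T) + \sum_(v : vert T) by_gen v.

Definition by_wf (T : bytree) : Prop :=
  involutive (@opp T) /\ forall d : half T, blueH (opp d) = blueH d.

Definition blue_degree (T : bytree) (v : vert T) : nat :=
  #|[set d : half T | (src d == v) && blueH d]|.

Definition by_cond1 (T : bytree) : Prop :=
  forall v : vert T, ~~ blueV v ->
    [/\ by_gen v = 0, 3 <= degree v
      & forall d : half T, src d = v -> ~~ blueH d].

Definition by_cond2 (T : bytree) : Prop :=
  forall v : vert T, blueV v -> by_gen v = 0 ->
    exists2 d : half T, src d = v & ~~ blueH d.

Definition by_cond3 (T : bytree) : Prop :=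
  forall v : vert T, blue_degree v <= 2 * by_gen v + 2.

Definition by_lone_vertex (T : bytree) : Prop :=
  [/\ #|vert T| = 1, #|half T| = 0
    & forall v : vert T, blueV v /\ by_gen v = 0].

Definition closed_by (T : bytree) : Prop :=
  [/\ by_wf T /\ is_tree T,
      forall d : half T, ~~ is_open d,
      by_cond1 T,
      by_cond3 T
    & by_cond2 T \/ by_lone_vertex T].

Definition by_open_exception (T : bytree) : Prop :=
  [/\ #|vert T| = 1,
      forall v : vert T, blueV v /\ by_gen v = 0
    & #|half T| = 1 /\ forall d : half T, is_open d /\ blueH d].

Definition open_by (T : bytree) : Prop :=
  [/\ by_wf T /\ is_tree T,
      #|[set d : half T | is_open d]| = 1,
      by_cond1 T,
      by_cond3 T
    & by_cond2 T \/ by_open_exception T].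

Definition by_removable (T : bytree) (H : subspace T) (v : vert T) : bool :=
  [&& by_gen v == 0, degree_in H v == 2
    & [forall d in H.2, (src d == v) ==> (blueH d == blueV v)]].

Definition by_kept (T : bytree) (H : subspace T) (v : vert T) : bool :=
  (v \in H.1) && ~~ by_removable H v.

Definition by_sub (T : bytree) (H : subspace T) : bytree :=
  {| by_graph := smooth H (by_kept H);
     by_gen := fun v : vert (smooth H (by_kept H)) => by_gen (val v);
     blueV := fun v : vert (smooth H (by_kept H)) => blueV (val v);
     blueH := fun d : half (smooth H (by_kept H)) => blueH (val d) |}.

Definition closed_by_subtree (T : bytree) (H : subspace T) : Prop :=
  [/\ closed_union H,
      connected_in H,
      closed_by (by_sub H)
    & by_lone_vertex (by_sub H) -> by_genus T = 0].

Definition by_core (T : bytree) (H : subspace T) : Prop :=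
  maximal_sub (@closed_by_subtree T) H /\
  forall H', maximal_sub (@closed_by_subtree T) H' -> H' = H.

Definition by_equiv (T T' : bytree) : Prop :=
  exists (H : subspace T) (H' : subspace T'),
    [/\ by_core H, by_core H' & by_iso (by_sub H) (by_sub H')].

Record picture := Picture {
  pts : finType;
  clusters : {set {set pts}} }.

Arguments clusters : clear implicits.

Definition cluster_picture (C : picture) : Prop :=
  [/\ set0 \notin clusters C,
      setT \in clusters C,
      forall x : pts C, [set x] \in clusters C
    & {in clusters C &, forall s t : {set pts C},
        [\/ [disjoint s & t], s \subset t | t \subset s]}].

Definition cp_iso (C C' : picture) : Prop :=
  exists2 f : pts C -> pts C', bijective f
    & [set f @: (s : {set pts C}) | s in clusters C] = clusters C'.

(* For 0 < n, the g such that n is 2g+1 or 2g+2. *)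
Definition genus_of_size (n : nat) : nat := n.-1./2.

Definition cp_genus (C : picture) : nat := genus_of_size #|pts C|.

Definition child (C : picture) (s' s : {set pts C}) : bool :=
  [&& s' \in clusters C, s \in clusters C, s' \proper s
    & [forall t in clusters C, ~~ ((s' \proper t) && (t \proper s))]].

Definition proper_cluster (C : picture) (s : {set pts C}) : bool :=
  (s \in clusters C) && ((1 < #|s|) || (#|s| == 1) && (#|pts C| == 1)).

Definition odd_children (C : picture) (s : {set pts C}) : {set {set pts C}} :=
  [set s' | child s' s && odd #|s'|].

Definition ubereven (C : picture) (s : {set pts C}) : bool :=
  (#|pts C| != 1) && (odd_children s == set0).

Definition cluster_genus (C : picture) (s : {set pts C}) : nat :=
  if ubereven s then 0 else genus_of_size #|odd_children s|.

(* The picture on [X + {r}], where [r] is [None]. *)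
Definition add_point (C : picture) : picture :=
  Picture ([set Some @: (s : {set pts C}) | s in clusters C]
           :|: [set setT; [set None]]).

Inductive cp_move (C : picture) : picture -> Prop :=
| Move_i (s : {set pts C}) :
    child s setT -> #|pts C| = 2 * cp_genus C + 2 ->
    cp_move C (Picture (~: s |: clusters C))
| Move_ii (s : {set pts C}) :
    child s setT -> 2 <= #|s| ->
    #|[set s' : {set pts C} | child s' setT]| = 2 ->
    #|pts C| = 2 * cp_genus C + 2 ->
    cp_move C (Picture (clusters C :\ s))
| Move_iii (C' : picture) :
    #|pts C| = 2 * cp_genus C + 1 -> cp_iso (add_point C) C' ->
    cp_move C C'
| Move_iv (C' : picture) :
    #|pts C| = 2 * cp_genus C + 2 -> cp_iso (add_point C') C ->
    cp_move C C'.

Inductive cp_moves (C : picture) : picture -> Prop :=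
| Moves_refl : cp_moves C C
| Moves_step (C1 C2 : picture) :
    cp_moves C C1 -> cp_move C1 C2 -> cluster_picture C2 -> cp_moves C C2.

Definition cp_reach (C C' : picture) : Prop :=
  exists2 C1, cp_moves C C1 & cp_iso C1 C'.

Definition cp_equiv (C C' : picture) : Prop := cp_reach C C' \/ cp_reach C' C.

Definition T_of_G (G : hgraph) : bytree :=
  {| by_graph := top_quotient G;
     by_gen := fun o : vert (top_quotient G) =>
                 if #|val o| == 1 then hg_gen (orb_rep o) else 0;
     blueV := fun o : vert (top_quotient G) => #|val o| == 1;
     blueH := fun o : half (top_quotient G) => #|val o| == 1 |}.

(* The copies T^+ and T^- are indexed by [false] and [true]; a blue point has the
  same image in both and is represented in T^+ only. *)

(* The vertex of a one-vertex tree is not to be forgotten. *)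
Definition genus0_leaf (T : bytree) (v : vert T) : bool :=
  [&& by_gen v == 0, degree v == 1 & #|vert T| != 1].

Definition glueV (T : bytree) : finType :=
  {p : vert T * bool | ~~ genus0_leaf p.1 && (blueV p.1 ==> ~~ p.2)}.

Definition glueH (T : bytree) : finType :=
  {p : half T * bool | ~~ genus0_leaf (src p.1) && (blueH p.1 ==> ~~ p.2)}.

Definition glue_end (T : bytree) (p : glueH T) : vert T * bool :=
  (src (val p).1, ~~ blueV (src (val p).1) && (val p).2).

Fact glue_end_subproof (T : bytree) (p : glueH T) :
  ~~ genus0_leaf (glue_end p).1 && (blueV (glue_end p).1 ==> ~~ (glue_end p).2).
Proof. by case/andP: (valP p) => Hl _ /=; rewrite Hl; case: blueV. Qed.

Definition glue_src (T : bytree) (p : glueH T) : glueV T :=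
  exist _ (glue_end p) (glue_end_subproof p).

Definition glue_graph (T : bytree) : graph :=
  {| vert := glueV T;
     half := glueH T;
     src := @glue_src T;
     opp := fun p =>
       insubd p (if genus0_leaf (src (opp (val p).1))
                 then ((val p).1, ~~ (val p).2)
                 else (opp (val p).1, (val p).2)) |}.

Definition G_of_T (T : bytree) : hgraph :=
  {| hg_graph := glue_graph T;
     hg_gen := fun p : vert (glue_graph T) => by_gen (val p).1;
     iotaV := fun p : vert (glue_graph T) =>
       if blueV (val p).1 then p else insubd p ((val p).1, ~~ (val p).2);
     iotaH := fun p : half (glue_graph T) =>
       if blueH (val p).1 then p else insubd p ((val p).1, ~~ (val p).2) |}.

Definition cvert (C : picture) : finType :=
  {s : {set pts C} | proper_cluster s}.

(* An edge is a pair (v_s', v_s) with s' a child of s. *)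
Definition cedge (C : picture) : finType :=
  {e : cvert C * cvert C | child (val e.1) (val e.2)}.

Definition ctop (C : picture) : finType := {v : cvert C | val v == setT}.

(* The half-edges of the edge [e] at v_s' and v_s are [inl (e, false)] and
   [inl (e, true)]. *)
Definition cluster_graph (C : picture) : graph :=
  {| vert := cvert C;
     half := (cedge C * bool + ctop C)%type;
     src := fun x => match x with
                     | inl (e, b) => if b then (val e).2 else (val e).1
                     | inr v => val v
                     end;
     opp := fun x => match x with
                     | inl (e, b) => inl (e, ~~ b)
                     | inr v => inr v
                     end |}.

Definition T_of_C (C : picture) : bytree :=
  {| by_graph := cluster_graph C;
     by_gen := fun v : vert (cluster_graph C) => cluster_genus (val v);
     blueV := fun v : vert (cluster_graph C) => ~~ ubereven (val v);
     blueH := fun x : half (cluster_graph C) =>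
                match x with
                | inl (e, _) => odd #|val (val e).1|
                | inr v => odd #|val (val v)|
                end |}.

(* [p] is a path from [u] to infinity, given by the half-edges leaving its
   successive vertices, the last one being open. *)
Definition path_to_infty (G : graph) (u : vert G) (p : seq (half G)) : bool :=
  if p is d :: p' then
    [&& src d == u,
        path [rel x y | ~~ is_open x && (src (opp x) == src y)] d p'
      & is_open (last d p')]
  else false.

Definition shortest_to_infty (G : graph) (u : vert G) (p : seq (half G)) :
    bool :=
  path_to_infty u p &&
  [forall n : 'I_(size p), [forall q : n.-tuple (half G), ~~ path_to_infty u q]].

(* A shortest path passes through each vertex at most once. *)
Definition vle (G : graph) (v v' : vert G) : bool :=
  [exists n : 'I_(#|vert G|.+1), [exists p : n.-tuple (half G),
    shortest_to_infty v p && (v' \in map src p)]].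

Definition roots_at (T : bytree) (v : vert T) : nat :=
  2 * by_gen v + 2 - blue_degree v.

Definition root_type (T : bytree) : finType :=
  {x : {v : vert T & 'I_(roots_at v)} | blueV (tag x)}.

Definition cluster_at (T : bytree) (v : vert T) : {set root_type T} :=
  [set x : root_type T | vle (tag (val x)) v].

Definition C_of_T (T : bytree) : picture :=
  Picture ([set cluster_at v | v : vert T]
           :|: [set [set x] | x : root_type T]).

(* [F] and [H] induce mutually inverse bijections between the objects satisfying
   [P] up to [isoA] and the objects satisfying [Q] up to [isoB]. *)
Definition inverse_bijections (A B : Type)
    (P : A -> Prop) (isoA : A -> A -> Prop)
    (Q : B -> Prop) (isoB : B -> B -> Prop)
    (F : A -> B) (H : B -> A) : Prop :=
  [/\ (forall a, P a -> Q (F a)) /\ (forall b, Q b -> P (H b)),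
      forall a a', P a -> P a' -> isoA a a' -> isoB (F a) (F a'),
      forall b b', Q b -> Q b' -> isoB b b' -> isoA (H b) (H b'),
      forall a, P a -> isoA (H (F a)) a
    & forall b, Q b -> isoB (F (H b)) b].

Definition preserves_genus (A B : Type) (P : A -> Prop)
    (gA : A -> nat) (gB : B -> nat) (F : A -> B) : Prop :=
  forall a, P a -> gB (F a) = gA a.

Definition preserves_equiv (A B : Type) (P : A -> Prop)
    (eqA : A -> A -> Prop) (eqB : B -> B -> Prop) (F : A -> B) : Prop :=
  forall a a', P a -> P a' -> (eqA a a' <-> eqB (F a) (F a')).

(* Main.v *)
(* A hyperelliptic graph, with the midpoints of its anti-invariant edges added,
   is a double cover of its quotient tree, and a double cover of a tree is
   determined by the branch locus, since over a tree it splits into two sheets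
   away from the branching; hence T and G are mutually inverse.  The core of an
   open BY tree is obtained by deleting the open edge and, at most, the root, and
   the core of the cover is the cover of the core.

   Rooting an open BY tree at infinity, condition (3) gives every blue vertex a
   number of roots, its weight; the order and the weights determine the sizes of
   the clusters, hence the colours and the genera, so that trees and cluster
   pictures determine each other.

   For the equivalences, complete a picture of odd size by a point at infinity
   and call a set of points a split if it or its complement is a cluster.  The
   moves preserve the splits.  Conversely, moves (i) and (ii) bring a picture of
   even size into a normal form depending only on its splits and a chosen point.
   On the side of trees, the splits of the picture of T are the partitions of the
   roots of the core of T by its edges; and the core can be recovered from them,
   because attaching a blue open edge to it where a root sits gives an open BY
   tree whose picture is read off the splits. *)

From mathcomp Require Import all_boot all_algebra perm.
From mathcomp Require Import zify ring lra.
Require Import Defs.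

Set Implicit Arguments.
Unset Strict Implicit.
Unset Printing Implicit Defensive.

(** On the side of graphs everything is reduced to one relation, [dcover]. It links [G] with
    [T_of_G G], [G_of_T T] with [T], and the core of [G] with the core of [T]. The cover always
    determines the base ([dcover_base_iso]) and, over a tree, the base determines the cover
    ([dcover_unique]); bijections and equivalences then follow formally. The obstacle is that
    midpoints of anti-invariant edges are not vertices of [G]: hence the set [L] of leaves without
    preimage, and the passage to [halve G], for which [L] is empty. Being a tree is handled through
    a rank function with one descending half-edge at each vertex but the root, so that paths and
    cycles are met only at the beginning. The constant [2 * g + 2] is the number of branch points of
    a hyperelliptic curve of genus g. At a blue vertex the blue edges use up some of them and the
    rest are the roots; all statements on parity and on the total genus come from this balance. Maps
    are mostly given first as relations, because their values come from existence statements. *)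

Lemma rel_bijection (A B : finType) (R : A -> B -> Prop) :
    (forall a, exists b, R a b) -> (forall b, exists a, R a b) ->
    (forall a b b', R a b -> R a b' -> b = b') ->
    (forall a a' b, R a b -> R a' b -> a = a') ->
  exists2 f : A -> B, bijective f & forall a, R a (f a).
Proof.
move=> /fin_all_exists [f Rf] /fin_all_exists [g Rg] RA RB.
exists f => //; exists g => [a | b]; first exact: RB (Rg _) (Rf _).
exact: RA (Rf _) (Rg _).
Qed.

(** * Trees *)

Section Trees.

Variable T : graph.
Hypothesis oppK : involutive (@opp T).
Implicit Types (d e : half T) (u v w : vert T).

Definition adj_without d : rel (vert T) :=
  [rel x y | [exists e, [&& e != d, e != opp d, src e == x
                          & src (opp e) == y]]].

Lemma adj_without_sym d : symmetric (adj_without d).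
Proof.
suff sub x y : adj_without d x y -> adj_without d y x.
  by move=> x y; apply/idP/idP => /sub.
case/existsP=> e /and4P[ed eod ex ey]; apply/existsP; exists (opp e).
by rewrite oppK ex ey (inv_eq oppK) eod (inj_eq (inv_inj oppK)) ed.
Qed.

Let crel := [rel d e : half T | (src (opp d) == src e) && (e != opp d)].

(** A vertex path without repetition lifts to half-edges without backtracking, since turning back
    along [e] would revisit [src e]. Only the first step after [d0] escapes this argument; the last
    hypothesis takes care of it. *)
Lemma lift_path d p x d0 :
    path (adj_without d) x p -> uniq (x :: p) -> src (opp d0) = x ->
    (forall e, e != d -> e != opp d -> src (opp e) \in p -> e != opp d0) ->
  exists es : seq (half T),
    [/\ path crel d0 es, map src es = belast x p,
        all (fun e => ~~ is_open e) es,
        all (fun e => (e != d) && (e != opp d)) es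
      & src (opp (last d0 es)) = last x p].
Proof.
elim: p x d0 => [|y p IHp] x d0 /=; first by move=> _ _ <- _; exists [::].
case/andP=> /existsP[e /and4P[ed eod /eqP ex /eqP ey]] pth.
case/andP=> xyp uyp d0x avoid.
have [e' _ _ he'|es [pe se oe ne le]] := IHp y e pth uyp ey.
  apply: contra xyp => /eqP e'E; rewrite inE; apply/orP; right.
  by rewrite -ex -[e]oppK -e'E.
exists (e :: es); split=> //=; rewrite ?ed ?eod ?ne ?pe ?se ?ex ?d0x ?eqxx ?oe //=.
  by rewrite andbT; apply: avoid; rewrite // ey mem_head.
rewrite andbT; apply: contra xyp => /eqP opn.
by rewrite inE -ex -ey opn eqxx.
Qed.

(** A path between the two ends that avoids the edge would close up with [d] to a simple cycle. For
    a loop the path is empty and [[:: d]] is the cycle. *)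
Lemma tree_bridge d : (forall c : seq (half T), ~~ simple_cycle c) ->
  ~~ is_open d -> ~~ connect (adj_without d) (src (opp d)) (src d).
Proof.
move=> acyc dopen; apply/negP => /connectP[p pth lst].
case/shortenP: pth lst => p' pth' up' _ lst.
have [e _ eod _ //|es [pe se oe ne le]] := lift_path pth' up' (erefl (src (opp d))).
case/negP: (acyc (d :: es)); rewrite /simple_cycle /= dopen oe andbT.
apply/and3P; split.
- rewrite se; have := up'; rewrite lastI rcons_uniq -lst.
  by [].
- by [].
- rewrite rcons_path; apply/andP; split; first exact: pe.
  rewrite /= le -lst eqxx /=; case: (lastP es) pe ne {se oe le} => [|es' e] _ ne.
    by rewrite /= eq_sym.
  rewrite last_rcons; apply/eqP => dE.
  by move: ne; rewrite all_rcons dE oppK eqxx andbF.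
Qed.

(** The local content of being a tree with root [r]: the rank behaves like the distance to [r]. By
    [tree_ranked] and [ranked_tree] it is equivalent to [is_tree], so a new graph is shown to be a
    tree by exhibiting a rank, and no cycle has to be transported. *)
Record ranked (r : vert T) (rk : vert T -> nat) : Prop := Ranked {
  rk_root : forall d, src d = r -> rk r <= rk (src (opp d));
  rk_desc : forall v, v != r -> exists2 d, src d = v & rk (src (opp d)) < rk v;
  rk_neq : forall d, ~~ is_open d -> rk (src (opp d)) != rk (src d);
  rk_uniq : forall d d', src d = src d' -> rk (src (opp d)) < rk (src d) ->
    rk (src (opp d')) < rk (src d') -> d = d' }.

Let adjT := [rel x y | [exists d in (whole T).2,
                          (src d == x) && (src (opp d) == y)]].

Lemma tree_ranked (r : vert T) : is_tree T -> exists rk, ranked r rk.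
Proof.
move=> [[_ conn] acyc].
pose P v n := [exists p : n.-tuple (vert T), path adjT v p && (last v p == r)].
have exP v : exists n, P v n.
  have := conn v r (in_setT _) (in_setT _); case/connectP=> p pth lst.
  exists (size p); apply/existsP; exists (in_tuple p).
  by rewrite /= -lst eqxx andbT; exact: pth.
pose rk v := ex_minn (exP v).
have rkP v n : P v n -> rk v <= n by rewrite /rk; case: ex_minnP => m _; apply.
have desc v : v != r -> exists2 d, src d = v & rk (src (opp d)) < rk v.
  move=> vr; rewrite [rk v]/rk; case: ex_minnP => [[|n] /existsP[p]].
    by rewrite tuple0 /= => vr'; rewrite vr' in vr.
  case/tupleP: p => y p /= /andP[/andP[/exists_inP[d _ /andP[/eqP dv /eqP dy]]]].
  move=> pth lst _; exists d => //; rewrite ltnS; apply: rkP.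
  by apply/existsP; exists p; rewrite dy pth.
have rkr : rk r = 0.
  apply/eqP; rewrite -leqn0; apply: rkP; apply/existsP; exists [tuple].
  by rewrite /= eqxx.
pose upo v := [pick d | (src d == v) && (rk (src (opp d)) < rk v)].
have upoP v d : upo v = Some d -> src d = v /\ rk (src (opp d)) < rk v.
  by rewrite /upo; case: pickP => // e /andP[/eqP ? ?] [<-].
have upoE v : v != r -> exists d, upo v = Some d.
  move=> /desc[d dv lt]; rewrite /upo; case: pickP => [e|/(_ d)]; first by exists e.
  by rewrite dv eqxx lt.
(* Every edge is the chosen descending edge of one of its ends. Otherwise the descending paths from
   both ends to [r] avoid it, although it is a bridge. *)
have claim d : ~~ is_open d -> upo (src d) = Some d \/ upo (src (opp d)) = Some (opp d).
  move=> dopen; case: (upo (src d) =P Some d) => [|n1]; first by left.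
  case: (upo (src (opp d)) =P Some (opp d)) => [|n2]; first by right.
  exfalso.
  have toR v : connect (adj_without d) v r.
    have [n] := ubnP (rk v); elim: n v => // n IH v ltn.
    have [->//|vr] := eqVneq v r; have [e ue] := upoE v vr.
    have [ev lt] := upoP _ _ ue.
    apply: connect_trans (IH (src (opp e)) _); last exact: leq_trans lt _.
    apply: connect1; apply/existsP; exists e; rewrite ev !eqxx !andbT.
    by apply/andP; split; apply/eqP => eE;
      [case: n1 | case: n2]; rewrite -eE ev.
  case/negP: (tree_bridge acyc dopen).
  by apply: connect_trans (toR _) _; rewrite (sym_connect_sym (adj_without_sym d)).
exists rk; split=> //.
- by rewrite rkr.
- move=> d /claim[/upoP[_] lt|/upoP[_]]; first by rewrite neq_ltn lt.
  by rewrite oppK => lt; rewrite neq_ltn lt orbT.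
- have fwd d : rk (src (opp d)) < rk (src d) -> upo (src d) = Some d.
    move=> lt; have dopen : ~~ is_open d.
      by apply: contraL lt => /eqP->; rewrite ltnn.
    by case: (claim d dopen) => // /upoP[_]; rewrite oppK => /(ltn_trans lt); rewrite ltnn.
  by move=> d d' dd' /fwd lt /fwd lt'; move: lt; rewrite dd' lt' => -[->].
Qed.

(** At a vertex of maximal rank on a simple cycle, the half-edge that leaves and the opposite of the
    one that arrives both descend. By [rk_uniq] they coincide, which is the backtracking that
    [simple_cycle] forbids. *)
Lemma ranked_tree (r : vert T) rk : ranked r rk -> is_tree T.
Proof.
move=> [_ desc neq uniqu]; split.
  split=> [|u v _ _]; first by apply/set0Pn; exists r; rewrite inE.
  have toR w : connect adjT w r.
    have [n] := ubnP (rk w); elim: n w => // n IH w ltn.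
    have [->//|wr] := eqVneq w r; have [e ew lt] := desc w wr.
    apply: connect_trans (IH (src (opp e)) _); last exact: leq_trans lt _.
    by apply: connect1; apply/exists_inP; exists e; rewrite ?inE // ew !eqxx.
  have adjsym : symmetric adjT.
    suff sub x y : adjT x y -> adjT y x by move=> x y; apply/idP/idP => /sub.
    case/exists_inP=> e _ /andP[ex ey]; apply/exists_inP; exists (opp e).
      by rewrite inE.
    by rewrite oppK ex ey.
  by apply: connect_trans (toR u) _; rewrite (sym_connect_sym adjsym).
move=> c; apply/negP => /and4P[c0 uc oc cc].
have [d0 cE] : exists d0, d0 \in c.
  by case: c c0 {uc oc cc} => // d0 c _; exists d0; rewrite mem_head.
have [d dc dmax] : exists2 d, d \in c & forall e, e \in c -> rk (src e) <= rk (src d).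
  case: (@arg_maxnP _ d0 [pred d | d \in c] (fun d => rk (src d)) cE) => d dc dm.
  by exists d.
have [i c' rotE] := rot_to dc.
have cc' : cycle crel (d :: c') by rewrite -rotE rot_cycle.
have memc e : (e \in d :: c') = (e \in c) by rewrite -rotE mem_rot.
have nop e : e \in c -> ~~ is_open e by move=> ec; exact: (allP oc).
pose e := last d c'.
have ec : e \in c by rewrite -memc; exact: mem_last.
have /andP[/eqP ed dne] : crel e d.
  by move: cc'; rewrite /= rcons_path => /andP[_].
have nx : rk (src (opp d)) <= rk (src d).
  case: c' {rotE e ec ed dne} cc' memc => [|y c'] /=.
    by rewrite andbT => /andP[/eqP-> _] _.
  by case/andP=> /andP[/eqP-> _ _] memc; apply: dmax; rewrite -memc !inE eqxx orbT.
case/eqP: dne; apply: uniqu => //.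
- by rewrite ltn_neqAle nx neq // nop.
- by rewrite ed oppK ltn_neqAle dmax // andbT -ed eq_sym neq // nop.
Qed.

End Trees.

(** A tree rooted at infinity: [up v] is the first half-edge on the way from [v] to infinity, so at
    the root it is the open one. Of the two half-edges of an edge one points to infinity; this is
    [or_up]. *)
Record orooted (T : graph) (r : vert T) (up : vert T -> half T)
    (rk : vert T -> nat) : Prop := ORooted {
  or_oppK : involutive (@opp T);
  or_src : forall v, src (up v) = v;
  or_open : forall d, is_open d = (d == up r);
  or_up : forall d, d = up (src d) \/ opp d = up (src (opp d));
  or_rk : forall v, v != r -> rk (src (opp (up v))) < rk v }.

(** The open half-edge is its own opposite, so in a rooted tree the root is its own parent and the
    iterates of [parent] run through the ancestors and stay at the root. *)
Definition parent (T : graph) (up : vert T -> half T) (v : vert T) : vert T :=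
  src (opp (up v)).

Lemma open_tree_rooted (T : graph) : involutive (@opp T) -> is_tree T ->
    #|[set d : half T | is_open d]| = 1 ->
  exists r up rk, @orooted T r up rk.
Proof.
move=> oppK tr /eqP/cards1P[o oE].
have openE d : is_open d = (d == o) by have := in_set1 d o; rewrite -oE inE.
have [rk [rkr desc neq uniqu]] := tree_ranked oppK (src o) tr.
have /fin_all_exists[up upP] v : exists d, src d = v /\
    if v == src o then d = o else rk (src (opp d)) < rk v.
  by have [->|/desc[d dv lt]] := eqVneq v (src o); [exists o | exists d].
exists (src o), up, rk; split=> //.
- by move=> v; have [] := upP v.
- by move=> d; rewrite openE; have [_] := upP (src o); rewrite eqxx => ->.
- have fwd d : rk (src (opp d)) < rk (src d) -> d = up (src d).
    move=> lt; have [us] := upP (src d); case: eqP => [so|_ lt'].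
      by move: lt; rewrite so ltnNge (rkr d).
    by apply: uniqu; rewrite ?us.
  move=> d; have [opn|/neq] := boolP (is_open d).
    left; move: opn; rewrite openE => /eqP->; have [_] := upP (src o).
    by rewrite eqxx.
  rewrite neq_ltn => /orP[/fwd|]; first by left.
  by move=> lt; right; apply: fwd; rewrite oppK.
- by move=> v vr; have [_] := upP v; rewrite (negPf vr).
Qed.

Section OpenRooted.

Variables (T : graph) (r : vert T) (up : vert T -> half T) (rk : vert T -> nat).
Hypothesis rt : orooted r up rk.
Implicit Types (d e : half T) (u v w : vert T).

Local Notation par := (parent up).

Lemma up_inj : injective up.
Proof. by move=> u v /(congr1 src); rewrite !(or_src rt). Qed.

Lemma up_open v : is_open (up v) = (v == r).
Proof. by rewrite (or_open rt) (inj_eq up_inj). Qed.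

Lemma par_root : par r = r.
Proof.
by rewrite /parent; have := up_open r; rewrite eqxx => /eqP->; rewrite (or_src rt).
Qed.

Lemma par_neq v : v != r -> par v != v.
Proof. by move=> /(or_rk rt); apply: contraL => /eqP; rewrite /parent => ->; rewrite ltnn. Qed.

Lemma not_up_opp d : d != up (src d) -> ~~ is_open d /\ opp d = up (src (opp d)).
Proof.
move=> du; split; last by case: (or_up rt d) => // /eqP; rewrite (negPf du).
apply: contra du; rewrite (or_open rt) => /eqP->.
by rewrite (or_src rt).
Qed.

(** An edge cannot point to infinity at both ends: each end would be the parent of the other,
    against the ranks. *)
Lemma opp_up_neq v : v != r -> opp (up v) != up (src (opp (up v))).
Proof.
move=> vr; apply/eqP => oE.
have pr : par v != r.
  apply: contra vr => /eqP; rewrite -/(par v) in oE; rewrite /parent => pE.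
  move: oE; rewrite /parent pE => /(congr1 opp); rewrite (or_oppK rt).
  have /eqP-> : is_open (up r) by rewrite up_open.
  by move=> /up_inj->.
have := ltn_trans (or_rk rt pr) (or_rk rt vr).
by rewrite /parent -oE (or_oppK rt) (or_src rt) ltnn.
Qed.

Lemma opp_up_desc d : opp d = up (src (opp d)) -> src (opp d) != r ->
  rk (src d) < rk (src (opp d)).
Proof. by move=> oE /(or_rk rt); rewrite -oE (or_oppK rt). Qed.

Lemma orooted_ranked : ranked r rk.
Proof.
have descE d : rk (src (opp d)) < rk (src d) -> d = up (src d).
  move=> lt; case: (or_up rt d) => // oE.
  have [rE|nr] := eqVneq (src (opp d)) r.
    have : is_open (opp d) by rewrite oE rE up_open.
    rewrite /is_open (or_oppK rt) => /eqP dE.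
    by move: lt; rewrite -dE ltnn.
  by have := ltn_trans lt (opp_up_desc oE nr); rewrite ltnn.
split.
- move=> d dr; rewrite leqNgt; apply/negP => lt.
  have := descE d; rewrite dr => /(_ lt) dE.
  have /eqP oE : is_open d by rewrite dE up_open.
  by move: lt; rewrite oE dr ltnn.
- by move=> v vr; exists (up v); rewrite ?(or_src rt) // (or_rk rt).
- move=> d dop; case: (or_up rt d) => dE.
    have sr : src d != r by rewrite -up_open -dE.
    by have := or_rk rt sr; rewrite -dE neq_ltn => ->.
  have sr : src (opp d) != r.
    by rewrite -up_open -dE /is_open (or_oppK rt) eq_sym.
  by have := or_rk rt sr; rewrite -dE (or_oppK rt) neq_ltn orbC => ->.
- by move=> d d' ss /descE-> /descE->; rewrite ss.
Qed.

Lemma orooted_tree : is_tree T.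
Proof. exact: (ranked_tree (or_oppK rt) orooted_ranked). Qed.

(** There are neither loops nor multiple edges, and the open half-edge is the only one whose ends
    agree. Hence an isomorphism of such trees need only be given on vertices, see [simple_iso]. *)
Lemma orooted_simple : injective (fun d : half T => (src d, src (opp d))).
Proof.
suff key d d' : src d = src d' -> src (opp d) = src (opp d') ->
    d = up (src d) -> d = d'.
  move=> d d' [e1 e2]; case: (or_up rt d) => dE; first exact: key.
  apply: (inv_inj (or_oppK rt)); apply: key => //.
  by rewrite !(or_oppK rt).
move=> e1 e2 dE; case: (or_up rt d') => d'E; first by rewrite dE d'E e1.
have [sr|sr] := eqVneq (src d) r.
  have opn : is_open d by rewrite dE sr up_open.
  have oE : opp d = d by exact/eqP.
  by apply: (inv_inj (or_oppK rt)); rewrite d'E -e2 oE -dE.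
have [rE|nr] := eqVneq (src (opp d')) r.
  have opn : is_open (opp d') by rewrite d'E rE up_open.
  move: opn; rewrite /is_open (or_oppK rt) => /eqP opn.
  by case/eqP: sr; rewrite e1 opn.
have lt := or_rk rt sr; rewrite -dE in lt.
by have := ltn_trans lt; rewrite e1 e2 => /(_ _ (opp_up_desc d'E nr)); rewrite ltnn.
Qed.

Lemma fiter_par_root v : exists n, iter n par v = r.
Proof.
have [n] := ubnP (rk v); elim: n v => // n IH v ltn.
have [->|vr] := eqVneq v r; first by exists 0.
have [|m mE] := IH (par v); first exact: leq_trans (or_rk rt vr) _.
by exists m.+1; rewrite iterSr.
Qed.

End OpenRooted.

(** * Isomorphisms *)

Lemma tree_transport (T T' : graph) (fV : vert T -> vert T') (fH : half T -> half T') :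
    bijective fV -> bijective fH -> (forall d, src (fH d) = fV (src d)) ->
    (forall d, opp (fH d) = fH (opp d)) -> involutive (@opp T) ->
  is_tree T -> is_tree T'.
Proof.
move=> [gV gVK fVK] [gH gHK fHK] srcE oppE oppK tr.
have sE d : src (gH d) = gV (src d) by rewrite -[d in RHS]fHK srcE gVK.
have oE d : opp (gH d) = gH (opp d) by rewrite -[d in RHS]fHK oppE gHK.
have oppK' : involutive (@opp T') by move=> d; rewrite -[d]fHK !oppE oppK.
have [[/set0Pn[r _] _] _] := tr.
have [rk [h1 h2 h3 h4]] := tree_ranked oppK r tr.
apply: (@ranked_tree T' oppK' (fV r) (rk \o gV)); split.
- by move=> d dr; have := h1 (gH d); rewrite sE oE sE dr gVK => /(_ erefl) /=; rewrite gVK.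
- move=> v vr; case: (h2 (gV v)) => [|d dv lt].
    by apply: contraNneq vr => <-; rewrite fVK.
  by exists (fH d); rewrite ?srcE ?dv ?fVK //= oppE srcE gVK.
- move=> d dop; have := h3 (gH d); rewrite /is_open oE (can_eq fHK) !sE; exact.
- move=> d d' ss /= lt lt'; apply: (can_inj fHK); apply: h4.
  + by rewrite !sE ss.
  + by rewrite oE !sE.
  + by rewrite oE !sE.
Qed.

Definition by_iso_on (T T' : bytree) (fV : vert T -> vert T')
    (fH : half T -> half T') : Prop :=
  [/\ bijective fV /\ bijective fH,
      forall d, src (fH d) = fV (src d),
      forall d, opp (fH d) = fH (opp d),
      forall v, by_gen (fV v) = by_gen v
    & (forall v, blueV (fV v) = blueV v) /\
      (forall d, blueH (fH d) = blueH d)].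

Lemma by_iso_sym (T T' : bytree) : by_iso T T' -> by_iso T' T.
Proof.
move=> [fV [fH [[[gV gVK fVK] [gH gHK fHK]] sE oE gE [bV bH]]]].
exists gV, gH; split; [split | | | | split].
- by exists fV.
- by exists fH.
- by move=> d; rewrite -{2}[d]fHK sE gVK.
- by move=> d; rewrite -{2}[d]fHK oE gHK.
- by move=> v; rewrite -{2}[v]fVK gE.
- by move=> v; rewrite -{2}[v]fVK bV.
- by move=> d; rewrite -{2}[d]fHK bH.
Qed.

Lemma by_iso_trans (T2 T1 T3 : bytree) : by_iso T1 T2 -> by_iso T2 T3 -> by_iso T1 T3.
Proof.
move=> [fV [fH [[bfV bfH] sE oE gE [bV bH]]]] [gV [gH [[bgV bgH] sE' oE' gE' [bV' bH']]]].
exists (gV \o fV), (gH \o fH); split; [split | | | | split]; try exact: bij_comp;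
  by move=> x /=; rewrite ?sE' ?sE ?oE' ?oE ?gE' ?gE ?bV' ?bV ?bH' ?bH.
Qed.

Lemma by_iso_tree (T T' : bytree) : involutive (@opp T) -> by_iso T T' ->
  is_tree T -> is_tree T'.
Proof. by move=> oK [fV [fH [[bV bH] sE oE _ _]]]; exact: tree_transport bV bH sE oE oK. Qed.

Definition edge_col (T : bytree) (b : bool) (u v : vert T) : bool :=
  [exists d : half T, [&& src d == u, src (opp d) == v & blueH d == b]].

Definition simple_graph (T : graph) : Prop :=
  involutive (@opp T) /\ injective (fun d : half T => (src d, src (opp d))).

Lemma simple_iso (T T' : bytree) (f : vert T -> vert T') :
    simple_graph T -> simple_graph T' -> bijective f ->
    (forall v, by_gen (f v) = by_gen v) -> (forall v, blueV (f v) = blueV v) ->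
    (forall b u v, edge_col b (f u) (f v) = edge_col b u v) ->
  exists fH, by_iso_on f fH.
Proof.
move=> [oK inj] [oK' inj'] bf genE bVE eE.
have [g gK fK] := bf.
pose R (d : half T) (d' : half T') :=
  [/\ src d' = f (src d), src (opp d') = f (src (opp d)) & blueH d' = blueH d].
have [|||d d' e [s1 o1 _] [s2 o2 _]|fH bH RH] := @rel_bijection _ _ R.
- move=> d; have : edge_col (blueH d) (f (src d)) (f (src (opp d))).
    by rewrite eE; apply/existsP; exists d; rewrite !eqxx.
  by case/existsP=> d' /and3P[/eqP ? /eqP ? /eqP ?]; exists d'.
- move=> d'; have : edge_col (blueH d') (g (src d')) (g (src (opp d'))).
    by rewrite -eE !fK; apply/existsP; exists d'; rewrite !eqxx.
  case/existsP=> d /and3P[/eqP h1 /eqP h2 /eqP h3]; exists d.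
  by split; rewrite ?h1 ?h2 ?fK.
- by move=> d d' e [s1 o1 _] [s2 o2 _]; apply: inj'; rewrite s1 s2 o1 o2.
- apply: inj; move: s2 o2; rewrite s1 o1 => /(bij_inj bf) -> /(bij_inj bf) ->.
  by [].
exists fH; split=> //.
- by move=> d; have [] := RH d.
- move=> d; have [s1 o1 _] := RH d; have [s2 o2 _] := RH (opp d).
  by apply: inj'; rewrite s2 o2 !oK oK' s1 o1.
- by split=> // d; have [] := RH d.
Qed.

(** * Double covers *)

(* [G] is a double cover of [T], with covering involution [iota], branched along
   the blue part; the vertices in [L] are leaves of [T] whose preimages are
   midpoints of anti-invariant edges and hence are not vertices of [G]. *)
Record dcover (G : hgraph) (T : bytree) (L : pred (vert T))
    (pV : vert G -> vert T) (pH : half G -> half T) : Prop := DCover {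
  dc_src : forall d, src (pH d) = pV (src d);
  dc_opp : forall d, ~~ anti_inv d -> opp (pH d) = pH (opp d);
  dc_anti : forall d, anti_inv d -> L (src (opp (pH d)));
  dc_V : forall v w, pV v = pV w -> w = v \/ w = iotaV v;
  dc_iV : forall v, pV (iotaV v) = pV v;
  dc_H : forall d e, pH d = pH e -> e = d \/ e = iotaH d;
  dc_iH : forall d, pH (iotaH d) = pH d;
  dc_imV : forall t, ~~ L t -> exists v, pV v = t;
  dc_nL : forall v, ~~ L (pV v);
  dc_imH : forall d, ~~ L (src d) -> exists h, pH h = d;
  dc_bV : forall v, blueV (pV v) = (iotaV v == v);
  dc_bH : forall d, blueH (pH d) = (iotaH d == d);
  dc_gen : forall v, by_gen (pV v) = hg_gen v;
  dc_L : forall t, L t -> [/\ blueV t, by_gen t = 0 &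
    exists d, [/\ src d = t, ~~ blueH d, ~~ L (src (opp d)) &
               forall d', src d' = t -> d' = d]] }.

Section Cover.

Variables (G : hgraph) (T : bytree) (L : pred (vert T)).
Variables (pV : vert G -> vert T) (pH : half G -> half T).
Hypotheses (wfG : hyp_wf G) (wfT : by_wf T) (cov : dcover L pV pH).

Lemma hg_oppK : involutive (@opp G). Proof. by case: wfG. Qed.
Lemma hg_iVK : involutive (@iotaV G). Proof. by case: wfG. Qed.
Lemma hg_iHK : involutive (@iotaH G). Proof. by case: wfG. Qed.
Lemma hg_srcI (d : half G) : src (iotaH d) = iotaV (src d). Proof. by case: wfG. Qed.
Lemma hg_oppI (d : half G) : opp (iotaH d) = iotaH (opp d). Proof. by case: wfG. Qed.
Lemma by_oppK : involutive (@opp T). Proof. by case: wfT. Qed.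
Lemma by_bopp (d : half T) : blueH (opp d) = blueH d. Proof. by case: wfT. Qed.

Lemma anti_opp (d : half G) : anti_inv (opp d) = anti_inv d.
Proof.
rewrite /anti_inv /is_open hg_oppK eq_sym; congr (_ && _).
by rewrite -hg_oppI (inv_eq hg_oppK).
Qed.

Lemma anti_iota (d : half G) : anti_inv (iotaH d) = anti_inv d.
Proof.
by rewrite /anti_inv /is_open hg_oppI !(inj_eq (inv_inj hg_iHK)).
Qed.

Lemma anti_nfix (d : half G) : anti_inv d -> iotaH d != d.
Proof. by case/andP=> opn /eqP->. Qed.

Lemma dc_src_nL h : ~~ L (src (pH h)).
Proof. by rewrite (dc_src cov) (dc_nL cov). Qed.

(** The neighbour of a leaf in [L] is not in [L], so [opp d] is the image of some [h]. If [h] were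
    not anti-invariant, [d] would be the image of [opp h], but images never start in [L]. *)
Lemma dc_leaf d : L (src d) -> exists2 h, pH h = opp d & anti_inv h.
Proof.
move=> Ld; have [_ _ [d' [d's _ nL uniqd]]] := dc_L cov Ld.
have dE : d = d' by apply: uniqd.
rewrite -dE in nL; have [h hE] := dc_imH cov nL.
exists h => //; apply/negPn/negP => /(dc_opp cov); rewrite hE by_oppK => dE'.
by have := dc_src_nL (opp h); rewrite -dE' Ld.
Qed.

Lemma dc_antiE h : anti_inv h = L (src (opp (pH h))).
Proof.
apply/idP/idP => [/(dc_anti cov) //|Lh]; apply/negPn/negP => /(dc_opp cov) E.
by have := dc_src_nL (opp h); rewrite -E Lh.
Qed.

Lemma dc_openE h : is_open (pH h) = is_open h.
Proof.
have [ah|nah] := boolP (anti_inv h).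
  have [/negPf-> _] := andP ah; apply/negP => /eqP oE.
  by move: (dc_anti cov ah); rewrite oE (negPf (dc_src_nL h)).
rewrite /is_open (dc_opp cov nah); apply/eqP/eqP => [/esym|->] //.
move=> /(dc_H cov)[//|E].
apply/eqP; apply: contraNT nah => opn; by rewrite /anti_inv /is_open opn E eqxx.
Qed.

End Cover.

(** A point of the base outside [L] comes from a vertex or half-edge of [G]. A leaf in [L] and its
    half-edge are seen from [G] only as the far side of an anti-invariant half-edge. The disjunction
    matches the two bases through either kind of witness. *)
Lemma dcover_base_total (G : hgraph) (T T' : bytree) (L : pred (vert T))
    (L' : pred (vert T')) pV pH pV' pH' : hyp_wf G -> by_wf T ->
    dcover (G := G) L pV pH -> dcover (G := G) L' pV' pH' ->
  (forall t, exists t', (exists2 g, pV g = t & pV' g = t') \/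
    (exists2 a, anti_inv a & src (opp (pH a)) = t /\ src (opp (pH' a)) = t')) /\
  (forall d, exists d', (exists2 h, pH h = d & pH' h = d') \/
    (exists2 a, anti_inv a & opp (pH a) = d /\ opp (pH' a) = d')).
Proof.
move=> wG wT c c'; split=> [t|d].
  have [Lt|/(dc_imV c)[g gt]] := boolP (L t); last by exists (pV' g); left; exists g.
  have [_ _ [d [dt _ _ _]]] := dc_L c Lt.
  have [|h hd ah] := @dc_leaf _ _ _ _ _ wT c d; first by rewrite dt.
  by exists (src (opp (pH' h))); right; exists h; rewrite // hd (by_oppK wT).
have [Ld|/(dc_imH c)[h hd]] := boolP (L (src d)); last by exists (pH' h); left; exists h.
have [h hd ah] := dc_leaf wT c Ld.
by exists (opp (pH' h)); right; exists h; rewrite // hd (by_oppK wT).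
Qed.

(** Two witnesses of the same kind over one point are equal or conjugate, or half-edges over the
    only half-edge at a leaf of [L]; the second cover does not separate conjugates either. Witnesses
    of different kinds cannot meet because [L] tells them apart. *)
Lemma dcover_base_fun (G : hgraph) (T T' : bytree) (L : pred (vert T))
    (L' : pred (vert T')) pV pH pV' pH' : hyp_wf G -> by_wf T ->
    dcover (G := G) L pV pH -> dcover (G := G) L' pV' pH' ->
  (forall t t' t'', (exists2 g, pV g = t & pV' g = t') \/
    (exists2 a, anti_inv a & src (opp (pH a)) = t /\ src (opp (pH' a)) = t') ->
    (exists2 g, pV g = t & pV' g = t'') \/
    (exists2 a, anti_inv a & src (opp (pH a)) = t /\ src (opp (pH' a)) = t'') ->
    t' = t'') /\
  (forall d d' d'', (exists2 h, pH h = d & pH' h = d') \/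
    (exists2 a, anti_inv a & opp (pH a) = d /\ opp (pH' a) = d') ->
    (exists2 h, pH h = d & pH' h = d'') \/
    (exists2 a, anti_inv a & opp (pH a) = d /\ opp (pH' a) = d'') -> d' = d'').
Proof.
move=> wG wT c c'.
have HE (a a2 : half G) : pH a = pH a2 -> pH' a = pH' a2.
  by move=> /(dc_H c)[->|->] //; rewrite (dc_iH c').
split=> [t t' t''|d d' d''].
  case=> [[g gt <-]|[a aa [at_ <-]]]; case=> [[g' gt' <-]|[a' aa' [at' <-]]].
  - by move: gt'; rewrite -gt => /esym/(dc_V c)[->|->] //; rewrite (dc_iV c').
  - by have := dc_anti c aa'; rewrite at' -gt (negPf (dc_nL c g)).
  - by have := dc_anti c aa; rewrite at_ -gt' (negPf (dc_nL c g')).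
  - have La := dc_anti c aa; have [_ _ [d [_ _ _ uniqd]]] := dc_L c La.
    have : opp (pH a) = opp (pH a').
      by rewrite (uniqd (opp (pH a))) // (uniqd (opp (pH a'))) // at' at_.
    by move=> /(inv_inj (by_oppK wT))/HE->.
case=> [[h ht <-]|[a aa [at_ <-]]]; case=> [[h' ht' <-]|[a' aa' [at' <-]]].
- by apply: HE; rewrite ht.
- by have := dc_anti c aa'; rewrite at' -ht (negPf (dc_src_nL c h)).
- by have := dc_anti c aa; rewrite at_ -ht' (negPf (dc_src_nL c h')).
- by congr opp; apply: HE; apply: (inv_inj (by_oppK wT)); rewrite at_ at'.
Qed.

(** Both bases are the quotient of [G] by its involution: colours are read off from the fixed
    points, genera from the vertices, and the leaves in [L] from the anti-invariant edges. *)
Lemma dcover_base_iso (G : hgraph) (T T' : bytree) (L : pred (vert T))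
    (L' : pred (vert T')) pV pH pV' pH' : hyp_wf G -> by_wf T -> by_wf T' ->
    dcover (G := G) L pV pH -> dcover (G := G) L' pV' pH' ->
  by_iso T T'.
Proof.
move=> wG wT wT' c c'.
pose RV t t' := (exists2 g, pV g = t & pV' g = t') \/
    (exists2 a, anti_inv a & src (opp (pH a)) = t /\ src (opp (pH' a)) = t').
pose RH d d' := (exists2 h, pH h = d & pH' h = d') \/
    (exists2 a, anti_inv a & opp (pH a) = d /\ opp (pH' a) = d').
have swapV t t' : RV t t' <-> (exists2 g, pV' g = t' & pV g = t) \/
    (exists2 a, anti_inv a & src (opp (pH' a)) = t' /\ src (opp (pH a)) = t).
  by split=> -[[x ? ?]|[x ? [? ?]]]; [left|right|left|right]; exists x.
have swapH t t' : RH t t' <-> (exists2 g, pH' g = t' & pH g = t) \/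
    (exists2 a, anti_inv a & opp (pH' a) = t' /\ opp (pH a) = t).
  by split=> -[[x ? ?]|[x ? [? ?]]]; [left|right|left|right]; exists x.
have [totV totH] := dcover_base_total wG wT c c'.
have [totV' totH'] := dcover_base_total wG wT' c' c.
have [funV funH] := dcover_base_fun wG wT c c'.
have [funV' funH'] := dcover_base_fun wG wT' c' c.
have [//|t'|//|t t' t'' /swapV h1 /swapV h2|fV bV RfV] := @rel_bijection _ _ RV.
- by have [t /swapV] := totV' t'; exists t.
- exact: funV' h1 h2.
have [//|t'|//|t t' t'' /swapH h1 /swapH h2|fH bH RfH] := @rel_bijection _ _ RH.
- by have [t /swapH] := totH' t'; exists t.
- exact: funH' h1 h2.
exists fV, fH; split=> //; last split.
- move=> d; apply: (funV (src d)); last exact: RfV.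
  case: (RfH d) => [[h hd hd']|[a aa [ad ad']]].
    by left; exists (src h); rewrite -(dc_src c, dc_src c') ?hd ?hd' // -(dc_src c') hd'.
  by right; exists a; rewrite // ad ad'.
- move=> d; apply: (funH (opp d)); last exact: RfH.
  case: (RfH d) => [[h <- <-]|[a aa [<- <-]]].
    have [ah|nah] := boolP (anti_inv h); first by right; exists h.
    by left; exists (opp h); rewrite ?(dc_opp c) ?(dc_opp c').
  by left; exists a; rewrite ?(by_oppK wT) ?(by_oppK wT').
- move=> t; case: (RfV t) => [[g <- <-]|[a aa [<- <-]]].
    by rewrite (dc_gen c) (dc_gen c').
  by have [_ -> _] := dc_L c (dc_anti c aa); have [_ -> _] := dc_L c' (dc_anti c' aa).
- move=> t; case: (RfV t) => [[g <- <-]|[a aa [<- <-]]].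
    by rewrite (dc_bV c) (dc_bV c').
  by have [-> _ _] := dc_L c (dc_anti c aa); have [-> _ _] := dc_L c' (dc_anti c' aa).
- move=> d; case: (RfH d) => [[g <- <-]|[a aa [<- <-]]].
    by rewrite (dc_bH c) (dc_bH c').
  by rewrite (by_bopp wT) (by_bopp wT') (dc_bH c) (dc_bH c').
Qed.

(* A sheet of the cover: a choice, compatible with incidence, of one of the two
   preimages of each yellow vertex and edge. *)
Definition sheet (G : hgraph) (sv : vert G -> bool) (sh : half G -> bool) : Prop :=
  [/\ forall v, sv (iotaV v) = (sv v ==> (iotaV v == v)),
      forall d, sh (iotaH d) = (sh d ==> (iotaH d == d)),
      forall d, iotaV (src d) != src d -> sv (src d) = sh d
    & forall d, ~~ anti_inv d -> sh (opp d) = sh d].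

(** Comparing positions in the enumeration selects one element in each orbit of size two, and the
    element of each orbit of size one. *)
Lemma orientation (I : finType) (i : I -> I) (x : I) : involutive i ->
  let c x := enum_rank x <= enum_rank (i x) in c (i x) = (c x ==> (i x == x)).
Proof.
move=> iK c; rewrite /c iK; have [->|ne] := eqVneq (i x) x; first by rewrite leqnn.
have : enum_rank (i x) != enum_rank x :> nat.
  by apply: contra ne => /eqP/val_inj/enum_rank_inj->.
by case: ltngtP.
Qed.

Section Sheet.

Variables (G : hgraph) (T : bytree) (L : pred (vert T)).
Variables (pV : vert G -> vert T) (pH : half G -> half T).
Hypotheses (wfG : hyp_wf G) (wfT : by_wf T) (cov : dcover L pV pH).
Variables (r : vert T) (rk : vert T -> nat).
Hypothesis rkd : ranked r rk.

Let desc (h : half G) := rk (src (opp (pH h))) < rk (src (pH h)).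

(** The sheets are extended from [r] outwards. A vertex copies the sheet of its neighbour one step
    closer to [r], unless one of the two is a branch point, where the choice is free. This is
    consistent because the base has a single descending half-edge at each vertex. *)
Lemma vertex_sheet : exists sv : vert G -> bool,
  (forall v, sv (iotaV v) = (sv v ==> (iotaV v == v))) /\
  (forall h, ~~ anti_inv h -> iotaV (src h) != src h ->
     iotaV (src (opp h)) != src (opp h) -> sv (src (opp h)) = sv (src h)).
Proof.
have srcI := hg_srcI wfG; have oppI := hg_oppI wfG; have iVK := hg_iVK wfG.
have oK := hg_oppK wfG.
suff [sv [s1 s2]] : exists sv : vert G -> bool,
  (forall v, sv (iotaV v) = (sv v ==> (iotaV v == v))) /\
  (forall h, ~~ anti_inv h -> desc h -> iotaV (src h) != src h ->
     iotaV (src (opp h)) != src (opp h) -> sv (src (opp h)) = sv (src h)).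
  exists sv; split=> // h nah n1 n2.
  have [/eqP->//|opn] := boolP (is_open h).
  have opn' : ~~ is_open (pH h) by rewrite (dc_openE cov).
  have := rk_neq rkd opn'; rewrite neq_ltn => /orP[lt|lt]; first exact: s2.
  apply/esym; have := s2 (opp h); rewrite oK; apply=> //.
    by rewrite (anti_opp wfG).
  by rewrite /desc -(dc_opp cov nah) (by_oppK wfT).
have [N ltN] : exists N, forall v, rk v < N.
  exists (\max_v rk v).+1 => v; rewrite ltnS; exact: leq_bigmax.
suff [sv [s1 s2]] : exists sv : vert G -> bool,
  (forall v, sv (iotaV v) = (sv v ==> (iotaV v == v))) /\
  (forall h, ~~ anti_inv h -> desc h -> rk (pV (src h)) < N ->
     iotaV (src h) != src h ->
     iotaV (src (opp h)) != src (opp h) -> sv (src (opp h)) = sv (src h)).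
  by exists sv; split=> // h nah dh; apply: s2.
elim: N {ltN} => [|N [sv [s1 s2]]].
  exists (fun v => enum_rank v <= enum_rank (iotaV v)); split=> // v.
  exact: (orientation v iVK).
have dI h : desc (iotaH h) = desc h by rewrite /desc (dc_iH cov).
pose good g h := [&& ~~ anti_inv h, desc h, src h == g & iotaV (src (opp h)) != src (opp h)].
(* [sv] is already compatible below rank [N]. Only unbranched vertices of rank [N] are changed, and
   only if their descending edge leads to an unbranched vertex. *)
pose sv' g := if (rk (pV g) == N) && (iotaV g != g) then
    if [pick h | good g h] is Some h then sv (src (opp h)) else sv g
  else sv g.
have svE h : good (src h) h -> rk (pV (src h)) = N -> iotaV (src h) != src h ->
    sv' (src h) = sv (src (opp h)).
  move=> gh rkh nf; rewrite /sv' rkh eqxx nf /=; case: pickP => [e|/(_ h)]; last by rewrite gh.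
  case/and4P=> nae de /eqP seh nfe; have /and4P[nah dh _ nfh] := gh.
  have pE : pH e = pH h.
    apply: (rk_uniq rkd) => //; by rewrite !(dc_src cov) seh.
  case: (dc_H cov pE) => [->//|hE]; case/eqP: nf.
  by rewrite {1}hE srcI iVK seh.
exists sv'; split=> [v|h nah dh].
  rewrite /sv' (dc_iV cov) iVK [v == iotaV v]eq_sym.
  case: ifP => //= /andP[/eqP rv nf].
  case: pickP => [h' h'P|none'].
    have /and4P[na' d' /eqP s' nf'] := h'P.
    have gI : good v (iotaH h').
      rewrite /good (anti_iota wfG) na' dI d' srcI s' iVK eqxx /=.
      by rewrite oppI srcI (inj_eq (inv_inj iVK)).
    have sI : src (iotaH h') = v by rewrite srcI s' iVK.
    have := svE (iotaH h'); rewrite sI => /(_ gI rv nf); rewrite /sv' rv eqxx nf /= => ->.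
    by rewrite oppI srcI s1 (negPf nf) (negPf nf') !implybF negbK.
  case: pickP => [h' h'P|none]; last by rewrite s1 (negPf nf).
  have /and4P[na' d' /eqP s' nf'] := h'P.
  have := none' (iotaH h'); rewrite /good (anti_iota wfG) na' dI d'.
  by rewrite srcI s' eqxx oppI srcI (inj_eq (inv_inj iVK)) nf'.
rewrite ltnS leq_eqVlt => /orP[/eqP rv|lt] nf nf'; last first.
  rewrite /sv' (ltn_eqF lt) /=; have lt' : rk (pV (src (opp h))) < N.
    by apply: leq_trans (ltnW lt); move: dh; rewrite /desc (dc_opp cov nah) !(dc_src cov).
  by rewrite (ltn_eqF lt') /=; apply: s2.
rewrite (svE h) //; last by rewrite /good nah dh eqxx.
rewrite /sv'; have lt' : rk (pV (src (opp h))) < N.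
  by rewrite -rv; move: dh; rewrite /desc (dc_opp cov nah) !(dc_src cov).
by rewrite (ltn_eqF lt').
Qed.

(** An edge with an unbranched end inherits the sheet of that end. Between two branch points the
    sheet of an edge is free, but both half-edges must agree; an anti-invariant edge, on the
    contrary, has its half-edges on different sheets. *)
Lemma sheet_exists : exists sv sh, @sheet G sv sh.
Proof.
have srcI := hg_srcI wfG; have oppI := hg_oppI wfG; have iVK := hg_iVK wfG.
have iHK := hg_iHK wfG; have oK := hg_oppK wfG.
have [sv [s1 s2]] := vertex_sheet.
(* [m] takes the same value on both half-edges of an edge, so comparing [m h] with [m (iotaH h)]
   chooses between whole edges. *)
pose m (h : half G) := minn (enum_rank h) (enum_rank (opp h)).
pose c (h : half G) := if anti_inv h then enum_rank h <= enum_rank (iotaH h)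
  else m h <= m (iotaH h).
have cI h : c (iotaH h) = (c h ==> (iotaH h == h)).
  rewrite /c (anti_iota wfG); case: ifP => ah; first exact: (orientation h iHK).
  rewrite iHK; have [->|nf] := eqVneq (iotaH h) h; first by rewrite leqnn.
  have : m (iotaH h) != m h.
    have eqr (x y : half G) : (enum_rank x == enum_rank y :> nat) = (x == y).
      by apply/eqP/eqP => [/val_inj/enum_rank_inj|->].
    have aE : iotaH h != opp h.
      apply: contraFN ah => /eqP hE; rewrite /anti_inv hE eqxx andbT.
      by rewrite /is_open -hE.
    apply/negP; rewrite /m /minn; case: ifP => _; case: ifP => _; rewrite eqr.
    - by rewrite (negPf nf).
    - by rewrite (negPf aE).
    - by rewrite (inv_eq oK) (negPf aE).
    - by rewrite (inj_eq (inv_inj oK)) (negPf nf).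
  by case: ltngtP.
have cO h : ~~ anti_inv h -> c (opp h) = c h.
  by move=> nah; rewrite /c (anti_opp wfG) (negPf nah) -oppI /m !oK !(minnC (enum_rank (opp _))).
have fixS (h : half G) : iotaH h = h -> iotaV (src h) = src h.
  by move=> hE; have := srcI h; rewrite hE.
pose sh h := if iotaV (src h) != src h then sv (src h) else
  if ~~ anti_inv h && (iotaV (src (opp h)) != src (opp h)) then sv (src (opp h)) else c h.
exists sv, sh; split=> [//|h|h nf|h nah].
- rewrite /sh (anti_iota wfG) oppI !srcI !(inj_eq (inv_inj iVK)) !s1 cI.
  have [hf|hnf] := eqVneq (iotaH h) h.
    have hf' : iotaH (opp h) = opp h by rewrite -oppI hf.
    by rewrite (fixS h hf) (fixS _ hf') !eqxx /= andbF !implybT.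
  by case: ifP => [/negPf->//|_]; case: ifP => // /andP[_ /negPf->].
- by rewrite /sh nf.
- rewrite /sh (anti_opp wfG) nah oK /=.
  have [e1|e1] := eqVneq (iotaV (src h)) (src h);
    have [e2|e2] := eqVneq (iotaV (src (opp h))) (src (opp h)) => //=.
    exact: cO.
  exact: s2.
Qed.

End Sheet.

Lemma sheet_fixV (G : hgraph) sv sh (v : vert G) : sheet sv sh -> iotaV v = v -> sv v.
Proof. by case=> s1 _ _ _ vE; have := s1 v; rewrite vE eqxx implybT. Qed.

Lemma sheet_fixH (G : hgraph) sv sh (v : half G) : sheet sv sh -> iotaH v = v -> sh v.
Proof. by case=> _ s1 _ _ vE; have := s1 v; rewrite vE eqxx implybT. Qed.

(** Points of the two covers are matched when they lie over the same point and on the same sheet. If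
    a candidate is on the wrong sheet, it is not fixed, since a sheet contains all fixed points, and
    its conjugate is on the right one. The same remark makes the partner unique. *)
Lemma dcover_unique (T : bytree) (L : pred (vert T)) (G G' : hgraph)
    pV pH pV' pH' : is_tree T -> by_wf T -> hyp_wf G -> hyp_wf G' ->
    dcover (G := G) L pV pH -> dcover (G := G') L pV' pH' ->
  hg_iso G G'.
Proof.
move=> tr wT wG wG' c c'; have [[/set0Pn[r _] _] _] := tr.
have [rk rkd] := tree_ranked (by_oppK wT) r tr.
have [sv [sh S]] := sheet_exists wG wT c rkd.
have [sv' [sh' S']] := sheet_exists wG' wT c' rkd.
pose RV g g' := pV g = pV' g' /\ sv g = sv' g'.
pose RH h h' := pH h = pH' h' /\ sh h = sh' h'.
have fixVE g g' : pV g = pV' g' -> (iotaV g == g) = (iotaV g' == g').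
  by move=> E; rewrite -(dc_bV c) -(dc_bV c') E.
have fixHE h h' : pH h = pH' h' -> (iotaH h == h) = (iotaH h' == h').
  by move=> E; rewrite -(dc_bH c) -(dc_bH c') E.
have totV g : exists g', RV g g'.
  have [g' gE] := dc_imV c' (dc_nL c g).
  have [sE|sE] := eqVneq (sv g) (sv' g'); first by exists g'.
  exists (iotaV g'); split; first by rewrite (dc_iV c').
  have nf : iotaV g' != g'.
    apply: contra sE => f'; have := f'; rewrite -(fixVE g) // => /eqP fg.
    by rewrite (sheet_fixV S fg) (sheet_fixV S' (eqP f')).
  by case: S' => -> _ _ _; rewrite (negPf nf) implybF; case: (sv g) (sv' g') sE => [] [].
have totV' g' : exists g, RV g g'.
  have [g gE] := dc_imV c (dc_nL c' g').
  have [sE|sE] := eqVneq (sv g) (sv' g'); first by exists g.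
  exists (iotaV g); split; first by rewrite (dc_iV c).
  have nf : iotaV g != g.
    apply: contra sE => f; have := f; rewrite (fixVE g g') // => /eqP fg'.
    by rewrite (sheet_fixV S' fg') (sheet_fixV S (eqP f)).
  by case: S => -> _ _ _; rewrite (negPf nf) implybF; case: (sv g) (sv' g') sE => [] [].
have totH h : exists h', RH h h'.
  have [h' gE] := dc_imH c' (dc_src_nL c h).
  have [sE|sE] := eqVneq (sh h) (sh' h'); first by exists h'.
  exists (iotaH h'); split; first by rewrite (dc_iH c').
  have nf : iotaH h' != h'.
    apply: contra sE => f'; have := f'; rewrite -(fixHE h) // => /eqP fg.
    by rewrite (sheet_fixH S fg) (sheet_fixH S' (eqP f')).
  by case: S' => _ -> _ _; rewrite (negPf nf) implybF; case: (sh h) (sh' h') sE => [] [].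
have totH' h' : exists h, RH h h'.
  have [h gE] := dc_imH c (dc_src_nL c' h').
  have [sE|sE] := eqVneq (sh h) (sh' h'); first by exists h.
  exists (iotaH h); split; first by rewrite (dc_iH c).
  have nf : iotaH h != h.
    apply: contra sE => f; have := f; rewrite (fixHE h h') // => /eqP fg'.
    by rewrite (sheet_fixH S' fg') (sheet_fixH S (eqP f)).
  by case: S => _ -> _ _; rewrite (negPf nf) implybF; case: (sh h) (sh' h') sE => [] [].
have funV g g1 g2 : RV g g1 -> RV g g2 -> g1 = g2.
  move=> [pE1 s1] [pE2 sE]; have /(dc_V c')[//|E] : pV' g1 = pV' g2 by rewrite -pE1.
  move: sE; rewrite s1 E; case: S' => -> _ _ _; have [//|] := eqVneq (iotaV g1) g1.
  by case: (sv' g1).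
have funV' g g1 g2 : RV g1 g -> RV g2 g -> g1 = g2.
  move=> [pE1 s1] [pE2 sE]; have /(dc_V c)[//|E] : pV g1 = pV g2 by rewrite pE1.
  move: sE; rewrite -s1 E; case: S => -> _ _ _; have [//|] := eqVneq (iotaV g1) g1.
  by case: (sv g1).
have funH h h1 h2 : RH h h1 -> RH h h2 -> h1 = h2.
  move=> [pE1 s1] [pE2 sE]; have /(dc_H c')[//|E] : pH' h1 = pH' h2 by rewrite -pE1.
  move: sE; rewrite s1 E; case: S' => _ -> _ _; have [//|] := eqVneq (iotaH h1) h1.
  by case: (sh' h1).
have funH' h h1 h2 : RH h1 h -> RH h2 h -> h1 = h2.
  move=> [pE1 s1] [pE2 sE]; have /(dc_H c)[//|E] : pH h1 = pH h2 by rewrite pE1.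
  move: sE; rewrite -s1 E; case: S => _ -> _ _; have [//|] := eqVneq (iotaH h1) h1.
  by case: (sh h1).
have [fV bV RfV] := rel_bijection totV totV' funV (fun g1 g2 g => @funV' g g1 g2).
have [fH bH RfH] := rel_bijection totH totH' funH (fun h1 h2 h => @funH' h h1 h2).
have RiV g g' : RV g g' -> RV (iotaV g) (iotaV g').
  move=> [pE sE]; split; first by rewrite (dc_iV c) (dc_iV c').
  by case: S => -> _ _ _; case: S' => -> _ _ _; rewrite sE (fixVE _ _ pE).
have RiH h h' : RH h h' -> RH (iotaH h) (iotaH h').
  move=> [pE sE]; split; first by rewrite (dc_iH c) (dc_iH c').
  by case: S => _ -> _ _; case: S' => _ -> _ _; rewrite sE (fixHE _ _ pE).
exists fV, fH; split; [by [] | | | | split].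
- move=> h; have [pE sE] := RfH h; apply: funV (RfV (src h)).
  have pE' : pV (src h) = pV' (src (fH h)) by rewrite -(dc_src c) -(dc_src c') pE.
  split=> //; have [f|nf] := eqVneq (iotaV (src h)) (src h).
    have /eqP f' : iotaV (src (fH h)) == src (fH h) by rewrite -(fixVE _ _ pE') f.
    by rewrite (sheet_fixV S f) (sheet_fixV S' f').
  have nf' : iotaV (src (fH h)) != src (fH h) by rewrite -(fixVE _ _ pE').
  by case: S => _ _ -> // _; case: S' => _ _ -> // _.
- move=> h; have [pE sE] := RfH h; apply: funH (RfH (opp h)).
  have aE : anti_inv h = anti_inv (fH h) by rewrite (dc_antiE c) (dc_antiE c') pE.
  have [ah|nah] := boolP (anti_inv h).
    have /andP[_ /eqP<-] := ah; have /andP[_ /eqP<-] : anti_inv (fH h) by rewrite -aE.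
    exact: RiH.
  have nah' : ~~ anti_inv (fH h) by rewrite -aE.
  split; first by rewrite -(dc_opp c) // -(dc_opp c') // pE.
  by case: S => _ _ _ -> //; case: S' => _ _ _ -> //.
- by move=> g; have [pE _] := RfV g; rewrite -(dc_gen c) -(dc_gen c') pE.
- by move=> g; apply: funV (RfV _); apply: RiV.
- by move=> h; apply: funH (RfH _); apply: RiH.
Qed.

Lemma dcover_comp_base (G : hgraph) (T T' : bytree) (L : pred (vert T))
    (L' : pred (vert T')) pV pH fV fH : dcover (G := G) L pV pH ->
    by_iso_on fV fH -> (forall t, L' (fV t) = L t) ->
  dcover (G := G) (T := T') L' (fV \o pV) (fH \o pH).
Proof.
move=> c [[bV bH] sE oE gE [bVE bHE]] LE; have [gV gVK fVK] := bV; have [gH gHK fHK] := bH.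
split=> /=.
- by move=> d; rewrite sE (dc_src c).
- by move=> d /(dc_opp c); rewrite oE => ->.
- by move=> d /(dc_anti c); rewrite oE sE LE.
- by move=> v w /(bij_inj bV)/(dc_V c).
- by move=> v; rewrite (dc_iV c).
- by move=> v w /(bij_inj bH)/(dc_H c).
- by move=> v; rewrite (dc_iH c).
- by move=> t; rewrite -[t]fVK LE => /(dc_imV c)[v <-]; exists v; rewrite ?fVK.
- by move=> v; rewrite LE (dc_nL c).
- by move=> t; rewrite -[t]fHK sE LE => /(dc_imH c)[v <-]; exists v; rewrite ?fHK.
- by move=> v; rewrite bVE (dc_bV c).
- by move=> v; rewrite bHE (dc_bH c).
- by move=> v; rewrite gE (dc_gen c).
- move=> t; rewrite -[t]fVK LE => /(dc_L c)[b g [d [ds db dL du]]].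
  rewrite bVE gE; split=> //; exists (fH d); rewrite sE ds bHE oE sE LE; split=> // d'.
  by rewrite -[d']fHK sE => /(bij_inj bV)/du->.
Qed.

Lemma dcover_comp_total (G G' : hgraph) (T : bytree) (L : pred (vert T)) pV pH :
    hg_iso G G' -> dcover (G := G') L pV pH ->
  exists qV qH, dcover (G := G) L qV qH.
Proof.
move=> [fV [fH [[bV bH] sE oE gE [iVE iHE]]]] c.
have [gV gVK fVK] := bV; have [gH gHK fHK] := bH.
have aE d : anti_inv (fH d) = anti_inv d.
  by rewrite /anti_inv /is_open iHE oE !(inj_eq (bij_inj bH)).
exists (pV \o fV), (pH \o fH); split=> /=.
- by move=> d; rewrite (dc_src c) sE.
- by move=> d; rewrite -aE => /(dc_opp c); rewrite oE.
- by move=> d; rewrite -aE => /(dc_anti c).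
- by move=> v w /(dc_V c); rewrite iVE => -[/(bij_inj bV)|/(bij_inj bV)]; [left|right].
- by move=> v; rewrite -iVE (dc_iV c).
- by move=> v w /(dc_H c); rewrite iHE => -[/(bij_inj bH)|/(bij_inj bH)]; [left|right].
- by move=> v; rewrite -iHE (dc_iH c).
- by move=> t /(dc_imV c)[v <-]; exists (gV v); rewrite fVK.
- by move=> v; rewrite (dc_nL c).
- by move=> t /(dc_imH c)[v <-]; exists (gH v); rewrite fHK.
- by move=> v; rewrite (dc_bV c) iVE (inj_eq (bij_inj bV)).
- by move=> v; rewrite (dc_bH c) iHE (inj_eq (bij_inj bH)).
- by move=> v; rewrite (dc_gen c).
- exact: dc_L c.
Qed.

(** * The quotient as the base of a double cover *)

Section Orbits.

Variables (X : finType) (i : X -> X).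
Hypothesis iK : involutive i.

Lemma to_orb_rep (o : orb i) : to_orb i (orb_rep o) = o.
Proof. by apply: val_inj; rewrite SubK /orb_rep f_iinv. Qed.

Lemma to_orb_inj x y : to_orb i x = to_orb i y -> y = x \/ y = i x.
Proof.
move=> /(congr1 val); rewrite !SubK => E.
have : y \in fibre i x by rewrite E !inE eqxx.
by rewrite !inE => /orP[] /eqP; [left | right].
Qed.

Lemma to_orb_i x : to_orb i (i x) = to_orb i x.
Proof. by apply: val_inj; rewrite !SubK /fibre iK setUC. Qed.

Lemma orb_repP x : orb_rep (to_orb i x) = x \/ orb_rep (to_orb i x) = i x.
Proof. by apply: to_orb_inj; rewrite to_orb_rep. Qed.

Lemma card_to_orb x : (#|val (to_orb i x)| == 1) = (i x == x).
Proof. by rewrite SubK cards2 (eq_sym x); case: (i x == x). Qed.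

End Orbits.

Section Quotient.

Variable X : hgraph.
Hypotheses (wfX : hyp_wf X) (noanti : forall d : half X, ~~ anti_inv d).

(** For [X := halve G] this unfolds to [T_of_G G]. *)
Let Q : bytree :=
  {| by_graph := orbit_graph X;
     by_gen := fun o : vert (orbit_graph X) =>
                 if #|val o| == 1 then hg_gen (orb_rep o) else 0;
     blueV := fun o : vert (orbit_graph X) => #|val o| == 1;
     blueH := fun o : half (orbit_graph X) => #|val o| == 1 |}.

Hypothesis fixgen : forall v : vert X, hg_gen v != 0 -> iotaV v = v.

Lemma orbit_src (d : half X) : src (to_orb iotaH d : half Q) = to_orb iotaV (src d).
Proof.
rewrite /=; case: (orb_repP iotaH d) => -> //.
by rewrite (hg_srcI wfX) (to_orb_i (hg_iVK wfX)).
Qed.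

Lemma orbit_opp (d : half X) : opp (to_orb iotaH d : half Q) = to_orb iotaH (opp d).
Proof.
rewrite /=; case: (orb_repP iotaH d) => -> //.
by rewrite (hg_oppI wfX) (to_orb_i (hg_iHK wfX)).
Qed.

Lemma orbit_wf : by_wf Q.
Proof.
split=> d.
  by rewrite -[d]to_orb_rep !orbit_opp (hg_oppK wfX).
rewrite -[d]to_orb_rep orbit_opp /= !card_to_orb.
by rewrite -(inj_eq (inv_inj (hg_oppK wfX))) -(hg_oppI wfX) !(hg_oppK wfX).
Qed.

Lemma orbit_dcover : @dcover X Q pred0 (to_orb iotaV) (to_orb iotaH).
Proof.
have iVK := hg_iVK wfX; have iHK := hg_iHK wfX.
split=> //.
- exact: orbit_src.
- by move=> d _; exact: orbit_opp.
- by move=> d; rewrite (negPf (noanti d)).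
- by move=> v w /to_orb_inj.
- exact: to_orb_i iVK.
- by move=> v w /to_orb_inj.
- exact: to_orb_i iHK.
- by move=> t _; exists (orb_rep t); exact: to_orb_rep.
- by move=> t _; exists (orb_rep t); exact: to_orb_rep.
- exact: card_to_orb.
- exact: card_to_orb.
- move=> v; rewrite /= card_to_orb; case: eqP => [iv|ni].
    by case: (orb_repP iotaV v) => ->; rewrite ?iv.
  by apply/esym/eqP/contraT => /fixgen.
Qed.

End Quotient.

Section Halve.

Variable G : hgraph.
Hypothesis wfG : hyp_wf G.

Lemma halve_opp_anti (d : half G) (ad : anti_inv d) :
  @opp (halve G) (inl d) = inr (Sub d ad).
Proof. by rewrite /= (insubT (fun d => anti_inv d) ad). Qed.

Lemma halve_opp_nanti (d : half G) : ~~ anti_inv d ->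
  @opp (halve G) (inl d) = inl (opp d).
Proof. by move=> nad; rewrite /= insubN. Qed.

Lemma halve_iota_val (a : anti_half G) :
  val (insubd a (opp (val a))) = opp (val a).
Proof. by apply: insubdK; exact: (etrans (anti_opp wfG _) (valP a)). Qed.

Lemma halve_iotaK (a : anti_half G) :
  let f := fun a : anti_half G => insubd a (opp (val a)) in f (f a) = a.
Proof. by apply: val_inj; rewrite !halve_iota_val (hg_oppK wfG). Qed.

Lemma halve_wf : hyp_wf (halve G).
Proof.
have oK := hg_oppK wfG; split.
- case=> [d|a].
    have [ad|nad] := boolP (anti_inv d); first by rewrite (halve_opp_anti ad).
    by rewrite !halve_opp_nanti ?oK // (anti_opp wfG).
  by rewrite /= valK.
- by case=> [v|m] //=; rewrite (hg_iVK wfG).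
- case=> [d|a] /=; first by rewrite (hg_iHK wfG).
  by congr inr; exact: halve_iotaK.
- case=> [d|a] /=; first by rewrite (hg_srcI wfG).
  congr inr; apply: val_inj; rewrite !SubK /anti_edge halve_iota_val oK.
  by rewrite setUC.
- case=> [d|a].
    have [ad|nad] := boolP (anti_inv d).
      have ad' : anti_inv (iotaH d) by rewrite (anti_iota wfG).
      change (@opp (halve G) (inl (iotaH d)) = @iotaH (halve G) (@opp (halve G) (inl d))).
      rewrite (halve_opp_anti ad') (halve_opp_anti ad) /=.
      congr inr; apply: val_inj; rewrite halve_iota_val SubK.
      by have /andP[_ /eqP] := ad.
    change (@opp (halve G) (inl (iotaH d)) = @iotaH (halve G) (@opp (halve G) (inl d))).
    rewrite !halve_opp_nanti ?(anti_iota wfG) //=.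
    by rewrite (hg_oppI wfG).
  rewrite /= halve_iota_val; congr inl.
  by have /andP[_ /eqP] := valP a.
Qed.

Lemma halve_noanti (d : half (halve G)) : ~~ anti_inv d.
Proof.
case: d => [d|a]; last by rewrite /anti_inv andbF.
have [ad|nad] := boolP (anti_inv d).
  by rewrite /anti_inv (halve_opp_anti ad) andbF.
by have := nad; rewrite /anti_inv /is_open (halve_opp_nanti nad).
Qed.

Lemma halve_fixgen : hyp_cond1 G -> hyp_cond1 (halve G).
Proof. by move=> c1 [v|m] //= /c1->. Qed.

Lemma T_of_G_wf : by_wf (T_of_G G).
Proof. exact: (orbit_wf halve_wf). Qed.

Section Restrict.

Variables (T : bytree) (pV : vert (halve G) -> vert T) (pH : half (halve G) -> half T).
Hypotheses (wfT : by_wf T) (cov : @dcover (halve G) T pred0 pV pH).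

Definition is_mid : pred (vert T) := [pred t | [exists m : midpoint G, pV (inr m) == t]].

Lemma is_mid_src d : is_mid (src (pH d)) = if d is inr _ then true else false.
Proof.
rewrite (dc_src cov); case: d => [d|a] /=.
  by apply/existsP => -[m /eqP/esym/(dc_V cov)[]].
by apply/existsP; exists (mid a).
Qed.

(** The midpoints are forgotten and their images become the set [L]. The two half-edges at a
    midpoint are swapped by the involution, so the image has a single half-edge, and it is
    yellow. *)
Lemma dcover_restrict : @dcover G T is_mid (pV \o inl) (pH \o inl).
Proof.
have oppE d := dc_opp cov (halve_noanti d).
split=> /=.
- by move=> d; rewrite (dc_src cov).
- by move=> d nad; rewrite oppE halve_opp_nanti.
- by move=> d ad; rewrite oppE halve_opp_anti is_mid_src.
- by move=> v w /(dc_V cov)[[->]|[->]]; [left|right].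
- by move=> v; exact: (dc_iV cov (inl v)).
- by move=> v w /(dc_H cov)[[->]|[->]]; [left|right].
- by move=> v; exact: (dc_iH cov (inl v)).
- move=> t nm; have [[v|m] mt] := dc_imV cov (isT : ~~ pred0 t); first by exists v.
  by case/existsP: nm; exists m; rewrite mt.
- by move=> v; apply/existsP => -[m /eqP/esym/(dc_V cov)[]].
- move=> d; have [[h|a] <-] := dc_imH cov (isT : ~~ pred0 (src d)); first by exists h.
  by rewrite is_mid_src.
- by move=> v; rewrite (dc_bV cov).
- by move=> v; rewrite (dc_bH cov).
- by move=> v; rewrite (dc_gen cov).
- move=> t /existsP[m /eqP <-]; rewrite (dc_bV cov) (dc_gen cov) eqxx.
  have /codomP[a mE] := valP m.
  have mE' : m = mid a by apply: val_inj; rewrite SubK.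
  split=> //; exists (pH (inr a)); rewrite (dc_src cov) /= -mE' oppE /= is_mid_src.
  split=> // [|d'].
    rewrite (dc_bH cov); apply/eqP => /= -[/(congr1 val)]; rewrite halve_iota_val.
    by have /andP[/negP opn _] := valP a; move=> /eqP.
  have [d0 <-] := dc_imH cov (isT : ~~ pred0 (src d')).
  rewrite (dc_src cov) => E; have : src d0 = inr m by case: (dc_V cov (esym E)) => ->.
  case: d0 {E} => [//|a'] /= [E].
  have : val a' \in anti_edge a by rewrite -mE -E SubK !inE eqxx.
  rewrite !inE => /orP[/eqP/val_inj-> //|/eqP aE].
  rewrite -(dc_iH cov (inr a')) /=; congr (pH (inr _)); apply: val_inj.
  by rewrite halve_iota_val aE (hg_oppK wfG).
Qed.

End Restrict.

Section Extend.

Variables (T : bytree) (L : pred (vert T)).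
Variables (pV : vert G -> vert T) (pH : half G -> half T).
Hypotheses (wfT : by_wf T) (cov : dcover L pV pH).

Definition halveH (x : half (halve G)) : half T :=
  match x with inl d => pH d | inr a => opp (pH (val a)) end.

(** Which of the two half-edges of the anti-invariant edge is chosen does not matter: both have the
    same image, by [pH_anti_opp]. *)
Definition mid_rep (m : midpoint G) : anti_half G := iinv (valP m).

Lemma mid_repK m : mid (mid_rep m) = m.
Proof. by apply: val_inj; rewrite SubK /mid_rep f_iinv. Qed.

Definition halveV (x : vert (halve G)) : vert T :=
  match x with inl v => pV v | inr m => src (opp (pH (val (mid_rep m)))) end.

Lemma mid_inj (a b : anti_half G) : mid a = mid b -> val b = val a \/ val b = opp (val a).
Proof.
move=> /(congr1 val); rewrite !SubK => E.
have : val b \in anti_edge a by rewrite E !inE eqxx.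
by rewrite !inE => /orP[] /eqP; [left | right].
Qed.

Lemma pH_anti_opp (a : anti_half G) : pH (opp (val a)) = pH (val a).
Proof. by have /andP[_ /eqP <-] := valP a; rewrite (dc_iH cov). Qed.

Lemma halveV_mid a : halveV (inr (mid a)) = src (opp (pH (val a))).
Proof.
by rewrite /=; case: (mid_inj (esym (mid_repK (mid a)))) => -> //; rewrite pH_anti_opp.
Qed.

Lemma halveV_midL m : L (halveV (inr m)).
Proof. by rewrite -(mid_repK m) halveV_mid; apply: (dc_anti cov); exact: valP. Qed.

(** The converse of [dcover_restrict]. That a leaf of [L] is the image of only one midpoint follows
    from the uniqueness of its half-edge in [dc_L]. *)
Lemma dcover_extend : @dcover (halve G) T pred0 halveV halveH.
Proof.
have oK := by_oppK wfT.
have extH d e : halveH d = halveH e -> e = d \/ e = iotaH d.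
  case: d e => [d|a] [e|b] /=.
  - by move/(dc_H cov) => [->|->]; [left|right].
  - move=> E; have := dc_src_nL cov d; rewrite E.
    by rewrite (dc_anti cov (valP b)).
  - move=> E; have := dc_src_nL cov e; rewrite -E.
    by rewrite (dc_anti cov (valP a)).
  - move/(inv_inj oK)/(dc_H cov) => [/val_inj->|E]; [by left|right].
    have {}E : val b = iotaH (val a) := E.
    congr inr; apply: val_inj; rewrite halve_iota_val E.
    by have /andP[_ /eqP->] := valP a.
split=> //.
- by case=> [d|a]; rewrite [src _]/= ?halveV_mid //= (dc_src cov).
- move=> [d|a] _; last by rewrite /= oK.
  have [ad|nad] := boolP (anti_inv d); first by rewrite halve_opp_anti.
  by rewrite halve_opp_nanti //= (dc_opp cov).
- by move=> d; rewrite (negPf (halve_noanti d)).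
- case=> [v|m] [w|n].
  + by move/(dc_V cov) => [->|->]; [left|right].
  + move=> E; have := halveV_midL n; rewrite -E.
    by rewrite /= (negPf (dc_nL cov v)).
  + move=> E; have := halveV_midL m; rewrite E.
    by rewrite /= (negPf (dc_nL cov w)).
  + rewrite -(mid_repK m) -(mid_repK n) !halveV_mid => E; left; congr inr.
    have [_ _ [d [_ _ _ du]]] := dc_L cov (dc_anti cov (valP (mid_rep m))).
    have := du (opp (pH (val (mid_rep n)))); rewrite -E => /(_ erefl).
    rewrite -(du (opp (pH (val (mid_rep m)))) erefl) => /(inv_inj oK)/(dc_H cov)[/val_inj->//|].
    have /andP[_ /eqP->] := valP (mid_rep n); move=> aE.
    by apply: val_inj; rewrite !SubK /anti_edge aE (hg_oppK wfG) setUC.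
- by case=> [v|m] //=; rewrite (dc_iV cov).
- case=> [d|a]; first exact: (dc_iH cov).
  by rewrite /= halve_iota_val pH_anti_opp.
- move=> t _; have [Lt|/(dc_imV cov)[v <-]] := boolP (L t); last by exists (inl v).
  have [_ _ [d [dt _ _ _]]] := dc_L cov Lt.
  have [|h hE ah] := dc_leaf wfT cov (d := d); first by rewrite dt.
  by exists (inr (mid (Sub h ah))); rewrite halveV_mid SubK hE oK.
- move=> d _; have [Ld|/(dc_imH cov)[h <-]] := boolP (L (src d)); last by exists (inl h).
  have [h hE ah] := dc_leaf wfT cov Ld.
  by exists (inr (Sub h ah)); rewrite /= hE oK.
- case=> [v|m]; first exact: (dc_bV cov).
  by have [-> _ _] := dc_L cov (halveV_midL m); rewrite /= eqxx.
- case=> [d|a]; first exact: (dc_bH cov).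
  rewrite /= (by_bopp wfT) (dc_bH cov) (negPf (anti_nfix (valP a))).
  apply/esym/eqP => -[/(congr1 val)]; rewrite halve_iota_val.
  by have /andP[/negP opn _] := valP a; move=> /eqP.
- case=> [v|m]; first exact: (dc_gen cov).
  by have [_ -> _] := dc_L cov (halveV_midL m).
Qed.

End Extend.

Definition quotV (v : vert (halve G)) : vert (T_of_G G) := to_orb (@iotaV (halve G)) v.
Definition quotH (d : half (halve G)) : half (T_of_G G) := to_orb (@iotaH (halve G)) d.

Lemma T_of_G_dcover0 : hyp_cond1 G -> @dcover (halve G) (T_of_G G) pred0 quotV quotH.
Proof. by move=> c1; exact: (orbit_dcover halve_wf halve_noanti (halve_fixgen c1)). Qed.

Lemma T_of_G_dcover : hyp_cond1 G ->
  @dcover G (T_of_G G) (is_mid quotV) (quotV \o inl) (quotH \o inl).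
Proof. by move=> c1; exact: (dcover_restrict (T_of_G_dcover0 c1)). Qed.

End Halve.

(** * Gluing two copies of a tree *)

Section Glue.

Variable T : bytree.
Hypothesis wfT : by_wf T.
(** This is what [dc_L] asks of the leaves without preimage; [open_leafP] provides it for open BY
    trees. *)
Hypothesis leafT : forall t : vert T, genus0_leaf t -> [/\ blueV t, by_gen t = 0 &
    exists d, [/\ src d = t, ~~ blueH d, ~~ genus0_leaf (src (opp d)) &
               forall d', src d' = t -> d' = d]].
Hypothesis yellow0 : by_cond1 T.

Let oK := by_oppK wfT.

Lemma leaf_yellow (d : half T) : genus0_leaf (src d) -> ~~ blueH d.
Proof. by move=> /leafT[_ _ [d' [_ yd _ du]]]; rewrite (du d). Qed.

Lemma blue_src (d : half T) : blueH d -> blueV (src d).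
Proof. by move=> bd; apply/negPn/negP => /yellow0[_ _ /(_ d erefl)]; rewrite bd. Qed.

Lemma glueP (p : half (G_of_T T)) :
  ~~ genus0_leaf (src (val p).1) /\ (blueH (val p).1 -> (val p).2 = false).
Proof. by case/andP: (valP p) => nl /implyP b; split=> // /b/negPf. Qed.

Lemma glueVP (p : vert (G_of_T T)) :
  ~~ genus0_leaf (val p).1 /\ (blueV (val p).1 -> (val p).2 = false).
Proof. by case/andP: (valP p) => nl /implyP b; split=> // /b/negPf. Qed.

(** Crossing an edge towards a genus 0 leaf leads back to the same half-edge of [T] in the other
    copy, the leaf being no vertex upstairs. *)
Lemma glue_opp (p : half (G_of_T T)) : val (opp p) =
  if genus0_leaf (src (opp (val p).1)) then ((val p).1, ~~ (val p).2)
  else (opp (val p).1, (val p).2).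
Proof.
have [nl b] := glueP p; rewrite /= insubdK //; case: ifP => l; rewrite unfold_in /=.
  rewrite nl /= -(by_bopp wfT).
  by rewrite (negPf (leaf_yellow l)).
by rewrite l (by_bopp wfT); apply/implyP => /b->.
Qed.

Lemma glue_iotaV (p : vert (G_of_T T)) :
  val (iotaV p) = ((val p).1, ~~ blueV (val p).1 && ~~ (val p).2).
Proof.
have [nl b] := glueVP p.
have -> : iotaV p = if blueV (val p).1 then p else insubd p ((val p).1, ~~ (val p).2) by [].
case: ifP => bv; first by have := b bv; case: p {nl b bv} => -[t c] P /= ->.
rewrite /=.
by rewrite insubdK // unfold_in /= nl bv.
Qed.

Lemma glue_iotaH (p : half (G_of_T T)) :
  val (iotaH p) = ((val p).1, ~~ blueH (val p).1 && ~~ (val p).2).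
Proof.
have [nl b] := glueP p.
have -> : iotaH p = if blueH (val p).1 then p else insubd p ((val p).1, ~~ (val p).2) by [].
case: ifP => bv; first by have := b bv; case: p {nl b bv} => -[t c] P /= ->.
rewrite /=.
by rewrite insubdK // unfold_in /= nl bv.
Qed.

Lemma glue_anti (p : half (G_of_T T)) : anti_inv p = genus0_leaf (src (opp (val p).1)).
Proof.
have [nl b] := glueP p.
rewrite /anti_inv /is_open -!(inj_eq val_inj) glue_opp glue_iotaH.
case: ifP => l.
  have yd : ~~ blueH (val p).1 by rewrite -(by_bopp wfT) leaf_yellow.
  rewrite (negPf yd) /= eqxx andbT; apply/eqP => /(congr1 snd) /=.
  by case: (val p).2.
case: (val p) nl b => [d c] /= nl b; apply/negP => /andP[/eqP ne /eqP[dE cE]].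
apply: ne; rewrite -dE; congr (_, _).
Qed.

Lemma G_of_T_dcover : @dcover (G_of_T T) T (fun t => genus0_leaf t)
  (fun p => (val p).1) (fun p => (val p).1).
Proof.
split=> //.
- by move=> p; rewrite glue_anti glue_opp => /negPf->.
- by move=> p; rewrite glue_anti.
- move=> v w vw; have [_ bv] := glueVP v; have [_ bw] := glueVP w.
  have [e|ne] := eqVneq (val v).2 (val w).2.
    by left; apply: val_inj; move: e vw; case: (val v) (val w) => [? ?] [? ?] /= -> ->.
  right; apply: val_inj; rewrite glue_iotaV; move: ne vw bv bw.
  case: (val v) (val w) => [t c] [t' c'] /= ne -> bv bw; congr (_, _).
  move: bv bw ne; case: (blueV t') => /=; first by move=> /(_ isT)-> /(_ isT)->.
  by case: c c' => [] [].
- by move=> v; rewrite glue_iotaV.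
- move=> v w vw; have [_ bv] := glueP v; have [_ bw] := glueP w.
  have [e|ne] := eqVneq (val v).2 (val w).2.
    by left; apply: val_inj; move: e vw; case: (val v) (val w) => [? ?] [? ?] /= -> ->.
  right; apply: val_inj; rewrite glue_iotaH; move: ne vw bv bw.
  case: (val v) (val w) => [t c] [t' c'] /= ne -> bv bw; congr (_, _).
  move: bv bw ne; case: (blueH t') => /=; first by move=> /(_ isT)-> /(_ isT)->.
  by case: c c' => [] [].
- by move=> v; rewrite glue_iotaH.
- move=> t nl; have P : ~~ genus0_leaf (t, false).1 && (blueV (t, false).1 ==> ~~ (t, false).2).
    by rewrite nl implybT.
  by exists (exist _ (t, false) P).
- by move=> v; have [] := glueVP v.
- move=> d nl; have P : ~~ genus0_leaf (src (d, false).1) && (blueH (d, false).1 ==> ~~ (d, false).2).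
    by rewrite nl implybT.
  by exists (exist _ (d, false) P).
- move=> v; have [_ b] := glueVP v; rewrite -(inj_eq val_inj) glue_iotaV.
  case: (val v) b => [t c] /= b; rewrite xpair_eqE eqxx.
  by case: (blueV t) b => [/(_ isT)->|] //=; case: c.
- move=> v; have [_ b] := glueP v; rewrite -(inj_eq val_inj) glue_iotaH.
  case: (val v) b => [t c] /= b; rewrite xpair_eqE eqxx.
  by case: (blueH t) b => [/(_ isT)->|] //=; case: c.
Qed.

Lemma G_of_T_wf : hyp_wf (G_of_T T).
Proof.
split.
- move=> p; apply: val_inj; have [nl b] := glueP p.
  have [l|l] := boolP (genus0_leaf (src (opp (val p).1))).
    by rewrite glue_opp (glue_opp p) l /= l negbK; case: (val p).
  by rewrite glue_opp (glue_opp p) (negPf l) /= oK (negPf nl); case: (val p).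
- move=> p; apply: val_inj; rewrite glue_iotaV glue_iotaV /=; have [_ b] := glueVP p.
  by case: p b => [[t c] P] /=; case: (blueV t) => [/(_ isT)->|] //= _; rewrite negbK.
- move=> p; apply: val_inj; rewrite glue_iotaH glue_iotaH /=; have [_ b] := glueP p.
  by case: p b => [[t c] P] /=; case: (blueH t) => [/(_ isT)->|] //= _; rewrite negbK.
- move=> p; apply: val_inj; rewrite glue_iotaV [src _]/= [val _]/= /glue_end glue_iotaH.
  rewrite [src p]/= /= /glue_end /=; congr (_, _).
  have := @blue_src (val p).1; case: p => [[t c] P] /=.
  by case: (blueV (src t)) => //=; case: (blueH t) => //= /(_ isT).
- move=> p; apply: val_inj; rewrite glue_opp !glue_iotaH /= glue_opp.
  case: ifP => l /=; last by rewrite (by_bopp wfT).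
  have yd : ~~ blueH (val p).1 by rewrite -(by_bopp wfT) leaf_yellow.
  by rewrite (negPf yd).
Qed.

End Glue.

(** * Transfer of the defining conditions along a double cover *)

Lemma degree_le1 (T : graph) (t : vert T) (d0 : half T) :
  (forall d, src d = t -> d = d0) -> degree t <= 1.
Proof.
move=> du; rewrite -(cards1 d0); apply/subset_leq_card/subsetP => d.
by rewrite !inE => /eqP/du->.
Qed.

Lemma degree_eq1 (T : graph) (t : vert T) (d0 : half T) :
  src d0 = t -> (forall d, src d = t -> d = d0) -> degree t = 1.
Proof.
move=> dt du; apply/eqP/cards1P; exists d0; apply/setP => d; rewrite !inE.
by apply/eqP/eqP => [/du|->].
Qed.

Lemma degree1P (T : graph) (t : vert T) : degree t = 1 ->
  exists2 d0, src d0 = t & forall d, src d = t -> d = d0.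
Proof.
move=> /eqP/cards1P[d0 E]; have memE d : (src d == t) = (d == d0).
  by have := in_set1 d d0; rewrite -E inE.
exists d0 => [|d /eqP]; first by apply/eqP; rewrite memE.
by rewrite memE => /eqP.
Qed.

Lemma three_le_card (I : finType) (A : {set I}) x y z :
  x \in A -> y \in A -> z \in A -> x != y -> x != z -> y != z -> 2 < #|A|.
Proof.
move=> xA yA zA xy xz yz.
have <- : #|[set x; y; z]| = 3.
  by rewrite setUC cardsU1 cards2 xy !inE negb_or !(eq_sym z) xz yz.
by apply/subset_leq_card/subsetP => t; rewrite !inE => /orP[/orP[]|] /eqP->.
Qed.

Section OpenTree.

Variables (T : bytree) (r : vert T) (up : vert T -> half T) (rk : vert T -> nat).
Hypothesis rt : orooted r up rk.

(** A vertex of maximal rank has no children. As yellow vertices have degree at least 3, it also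
    shows that an open BY tree has a blue vertex. *)
Lemma top_leaf : exists t, forall d, src d = t -> d = up t.
Proof.
have [t _ tmax0] := @arg_maxnP _ r xpredT rk isT.
have tmax v : rk v <= rk t := tmax0 v isT.
exists t => d dt; case: (or_up rt d) => dE; first by rewrite dE dt.
have [or|nr] := eqVneq (src (opp d)) r; last first.
  by have := opp_up_desc rt dE nr; rewrite dt ltnNge tmax.
have opn : is_open (opp d) by rewrite dE or (up_open rt).
move: opn; rewrite /is_open (or_oppK rt) => /eqP doE.
by rewrite -dt [RHS](_ : _ = opp d) // dE or -or -doE.
Qed.

Lemma lone_root : (forall u, u != r -> parent up u != r) -> forall v, v = r.
Proof.
move=> H v; have [n] := fiter_par_root rt v; elim: n => // n IH /=.
have [E _|ne] := eqVneq (iter n (parent up) v) r; first exact: IH.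
by move/eqP; rewrite (negPf (H _ ne)).
Qed.

Lemma lone_half : (forall v, v = r) -> forall d, d = up r.
Proof.
move=> H d; case: (or_up rt d) => dE; first by rewrite {1}dE (H (src d)).
have opn : is_open (opp d) by rewrite dE (up_open rt) (H (src _)).
move: opn; rewrite /is_open (or_oppK rt) => /eqP dE'.
by rewrite {1}dE' dE (H (src _)).
Qed.

Lemma only_up t (d : half T) : (forall d', src d' = t -> d' = d) -> d = up t.
Proof. by move=> du; rewrite (du (up t)) // (or_src rt). Qed.

Hypothesis oT : open_by T.

(** Two leaves cannot be adjacent: the only half-edge of a leaf is its [up], and an edge does not
    point to infinity at both ends. If the leaf is the root, its half-edge is the open one and the
    tree has one vertex, which [genus0_leaf] excludes. *)
Lemma open_leafP (t : vert T) : genus0_leaf t -> [/\ blueV t, by_gen t = 0 &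
    exists d, [/\ src d = t, ~~ blueH d, ~~ genus0_leaf (src (opp d)) &
               forall d', src d' = t -> d' = d]].
Proof.
case: oT => [[[oK bo] _] _ c1 _ c2] /and3P[/eqP g0 /eqP deg nV].
have [d dt du] := degree1P deg.
have bt : blueV t by apply/negPn/negP => /c1[_]; rewrite deg.
have {c2} c2 : by_cond2 T by case: c2 => // -[V1]; rewrite V1 in nV.
have [d' d't yd] := c2 t bt g0.
split=> //; exists d; split=> //; first by rewrite -(du d').
apply/negP => /and3P[_ /eqP/degree1P[e es eu] _].
have dE : d = up t by exact: only_up.
have eE : e = up (src (opp d)) by exact: only_up.
have oE : opp d = e by exact: eu.
have [tr|tr] := eqVneq t r.
  case/negP: nV; apply/eqP; rewrite -(card1 r); apply: eq_card => v; rewrite [RHS]inE.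
  apply/esym/eqP; apply: (lone_root _ v) => u ur; apply/eqP => pu.
  have := opp_up_neq rt ur; rewrite (du (opp (up u))) -/(parent up u) ?pu //.
    by rewrite {1}dE dt eqxx.
by have := opp_up_neq rt tr; rewrite -dE oE es -eE eqxx.
Qed.

Lemma blue_exists : exists t : vert T, blueV t.
Proof.
have [t tu] := top_leaf; exists t; apply/negPn/negP.
case: oT => _ _ c1 _ _ /c1[_]; rewrite ltnNge.
by rewrite (leq_trans (degree_le1 tu)).
Qed.

End OpenTree.

Section Transfer.

Variables (G : hgraph) (T : bytree) (L : pred (vert T)).
Variables (pV : vert G -> vert T) (pH : half G -> half T).
Hypotheses (wfG : hyp_wf G) (wfT : by_wf T) (cov : dcover L pV pH).

Lemma lift_at v d : src d = pV v -> exists2 h, pH h = d & src h = v.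
Proof.
move=> dv; have nL : ~~ L (src d) by rewrite dv (dc_nL cov).
have [h hd] := dc_imH cov nL; have E : pV v = pV (src h) by rewrite -dv -hd (dc_src cov).
case: (dc_V cov E) => hE; first by exists h.
exists (iotaH h); first by rewrite (dc_iH cov).
by rewrite (hg_srcI wfG) hE (hg_iVK wfG).
Qed.

Lemma nfix_half h : iotaV (src h) != src h -> iotaH h != h :> half G.
Proof. by apply: contra => /eqP E; rewrite -(hg_srcI wfG) E. Qed.

Lemma degree_nfix v : iotaV v != v -> degree (pV v) = degree v.
Proof.
move=> nf; rewrite /degree -(card_in_imset (f := pH) (D := mem [set d | src d == v])).
  apply: eq_card => d; rewrite inE; apply/eqP/imsetP => [dv|[h]].
    by have [h hd hv] := lift_at dv; exists h; rewrite ?inE ?hv.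
  by rewrite inE => /eqP hv ->; rewrite (dc_src cov) hv.
move=> h1 h2; rewrite !inE => /eqP s1 /eqP s2 /(dc_H cov)[//|hE].
by move: nf; rewrite -{1}s1 -(hg_srcI wfG) -hE s2 eqxx.
Qed.

Lemma blue_degree_fix v : blue_degree (pV v) = #|[set d : half G | (src d == v) && (iotaH d == d)]|.
Proof.
rewrite /blue_degree -(card_in_imset (f := pH)); last first.
  move=> h1 h2; rewrite !inE => /andP[_ /eqP f1] _ /(dc_H cov)[//|].
  by rewrite f1.
apply: eq_card => d; rewrite inE; apply/andP/imsetP => [[/eqP dv bd]|[h]].
  have [h hd hv] := lift_at dv; exists h; rewrite ?inE ?hv ?eqxx //=.
  by rewrite -(dc_bH cov) hd.
by rewrite inE => /andP[/eqP hv f] ->; rewrite (dc_src cov) hv (dc_bH cov).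
Qed.

Lemma yellow_halves t (d : half T) : ~~ blueV t -> src d = t -> ~~ blueH d.
Proof.
move=> yt dt; have nL : ~~ L t by apply: contra yt => /(dc_L cov)[].
have [v vt] := dc_imV cov nL; rewrite -vt in dt; have [h hd hv] := lift_at dt.
by rewrite -hd (dc_bH cov) nfix_half // hv -(dc_bV cov) vt.
Qed.

Hypothesis c1G : hyp_cond1 G.
Hypothesis c3G : hyp_cond3 G.
(** The second alternative is what the open exceptions satisfy. *)
Hypothesis c2G : hyp_cond2 G \/ #|vert G| = 1 /\ forall d : half G, ~~ anti_inv d.

Lemma card1_eq (I : finType) (x y : I) : #|I| = 1 -> x = y.
Proof. by move=> /eqP/fintype1P[z zE]; rewrite (zE x) (zE y). Qed.

Lemma dcover_by_cond1 : by_cond1 T.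
Proof.
move=> t yt; have nL : ~~ L t by apply: contra yt => /(dc_L cov)[].
have [v vt] := dc_imV cov nL; have nf : iotaV v != v by rewrite -(dc_bV cov) vt.
have g0 : hg_gen v = 0 by apply/eqP/contraT => /c1G/eqP; rewrite (negPf nf).
split; first by rewrite -vt (dc_gen cov).
  rewrite -vt degree_nfix //; case: c2G => [->//|[V1 _]].
  by rewrite (card1_eq (iotaV v) v V1) eqxx in nf.
by move=> d; exact: yellow_halves.
Qed.

Lemma dcover_by_cond3 : by_cond3 T.
Proof.
move=> t; have [Lt|/(dc_imV cov)[v <-]] := boolP (L t); last first.
  by rewrite blue_degree_fix (dc_gen cov).
rewrite /blue_degree (_ : [set d | _] = set0) ?cards0 //.
apply/setP => d; rewrite !inE; have [_ _ [d' [_ yd _ du]]] := dc_L cov Lt.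
by apply/negP => /andP[/eqP/du->]; rewrite (negPf yd).
Qed.

(** A vertex of genus 0 has degree at least 3 but at most two invariant half-edges; the image of a
    half-edge that moves is yellow. For leaves in [L] the yellow half-edge is part of [dc_L]. *)
Lemma dcover_by_cond2 : hyp_cond2 G -> by_cond2 T.
Proof.
move=> c2 t bt g0; have [Lt|/(dc_imV cov)[v vt]] := boolP (L t).
  by have [_ _ [d [dt yd _ _]]] := dc_L cov Lt; exists d.
have gv : hg_gen v = 0 by rewrite -(dc_gen cov) vt.
suff /existsP[h /andP[/eqP hv nf]] : [exists h : half G, (src h == v) && (iotaH h != h)].
  by exists (pH h); rewrite ?(dc_src cov) ?hv ?(dc_bH cov).
apply/contraT; rewrite negb_exists => /forallP none.
have := c2 v gv; rewrite ltnNge.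
have <- : #|[set d : half G | (src d == v) && (iotaH d == d)]| = degree v.
  apply: eq_card => d; rewrite !inE; case: (src d =P v) => //= dv.
  by have := none d; rewrite dv eqxx /= negbK => ->.
by have := c3G v; rewrite gv => ->.
Qed.

(** A vertex over a genus 0 leaf would have at most the two preimages of the half-edge there, so
    degree at most 2. In the one-vertex case nothing is anti-invariant and [T] has a single vertex,
    which [genus0_leaf] does not count as a leaf. *)
Lemma dcover_leafE (t : vert T) : L t = genus0_leaf t.
Proof.
apply/idP/idP => [Lt|/and3P[/eqP g0 /eqP deg nV]].
  have [_ g0 [d [dt _ nL du]]] := dc_L cov Lt.
  rewrite /genus0_leaf g0 (degree_eq1 dt du) !eqxx /=.
  by apply/eqP => V1; move: nL; rewrite (card1_eq (src (opp d)) t V1) Lt.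
apply/negPn/negP => /[dup] nL /(dc_imV cov)[v vt].
case: c2G => [c2|[V1 nanti]].
  have := c2 v; rewrite -(dc_gen cov) vt => /(_ g0).
  have [/eqP f|nf] := boolP (iotaV v == v); last by rewrite -(degree_nfix nf) vt deg.
  have [d0 d0t d0u] := degree1P deg; rewrite -vt in d0t; have [h hd hv] := lift_at d0t.
  rewrite ltnNge => /negP[]; apply: leq_trans (_ : #|[set h; iotaH h]| <= 2); last first.
    by rewrite cards2; case: (_ != _).
  apply/subset_leq_card/subsetP => h'; rewrite !inE => /eqP h'v.
  have : pH h' = d0 by apply: d0u; rewrite (dc_src cov) h'v.
  by rewrite -hd => /esym/(dc_H cov)[->|->]; rewrite eqxx ?orbT.
case/negP: nV; apply/eqP; rewrite -(card1 t); apply: eq_card => t'; rewrite [RHS]inE.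
apply/esym/eqP; have [Lt'|/(dc_imV cov)[v' <-]] := boolP (L t'); last first.
  by rewrite -vt (card1_eq v v' V1).
have [_ _ [d [dt _ _ _]]] := dc_L cov Lt'; rewrite -dt in Lt'.
by have [h _] := dc_leaf wfT cov Lt'; rewrite (negPf (nanti h)).
Qed.

End Transfer.

Definition pullback (G : hgraph) (T : bytree) (pV : vert G -> vert T)
    (pH : half G -> half T) (H : subspace T) : subspace G :=
  ([set v | pV v \in H.1], [set h | pH h \in H.2]).

Section Connected.

Variables (G : hgraph) (T : bytree) (L : pred (vert T)).
Variables (pV : vert G -> vert T) (pH : half G -> half T).
Hypotheses (wfG : hyp_wf G) (wfT : by_wf T) (cov : dcover L pV pH).
Variable H : subspace T.
Hypothesis Hcl : forall d, d \in H.2 -> src d \in H.1 /\ opp d \in H.2.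
Hypothesis Hconn : connected_in H.
Variable t0 : vert T.
Hypotheses (t0H : t0 \in H.1) (bt0 : blueV t0).
Hypothesis Lt0 : L t0 -> exists2 d, d \in H.2 & src d = t0.

(* A path between two points of [H] lifts to a path from a given preimage of its
   start to one of the two preimages of its end; the latter are joined through
   a preimage of the branch point [t0]. *)
Lemma dcover_connected_in : connected_in (pullback pV pH H).
Proof.
set P := pullback pV pH H.
pose E := [rel x y | [exists d in P.2, (src d == x) && (src (opp d) == y)]].
have E1 h : pH h \in H.2 -> connect E (src h) (src (opp h)).
  by move=> hH; apply/connect1/exists_inP; exists h; rewrite ?inE ?eqxx.
have Pcl h : pH h \in H.2 -> pH (opp h) \in H.2.
  have [/andP[_ /eqP<-]|na] := boolP (anti_inv h); first by rewrite (dc_iH cov).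
  by rewrite -(dc_opp cov) // => /Hcl[].
have Esym : connect_sym E.
  apply: sym_connect_sym; suff sub x y : E x y -> E y x by move=> x y; apply/idP/idP => /sub.
  case/exists_inP=> h; rewrite inE => hH /andP[hx hy]; apply/exists_inP; exists (opp h).
    by rewrite inE Pcl.
  by rewrite (hg_oppK wfG) hx hy.
(* A leaf in [L] has no preimage; there the lifted path stops at a preimage of the neighbouring
   vertex. *)
pose Q x u := if L x then exists d u', [/\ d \in H.2, src d = x, pV u' = src (opp d)
    & connect E u u'] else exists2 u', pV u' = x & connect E u u'.
have Qstep u x y : Q x u -> [exists d in H.2, (src d == x) && (src (opp d) == y)] -> Q y u.
  move=> Qx /exists_inP[d dH /andP[/eqP dx /eqP dy]]; move: Qx; rewrite /Q -dx -dy.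
  have [_ oH] := Hcl dH.
  have [Lx|nLx] := ifPn (L (src d)).
    move=> [d' [u' [d'H d'x u'E cu]]].
    have [_ _ [e [_ _ nL eu]]] := dc_L cov Lx.
    have dd' : d' = d by rewrite (eu d') // (eu d).
    by rewrite (eu d erefl) (negPf nL) -(eu d erefl) -dd'; exists u'.
  move=> [u' u'x cu]; have [Ly|nLy] := ifPn (L (src (opp d))).
    by exists (opp d), u'; rewrite oH (by_oppK wfT).
  have [h hd hu] := lift_at wfG cov (esym u'x).
  have nah : ~~ anti_inv h by rewrite (dc_antiE cov) hd.
  exists (src (opp h)); first by rewrite -(dc_src cov) -(dc_opp cov) // hd.
  by apply: connect_trans cu _; rewrite -hu; apply: E1; rewrite hd.
have Qall u t : pV u \in H.1 -> t \in H.1 -> Q t u.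
  move=> uH tH; have [_ /(_ _ _ uH tH) /connectP[p pth ->]] := Hconn.
  have Q0 : Q (pV u) u by rewrite /Q (negPf (dc_nL cov u)); exists u.
  elim: p (pV u) Q0 pth => //= y p IH x Qx /andP[xy]; apply: IH.
  exact: Qstep Qx xy.
(* [g0] lies over the branch point or, if that is a midpoint, it is one end of the anti-invariant
   edge, whose other end is [iotaV g0]. Either way the two sheets meet. *)
have [g0 [g0H g0swap g0all]] : exists g0, [/\ pV g0 \in H.1, connect E g0 (iotaV g0) &
    forall u, pV u \in H.1 -> connect E u g0 \/ connect E u (iotaV g0)].
  have [Lt|nLt] := boolP (L t0); last first.
    have [g gt] := dc_imV cov nLt; exists g; rewrite gt.
    have /eqP fg : iotaV g == g by rewrite -(dc_bV cov) gt.
    split; rewrite ?fg // => u uH; have := Qall u t0 uH t0H; rewrite /Q (negPf nLt).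
    move=> [u' u't cu]; rewrite -gt in u't; left.
    by case: (dc_V cov u't) => gE; [rewrite gE | rewrite -fg gE (hg_iVK wfG)].
  have [d dH dt] := Lt0 Lt; have Ld : L (src d) by rewrite dt.
  have [h hd ah] := dc_leaf wfT cov Ld; have [_ oH] := Hcl dH.
  have hH : pH h \in H.2 by rewrite hd.
  have pE : pV (src h) = src (opp d) by rewrite -(dc_src cov) hd.
  exists (src h); split.
  - by rewrite pE; have [] := Hcl oH.
  - have := E1 h hH; have /andP[_ /eqP<-] := ah; by rewrite (hg_srcI wfG).
  - move=> u uH; have := Qall u t0 uH t0H; rewrite /Q Lt => -[d' [u' [d'H d't u'E cu]]].
    have [_ _ [e [_ _ _ eu]]] := dc_L cov Lt.
    have dd : d' = d by rewrite (eu d') // (eu d).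
    rewrite dd -pE in u'E.
    by case: (dc_V cov u'E) => ->; [left | right; rewrite (hg_iVK wfG)].
split; first by apply/set0Pn; exists g0; rewrite inE.
move=> u v; rewrite !inE => uH vH.
have toG w : pV w \in H.1 -> connect E w g0.
  move=> /g0all[//|cw]; apply: connect_trans cw _.
  by rewrite Esym.
by apply: connect_trans (toG u uH) _; rewrite Esym; exact: toG.
Qed.

End Connected.

Section ToHyp.

Variables (G : hgraph) (T : bytree) (L : pred (vert T)).
Variables (pV : vert G -> vert T) (pH : half G -> half T).
Hypotheses (wfG : hyp_wf G) (wfT : by_wf T) (cov : dcover L pV pH).
Hypotheses (c1 : by_cond1 T) (c3 : by_cond3 T).

Lemma dcover_hyp_cond1 : hyp_cond1 G.
Proof.
move=> v; rewrite -(dc_gen cov) => gv; apply/eqP; rewrite -(dc_bV cov).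
by apply: contraT => /c1[g0]; rewrite g0 in gv.
Qed.

Lemma dcover_hyp_cond3 : hyp_cond3 G.
Proof. by move=> v; rewrite -(blue_degree_fix wfG cov) -(dc_gen cov). Qed.

(** Over a yellow vertex the degree is unchanged. Over a blue one of genus 0 the yellow half-edge
    has two lifts, and a further half-edge, present since the degree is not 1, gives a third. *)
Lemma dcover_hyp_cond2 : by_cond2 T ->
  (forall v, by_gen (pV v) = 0 -> blueV (pV v) -> degree (pV v) != 1) -> hyp_cond2 G.
Proof.
move=> c2 nleaf v; rewrite -(dc_gen cov) => gv.
have [b|y] := boolP (blueV (pV v)); last first.
  by rewrite -(degree_nfix wfG cov) -?(dc_bV cov) //; have [] := c1 y.
have [d dv yd] := c2 _ b gv; have [h hd hv] := lift_at wfG cov dv.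
have fv : iotaV v = v by apply/eqP; rewrite -(dc_bV cov).
have [d' d'v d'd] : exists2 d', src d' = pV v & d' != d.
  case: (pickP [pred d' | (src d' == pV v) && (d' != d)]) => [d' /andP[/eqP ? ?]|none].
    by exists d'.
  case/eqP: (nleaf v gv b); apply: (degree_eq1 dv) => d' d'v; apply/eqP.
  by have := none d'; rewrite /= d'v eqxx /= => /negbFE.
have [h' h'd h'v] := lift_at wfG cov d'v.
apply: (@three_le_card _ _ h (iotaH h) h').
- by rewrite inE hv.
- by rewrite inE (hg_srcI wfG) hv fv.
- by rewrite inE h'v.
- by rewrite eq_sym -(dc_bH cov) hd.
- by apply: contra d'd => /eqP hE; rewrite -h'd -hE hd.
- by apply: contra d'd => /eqP hE; rewrite -h'd -hE (dc_iH cov) hd.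
Qed.

Lemma pullback_whole : pullback pV pH (whole T) = whole G.
Proof. by congr (_, _); apply/setP => x; rewrite !inE. Qed.

Lemma dcover_connected (t0 : vert T) : is_tree T -> blueV t0 -> connected G.
Proof.
move=> [conn _] b; rewrite /connected -pullback_whole.
apply: (dcover_connected_in wfG wfT cov (H := whole T) _ conn (t0 := t0)) => //.
by move=> /(dc_L cov)[_ _ [d [dt _ _ _]]]; exists d; rewrite ?inE.
Qed.

Lemma dcover_top_quotient : by_iso T (T_of_G G).
Proof.
exact: dcover_base_iso wfG wfT (T_of_G_wf wfG) cov (T_of_G_dcover wfG dcover_hyp_cond1).
Qed.

Lemma dcover_top_tree : is_tree T -> is_tree (top_quotient G).
Proof. exact: by_iso_tree (by_oppK wfT) dcover_top_quotient. Qed.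

End ToHyp.

Lemma dcover_eqL (G : hgraph) (T : bytree) (L L' : pred (vert T)) pV pH :
  dcover (G := G) L pV pH -> (forall t, L t = L' t) -> dcover (G := G) L' pV pH.
Proof.
move=> c LE; have idT : @by_iso_on T T id id by split=> //; split; exists id.
by have := dcover_comp_base c idT (fun t => esym (LE t)).
Qed.

Lemma by_iso_open_card (T T' : bytree) : by_iso T T' ->
  #|[set d : half T | is_open d]| = #|[set d : half T' | is_open d]|.
Proof.
move=> [fV [fH [[_ bH] _ oE _ _]]]; rewrite -(card_imset _ (bij_inj bH)).
apply: eq_card => d; have [g gK fK] := bH; rewrite -[d]fK !inE /is_open oE.
by rewrite (inj_eq (bij_inj bH)) mem_imset ?inE //; exact: bij_inj.
Qed.

Lemma dcover_open_hyp (G : hgraph) (T : bytree) pV pH : hyp_wf G -> open_by T ->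
  dcover (G := G) (fun t : vert T => genus0_leaf t) pV pH -> open_hyp G.
Proof.
move=> wG oT c; have [[wT tr] op1 c1 c3 c2] := oT.
have [r [up [rk rt]]] := open_tree_rooted (by_oppK wT) tr op1.
have [t0 bt0] := blue_exists rt oT.
have iso := dcover_top_quotient wG wT c c1.
have openup (d : half T) : is_open d -> ~~ genus0_leaf (src d).
  move=> /eqP opn; apply/negP => l; have [_ _ [d' [_ _ nl du]]] := dc_L c l.
  by rewrite -(du d) // opn l in nl.
split.
- by split=> //; apply: (dcover_connected wG wT c tr bt0).
- have opn : is_open (up r) by rewrite (up_open rt).
  have [h hE] := dc_imH c (openup _ opn).
  by exists h; rewrite -(dc_openE c) hE.
- by split; [exact: (dcover_hyp_cond1 c c1) | exact: (dcover_hyp_cond3 wG c c3)].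
- split; first exact: dcover_top_tree wG wT c c1 tr.
  by rewrite -(by_iso_open_card iso).
(* With a single vertex of genus 0 only the open half-edge is left. If blue it has one lift, if
   yellow two lifts swapped by the involution: these are the two open exceptions. *)
- have [V1|nV1] := eqVneq #|vert T| 1; last first.
    left; apply: (dcover_hyp_cond2 wG c c1); first by case: c2 => // -[]; move/eqP: nV1.
    move=> v g0 _; apply/negP => /eqP deg.
    by have := dc_nL c v; rewrite /genus0_leaf g0 deg !eqxx nV1.
  have vr v : v = r by exact: card1_eq.
  have dr d : d = up r := lone_half rt vr d.
  have br : blueV r by rewrite -(vr t0).
  have [v0 v0r] : exists v, pV v = r.
    by apply: (dc_imV c); rewrite /genus0_leaf V1 !andbF.
  have fv0 : iotaV v0 = v0 by apply/eqP; rewrite -(dc_bV c) v0r.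
  have GV v : v = v0.
    have /(dc_V c)[|] : pV v0 = pV v by rewrite (vr (pV v0)) (vr (pV v)).
      by [].
    by rewrite fv0.
  have [g0|g0] := eqVneq (by_gen r) 0; last first.
    by left => v gv; case/eqP: g0; rewrite -v0r (dc_gen c) -(GV v).
  right; split.
  + by rewrite -(card1 v0); apply: eq_card => v; rewrite [RHS]inE -(GV v) eqxx.
  + by move=> v; rewrite -(dc_gen c) (vr (pV v)).
  + by move=> d; rewrite -(dc_openE c) (dr (pH d)) (up_open rt).
  + have [h0 h0r] : exists h, pH h = up r.
      by apply: (dc_imH c); apply: openup; rewrite (up_open rt).
    have hE h : h = h0 \/ h = iotaH h0 by apply: (dc_H c); rewrite (dr (pH h)) h0r.
    have [f|nf] := eqVneq (iotaH h0) h0.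
      left; rewrite -(card1 h0); apply: eq_card => h; rewrite [RHS]inE.
      by apply/esym/eqP; case: (hE h) => ->.
    right; split.
      transitivity #|[set h0; iotaH h0]|; last by rewrite cards2 eq_sym nf.
      by rewrite -cardsT; apply: eq_card => h; rewrite !inE; case: (hE h) => ->; rewrite eqxx ?orbT.
    move=> h; case: (hE h) => ->; first exact/eqP.
    by rewrite (hg_iHK wG) => /esym/eqP; rewrite (negPf nf).
Qed.

Lemma open_hyp_by (G : hgraph) : open_hyp G -> open_by (T_of_G G) /\
  exists pV pH, dcover (G := G) (fun t : vert (T_of_G G) => genus0_leaf t) pV pH.
Proof.
move=> [[wG cG] [o oo] [c1 c3] [tr op1] c2]; have c := T_of_G_dcover wG c1.
have wT := T_of_G_wf wG.
have c2' : hyp_cond2 G \/ #|vert G| = 1 /\ forall d : half G, ~~ anti_inv d.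
  case: c2 => [|[V1 _ oa _]]; first by left.
  by right; split=> // d; rewrite /anti_inv oa.
have LE := dcover_leafE wG wT c c2'; split; last first.
  exists (quotV (G := G) \o inl), (quotH (G := G) \o inl).
  exact: dcover_eqL c LE.
split=> //.
- exact: dcover_by_cond1 wG c c1 c2'.
- exact: dcover_by_cond3 wG c c3.
(* A pair of swapped open edges has a yellow image, so the quotient satisfies [by_cond2] after all;
   only the single invariant open edge gives the exceptional BY tree. *)
- case: c2 => [c2|[V1 g0 oa halves]]; first by left; exact: (dcover_by_cond2 c c3 c2).
  have nL t : ~~ is_mid (quotV (G := G)) t.
    apply/negP => Lt; have [_ _ [d [dt _ _ _]]] := dc_L c Lt; rewrite -dt in Lt.
    by have [h _] := dc_leaf wT c Lt; rewrite /anti_inv oa.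
  have fV (v : vert G) : iotaV v = v by exact: card1_eq.
  case: halves => [H1|[H2 nf]]; last first.
    left=> t bt gt; have [v vt] := dc_imV c (nL t).
    have ov : src o = v by exact: card1_eq.
    exists (quotH (inl o)); first by rewrite (dc_src c) /= ov.
    by have := dc_bH c o; rewrite /= => ->; apply/eqP/nf.
  right; split.
  + have [v vt] := dc_imV c (nL (quotV (inl (src o)))).
    rewrite -(card1 (quotV (inl v))); apply: eq_card => t; rewrite [RHS]inE.
    have [v' <-] := dc_imV c (nL t); apply/esym/eqP; congr (quotV (inl _)).
    exact: card1_eq.
  + move=> t; have [v <-] := dc_imV c (nL t).
    by rewrite (dc_bV c) (dc_gen c) g0 fV eqxx.
  + have hE (h : half G) : h = o by exact: card1_eq.
    split.
      rewrite -(card1 (quotH (inl o))); apply: eq_card => t; rewrite [RHS]inE.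
      have [h <-] := dc_imH c (nL (src t)); apply/esym/eqP; congr (quotH (inl _)).
      exact: hE.
    move=> t; have [h <-] := dc_imH c (nL (src t)).
    by rewrite (dc_openE c) (dc_bH c) oa (hE (iotaH h)) (hE h) eqxx.
Qed.

(** * Hyperelliptic graphs and BY trees *)

Lemma open_by_rooted (T : bytree) : open_by T -> exists r up rk, @orooted T r up rk.
Proof. by move=> [[wT tr] op1 _ _ _]; exact: open_tree_rooted (by_oppK wT) tr op1. Qed.

Lemma glue_open_dcover (T : bytree) : open_by T -> hyp_wf (G_of_T T) /\
  @dcover (G_of_T T) T (fun t : vert T => genus0_leaf t) (fun p => (val p).1) (fun p => (val p).1).
Proof.
move=> oT; have [r [up [rk rt]]] := open_by_rooted oT; have [[wT _] _ c1 _ _] := oT.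
by split; [exact: (G_of_T_wf wT (open_leafP rt oT) c1) | exact: (G_of_T_dcover wT (open_leafP rt oT))].
Qed.

Lemma hyp_by_bijections : inverse_bijections open_hyp hg_iso open_by by_iso T_of_G G_of_T.
Proof.
split.
- split=> [G oG|T oT]; first by have [] := open_hyp_by oG.
  by have [wG c] := glue_open_dcover oT; exact: dcover_open_hyp wG oT c.
- move=> G G' oG oG' iso; have [oT [pV [pH c]]] := open_hyp_by oG.
  have [oT' [pV' [pH' c']]] := open_hyp_by oG'.
  have [qV [qH c'']] := dcover_comp_total iso c'.
  case: oG => [[wG _] _ _ _ _]; case: oT oT' => [[wT _] _ _ _ _] [[wT' _] _ _ _ _].
  exact: dcover_base_iso wG wT wT' c c''.
- move=> T T' oT oT' [fV [fH iso]]; have [wG c] := glue_open_dcover oT.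
  have [wG' c'] := glue_open_dcover oT'; case: oT' => [[wT' tr'] _ _ _ _].
  apply: dcover_unique tr' wT' wG wG' (dcover_comp_base c iso _) c' => t.
  case: iso => [[bV bH] sE _ gE _]; rewrite /genus0_leaf gE (bij_eq_card bV).
  congr [&& _, _ == _ & _]; rewrite /degree -(card_imset _ (bij_inj bH)).
  apply: eq_card => d; have [g gK fK] := bH; rewrite -[d]fK mem_imset ?inE; last exact: bij_inj.
  by rewrite sE (inj_eq (bij_inj bV)).
- move=> G oG; have [oT [pV [pH c]]] := open_hyp_by oG.
  have [wG' c'] := glue_open_dcover oT; case: oT => [[wT tr] _ _ _ _].
  case: oG => [[wG _] _ _ _ _]; exact: dcover_unique tr wT wG' wG c' c.
- move=> T oT; have [wG c] := glue_open_dcover oT; case: oT => [[wT _] _ c1 _ _].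
  exact: by_iso_sym (dcover_top_quotient wG wT c c1).
Qed.

(** * The rank of the relative homology *)

Section RankByCoords.

Import GRing.Theory.
Local Open Scope ring_scope.

(** The coordinates [j i] identify the left kernel with the vectors indexed by [I]: the first
    hypothesis is injectivity, the second lifts the standard basis. *)
Lemma rank_by_coords (F : fieldType) p q (I : finType) (N : 'M[F]_(p, q)) (j : I -> 'I_p) :
    (forall u : 'rV_p, u *m N = 0 -> (forall i, u 0 (j i) = 0) -> u = 0) ->
    (forall i, exists2 u : 'rV_p, u *m N = 0 & forall i', u 0 (j i') = (i' == i)%:R) ->
  \rank (kermx N) = #|I|.
Proof.
move=> inj surj; pose S : 'M[F]_(p, #|I|) := \matrix_(a, i) (a == j (enum_val i))%:R.
have SE (u : 'rV_p) i : (u *m S) 0 i = u 0 (j (enum_val i)).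
  rewrite mxE (bigD1 (j (enum_val i))) //= big1 ?addr0 ?mxE ?eqxx ?mulr1 // => a ne.
  by rewrite mxE (negPf ne) mulr0.
have <- : \rank (kermx N *m S) = \rank (kermx N).
  apply/mxrank_injP; rewrite -submx0; apply/rV_subP => v.
  rewrite sub_capmx !sub_kermx => /andP[/eqP vN /eqP vS].
  rewrite (inj v vN) ?sub0mx // => i.
  by have := SE v (enum_rank i); rewrite enum_rankK vS mxE.
apply/eqP; rewrite -[_ == _]/(row_full _) -sub1mx; apply/row_subP => i.
have [u uN uE] := surj (enum_val i).
have -> : row i 1%:M = u *m S.
  apply/rowP => k; rewrite SE uE !mxE (inj_eq enum_val_inj) eq_sym.
  by [].
by apply: submxMr; rewrite sub_kermx uN.
Qed.

Variables (G : graph) (BV : pred (vert G)) (BH : pred (half G)).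
Hypothesis oK : involutive (@opp G).
Hypothesis BHo : forall d, BH (opp d) = BH d.

Let n := #|half G|.
Let m := #|vert G|.

(** A linear relation, with coefficients [X] and [Y], among the columns of the two blocks of the
    matrix in [rkH1]. Transposing keeps the rank, so these relations form a space of dimension
    [rkH1 BV BH + #|vert G|]; they are easier to parametrise than cycles. *)
Definition cocycle (X : half G -> rat) (Y : vert G -> rat) : Prop :=
  forall e, X e + (~~ BH (opp e))%:R * X (opp e) + (~~ BV (src e))%:R * Y (src e) = 0.

Lemma rkH1_coords (I : finType) (j : I -> half G + vert G) :
    let at_ (X : half G -> rat) (Y : vert G -> rat) x :=
      match x with inl d => X d | inr v => Y v end in
    (forall X Y, cocycle X Y -> (forall i, at_ X Y (j i) = 0) ->
       (forall d, X d = 0) /\ (forall v, Y v = 0)) ->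
    (forall i, exists X Y, cocycle X Y /\ forall i', at_ X Y (j i') = (i' == i)%:R) ->
  (rkH1 BV BH + m = #|I|)%N.
Proof.
move=> at_ inj surj; rewrite /rkH1.
set A := (X in row_mx X _); set B := (X in row_mx _ X).
pose N := (row_mx A B)^T.
have solE (x : 'rV_n) (y : 'rV_m) : row_mx x y *m N = 0 <->
    cocycle (fun d => x 0 (enum_rank d)) (fun v => y 0 (enum_rank v)).
  rewrite /N tr_row_mx mul_row_col.
  have E e : (x *m A^T + y *m B^T) 0 (enum_rank e) = x 0 (enum_rank e)
      + (~~ BH (opp e))%:R * x 0 (enum_rank (opp e))
      + (~~ BV (src e))%:R * y 0 (enum_rank (src e)).
    rewrite mxE; congr (_ + _).
      rewrite mxE (eq_bigr (fun k => x 0 k * (enum_rank e == k)%:R +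
         (x 0 k * (~~ BH (opp e))%:R) * (enum_rank (opp e) == k)%:R)); last first.
        move=> k _; rewrite !mxE enum_rankK mulrDr -mulrA -natrM mulnb.
        rewrite -(can_eq (@enum_rankK (half G)) e) enum_valK.
        rewrite -(can_eq (@enum_rankK (half G)) (opp e)) enum_valK.
        case: (enum_rank (opp e) =P k) => [<-|]; rewrite ?andbF ?andbT ?enum_rankK //.
      rewrite big_split /= (bigD1 (enum_rank e)) //= eqxx mulr1 big1 ?addr0 => [|k ne]; last first.
        by rewrite eq_sym (negPf ne) mulr0.
      rewrite (bigD1 (enum_rank (opp e))) //= eqxx mulr1 big1 ?addr0 => [|k ne]; last first.
        by rewrite eq_sym (negPf ne) mulr0.
      by rewrite [X in _ + X]mulrC.
    rewrite mxE (bigD1 (enum_rank (src e))) //= big1 ?addr0 => [|k ne]; last first.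
      rewrite !mxE enum_rankK; case: eqP => [sE|_]; last by rewrite andbF mulr0.
      by case/eqP: ne; rewrite sE enum_valK.
    by rewrite !mxE !enum_rankK eqxx andbT mulrC.
  split=> [H e|H]; first by rewrite -E H mxE.
  by apply/rowP => k; rewrite -(enum_valK k) E H mxE.
pose jj i := match j i with inl d => lshift m (enum_rank d) | inr v => rshift n (enum_rank v) end.
have atE (x : 'rV_n) (y : 'rV_m) i : row_mx x y 0 (jj i) =
    at_ (fun d => x 0 (enum_rank d)) (fun v => y 0 (enum_rank v)) (j i).
  by rewrite /jj; case: (j i) => [d|v]; rewrite ?row_mxEl ?row_mxEr.
have rk2 : \rank (kermx N) = #|I|.
  apply: (@rank_by_coords _ _ _ I N jj) => [u|i].
    rewrite -[u]hsubmxK; move: (lsubmx u) (rsubmx u) => x y /solE sol z.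
    have [|X0 Y0] := inj _ _ sol; first by move=> i; rewrite -atE.
    have x0 : x = 0 by apply/rowP => k; rewrite [RHS]mxE -(enum_valK k).
    have y0 : y = 0 by apply/rowP => k; rewrite [RHS]mxE -(enum_valK k).
    by rewrite x0 y0 row_mx0.
  have [X [Y [sol XYi]]] := surj i.
  exists (row_mx (\row_k X (enum_val k)) (\row_k Y (enum_val k))).
    apply/solE => e; rewrite !mxE !enum_rankK; exact: sol.
  move=> i'; rewrite atE -XYi; case: (j i') => [d|v] /=; by rewrite mxE enum_rankK.
move: rk2; rewrite !mxrank_ker /N mxrank_tr => <-.
by rewrite addnBAC // rank_leq_row.
Qed.

Definition oriented (d : half G) : bool :=
  [&& ~~ BH d, ~~ is_open d & (enum_rank d < enum_rank (opp d))%N].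

Lemma is_open_opp d : is_open (opp d : half G) = is_open d.
Proof. by rewrite /is_open oK eq_sym. Qed.

Lemma orientedP d : ~~ BH d -> ~~ is_open d -> oriented d || oriented (opp d).
Proof.
move=> nb no; rewrite /oriented BHo is_open_opp nb no oK /= -neq_ltn.
by apply: contra no => /eqP/val_inj/enum_rank_inj dE; rewrite /is_open -dE.
Qed.

Lemma oriented_opp d : oriented d -> ~~ oriented (opp d).
Proof. by case/and3P=> _ _ lt; apply/negP => /and3P[_ _]; rewrite oK ltnNge ltnW. Qed.

Lemma mem_opp_imset (A : {set half G}) d : (d \in (@opp G) @: A) = (opp d \in A).
Proof. by rewrite -{1}[d]oK (mem_imset _ _ (inv_inj oK)). Qed.

Lemma card_oriented :
  (2 * #|[set d | oriented d]| = #|[set d : half G | ~~ BH d && ~~ is_open d]|)%N.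
Proof.
have -> : [set d : half G | ~~ BH d && ~~ is_open d] =
    [set d | oriented d] :|: (@opp G) @: [set d | oriented d].
  apply/setP => d; rewrite in_setU mem_opp_imset !inE.
  apply/andP/idP => [[nb no]|]; first by rewrite orientedP.
  by case/orP=> /and3P[]; rewrite ?BHo ?is_open_opp.
rewrite cardsU (_ : _ :&: _ = set0) ?cards0.
  by rewrite card_imset; [lia | exact: inv_inj].
apply/setP => d; rewrite in_setI mem_opp_imset !inE.
by apply/negP => /andP[/oriented_opp/negP].
Qed.

Lemma edge_cocycle o : oriented o ->
  cocycle (fun d => (d == o)%:R - (d == opp o)%:R) (fun=> 0).
Proof.
case/and3P=> nb no _ e; rewrite mulr0 addr0.
have oE : (opp e == opp o) = (e == o) := inj_eq (inv_inj oK) e o.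
have oE' : (opp e == o) = (e == opp o) by rewrite (inv_eq oK).
rewrite oE oE'; have [bo|_] := boolP (BH (opp e)); last by rewrite mul1r; ring.
have -> : (e == o) = false by apply: contraNF nb => /eqP <-; rewrite -BHo.
have -> : (e == opp o) = false by apply: contraNF nb => /eqP eo; rewrite -BHo -eo -BHo.
by rewrite mul0r addr0 subrr.
Qed.

Lemma oriented_opp_neq o o' : oriented o -> oriented o' -> (o' == opp o) = false.
Proof. by move=> h h'; apply/eqP => E; have := oriented_opp h; rewrite -E h'. Qed.

Definition locally_constant (a : vert G -> rat) : Prop :=
  forall d, ~~ BH d -> ~~ is_open d -> a (src d) = a (src (opp d)).

(** The equations at [d] and at [opp d] contain the same terms in [X], so their terms in [Y]
    agree. *)
Lemma cocycle_locally_constant X Y : cocycle X Y ->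
  locally_constant (fun v => (~~ BV v)%:R * Y v).
Proof.
move=> sol d nb no; have := sol d; have := sol (opp d); rewrite oK BHo nb !mul1r.
move: (X d) (X (opp d)) => x x' e1 e2.
apply: (@addrI _ (x + x')); rewrite e2 addrC -[x + x']addrC in e1 *.
by rewrite -e1 addrC.
Qed.

Lemma cocycle_zero X Y : cocycle X Y -> (forall v, (~~ BV v)%:R * Y v = 0) ->
  (forall d, oriented d -> X d = 0) -> forall d, X d = 0.
Proof.
move=> sol Y0 O0 d; have := sol d; rewrite Y0 addr0 BHo.
have [b|nb] := boolP (BH d); first by rewrite mul0r addr0.
have [/eqP->|no] := boolP (is_open d).
  by rewrite mul1r; lra.
case/orP: (orientedP nb no) => [/O0//|/O0->].
by rewrite mulr0 addr0.
Qed.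

(** An Euler characteristic: the hypothesis says that the relative H_0 vanishes, and then the
    relative rank is the number of edges minus the number of vertices off the subgraph. The free
    coordinates are [X] on one half-edge of each such edge, and [Y] on the vertices of the subgraph,
    where its coefficient is 0. *)
Lemma rkH1_relative :
    (forall a, locally_constant a -> (forall v, BV v -> a v = 0) -> forall v, a v = 0) ->
  (2 * (rkH1 BV BH + #|[set v | ~~ BV v]|) = #|[set d : half G | ~~ BH d && ~~ is_open d]|)%N.
Proof.
move=> lc; rewrite -card_oriented; congr (_ * _)%N.
pose I : finType := ({v : vert G | BV v} + {d | oriented d})%type.
pose j (i : I) := match i with inl v => inr (val v) | inr d => inl (val d) end.
have := @rkH1_coords I j; rewrite /= => /(_ _ _)/wrap[||].
- move=> X Y sol z.
  have Y0 : forall v, (~~ BV v)%:R * Y v = 0.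
    by apply: lc (cocycle_locally_constant sol) _ => v ->; rewrite mul0r.
  have X0 := cocycle_zero sol Y0 (fun d od => z (inr (Sub d od))).
  split=> // v; have [bv|nv] := boolP (BV v); first exact: (z (inl (Sub v bv))).
  by have := Y0 v; rewrite nv mul1r.
- case=> [b|o].
    exists (fun=> 0), (fun v => (v == val b)%:R); split.
      move=> e; rewrite mulr0 !add0r; case: eqP => [->|_]; last by rewrite mulr0.
      by rewrite (valP b) mul0r.
    by case=> [b'|o'] //=; rewrite (inj_eq val_inj).
  exists (fun d => (d == val o)%:R - (d == opp (val o))%:R), (fun=> 0); split.
    exact: edge_cocycle (valP o).
  case=> [b'|o'] //=; rewrite (oriented_opp_neq (valP o) (valP o')) subr0.
  by rewrite (inj_eq val_inj).
rewrite card_sum !card_sig => E.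
have mE : m = (#|[set v | BV v]| + #|[set v | ~~ BV v]|)%N.
  rewrite /m -cardsT -(cardsID [set v | BV v]) setTI; congr (_ + _)%N.
  by apply: eq_card => v; rewrite !inE andbT.
have cV : #|[set v | BV v]| = #|[pred v | BV v]| by apply: eq_card => v; rewrite !inE.
have cO : #|[set d | oriented d]| = #|[pred d | oriented d]|.
  by apply: eq_card => d; rewrite !inE.
by apply: (@addnI #|[pred v | BV v]|); rewrite cO -E mE cV addnCA.
Qed.

End RankByCoords.

Section RankAbsolute.

Import GRing.Theory.
Local Open Scope ring_scope.

Variable G : graph.
Hypothesis oK : involutive (@opp G).
Hypothesis conn : connected G.

(** On a connected graph the locally constant functions are the constants, which contribute one more
    free coordinate, the value of [Y] at [v0]. *)
Lemma rkH1_absolute : (2 * (rkH1 (pred0 : pred (vert G)) (pred0 : pred (half G)) + #|vert G|)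
  = #|[set d : half G | ~~ is_open d]| + 2)%N.
Proof.
pose BV : pred (vert G) := pred0; pose BH : pred (half G) := pred0.
have BHo d : BH (opp d) = BH d by [].
have [/set0Pn[v0 _] cn] := conn.
have lc a : locally_constant BH a -> forall v, a v = a v0.
  move=> lca v; have := cn v0 v (in_setT _) (in_setT _); case/connectP=> p pth ->.
  elim: p (v0) pth => //= y p IH x /andP[/exists_inP[d _ /andP[/eqP dx /eqP dy]]] /IH->.
  have [/eqP opn|nop] := boolP (is_open d); first by rewrite -dy opn dx.
  by rewrite -dx -dy (lca d).
have := card_oriented oK BHo.
rewrite (_ : [set d | _ & _] = [set d : half G | ~~ is_open d]); last by apply/setP => d; rewrite !inE.
move=> <-; rewrite -[X in _ = (_ + X)%N]/(2 * 1)%N -mulnDr; congr (2 * _)%N.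
pose I : finType := option {d | oriented BH d}.
pose j (i : I) := match i with None => inr v0 | Some d => inl (val d) end.
have := @rkH1_coords G BV BH I j; rewrite /= => /(_ _ _)/wrap[||].
- move=> X Y sol z; have Y0' := lc _ (cocycle_locally_constant oK BHo sol).
  have Yv0 : Y v0 = 0 := z None.
  have Y0 v : (~~ BV v)%:R * Y v = 0 by rewrite (Y0' v) Yv0 mulr0.
  have X0 := cocycle_zero oK BHo sol Y0 (fun d od => z (Some (Sub d od))).
  by split=> // v; have := Y0 v; rewrite mul1r.
- case=> [o|].
    exists (fun d => (d == val o)%:R - (d == opp (val o))%:R), (fun=> 0); split.
      exact: (edge_cocycle BV oK BHo (valP o)).
    case=> [o'|] //=; rewrite (oriented_opp_neq oK (valP o) (valP o')) subr0.
    by rewrite (inj_eq Some_inj) (inj_eq val_inj).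
  (* The solution with [Y] equal to 1: the equation becomes [X e + X (opp e) = -1]. On an open
     half-edge the two terms coincide, whence the value -1/2. *)
  exists (fun d => if is_open d then - 2^-1 else if oriented BH d then 0 else - 1), (fun=> 1); split.
    move=> e; rewrite !mul1r (is_open_opp oK).
    have [/eqP opn|no] := boolP (is_open e); first by lra.
    have := orientedP oK BHo (isT : ~~ BH e) no.
    case: ifP => [/(oriented_opp oK)/negPf-> _|_ /= ->]; by rewrite ?add0r ?addr0 addNr.
  case=> [o'|] //=; have /and3P[_ /negPf-> _] := valP o'.
  by rewrite (valP o').
rewrite card_option card_sig => E.
have cO : #|[set d | oriented BH d]| = #|[pred d | oriented BH d]|.
  by apply: eq_card => d; rewrite !inE.
by rewrite cO addn1 -E.
Qed.

End RankAbsolute.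

(** * The genus of a tree and of its double cover by counting *)

Section GenusCount.

Variables (T : bytree) (r : vert T) (up : vert T -> half T) (rk : vert T -> nat).
Hypotheses (rt : orooted r up rk) (oT : open_by T).

Lemma nonopen_count : #|[set d : half T | ~~ is_open d]| + 2 = 2 * #|vert T|.
Proof.
have oK := or_oppK rt; pose U := [set up v | v in [set~ r]].
have UE d : (d \in U) = (src d != r) && (d == up (src d)).
  apply/imsetP/andP => [[v]|[dr /eqP dE]].
    by rewrite !inE => vr ->; rewrite (or_src rt).
  by exists (src d); rewrite ?inE.
have -> : [set d : half T | ~~ is_open d] = U :|: (@opp T) @: U.
  apply/setP => d; rewrite in_setU (mem_opp_imset oK) !UE inE.
  have opnE : (is_open d) = (is_open (opp d)) by rewrite (is_open_opp oK).
  apply/idP/orP => [nop|]; last first.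
    by case=> /andP[ne /eqP dE]; [rewrite dE (up_open rt) | rewrite opnE dE (up_open rt)].
  case: (or_up rt d) => dE; [left | right]; rewrite -dE eqxx andbT -(up_open rt) -dE //.
  by rewrite -opnE.
have cU : #|U| = #|vert T|.-1 by rewrite card_imset ?cardsC1 //; exact: (up_inj rt).
rewrite cardsU (_ : U :&: _ = set0) ?cards0 ?subn0; last first.
  apply/setP => d; rewrite in_setI (mem_opp_imset oK) !UE inE.
  apply/negP => /andP[/andP[ne /eqP dE] /andP[_ /eqP oE]].
  by have := opp_up_neq rt ne; rewrite -dE {1}oE eqxx.
rewrite card_imset ?cU; last exact: inv_inj.
have : 0 < #|vert T| by apply/card_gt0P; exists r.
by case: #|_| => // k _ /=; lia.
Qed.

Lemma yellow_child (v : vert T) : ~~ blueV v -> exists2 d, src d = v /\ d != up v &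
  [/\ ~~ blueH d, ~~ is_open d & opp d = up (src (opp d))].
Proof.
case: oT => _ _ c1 _ _ yv; have [_ deg yd] := c1 v yv.
have [d dv du] : exists2 d, src d = v & d != up v.
  case: (pickP [pred d | (src d == v) && (d != up v)]) => [d /andP[/eqP ? ?]|none].
    by exists d.
  suff : degree v <= 1 by rewrite leqNgt (ltnW deg).
  apply: (degree_le1 (d0 := up v)) => d dv.
  by apply/eqP; have := none d; rewrite /= dv eqxx /= => /negbFE.
exists d => //; have := @not_up_opp _ _ _ _ rt d; rewrite dv => /(_ du)[? ?].
by split=> //; apply: yd.
Qed.

(** Going away from the root along yellow edges one ends at a blue vertex, so a function that is
    constant along them and zero on the blue part vanishes. *)
Lemma rkH1_by : 2 * (rkH1 (@blueV T) (@blueH T) + #|[set v : vert T | ~~ blueV v]|) =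
  #|[set d : half T | ~~ blueH d && ~~ is_open d]|.
Proof.
case: oT => [[wT _] _ c1 _ _]; apply: (rkH1_relative (by_oppK wT) (by_bopp wT)).
move=> a lc a0 v; have [m rkm] : exists m, forall v, rk v <= m.
  by exists (\max_v rk v) => w; exact: leq_bigmax.
have [n] := ubnP (m - rk v); elim: n v => // n IH v ltn.
have [bv|yv] := boolP (blueV v); first exact: a0.
have [d [dv _] [yd nod oE]] := yellow_child yv.
have wr : src (opp d) != r by rewrite -(up_open rt) -oE (is_open_opp (by_oppK wT)).
have lt := opp_up_desc rt oE wr; rewrite -dv (lc d yd nod); apply: IH.
have := rkm (src (opp d)); move: ltn lt; rewrite dv; lia.
Qed.

(** The Riemann-Hurwitz count: among the 2g + 2 branch points are the roots and, when the open edge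
    is blue, the point at infinity. The definition of [roots_at] is summed over the blue vertices,
    and the counts of vertices and edges are eliminated. *)
Lemma sum_roots : \sum_(v : vert T | blueV v) roots_at v + blueH (up r) = 2 * by_genus T + 2.
Proof.
case: (oT) => [[wT _] _ c1 c3 _].
have E1 := rkH1_by; have E2 := nonopen_count.
have E3 : #|[set d : half T | ~~ is_open d]| = #|[set d : half T | ~~ blueH d && ~~ is_open d]|
    + #|[set d : half T | blueH d && ~~ is_open d]|.
  rewrite -(cardsID [set d : half T | ~~ blueH d]); congr (_ + _); apply: eq_card => d.
    by rewrite !inE andbC.
  by rewrite !inE negbK.
have E4 : #|vert T| = #|[set v : vert T | blueV v]| + #|[set v : vert T | ~~ blueV v]|.
  rewrite -cardsT -(cardsID [set v : vert T | blueV v]) setTI; congr (_ + _).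
  by apply: eq_card => v; rewrite !inE andbT.
have E5 : \sum_(v : vert T | blueV v) roots_at v + \sum_(v : vert T | blueV v) blue_degree v
    = \sum_(v : vert T | blueV v) (2 * by_gen v + 2).
  by rewrite -big_split /=; apply: eq_bigr => v _; rewrite /roots_at subnK.
have E6 : \sum_(v : vert T | blueV v) (2 * by_gen v + 2) =
    2 * \sum_(v : vert T) by_gen v + 2 * #|[set v : vert T | blueV v]|.
  rewrite big_split /= sum_nat_cond_const mulnC; congr (_ + _).
  rewrite big_distrr [RHS](bigID (@blueV T)) /= [X in _ = _ + X]big1 ?addn0 // => v yv.
  by have [-> _ _] := c1 v yv; rewrite muln0.
have E7 : \sum_(v : vert T | blueV v) blue_degree v = #|[set d : half T | blueH d]|.
  rewrite -sum1_card (partition_big (@src T) (@blueV T)) /= => [|d]; last first.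
    by rewrite inE => /(blue_src c1).
  apply: eq_bigr => v _; rewrite /blue_degree -sum1_card; apply: eq_bigl => d.
  by rewrite !inE andbC.
have E8 : #|[set d : half T | blueH d]| = #|[set d : half T | blueH d && ~~ is_open d]| + blueH (up r).
  rewrite -(cardsID [set d : half T | ~~ is_open d]); congr (_ + _).
    by apply: eq_card => d; rewrite !inE.
  have -> : [set d : half T | blueH d] :\: [set d : half T | ~~ is_open d] =
      if blueH (up r) then [set up r] else set0.
    apply/setP => d; rewrite !inE negbK (or_open rt).
    by have [->|ne] := eqVneq d (up r); case: ifP => b; rewrite ?inE ?eqxx ?(negPf ne).
  by case: ifP; rewrite ?cards1 ?cards0.
rewrite /by_genus; move: E1 E2 E3 E4 E5 E6 E7 E8.
move: (rkH1 _ _) (\sum_(v | _) roots_at v) (\sum_(v | _) blue_degree v).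
move: (\sum_(v | _) (2 * _ + 2)) (\sum_(v : vert T) by_gen v).
move: #|[set d : half T | ~~ is_open d]| #|[set d : half T | ~~ blueH d && ~~ is_open d]|.
move: #|[set d : half T | blueH d]| #|[set d : half T | blueH d && ~~ is_open d]|.
move: #|[set v : vert T | blueV v]| #|[set v : vert T | ~~ blueV v]| #|vert T| (blueH (up r)).
lia.
Qed.

Variables (G : hgraph) (L : pred (vert T)) (pV : vert G -> vert T) (pH : half G -> half T).
Hypotheses (wG : hyp_wf G) (cG : connected G) (c : dcover L pV pH).

Lemma fibre_cardV t : \sum_(v : vert G | pV v == t) 1 + L t = 1 + ~~ blueV t.
Proof.
have [Lt|nLt] := boolP (L t).
  have [-> _ _] := dc_L c Lt; rewrite big1 ?addn0 // => v /eqP vt.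
  by have := dc_nL c v; rewrite vt Lt.
have [v vt] := dc_imV c nLt; rewrite addn0 sum1_card.
have E : (fun v => pV v == t) =i [set v; iotaV v].
  move=> w; rewrite !inE; apply/eqP/orP => [wt|[/eqP->|/eqP->]].
  - by rewrite -wt in vt; case: (dc_V c vt) => ->; rewrite eqxx; [left | right].
  - exact: vt.
  - by rewrite (dc_iV c).
by rewrite (eq_card E) cards2 -vt (dc_bV c) eq_sym; case: (_ == _).
Qed.

Lemma fibre_cardH d : \sum_(h : half G | pH h == d) 1 + 2 * L (src d) = 1 + ~~ blueH d.
Proof.
have [Ld|nLd] := boolP (L (src d)).
  have [_ _ [d' [_ yd _ du]]] := dc_L c Ld; rewrite -(du d erefl) in yd.
  rewrite yd big1 // => h /eqP hd.
  by have := dc_src_nL c h; rewrite hd Ld.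
have [h hd] := dc_imH c nLd; rewrite muln0 addn0 sum1_card.
have E : (fun h => pH h == d) =i [set h; iotaH h].
  move=> w; rewrite !inE; apply/eqP/orP => [wt|[/eqP->|/eqP->]].
  - by rewrite -wt in hd; case: (dc_H c hd) => ->; rewrite eqxx; [left | right].
  - exact: hd.
  - by rewrite (dc_iH c).
by rewrite (eq_card E) cards2 -hd (dc_bH c) eq_sym; case: (_ == _).
Qed.

(** The vertex genera agree, so the two ranks are compared by counting over [T]: two preimages of a
    yellow point, one of a blue point. A leaf in [L] loses its one preimage and its half-edge loses
    both; one vertex and one edge cancel in the Euler characteristic. *)
Lemma dcover_genus : hg_genus G = by_genus T.
Proof.
case: (oT) => [[wT _] _ c1 c3 _].
have E0 : \sum_(v : vert G) hg_gen v = \sum_(v : vert T) by_gen v.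
  rewrite (partition_big pV xpredT) //=; apply: eq_bigr => t _.
  rewrite (eq_bigr (fun=> by_gen t * 1)) => [|v /eqP <-]; last by rewrite (dc_gen c) muln1.
  rewrite -big_distrr /=; have := fibre_cardV t.
  have [Lt|nL] := boolP (L t); first by have [_ -> _] := dc_L c Lt; rewrite mul0n.
  have [bt|yt] := boolP (blueV t); first by rewrite !addn0 => ->; rewrite muln1.
  by have [-> _ _] := c1 t yt; rewrite mul0n.
have E1 := rkH1_by; have E2 := nonopen_count.
have E3 : #|[set d : half T | ~~ is_open d]| = #|[set d : half T | ~~ blueH d && ~~ is_open d]|
    + #|[set d : half T | blueH d && ~~ is_open d]|.
  rewrite -(cardsID [set d : half T | ~~ blueH d]); congr (_ + _); apply: eq_card => d.
    by rewrite !inE andbC.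
  by rewrite !inE negbK.
have E4 : #|vert G| + \sum_t L t = #|vert T| + #|[set v : vert T | ~~ blueV v]|.
  rewrite -!sum1_card (partition_big pV xpredT) //= -big_split /=.
  rewrite (eq_bigr _ (fun t _ => fibre_cardV t)) big_split /=; congr (_ + _).
  by rewrite [RHS]big_mkcond; apply: eq_bigr => v _; rewrite inE; case: blueV.
have E5 : #|[set h : half G | ~~ is_open h]| + 2 * \sum_(d : half T | ~~ is_open d) L (src d) =
    #|[set d : half T | ~~ is_open d]| + #|[set d : half T | ~~ blueH d && ~~ is_open d]|.
  rewrite -!sum1dep_card (partition_big pH (fun d => ~~ is_open d)) /=; last first.
    by move=> h; rewrite (dc_openE c).
  rewrite big_distrr -big_split /=.
  rewrite (eq_bigr (fun d => 1 + ~~ blueH d)) => [|d nod].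
    rewrite big_split /=; congr (_ + _).
    rewrite big_mkcond [RHS]big_mkcond; apply: eq_bigr => d _.
    by case: is_open; case: blueH.
  rewrite -fibre_cardH; congr (_ + _); apply: eq_bigl => h; case: eqP => [hd|]; last by rewrite andbF.
  by rewrite -(dc_openE c) hd nod.
have E6 : \sum_(d : half T | ~~ is_open d) L (src d) = \sum_t L t.
  rewrite (partition_big (@src T) xpredT) //=; apply: eq_bigr => t _.
  have [Lt|nLt] := boolP (L t); last first.
    by rewrite big1 // => d /andP[_ /eqP->]; rewrite (negPf nLt).
  have [_ _ [d [dt yd nL du]]] := dc_L c Lt.
  rewrite (big_pred1 d) ?dt ?Lt // => d'; apply/andP/eqP => [[_ /eqP/du //]|->].
  split; last exact/eqP; apply: contra nL => /eqP->.
  by rewrite dt.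
have E7 := rkH1_absolute (hg_oppK wG) cG.
rewrite /hg_genus /by_genus E0; congr (_ + _).
move: E1 E2 E3 E4 E5 E6 E7; set a := rkH1 _ _; set b := rkH1 _ _.
move: a b (\sum_t L t) (\sum_(d : half T | _) L (src d)).
move: #|[set d : half T | ~~ is_open d]| #|[set d : half T | ~~ blueH d && ~~ is_open d]|.
move: #|[set d : half G | ~~ is_open d]| #|[set d : half T | blueH d && ~~ is_open d]|.
move: #|[set v : vert T | ~~ blueV v]| #|vert T| #|vert G|.
lia.
Qed.

End GenusCount.

Lemma T_of_G_genus : preserves_genus open_hyp hg_genus by_genus T_of_G.
Proof.
move=> G oG; have [oT [pV [pH c]]] := open_hyp_by oG.
have [r [up [rk rt]]] := open_by_rooted oT; case: oG => [[wG cG] _ _ _ _].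
by rewrite (dcover_genus rt oT wG cG c).
Qed.

Lemma G_of_T_genus : preserves_genus open_by by_genus hg_genus G_of_T.
Proof.
move=> T oT; have [wG c] := glue_open_dcover oT; have oG := dcover_open_hyp wG oT c.
have [r [up [rk rt]]] := open_by_rooted oT; case: oG => [[_ cG] _ _ _ _].
exact: (dcover_genus rt oT wG cG c).
Qed.

(** * Cores of open BY trees *)

Section Smooth.

Variables (G : graph) (H : subspace G) (K : pred (vert G)).

Lemma other_halfP (d : half G) : degree_in H (src d) = 2 -> d \in H.2 ->
  [/\ other_half H d \in H.2, src (other_half H d) = src d, other_half H d != d
    & forall e, e \in H.2 -> src e = src d -> e = d \/ e = other_half H d].
Proof.
move=> /eqP/cards2P[a [b [ab E]]] dH.
have memE e : (e \in H.2) && (src e == src d) = (e == a) || (e == b).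
  by have := in_set2 e a b; rewrite -E inE.
have dab : (d == a) || (d == b) by rewrite -memE dH eqxx.
rewrite /other_half; case: pickP => [e /and3P[eH es ed]|none] /=.
  split=> //; first exact/eqP.
  have eab : (e == a) || (e == b) by rewrite -memE eH es.
  move=> f fH /eqP fs; have : (f == a) || (f == b) by rewrite -memE fH.
  move: dab eab ed ab => /orP[] /eqP-> /orP[] /eqP->; rewrite ?eqxx // => _ _ /orP[] /eqP->; auto.
have [c [cd]] : exists c, c != d /\ ((c == a) || (c == b)).
  case/orP: dab => /eqP->; [exists b | exists a]; rewrite eqxx ?orbT; split=> //.
  by rewrite eq_sym.
by rewrite -memE => /andP[cH cs]; have := none c; rewrite cH cs cd.
Qed.

Lemma other_halfK (d : half G) : degree_in H (src d) = 2 -> d \in H.2 ->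
  other_half H (other_half H d) = d.
Proof.
move=> deg dH; have [oH os ne uq] := other_halfP deg dH.
have deg' : degree_in H (src (other_half H d)) = 2 by rewrite os.
have [oH' os' ne' _] := other_halfP deg' oH.
rewrite os in os'; case: (uq _ oH' os') => // E.
by rewrite E eqxx in ne'.
Qed.

Definition pass (e : half G) : half G := if K (src e) then e else opp (other_half H e).

(** [pass] is stationary at a kept vertex, and its orbit gets there in fewer than [#|half G|] steps,
    so the fixed number of steps in [far_end] overshoots without harm. *)
Lemma far_end_pass n (d : half G) :
  K (src (iter n pass (opp d))) -> far_end H K d = iter n pass (opp d).
Proof.
set x := opp d; set y := iter n pass x => Ky.
have fy : pass y = y by rewrite /pass Ky.
have xy : fconnect pass x y by exact: fconnect_iter.
have lt : findex pass x y < #|half G| := leq_trans (findex_max xy) (max_card _).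
rewrite /far_end -/x -/(pass) -(subnK (ltnW lt)) iterD -/pass.
change (iter (#|half G| - findex pass x y) pass (iter (findex pass x y) pass x) = y).
by rewrite (iter_findex xy); elim: (_ - _) => //= k ->.
Qed.

Lemma smooth_degree (v : vert (smooth H K)) : degree v = degree_in H (val v).
Proof.
rewrite /degree /degree_in -(card_imset _ val_inj); apply: eq_card => d.
rewrite inE; apply/imsetP/andP => [[e]|[dH /eqP dv]].
  rewrite inE => /eqP ev ->; have /andP[eH _] := valP e; split=> //.
  by rewrite -ev.
have P : (d \in H.2) && K (src d) by rewrite dH dv (valP v).
by exists (Sub d P) => //; rewrite inE -(inj_eq val_inj) /= dv.
Qed.

Lemma smooth_oppE (d : half (smooth H K)) e : far_end H K (val d) = e ->
  e \in H.2 -> K (src e) -> val (opp d) = e.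
Proof. by move=> fE eH Ke; rewrite /= fE insubdK // unfold_in /= eH Ke. Qed.

End Smooth.

Section ByCore.

Variables (T : bytree) (r : vert T) (up : vert T -> half T) (rk : vert T -> nat).
Hypotheses (rt : orooted r up rk) (oT : open_by T).

Let oK := or_oppK rt.
Implicit Types (d e : half T) (u v w : vert T).

Lemma oT_wf : by_wf T. Proof. by case: oT => [[]]. Qed.
Lemma oT_bopp (d : half T) : blueH (opp d) = blueH d. Proof. exact: by_bopp oT_wf d. Qed.
Lemma oT_c1 : by_cond1 T. Proof. by case: oT. Qed.
Lemma oT_c3 : by_cond3 T. Proof. by case: oT. Qed.

Lemma oT_yellow (v : vert T) : v != r -> blueV v -> by_gen v = 0 ->
  exists2 d, src d = v & ~~ blueH d.
Proof.
case: oT => _ _ _ _ [c2|[V1 _ _]] vr; first exact: c2.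
by case/eqP: vr; exact: card1_eq.
Qed.

Lemma nonopen_src d : src d != r -> ~~ is_open d.
Proof. by apply: contra; rewrite (or_open rt) => /eqP->; rewrite (or_src rt). Qed.

Lemma noloop d : ~~ is_open d -> src (opp d) != src d.
Proof.
move=> nop; apply: contra nop => /eqP s; have := @orooted_simple _ _ _ _ rt d (opp d).
by rewrite /= oK s /is_open => <-.
Qed.

Lemma root_child d : src d = r -> ~~ is_open d -> opp d = up (src (opp d)).
Proof.
move=> dr nop; have := @not_up_opp _ _ _ _ rt d; rewrite dr -(or_open rt).
by case/(_ nop).
Qed.

Lemma up_nonopen v : v != r -> ~~ is_open (up v).
Proof. by rewrite (up_open rt). Qed.

(** With rank 0, [rkH1_by] gives as many yellow edges, the open one aside, as yellow vertices, while
    each yellow vertex has at least two yellow edges to children. So there are no yellow vertices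
    and no such edges, and a blue vertex of genus 0 other than the root would need one. *)
Lemma genus0_lone : by_genus T = 0 -> forall v, v = r.
Proof.
move=> /eqP; rewrite addn_eq0 => /andP[/eqP rk0 gen0].
have g0 v : by_gen v = 0.
  by apply/eqP; move: gen0; rewrite sum_nat_eq0 => /forallP/(_ v).
have E := rkH1_by rt oT; rewrite rk0 add0n in E.
pose A := [set d : half T | ~~ blueV (src d) && (d != up (src d))].
have cA : 2 * #|[set v : vert T | ~~ blueV v]| <= #|A|.
  rewrite -[X in _ <= X]sum1_card (partition_big (@src T) (fun v => ~~ blueV v)) /=; last first.
    by move=> d; rewrite inE => /andP[].
  rewrite -sum1dep_card big_distrr /=; apply: leq_sum => v yv.
  rewrite muln1 sum1_card; have [_ deg _] := oT_c1 yv.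
  have : degree v = #|[set d | src d == v] :&: [set up v]| + #|[set d | src d == v] :\: [set up v]|.
    by rewrite cardsID.
  have -> : [set d | src d == v] :&: [set up v] = [set up v].
    by apply/setIidPr; rewrite sub1set inE (or_src rt).
  rewrite cards1 => degE.
  rewrite (eq_card (_ : _ =i [set d | src d == v] :\ up v)) => [|d].
    by move: deg; rewrite degE add1n ltnS.
  rewrite !inE -topredE /= inE andbC; case: (src d =P v) => [->|]; rewrite ?andbF ?andbT //=.
  by rewrite yv.
have AE d : d \in A -> [/\ ~~ blueH d, ~~ is_open d & opp d = up (src (opp d))].
  rewrite inE => /andP[yd du]; have [nop dE] := not_up_opp rt du; split=> //.
  by have [_ _ ->] := oT_c1 yd.
have cAA : 2 * #|A| <= #|[set d : half T | ~~ blueH d && ~~ is_open d]|.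
  have <- : #|A :|: (@opp T) @: A| = 2 * #|A|.
    rewrite cardsU (_ : _ :&: _ = set0) ?cards0; last first.
      apply/setP => d; rewrite in_setI (mem_opp_imset oK) in_set0; apply/negP => /andP[dA oA].
      have [_ nop dE] := AE _ dA; have [_ _] := AE _ oA; rewrite oK => d2.
      by move: dA; rewrite inE -d2 eqxx andbF.
    by rewrite card_imset ?subn0; [lia | exact: inv_inj].
  apply/subset_leq_card/subsetP => d; rewrite in_setU (mem_opp_imset oK) inE.
  case/orP=> /AE[]; rewrite ?oT_bopp ?(is_open_opp oK) => -> -> //.
have noy : #|[set d : half T | ~~ blueH d && ~~ is_open d]| = 0.
  move: E cA cAA; move: #|A| #|[set v : vert T | ~~ blueV v]| #|_| => a b e; lia.
have noyd d : ~~ blueH d -> ~~ is_open d -> False.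
  by move=> yd nop; have := cards0_eq noy; move/setP/(_ d); rewrite !inE yd nop.
move=> v; apply/eqP; apply: contraT => vr.
have [bv|yv] := boolP (blueV v).
  have [d dv yd] := oT_yellow vr bv (g0 v); case: (noyd d yd).
  by apply: nonopen_src; rewrite dv.
have [_ _ yel] := oT_c1 yv; case: (noyd (up v)); last exact: up_nonopen.
by apply: yel; rewrite (or_src rt).
Qed.

(* The root has to be removed from the core, together with its blue edge, when
   the yellow open edge is its only yellow edge and it has one blue edge. *)
Definition special : bool :=
  [&& blueV r, by_gen r == 0, ~~ blueH (up r), degree r == 2
    & [exists d, (src d == r) && blueH d]].

Definition coreV : {set vert T} := [set v | ~~ (special && (v == r))].

Definition coreH : {set half T} :=
  [set d | [&& ~~ is_open d, src d \in coreV & src (opp d) \in coreV]].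

Definition core : subspace T := (coreV, coreH).

(** The root is no vertex of the core, being either deleted or an interior point of an edge. *)
Definition dropped : bool := special || by_removable core r.

Lemma coreH_opp d : (opp d \in coreH) = (d \in coreH).
Proof. by rewrite !inE (is_open_opp oK) oK andbCA andbA andbC [RHS]andbC -!andbA; do !bool_congr. Qed.

Lemma specialP : special -> exists d1, [/\ src d1 = r, blueH d1, ~~ is_open d1
  & forall d, src d = r -> d = up r \/ d = d1].
Proof.
case/and5P=> br _ yo /eqP/eqP/cards2P[a [b [ab E]]] /existsP[d1 /andP[/eqP d1r bd1]].
have memE e : (src e == r) = (e == a) || (e == b).
  by have := in_set2 e a b; rewrite -E inE.
have d1u : d1 != up r by apply: contraNneq yo => <-.
exists d1; split=> //; first by rewrite (or_open rt).
move=> d /eqP dr.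
have hu : (up r == a) || (up r == b) by rewrite -memE (or_src rt).
have h1 : (d1 == a) || (d1 == b) by rewrite -memE d1r.
rewrite memE in dr; move: d1u.
by case/orP: hu => /eqP->; case/orP: h1 => /eqP->; rewrite ?eqxx //; case/orP: dr => /eqP->; auto.
Qed.

Lemma special_yellow d : special -> ~~ blueH d -> ~~ is_open d -> src d != r.
Proof.
move=> /specialP[d1 [_ bd1 _ du]] yd nop; apply/eqP => dr.
by case: (du d dr) => E; rewrite E ?bd1 // (up_open rt) ?eqxx in yd nop.
Qed.

Lemma yellow_core d : ~~ blueH d -> ~~ is_open d -> d \in coreH.
Proof.
move=> yd nop; rewrite !inE nop /=; case sp: special => //=.
rewrite special_yellow //= special_yellow ?oT_bopp // ?(is_open_opp oK) //.
Qed.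

Lemma nspecial_core d : ~~ special -> (d \in coreH) = ~~ is_open d.
Proof. by move=> /negPf sp; rewrite !inE sp /= !andbT. Qed.

Lemma coreH_nonopen d : d \in coreH -> ~~ is_open d.
Proof. by rewrite inE => /and3P[]. Qed.

Lemma removable_nspecial : by_removable core r -> ~~ special.
Proof.
case/and3P=> _ /eqP deg _; apply/negP => sp; move: deg; rewrite /degree_in.
rewrite (_ : [set d in _ | _] = set0) ?cards0 //; apply/setP => d; rewrite !inE sp /=.
by apply/negP => /andP[/and3P[_ h _] /eqP dr]; rewrite dr eqxx in h.
Qed.

(** Any vertex other than the root still has a yellow half-edge in the core if it is blue of genus
    0, and all its half-edges if it is yellow; in neither case can it be smoothed. *)
Lemma keptE v : by_kept core v = ~~ (dropped && (v == r)).
Proof.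
rewrite /by_kept inE /dropped; have [->|vr] := eqVneq v r.
  by rewrite !andbT negb_or.
rewrite !andbF /=; apply/negP => /and3P[/eqP g0 deg /forall_inP col].
have [bv|yv] := boolP (blueV v).
  have [d dv yd] := oT_yellow vr bv g0; have nop : ~~ is_open d by apply: nonopen_src; rewrite dv.
  by have := col d (yellow_core yd nop); rewrite dv eqxx bv (negPf yd).
have [_ d3 yel] := oT_c1 yv; move: deg; rewrite /degree_in (_ : #|_| = degree v).
  by rewrite -(subnKC d3).
apply: eq_card => d; rewrite !inE; case: (src d =P v) => [dv|]; rewrite ?andbF // andbT.
have := @yellow_core d (yel d dv); rewrite !inE => -> //.
by apply: nonopen_src; rewrite dv.
Qed.

Lemma dropped_half d : dropped -> d \in coreH -> src d = r -> by_removable core r.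
Proof.
case/orP=> // sp; rewrite !inE sp /= => /and3P[_ h _] dr.
by rewrite dr eqxx in h.
Qed.

Lemma removable_deg : by_removable core r -> degree_in core r = 2.
Proof. by case/and3P=> _ /eqP. Qed.

(** The closed form of [far_end] in the core: at most one vertex, the smoothed root, has to be
    passed. *)
Definition core_opp (d : half T) : half T :=
  if dropped && (src (opp d) == r) then opp (other_half core (opp d)) else opp d.

Lemma core_through d : d \in coreH -> dropped -> src (opp d) = r ->
  let e := other_half core (opp d) in
  [/\ by_removable core r, e \in coreH, src e = r, e != opp d & other_half core e = opp d].
Proof.
move=> dH dr sr e; have oH : opp d \in core.2 by rewrite coreH_opp.
have rem := dropped_half dr oH sr; have deg := removable_deg rem.
rewrite -sr in deg; have [h1 h2 h3 h4] := other_halfP deg oH.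
by split=> //; [rewrite /e h2 | exact: other_halfK].
Qed.

Lemma core_opp_in d : d \in coreH -> core_opp d \in coreH /\ by_kept core (src (core_opp d)).
Proof.
move=> dH; rewrite /core_opp keptE; case: ifP => [/andP[dr /eqP sr]|/negbT h].
  have [rem eH er _ _] := core_through dH dr sr; rewrite coreH_opp; split=> //.
  by have := noloop (coreH_nonopen eH); rewrite er dr => ->.
by rewrite coreH_opp.
Qed.

Lemma core_far_end d : d \in coreH -> by_kept core (src d) ->
  far_end core (by_kept core) d = core_opp d.
Proof.
move=> dH kd; have := core_opp_in dH; rewrite /core_opp; case: ifP => [/andP[dr /eqP sr]|/negbT h] [_ k].
  have E : pass core (by_kept core) (opp d) = opp (other_half core (opp d)).
    by rewrite /pass keptE dr sr eqxx.
  by rewrite (@far_end_pass _ _ _ 1) /= E.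
by rewrite (@far_end_pass _ _ _ 0).
Qed.

Local Notation T' := (by_sub core).

Lemma core_oppE (d : half T') : val (opp d) = core_opp (val d).
Proof.
have /andP[dH kd] := valP d; have [oH ok] := core_opp_in dH.
by apply: smooth_oppE => //; exact: core_far_end.
Qed.

Lemma core_srcE (d : half T') : val (src d) = src (val d). Proof. by []. Qed.

Lemma core_opp_kept d : by_kept core (src d) -> core_opp (opp d) = d.
Proof.
by rewrite keptE /core_opp oK => /negPf->.
Qed.

Lemma core_wf : by_wf T'.
Proof.
split=> d.
  apply: val_inj; rewrite core_oppE core_oppE; have /andP[dH kd] := valP d.
  rewrite {2}/core_opp; case: ifP => [/andP[dr /eqP sr]|_]; last exact: core_opp_kept.
  have [_ _ er _ oE] := core_through dH dr sr.
  by rewrite /core_opp oK er dr eqxx /= oE oK.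
rewrite /= -[val (insubd _ _)]/(val (opp d)) core_oppE; have /andP[dH kd] := valP d.
rewrite /core_opp; case: ifP => [/andP[dr /eqP sr]|_]; last exact: oT_bopp.
have [/and3P[_ _ /forall_inP col] eH er _ _] := core_through dH dr sr; rewrite oT_bopp.
have := col _ eH; rewrite er eqxx => /eqP->; have := col (opp (val d)); rewrite coreH_opp => /(_ dH).
by rewrite sr eqxx oT_bopp => /eqP.
Qed.

Lemma core_root : exists r' : vert T', (if dropped then parent up (val r') = r else val r' = r).
Proof.
case dr: dropped; last first.
  by have P : by_kept core r by [rewrite keptE dr]; exists (Sub r P).
have [d [dr' nop]] : exists d, src d = r /\ ~~ is_open d.
  case/orP: dr => [/specialP[d1 [? _ ? _]]|rem]; first by exists d1.
  have := removable_deg rem => /eqP/cards2P[a [b [_ E]]].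
  have : a \in [set a; b] by rewrite !inE eqxx.
  by rewrite -E inE => /andP[/coreH_nonopen nop /eqP ar]; exists a.
have P : by_kept core (src (opp d)).
  by rewrite keptE dr; have := noloop nop; rewrite dr' => ->.
by exists (Sub (src (opp d)) P); rewrite SubK /parent -root_child // oK.
Qed.

(** When the root is gone, a child takes over. If the root was smoothed, its two children become
    neighbours and either of them may serve. *)
Lemma core_ranked : exists r' rk', @ranked T' r' rk'.
Proof.
have [r' r'P] := core_root.
(* The shift makes [r'] the unique minimum; its former sibling may have had the same or a smaller
   rank. *)
pose rk' (v : vert T') := if v == r' then 0 else (rk (val v)).+1.
have rk'0 : rk' r' = 0 by rewrite /rk' eqxx.
have rk'S (v : vert T') : v != r' -> rk' v = (rk (val v)).+1 by rewrite /rk' => /negPf->.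
have upr x : dropped -> x != r -> parent up x = r -> exists2 e, e \in core.2 \/ special & [/\ src e = r, ~~ is_open e & opp e = up x].
  move=> dr xr px; exists (opp (up x)); last first.
    by rewrite oK (is_open_opp oK) up_nonopen.
  have [sp|nsp] := boolP special; [by right | left].
  by rewrite nspecial_core // (is_open_opp oK) up_nonopen.
have descE (d : half T') : rk' (src (opp d)) < rk' (src d) -> val d = up (src (val d)).
  move=> lt; have /andP[dH kd] := valP d; case: (or_up rt (val d)) => // oE.
  have nop := coreH_nonopen dH.
  have sr : src (opp (val d)) != r by rewrite -(up_open rt) -oE (is_open_opp oK).
  have lt0 := opp_up_desc rt oE sr.
  have oE' : val (src (opp d)) = src (opp (val d)).
    by rewrite core_srcE core_oppE /core_opp (negPf sr) andbF.
  have nr : src (opp d) != r'.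
    apply/eqP => rE; move: r'P; rewrite -rE oE' /parent -oE oK.
    move: kd; rewrite keptE; case: dropped => [/= /eqP//|_ /eqP].
    by rewrite (negPf sr).
  have nr' : src d != r' by apply: contraTneq lt => ->; rewrite rk'0.
  move: lt; rewrite !rk'S // oE' core_srcE ltnS ltnNge.
  by rewrite (ltnW lt0).
exists r', rk'; split.
- by move=> d dr; rewrite rk'0.
- move=> v vr; have kv := valP v.
  have vnr : val v != r.
    apply: contra vr => /eqP vr; move: kv r'P; rewrite keptE vr eqxx andbT => /negPf-> r'P.
    by apply/eqP/val_inj; rewrite vr.
  have uH : up (val v) \in coreH.
    rewrite !inE up_nonopen // (or_src rt) (negPf vnr) andbF /=.
    apply/negP => /andP[sp /eqP pr]; have dr : dropped by rewrite /dropped sp.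
    rewrite dr in r'P; have [d1 [d1r bd1 nop1 du]] := specialP sp.
    have r'nr : val r' != r by have := valP r'; rewrite keptE dr.
    case/eqP: vr; apply/val_inj/(up_inj rt)/(inv_inj oK).
    have := du _ pr; have := du _ r'P.
    have h x : x != r -> opp (up x) != up r.
      move=> xr; apply: contra (up_nonopen xr) => /eqP E.
      by rewrite -(is_open_opp oK) E (up_open rt).
    by case=> [/eqP|->]; [rewrite (negPf (h _ r'nr)) | case=> // /eqP; rewrite (negPf (h _ vnr))].
  have P : (up (val v) \in core.2) && by_kept core (src (up (val v))).
    by rewrite uH (or_src rt).
  exists (Sub (up (val v)) P : half T'); first by apply: val_inj; rewrite /= (or_src rt).
  set d := (Sub _ _ : half T').
  have oE : val (src (opp d)) = src (core_opp (up (val v))) by rewrite core_srcE core_oppE.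
  rewrite (rk'S v vr); have [->|nr] := eqVneq (src (opp d)) r'; first by rewrite rk'0.
  rewrite rk'S // ltnS oE /core_opp; case: ifP => [/andP[dr /eqP sr]|_]; last exact: (or_rk rt).
  have [rem eH er ene _] := core_through uH dr sr; rewrite dr in r'P.
  have r'nr : val r' != r by have := valP r'; rewrite keptE dr.
  have [e [eH'|sp] [es enop eo]] := upr _ dr r'nr r'P; last first.
    by have := removable_nspecial rem; rewrite sp.
  have deg := removable_deg rem; rewrite -sr in deg.
  have oH : opp (up (val v)) \in core.2 by rewrite coreH_opp.
  have [_ _ _ uq] := other_halfP deg oH.
  case/eqP: nr; apply: val_inj; rewrite oE /core_opp dr sr eqxx /=.
  case: (uq e eH' _) => [|eE|<-]; first by rewrite es sr.
    by case/eqP: vr; apply/val_inj/(up_inj rt); rewrite -eo eE oK.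
  by rewrite eo (or_src rt).
- move=> d nop; have /andP[dH kd] := valP d; rewrite neq_ltn.
  have [dr0|dr0] := eqVneq (src d) r'.
    have [E|E] := eqVneq (src (opp d)) r'; last by rewrite dr0 rk'0 (rk'S _ E) orbT.
    exfalso; have := dr0; rewrite -E => /(congr1 val); rewrite core_srcE core_srcE core_oppE.
    rewrite /core_opp; case: ifP => [/andP[dr /eqP sr]|_ /esym/eqP].
      have [rem eH er ene _] := core_through dH dr sr => Es.
      have e1 := root_child er (coreH_nonopen eH).
      have e2 : opp (opp (val d)) = up (src (opp (opp (val d)))).
        by apply: root_child => //; rewrite (is_open_opp oK) coreH_nonopen.
      rewrite oK in e2; case/eqP: ene; apply: (inv_inj oK).
      by rewrite oK e1 -Es -e2.
    by rewrite (negPf (noloop (coreH_nonopen dH))).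
  rewrite (rk'S _ dr0); have [E0|E0] := eqVneq (src (opp d)) r'; first by rewrite E0 rk'0.
  rewrite (rk'S _ E0) !ltnS -neq_ltn core_srcE core_srcE core_oppE /core_opp.
  case: ifP => [/andP[dr /eqP sr]|_]; last first.
    exact: (rk_neq (orooted_ranked rt) (coreH_nonopen dH)).
  have [rem eH er ene _] := core_through dH dr sr; rewrite dr in r'P.
  have r'nr : val r' != r by have := valP r'; rewrite keptE dr.
  have [e [eH'|sp] [es enop eo]] := upr _ dr r'nr r'P; last first.
    by have := removable_nspecial rem; rewrite sp.
  have deg := removable_deg rem; rewrite -sr in deg.
  have oH : opp (val d) \in core.2 by rewrite coreH_opp.
  have [_ _ _ uq] := other_halfP deg oH.
  case: (uq e eH' _) => [|eE|eE]; first by rewrite es sr.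
    case/eqP: dr0; apply: val_inj; rewrite core_srcE -[val d]oK -eE eo (or_src rt).
    by [].
  case/eqP: E0; apply: val_inj.
  by rewrite core_srcE core_oppE /core_opp dr sr eqxx /= -eE eo (or_src rt).
- move=> d d' ss /descE dE /descE d'E; apply: val_inj; rewrite dE d'E.
  by congr up; have := congr1 val ss.
Qed.

Lemma core_tree : is_tree T'.
Proof. have [r' [rk' rd]] := core_ranked; exact: (ranked_tree (by_oppK core_wf) rd). Qed.

End ByCore.

Lemma ranked_simple (T : graph) r rk : involutive (@opp T) -> @ranked T r rk ->
  (forall d d' : half T, is_open d -> is_open d' -> src d = src d' -> d = d') ->
  simple_graph T.
Proof.
move=> oK [_ _ neq uq] op; split=> // d d' [s o].
have key (e e' : half T) : is_open e -> src e = src e' -> src (opp e) = src (opp e') -> is_open e'.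
  move=> /eqP oe ss so; apply/negPn/negP => /neq.
  by rewrite -so -ss oe eqxx.
have [opn|nop] := boolP (is_open d); first by apply: op => //; exact: key opn s o.
have nop' : ~~ is_open d'.
  by apply: contra nop => opn; apply: key opn (esym s) (esym o).
have := neq d nop; rewrite neq_ltn => /orP[lt|lt].
  by apply: uq; rewrite -?s -?o.
apply: (inv_inj oK); apply: uq; rewrite ?oK -?s -?o //.
Qed.

Section ByCore2.

Variables (T : bytree) (r : vert T) (up : vert T -> half T) (rk : vert T -> nat).
Hypotheses (rt : orooted r up rk) (oT : open_by T).

Let oK := or_oppK rt.
Implicit Types (d e : half T) (u v w : vert T).

Local Notation special := (special r up).
Local Notation coreV := (coreV r up).
Local Notation coreH := (coreH r up).
Local Notation core := (core r up).
Local Notation dropped := (dropped r up).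
Local Notation core_opp := (core_opp r up).
Local Notation T' := (by_sub core).

Lemma core_noloop d : d \in coreH -> by_kept core (src d) -> src (core_opp d) != src d.
Proof.
move=> dH kd; rewrite /core_opp; case: ifP => [/andP[dr /eqP sr]|_]; last first.
  exact: (noloop rt (coreH_nonopen dH)).
have [rem eH er ene _] := core_through rt dH dr sr; apply/eqP => Es.
have e1 := root_child rt er (coreH_nonopen eH).
have e2 : opp (opp d) = up (src (opp (opp d))).
  by apply: (root_child rt) => //; rewrite (is_open_opp oK) (coreH_nonopen dH).
rewrite oK in e2; case/eqP: ene; apply: (inv_inj oK).
by rewrite oK e1 Es -e2.
Qed.

Lemma core_nopen (d : half T') : ~~ is_open d.
Proof.
have /andP[dH kd] := valP d; apply: contra (core_noloop dH kd) => /eqP opn.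
by rewrite -(core_oppE rt oT) opn.
Qed.

Lemma core_simple : simple_graph T'.
Proof.
have [r' [rk' rd]] := core_ranked rt oT; apply: ranked_simple (by_oppK (core_wf rt oT)) rd _ => d.
by rewrite (negPf (core_nopen d)).
Qed.

Lemma core_closed_union : closed_union core.
Proof.
move=> d dH; rewrite (coreH_opp rt) dH; split=> //; last exact: (coreH_nonopen dH).
by move: dH; rewrite inE => /and3P[].
Qed.

Lemma core_connected_in : connected_in core.
Proof.
pose E := [rel x y | [exists d in core.2, (src d == x) && (src (opp d) == y)]].
have Esym : connect_sym E.
  apply: sym_connect_sym; suff sub x y : E x y -> E y x by move=> x y; apply/idP/idP => /sub.
  case/exists_inP=> h hH /andP[hx hy]; apply/exists_inP; exists (opp h).
    by rewrite (coreH_opp rt).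
  by rewrite oK hx hy.
suff [c cV cP] : exists2 c, c \in coreV & forall v, v \in coreV -> connect E v c.
  split; first by apply/set0Pn; exists c.
  by move=> u v uV vV; apply: connect_trans (cP u uV) _; rewrite Esym cP.
have step v : v \in coreV -> v != r -> parent up v \in coreV -> connect E v (parent up v).
  move=> vV vr pV; apply: connect1; apply/exists_inP; exists (up v).
    by rewrite inE (up_nonopen rt) // (or_src rt) vV.
  by rewrite (or_src rt) !eqxx.
have [sp|nsp] := boolP special; last first.
  have inV v : v \in coreV by rewrite inE (negPf nsp).
  exists r => // v _; have [n] := ubnP (rk v); elim: n v => // n IH v ltn.
  have [->//|vr] := eqVneq v r; apply: connect_trans (step v _ vr _) (IH _ _) => //.
  exact: leq_trans (or_rk rt vr) _.
have [d1 [d1r bd1 nop1 du]] := specialP rt sp.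
have inV v : (v \in coreV) = (v != r) by rewrite inE sp.
exists (src (opp d1)); first by rewrite inV -d1r (noloop rt).
move=> v; have [n] := ubnP (rk v); elim: n v => // n IH v ltn; rewrite inV => vr.
have [pr|pr] := eqVneq (parent up v) r; last first.
  apply: connect_trans (step v _ vr _) (IH _ _ _); rewrite ?inV //.
  exact: leq_trans (or_rk rt vr) _.
case: (du _ pr) => [oE|<-]; last by rewrite oK (or_src rt).
have := up_nonopen rt vr.
by rewrite -(is_open_opp oK) oE (up_open rt) eqxx.
Qed.

Lemma lone_core : (forall v, v = r) -> [/\ forall v : vert T', val v = r,
   #|vert T'| = 1, #|half T'| = 0 & blueV r].
Proof.
move=> H; have hE := lone_half rt H.
have noH d : d \notin coreH by rewrite inE (hE d) (up_open rt) eqxx.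
have br : blueV r.
  apply/negPn/negP => yr; have [_ deg _] := oT_c1 oT yr.
  by have := degree_le1 (t := r) (fun d _ => hE d); rewrite leqNgt (ltnW deg).
have kr : by_kept core r.
  rewrite (keptE rt oT) eqxx andbT /dropped negb_or; apply/andP; split.
    apply/negP => /and5P[_ _ _ /eqP deg _].
    by have := degree_le1 (t := r) (fun d _ => hE d); rewrite deg.
  apply/negP => /removable_deg; rewrite /degree_in (_ : [set d in _ | _] = set0) ?cards0 //.
  by apply/setP => d; rewrite inE (negPf (noH d)) inE.
split=> //.
  rewrite -(card1 (Sub r kr : vert T')); apply: eq_card => v; rewrite [RHS]inE.
  by apply/esym/eqP/val_inj; rewrite SubK (H (val v)).
apply/eqP; rewrite -leqn0 leqNgt; apply/negP => /card_gt0P[d _].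
by have /andP[dH _] := valP d; rewrite (negPf (noH _)) in dH.
Qed.

Lemma degree_root : ~~ special -> degree r = 1 + degree_in core r.
Proof.
move=> nsp; rewrite /degree (cardsD1 (up r)) inE (or_src rt) eqxx; congr (_ + _).
apply: eq_card => d; rewrite [RHS]inE (nspecial_core _ nsp) (or_open rt) !inE.
by [].
Qed.

(** A yellow root loses only its open edge. If its degree drops to 2, all its edges being yellow, it
    is smoothed away. *)
Lemma core_by_cond1 : by_cond1 T'.
Proof.
move=> v yv; have [g0 deg yel] := oT_c1 oT yv.
split=> //; last by move=> d dv; apply: yel; rewrite -dv.
rewrite smooth_degree; have [vr|vr] := eqVneq (val v) r; last first.
  rewrite /degree_in (_ : #|_| = degree (val v)) //; apply: eq_card => d; rewrite inE [RHS]inE.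
  case: (src d =P val v) => [dv|]; rewrite ?andbF // andbT.
  by apply: (yellow_core rt oT (yel d dv)); apply: (nonopen_src rt); rewrite dv.
have nsp : ~~ special by apply: contra yv => /and5P[br _ _ _ _]; rewrite /= vr.
rewrite vr in g0 deg yel *; rewrite (degree_root nsp) add1n ltnS leq_eqVlt in deg.
case/orP: deg => // /eqP deg2.
have rem : by_removable core r.
  apply/and3P; split; rewrite ?g0 -?deg2 //.
  apply/forall_inP => d dH; apply/implyP => /eqP dv.
  by have := yv; rewrite /= vr (negPf (yel d dv)) => /negPf->.
have := valP v; rewrite (keptE rt oT) vr eqxx /dropped rem orbT.
by [].
Qed.

Lemma core_by_cond3 : by_cond3 T'.
Proof.
move=> v; apply: leq_trans (oT_c3 oT (val v)); rewrite /blue_degree -(card_imset _ val_inj).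
apply/subset_leq_card/subsetP => d /imsetP[e ein ->]; move: ein; rewrite !inE.
by case/andP=> /eqP <- be; rewrite eqxx.
Qed.

(** The critical case is a blue root of genus 0 whose only yellow edge was the open one. In the core
    it has at most two edges by [by_cond3], all blue, and at least one since there are other
    vertices. With one edge it is [special], with two it is removable, so it is not a vertex of the
    core. *)
Lemma core_by_cond2 : (exists v, v != r) -> by_cond2 T'.
Proof.
move=> [v0 v0r] v bv g0; have kv := valP v.
suff [d dv [yd dH]] : exists2 d, src d = val v & ~~ blueH d /\ d \in coreH.
  have P : (d \in core.2) && by_kept core (src d) by rewrite dH dv kv.
  by exists (Sub d P : half T') => //; apply: val_inj; rewrite core_srcE.
have [vr|vr] := eqVneq (val v) r; last first.
  have [d dv yd] := oT_yellow oT vr bv g0; exists d => //; split=> //.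
  by apply: (yellow_core rt oT) => //; apply: (nonopen_src rt); rewrite dv.
rewrite vr; case: (pickP [pred d | [&& src d == r, ~~ blueH d & ~~ is_open d]]) => [d|none].
  by case/and3P=> /eqP dr yd nop; exists d => //; split=> //; exact: (yellow_core rt oT).
have bl d : src d = r -> ~~ is_open d -> blueH d.
  by move=> dr nop; have := none d; rewrite /= dr eqxx nop andbT => /negbFE.
have br : blueV r by rewrite -vr.
have gr : by_gen r = 0 by rewrite -vr.
have ndr : ~~ dropped by move: kv; rewrite (keptE rt oT) vr eqxx andbT.
have nsp : ~~ special by apply: contra ndr => sp; rewrite /dropped sp.
have degE := degree_root nsp.
have c2 : by_cond2 T.
  case: (oT) => _ _ _ _ [//|[V1 _ _]].
  by case/eqP: v0r; exact: card1_eq.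
have [d0 d0r yd0] := c2 r br gr.
have d0u : d0 = up r.
  by apply/eqP; rewrite -(or_open rt); apply: contraR yd0 => /(bl d0 d0r).
rewrite d0u in yd0.
have k2 : degree_in core r <= 2.
  have := oT_c3 oT r; rewrite gr; apply: leq_trans.
  apply/subset_leq_card/subsetP => d; rewrite !inE => /andP[/and3P[nop _ _] /eqP dr].
  by rewrite dr eqxx bl.
have k0 : 0 < degree_in core r.
  rewrite lt0n; apply/negP => /eqP/cards0_eq k0.
  case/eqP: v0r; apply: (lone_root rt) => u ur; apply/eqP => pu.
  have := k0; move/setP/(_ (opp (up u))); rewrite inE (nspecial_core _ nsp) (is_open_opp oK).
  by rewrite (up_nonopen rt ur) -/(parent up u) pu eqxx inE.
have k1 : degree_in core r != 1.
  apply: contra nsp => /eqP k1; rewrite /special br gr yd0 degE k1 /=.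
  have : 0 < degree_in core r by [].
  case/card_gt0P=> d; rewrite inE => /andP[/coreH_nonopen nop /eqP dr].
  by apply/existsP; exists d; rewrite dr eqxx bl.
case/negP: ndr; rewrite /dropped; apply/orP; right; apply/and3P; split.
- by rewrite gr.
- by move: k0 k1 k2; case: (degree_in _ _) => [|[|[|]]].
- apply/forall_inP => d /coreH_nonopen nop; apply/implyP => /eqP dr.
  by rewrite br bl.
Qed.

Lemma core_closed_by : closed_by T'.
Proof.
split; first by split; [exact: (core_wf rt oT) | exact: (core_tree rt oT)].
- exact: core_nopen.
- exact: core_by_cond1.
- exact: core_by_cond3.
- case: (pickP [pred v | v != r]) => [v vr|allr].
    by left; apply: core_by_cond2; exists v.
  have allE v : v = r by apply/eqP; exact: negbFE (allr v).
  have [vr V1 H0 br] := lone_core allE.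
  have [g0|gn] := eqVneq (by_gen r) 0.
    by right; split=> // v; rewrite /= vr.
  by left=> v _; rewrite /= vr => /eqP; rewrite (negPf gn).
Qed.

Lemma lone_core_genus : by_lone_vertex T' -> by_genus T = 0.
Proof.
move=> [V1 H0 bg]; case: (pickP [pred v | v != r]) => [v vr|allr].
  have [x _] : exists x, x \in vert T' by apply/card_gt0P; rewrite V1.
  have [bx gx] := bg x; have c2 : by_cond2 T' by apply: core_by_cond2; exists v.
  have [d _ _] := c2 x bx gx; have : 0 < #|half T'| by apply/card_gt0P; exists d.
  by rewrite H0.
have allE v : v = r by apply/eqP; exact: negbFE (allr v).
have [vr _ _ br] := lone_core allE.
have [x _] : exists x, x \in vert T' by apply/card_gt0P; rewrite V1.
have [_ gx] := bg x; rewrite /= vr in gx.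
have E := rkH1_by rt oT.
have z : #|[set d : half T | ~~ blueH d && ~~ is_open d]| = 0.
  apply/eqP; rewrite cards_eq0; apply/eqP/setP => d; rewrite !inE.
  by rewrite (lone_half rt allE d) (up_open rt) eqxx andbF.
rewrite /by_genus big1 ?addn0 => [|v _]; last by rewrite (allE v).
by move: E; rewrite z; move: (rkH1 _ _) #|_| => a b; lia.
Qed.

Lemma core_closed_by_subtree : closed_by_subtree core.
Proof.
split; [exact: core_closed_union | exact: core_connected_in | exact: core_closed_by | exact: lone_core_genus].
Qed.

(** Only the special case restricts anything. There a subtree containing [r] would have it as a
    vertex of genus 0 without yellow edge, hence be a lone vertex. Then [T] has genus 0, and by
    [genus0_lone] no second vertex, but the blue edge at [r] leads to one. *)
Lemma core_max H : closed_by_subtree H -> sub_le H core.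
Proof.
move=> [cl cn [_ _ _ _ c2] lone].
have [sp|nsp] := boolP special; last first.
  split; first by apply/subsetP => v _; rewrite inE (negPf nsp).
  by apply/subsetP => d /cl[_ _ nop]; rewrite (nspecial_core _ nsp).
have [d1 [d1r bd1 nop1 du]] := specialP rt sp.
have rH : r \notin H.1.
  apply/negP => rH; have deg1 : degree_in H r <= 1.
    rewrite -(cards1 d1); apply/subset_leq_card/subsetP => d; rewrite !inE.
    case/andP=> /cl[_ _ nop] /eqP/du[dE|->//].
    by rewrite dE (up_open rt) eqxx in nop.
  have kr : by_kept H r.
    rewrite /by_kept rH; apply/negP => /and3P[_ /eqP deg _].
    by rewrite deg in deg1.
  have /and5P[br /eqP gr _ _ _] := sp; case: c2 => [c2|/lone g0].
    have [d dr yd] := c2 (Sub r kr) br gr; have /andP[/cl[_ _ nop] _] := valP d.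
    have := special_yellow rt sp yd nop.
    by rewrite (_ : src (val d) = r) ?eqxx //; have := congr1 val dr.
  by have := noloop rt nop1; rewrite d1r (genus0_lone rt oT g0 (src _)) eqxx.
have inV v : v \in H.1 -> v \in coreV by move=> vH; rewrite inE sp; apply: contraNneq rH => <-.
split; first exact/subsetP.
apply/subsetP => d /cl[dV oH nop]; have [oV _ _] := cl _ oH.
by rewrite inE nop !inV.
Qed.

Lemma core_is_core : by_core core.
Proof.
have mx : maximal_sub (@closed_by_subtree T) core.
  split=> [|H cH [le1 le2]]; first exact: core_closed_by_subtree.
  have [le1' le2'] := core_max cH; case: H cH le1 le2 le1' le2' => a b /= _ l1 l2 l1' l2'.
  by congr (_, _); apply/eqP; rewrite eqEsubset ?l1 ?l1' ?l2 ?l2'.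
split=> // H [cH mH]; rewrite (mH core) //; first exact: core_closed_by_subtree.
exact: core_max.
Qed.

Lemma by_core_eq H : by_core H -> H = core.
Proof. by case=> _ uq; apply/esym/uq; case: core_is_core. Qed.

End ByCore2.

Lemma by_equivE (T T' : bytree) r up rk r' up' rk' : @orooted T r up rk -> open_by T ->
  @orooted T' r' up' rk' -> open_by T' ->
  by_equiv T T' <-> by_iso (by_sub (core r up)) (by_sub (core r' up')).
Proof.
move=> rt oT rt' oT'; split=> [[H [H' [cH cH' iso]]]|iso].
  by rewrite -(by_core_eq rt oT cH) -(by_core_eq rt' oT' cH').
by exists (core r up), (core r' up'); split=> //; [exact: core_is_core rt oT | exact: core_is_core rt' oT'].
Qed.

(** * Cores of open hyperelliptic graphs *)

Lemma closed_blue_exists (T : bytree) : by_wf T -> is_tree T ->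
  (forall d : half T, ~~ is_open d) -> by_cond1 T -> exists t : vert T, blueV t.
Proof.
move=> wT tr nop c1; have [[/set0Pn[r _] _] _] := tr.
have [rk [_ _ neq uq]] := tree_ranked (by_oppK wT) r tr.
have [t _ tmax0] := @arg_maxnP _ r xpredT rk isT.
have tmax v : rk v <= rk t := tmax0 v isT.
exists t; apply/negPn/negP => /c1[_ deg _].
have /card_gt0P[d0] : 0 < degree t by exact: leq_trans deg.
rewrite inE => /eqP d0t.
have desc d : src d = t -> rk (src (opp d)) < rk (src d).
  by move=> dt; rewrite ltn_neqAle neq // dt tmax.
suff : degree t <= 1 by rewrite leqNgt (ltnW deg).
by apply: (degree_le1 (d0 := d0)) => d dt; apply: uq; rewrite ?desc // dt d0t.
Qed.

Lemma adjacent_leaves (T : graph) (d : half T) : involutive (@opp T) -> connected T ->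
    (forall e, src e = src d -> e = d) -> (forall e, src e = src (opp d) -> e = opp d) ->
  (forall v, v = src d \/ v = src (opp d)) /\ (forall e, e = d \/ e = opp d).
Proof.
move=> oK [_ cn] du ou; have V v : v = src d \/ v = src (opp d).
  have := cn (src d) v (in_setT _) (in_setT _) => /connectP[p pth ->].
  suff main q x : x = src d \/ x = src (opp d) ->
      path [rel x y | [exists d in (whole T).2, (src d == x) && (src (opp d) == y)]] x q ->
      last x q = src d \/ last x q = src (opp d) by apply: main pth; left.
  elim: q x => [|y q IH] x //= xd.
  case/andP=> /exists_inP[e _ /andP[/eqP ex /eqP <-]]; apply: IH.
  by case: xd => xE; rewrite xE in ex; [right; rewrite (du e ex) | left; rewrite (ou e ex) oK].
by split=> // e; case: (V (src e)) => [/du|/ou]; auto.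
Qed.

Lemma genus0_leaf_iso (T T' : bytree) fV fH : @by_iso_on T T' fV fH ->
  forall t, genus0_leaf (fV t) = genus0_leaf t.
Proof.
move=> [[bV bH] sE _ gE _] t; rewrite /genus0_leaf gE (bij_eq_card bV).
congr [&& _, _ == _ & _]; rewrite /degree -(card_imset _ (bij_inj bH)).
apply: eq_card => d; have [g gK fK] := bH; rewrite -[d]fK mem_imset ?inE; last exact: bij_inj.
by rewrite sE (inj_eq (bij_inj bV)).
Qed.

(** * The preimage of the core as a double cover of the core *)

Section CoverCore.

Variables (T : bytree) (r : vert T) (up : vert T -> half T) (rk : vert T -> nat).
Hypotheses (rt : orooted r up rk) (oT : open_by T).
Variables (X : hgraph) (PV : vert X -> vert T) (PH : half X -> half T).
Hypotheses (wX : hyp_wf X) (cX : dcover (pred0 : pred (vert T)) PV PH).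

Let oK := or_oppK rt.
Let wT := oT_wf oT.
Let xK := hg_oppK wX.
Local Notation core := (core r up).
Local Notation coreV := (coreV r up).
Local Notation coreH := (coreH r up).
Local Notation dropped := (dropped r up).
Local Notation core_opp := (core_opp r up).
Local Notation T' := (by_sub core).
Local Notation H := (pullback PV PH core).
Implicit Types (v w : vert X) (d e h : half X).

Let wT' : by_wf T' := core_wf rt oT.
Let trT' : is_tree T' := core_tree rt oT.

Lemma PH_opp d : PH (opp d) = opp (PH d).
Proof. by rewrite (dc_opp cX) // (dc_antiE cX). Qed.

Lemma PH_src d : src (PH d) = PV (src d). Proof. exact: dc_src cX d. Qed.

Lemma memH d : (d \in H.2) = (PH d \in coreH). Proof. by rewrite inE. Qed.

Lemma memV v : (v \in H.1) = (PV v \in coreV). Proof. by rewrite inE. Qed.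

Lemma memH_opp d : (opp d \in H.2) = (d \in H.2).
Proof. by rewrite !memH PH_opp (coreH_opp rt). Qed.

Lemma memH_iota d : (iotaH d \in H.2) = (d \in H.2).
Proof. by rewrite !memH (dc_iH cX). Qed.

Lemma degree_in_pullback v :
    (forall d, d \in H.2 -> src d = v -> iotaV v = v -> iotaH d = d) ->
  degree_in H v = degree_in core (PV v).
Proof.
move=> fx; rewrite /degree_in -(card_in_imset (f := PH)); last first.
  move=> h1 h2; rewrite inE => /andP[h1H /eqP s1]; rewrite inE => /andP[_ /eqP s2].
  move=> /(dc_H cX)[//|E]; rewrite E in s2; have := hg_srcI wX h1; rewrite s2 s1.
  by move=> /esym/(fx _ h1H s1) fE; rewrite E fE.
apply: eq_card => d; rewrite [RHS]inE; apply/imsetP/andP => [[h]|[dH /eqP dv]].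
  by rewrite inE memH => /andP[hH /eqP hv] ->; rewrite PH_src hv.
by have [h hd hv] := lift_at wX cX dv; exists h => //; rewrite inE memH hd dH hv eqxx.
Qed.

Lemma removed_root v : PV v = r -> by_removable core r -> hg_removable H v.
Proof.
move=> vr rem; have /and3P[g0 _ /forall_inP col] := rem.
rewrite /hg_removable -(dc_gen cX) vr g0 /= degree_in_pullback ?vr ?removable_deg //.
move=> d dH dv fv; apply/eqP; rewrite -(dc_bH cX).
rewrite memH in dH; have := col _ dH; rewrite PH_src dv vr eqxx /= => /eqP->.
by rewrite -vr (dc_bV cX) fv.
Qed.

Lemma core_two (t : vert T') (d : half T') : src d = t -> #|vert T'| != 1.
Proof.
move=> dt; apply/eqP => V1; have [_ inj] := core_simple rt oT.
have E : src (opp d) = src d by exact: card1_eq.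
have dE : d = opp d.
  by apply: inj; change ((src d, src (opp d)) = (src (opp d), src (opp (opp d))));
    rewrite (by_oppK wT') E.
by have := core_nopen rt oT d; rewrite /is_open -dE eqxx.
Qed.

Lemma core_leafE (t : vert T') : genus0_leaf t = (by_gen t == 0) && (degree t == 1).
Proof.
rewrite /genus0_leaf; case: (by_gen t == 0) => //=; case: (degree t =P 1) => //= /degree1P[d dt _].
exact: core_two dt.
Qed.

(** Over a yellow vertex the degree is the one in the core, at least 3. Over a blue vertex of genus
    0 the yellow half-edge has two lifts and any other half-edge adds a third, so degree 2 upstairs
    means a leaf below. A lone vertex has degree 0 in both. *)
Lemma removable_kept v (t : vert T') : val t = PV v -> hg_removable H v = genus0_leaf t.
Proof.
move=> tv; have [_ _ c1 _ c2] := core_closed_by rt oT.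
rewrite /hg_removable -(dc_gen cX) -tv core_leafE -[by_gen t]/(by_gen (val t)).
case: (by_gen (val t) =P 0) => //= g0; rewrite smooth_degree.
have [bt|yt] := boolP (blueV t); last first.
  have [_ deg _] := c1 t yt; rewrite smooth_degree in deg.
  rewrite degree_in_pullback -?tv.
    by move: deg; case: (degree_in _ _) => [|[|[]]].
  move=> d _ _ /eqP fv; rewrite -(dc_bV cX) -tv in fv.
  by have := yt; rewrite /= fv.
have fv : iotaV v = v by apply/eqP; rewrite -(dc_bV cX) -tv.
case: c2 => [c2|[_ H0 _]]; last first.
  have no0 : degree_in core (val t) = 0.
    rewrite -smooth_degree; apply/eqP; rewrite cards_eq0; apply/eqP/setP => d.
    by have := max_card (pred1 d); rewrite H0 card1.
  rewrite no0 /=; have := degree_in_pullback (v := v); rewrite -tv no0 => -> // d dH dv _.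
  have : PH d \in [set e in core.2 | src e == val t] by rewrite inE -memH dH PH_src dv tv eqxx.
  by have /cards0_eq-> := no0; rewrite inE.
have [d0 d0t yd0] := c2 t bt g0.
have d0H : val d0 \in coreH by have /andP[] := valP d0.
have d0v : src (val d0) = PV v by rewrite -tv -d0t.
have [h hd hv] := lift_at wX cX d0v.
have hI : iotaH h != h by rewrite -(dc_bH cX) hd.
have hin : h \in [set e in H.2 | src e == v] by rewrite inE memH hd d0H hv eqxx.
have hIin : iotaH h \in [set e in H.2 | src e == v].
  by rewrite inE memH (dc_iH cX) hd d0H (hg_srcI wX) hv fv eqxx.
have d0in : val d0 \in [set e in core.2 | src e == val t] by rewrite inE d0H -d0t eqxx.
have [deg1|deg1] := eqVneq (degree_in core (val t)) 1.
  rewrite /degree_in; apply/eqP; transitivity #|[set h; iotaH h]|; last by rewrite cards2 eq_sym hI.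
  apply: eq_card => e; rewrite [LHS]inE [RHS]in_set2.
  apply/andP/orP => [[eH /eqP ev]|[/eqP->|/eqP->]].
  - rewrite memH in eH; have ein : PH e \in [set e in core.2 | src e == val t] by rewrite inE eH PH_src ev tv eqxx.
    have : PH h = PH e.
      move: ein d0in hd; have /eqP/cards1P[a ->] := deg1.
      by rewrite !inE => /eqP-> /eqP-> ->.
    by move/(dc_H cX) => [->|->]; rewrite eqxx; auto.
  - by move: hin; rewrite inE => /andP[].
  - by move: hIin; rewrite inE => /andP[].
have [d1 d1in d1d] : exists2 d1, d1 \in [set e in core.2 | src e == val t] & d1 != val d0.
  case: (pickP [pred d1 | (d1 \in [set e in core.2 | src e == val t]) && (d1 != val d0)]) => [d1|none].
    by case/andP; exists d1.
  case/eqP: deg1; rewrite /degree_in; apply/eqP/cards1P; exists (val d0); apply/setP => e.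
  rewrite in_set1; have := none e; rewrite /=.
  by have [->|_] := eqVneq e (val d0); rewrite ?d0in // andbT.
move: (d1in); rewrite inE tv => /andP[d1H /eqP d1v].
have [h1 h1d h1v] := lift_at wX cX d1v.
have : 2 < degree_in H v.
  apply: (@three_le_card _ _ h (iotaH h) h1) => //.
  - by rewrite inE memH h1d d1H h1v eqxx.
  - by rewrite eq_sym.
  - by apply: contra d1d => /eqP E; rewrite -h1d -E hd.
  - by apply: contra d1d => /eqP E; rewrite -h1d -E (dc_iH cX) hd.
by case: (degree_in _ _) => [|[|[]]].
Qed.

(** Such a core is a single yellow edge with two blue ends of genus 0, and its preimage is a
    circle. *)
Definition exceptional : bool := [forall t : vert T', genus0_leaf t].

(* In the exceptional circle the two leaves of the core lift to vertices. *)
Definition core_leaf (t : vert T') : bool := ~~ exceptional && genus0_leaf t.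

Lemma kept_over v : v \in H.1 -> by_kept core (PV v) \/ PV v = r /\ by_removable core r.
Proof.
rewrite memV => vV; have [k|nk] := boolP (by_kept core (PV v)); first by left.
right; move: nk; rewrite (keptE rt oT) negbK => /andP[dr /eqP vr]; split=> //.
by case/orP: dr => // sp; move: vV; rewrite inE sp vr eqxx.
Qed.

(** On the circle the invariant points are taken as vertices, and they should be the two over the
    leaves. A smoothed blue root would be another one; but its edges would be blue, while the edge
    at a genus 0 leaf is yellow. *)
Lemma exceptional_yellow_root : exceptional -> by_removable core r -> ~~ blueV r.
Proof.
move=> /forallP exc rem; apply/negP => br.
have /and3P[_ deg /forall_inP col] := rem.
have : 0 < degree_in core r by rewrite (eqP deg).
case/card_gt0P=> e; rewrite inE => /andP[eH /eqP er].
have dpd : dropped by rewrite /dropped rem orbT.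
have nop := coreH_nonopen eH.
have oH : opp e \in core.2 by rewrite (coreH_opp rt).
have ku : by_kept core (src (opp e)).
  by rewrite (keptE rt oT) dpd /= -er (noloop rt).
have P : (opp e \in core.2) && by_kept core (src (opp e)) by rewrite oH.
pose d : half T' := Sub (opp e) P.
have bd : blueH d.
  by rewrite /= (oT_bopp oT); have := col e eH; rewrite er eqxx br => /eqP.
have /and3P[/eqP g0 /eqP deg1 V1] := exc (src d).
have [d' d'u uq] := degree1P deg1.
have [_ _ c1 _ c2] := core_closed_by rt oT; case: c2 => [c2|[V1' _ _]]; last by rewrite V1' in V1.
have bs : blueV (src d) := blue_src c1 bd.
have [d2 d2s yd2] := c2 _ bs g0.
by move: yd2; rewrite (uq d2 d2s) -(uq d erefl) bd.
Qed.

(** [hg_kept] has one rule for circles and one for all other graphs. [core_leaf] is made empty in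
    the exceptional case so that both rules read the same over the core. *)
Lemma hg_keptP v : hg_kept H v = [exists t : vert T', (val t == PV v) && ~~ core_leaf t].
Proof.
have [exc|nexc] := boolP exceptional.
  have all_rem : [forall u in H.1, hg_removable H u].
    apply/forall_inP => u /kept_over[k|[ur rem]]; last exact: removed_root.
    by rewrite (@removable_kept u (Sub (PV u) k)) // (forallP exc).
  rewrite /hg_kept all_rem; apply/andP/existsP => [[vH /eqP fv]|[t /andP[/eqP tv _]]].
    case: (kept_over vH) => [k|[vr rem]].
      by exists (Sub (PV v) k); rewrite SubK eqxx /core_leaf exc.
    have : blueV (PV v) by rewrite (dc_bV cX) fv.
    by rewrite vr (negPf (exceptional_yellow_root exc rem)).
  have /andP[tV _] := valP t; rewrite memV -tv tV; split=> //.
  have := removable_kept tv; have lt := forallP exc t; rewrite lt => _.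
  rewrite -(dc_bV cX) -tv; have [_ _ c1 _ _] := core_closed_by rt oT.
  have /and3P[_ /eqP deg1 _] := lt.
  by apply/negPn/negP => yt; have [_] := c1 t yt; rewrite deg1.
have nall : [forall u in H.1, hg_removable H u] = false.
  apply/negP => /forall_inP all_rem; move: nexc => /forallPn[t nl].
  have [v' v't] := dc_imV cX (isT : ~~ pred0 (val t)).
  case/negP: nl; rewrite -(removable_kept (esym v't)); apply: all_rem.
  by rewrite memV v't; have /andP[] := valP t.
rewrite /hg_kept nall; apply/andP/existsP => [[vH nr]|[t /andP[/eqP tv nl]]].
  case: (kept_over vH) => [k|[vr rem]]; last by rewrite (removed_root vr rem) in nr.
  exists (Sub (PV v) k); rewrite SubK eqxx /core_leaf nexc /=.
  by rewrite -(@removable_kept v (Sub (PV v) k)).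
have /andP[tV _] := valP t; rewrite memV -tv tV; split=> //.
by rewrite (removable_kept tv); move: nl; rewrite /core_leaf nexc.
Qed.

Lemma hg_kept_by v : hg_kept H v -> by_kept core (PV v).
Proof. by rewrite hg_keptP => /existsP[t /andP[/eqP <- _]]; exact: valP. Qed.

Lemma hg_kept_iota v : hg_kept H (iotaV v) = hg_kept H v.
Proof. by rewrite !hg_keptP (dc_iV cX). Qed.

Local Notation K := (hg_kept H).
Local Notation X' := (hg_smooth H).

Definition down_half (d : half X) (dH : PH d \in coreH) (k : by_kept core (src (PH d))) : half T' :=
  Sub (PH d) (introT andP (conj dH k)).

Definition lift_opp d : half X :=
  if dropped && (PV (src (opp d)) == r) then opp (other_half H (opp d)) else opp d.

(** If the two half-edges at a vertex over the smoothed root had the same image, they would be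
    swapped by the involution at a fixed vertex. The root would then be blue, and so would its edges
    in the core, but half-edges over blue ones are not swapped. *)
Lemma lift_other e : e \in H.2 -> PV (src e) = r -> by_removable core r ->
  [/\ degree_in H (src e) = 2, PH (other_half H e) = other_half core (PH e)
    & other_half H (iotaH e) = iotaH (other_half H e)].
Proof.
move=> eH er rem; have /andP[_ /eqP deg] := removed_root er rem.
have [oH os ne uq] := other_halfP deg eH.
have degI : degree_in H (src (iotaH e)) = 2.
  by rewrite (hg_srcI wX); have /andP[_ /eqP] := @removed_root (iotaV (src e)) (etrans (dc_iV cX _) er) rem.
have eIH : iotaH e \in H.2 by rewrite memH_iota.
have [_ _ _ uqI] := other_halfP degI eIH.
split=> //.
  have deg' : degree_in core (src (PH e)) = 2 by rewrite PH_src er removable_deg.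
  have eH' : PH e \in core.2 by rewrite -memH.
  have [_ _ _ uq'] := other_halfP deg' eH'.
  case: (uq' (PH (other_half H e))) => //; first by rewrite -memH.
    by rewrite !PH_src os.
  move=> /esym/(dc_H cX)[E|E]; first by rewrite E eqxx in ne.
  have /and3P[_ _ /forall_inP col] := rem.
  have := col _ eH'; rewrite PH_src er eqxx /= (dc_bH cX) -er (dc_bV cX) => /eqP bE.
  have : iotaV (src e) = src e by rewrite -(hg_srcI wX) -E os.
  by move=> /eqP; rewrite -bE => /eqP fe; move: ne; rewrite E fe eqxx.
case: (uqI (iotaH (other_half H e))) => //.
- by rewrite memH_iota.
- by rewrite !(hg_srcI wX) os.
- by move=> /(inv_inj (hg_iHK wX)) E; rewrite E eqxx in ne.
Qed.

Section Half.

Variable d : half X.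
Hypotheses (dH : d \in H.2) (kd : by_kept core (src (PH d))).

Lemma lift_oppP : [/\ PH (lift_opp d) = core_opp (PH d), lift_opp d \in H.2,
  by_kept core (src (PH (lift_opp d))), lift_opp (lift_opp d) = d
  & lift_opp (iotaH d) = iotaH (lift_opp d) /\
    exists n, iter n (pass H K) (opp d) = lift_opp d].
Proof.
have dH' : PH d \in coreH by rewrite -memH.
have [oH kO] := core_opp_in rt oT dH'.
have PE : PH (lift_opp d) = core_opp (PH d).
  rewrite /lift_opp /core_opp -PH_opp PH_src.
  case: ifP => [/andP[dr /eqP sr]|_] //; rewrite PH_opp.
  have sr' : src (opp (PH d)) = r by rewrite -PH_opp PH_src.
  have [rem _ _ _ _] := core_through rt dH' dr sr'.
  have oH' : opp d \in H.2 by rewrite memH_opp.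
  by have [_ ->] := lift_other oH' sr rem; rewrite PH_opp.
split=> //; [by rewrite memH PE | by rewrite PE | | split].
- rewrite {2}/lift_opp; case: ifP => [/andP[dr /eqP sr]|_]; last first.
    rewrite /lift_opp xK -PH_src.
    by move: kd; rewrite (keptE rt oT) => /negPf->.
  have sr' : src (opp (PH d)) = r by rewrite -PH_opp PH_src.
  have [rem _ _ _ _] := core_through rt dH' dr sr'.
  have oH' : opp d \in H.2 by rewrite memH_opp.
  have [deg _ _] := lift_other oH' sr rem; have [_ os _ _] := other_halfP deg oH'.
  by rewrite /lift_opp xK os sr dr eqxx /= (other_halfK deg oH') xK.
- rewrite /lift_opp (hg_oppI wX) (hg_srcI wX) (dc_iV cX).
  case: ifP => [/andP[dr /eqP sr]|_] //.
  have sr' : src (opp (PH d)) = r by rewrite -PH_opp PH_src.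
  have [rem _ _ _ _] := core_through rt dH' dr sr'.
  have oH' : opp d \in H.2 by rewrite memH_opp.
  by have [_ _ ->] := lift_other oH' sr rem; rewrite (hg_oppI wX).
- rewrite /lift_opp; case: ifP => [/andP[dr /eqP sr]|_]; last by exists 0.
  exists 1; rewrite /= /pass; case: ifP => // /hg_kept_by.
  by rewrite (keptE rt oT) dr sr eqxx.
Qed.

End Half.

(** A vertex over a core leaf has just two half-edges, swapped by the involution, and is smoothed
    away; passing through it leads from one sheet to the other. *)
Lemma leaf_pass e (t : vert T') : e \in H.2 -> val t = PV (src e) -> core_leaf t ->
  pass H K e = iotaH (opp e) /\ iotaH e != e.
Proof.
move=> eH tE lt; have nk : ~~ K (src e).
  rewrite hg_keptP; apply/existsP => -[t' /andP[/eqP t'E]].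
  by rewrite (_ : t' = t) ?lt //; apply: val_inj; rewrite t'E.
have /andP[_ lf] := lt; rewrite -(removable_kept tE) in lf.
have /andP[_ /eqP deg] := lf; have [oH os ne uq] := other_halfP deg eH.
have [_ _ c1 _ c2] := core_closed_by rt oT.
have /andP[_ /and3P[/eqP g0 /eqP deg1 V1]] := lt.
have bt : blueV t by apply/negPn/negP => /c1[_]; rewrite deg1.
have fe : iotaV (src e) = src e by apply/eqP; rewrite -(dc_bV cX) -tE.
have ye : iotaH e != e.
  case: c2 => [c2|[V1' _ _]]; last by rewrite V1' in V1.
  have [d0 d0t yd0] := c2 t bt g0; have [d1 d1t uq1] := degree1P deg1.
  have eH' : PH e \in coreH by rewrite -memH.
  have ke : by_kept core (src (PH e)) by rewrite PH_src -tE (valP t).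
  have E : down_half eH' ke = d0.
    rewrite (uq1 d0 d0t); apply: uq1; apply: val_inj; rewrite /= tE.
    exact: PH_src.
  by move: yd0; rewrite -E /= (dc_bH cX).
split=> //; rewrite /pass (negPf nk) -(hg_oppI wX); congr opp.
case: (uq (iotaH e)); rewrite ?memH_iota // ?(hg_srcI wX) //.
by move=> E; rewrite E eqxx in ye.
Qed.

(** Over a leaf of the core the path does not stop: it changes to the other sheet and runs back over
    the same edge, ending at the conjugate of its start. This is how anti-invariant edges arise
    after smoothing, whether the turning point was a midpoint or a vertex. *)
Lemma hg_far_end d (dH : PH d \in coreH) (k : by_kept core (src (PH d))) : K (src d) ->
  far_end H K d = if core_leaf (src (opp (down_half dH k))) then iotaH d else lift_opp d.
Proof.
move=> Kd; have dH' : d \in H.2 by rewrite memH.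
have [PE oH kO oo [oI [n nE]]] := lift_oppP dH' k.
set t := src (opp _); have tE : val t = PV (src (lift_opp d)).
  by rewrite /t core_srcE (core_oppE rt oT) SubK -PE PH_src.
case: ifP => lt; last first.
  rewrite (@far_end_pass _ _ _ n) nE //; rewrite hg_keptP; apply/existsP; exists t.
  by rewrite tE eqxx lt.
have [pE nf] := leaf_pass oH tE lt.
have gH : iotaH (lift_opp d) \in H.2 by rewrite memH_iota.
have kg : by_kept core (src (PH (iotaH (lift_opp d)))) by rewrite (dc_iH cX).
have [_ _ _ _ [_ [n' n'E]]] := lift_oppP gH kg.
have oE : lift_opp (iotaH (lift_opp d)) = iotaH d.
  by have [_ _ _ _ [-> _]] := lift_oppP oH kO; rewrite oo.
rewrite oE (hg_oppI wX) in n'E.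
have E : iter (n' + n.+1) (pass H K) (opp d) = iotaH d by rewrite iterD iterS nE pE.
by rewrite (@far_end_pass _ _ _ (n' + n.+1)) E // (hg_srcI wX) hg_kept_iota.
Qed.

Definition subV (v : vert X') : vert T' := Sub (PV (val v)) (hg_kept_by (valP v)).

Lemma subH_proof (d : half X') : (PH (val d) \in core.2) && by_kept core (src (PH (val d))).
Proof. by have /andP[dH kd] := valP d; rewrite -memH dH PH_src hg_kept_by. Qed.

Definition subH (d : half X') : half T' := Sub (PH (val d)) (subH_proof d).

Lemma subV_nleaf (v : vert X') : ~~ core_leaf (subV v).
Proof.
have := valP v; rewrite hg_keptP => /existsP[t /andP[/eqP tE nl]].
by rewrite (_ : subV v = t) //; apply: val_inj; rewrite SubK.
Qed.

Lemma sub_iotaV (v : vert X') : val (iotaV v) = iotaV (val v).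
Proof. by apply: insubdK; exact: (etrans (hg_kept_iota _) (valP v)). Qed.

Lemma sub_iotaH (d : half X') : val (iotaH d) = iotaH (val d).
Proof.
have /andP[dH kd] := valP d.
have P : (iotaH (val d) \in H.2) && K (src (iotaH (val d))).
  by rewrite memH_iota dH (hg_srcI wX) hg_kept_iota.
by apply: insubdK; exact: P.
Qed.

Lemma sub_opp (d : half X') :
  val (opp d) = if core_leaf (src (opp (subH d))) then iotaH (val d) else lift_opp (val d).
Proof.
have /andP[dH kd] := valP d; have /andP[dH' kd'] := subH_proof d.
have fE := hg_far_end dH' kd' kd.
have sE : down_half dH' kd' = subH d by exact: val_inj.
rewrite sE in fE; have [PE oH kO _ _] := lift_oppP dH kd'.
apply: smooth_oppE fE _ _; case: ifP => lf; rewrite ?memH_iota //.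
  by rewrite (hg_srcI wX) hg_kept_iota.
rewrite hg_keptP; apply/existsP; exists (src (opp (subH d))).
by rewrite lf andbT core_srcE (core_oppE rt oT) SubK -PE PH_src.
Qed.

Lemma subH_opp (d : half X') : ~~ core_leaf (src (opp (subH d))) -> subH (opp d) = opp (subH d).
Proof.
move=> nl; apply: val_inj; rewrite SubK sub_opp (negPf nl) (core_oppE rt oT) SubK.
have /andP[dH kd] := valP d; have /andP[dH' kd'] := subH_proof d.
by have [-> _ _ _ _] := lift_oppP dH kd'.
Qed.

Lemma subH_iota (d : half X') : subH (iotaH d) = subH d.
Proof. by apply: val_inj; rewrite !SubK sub_iotaH (dc_iH cX). Qed.

Lemma subH_src (d : half X') : src (subH d) = subV (src d).
Proof. by apply: val_inj; rewrite core_srcE !SubK PH_src. Qed.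

Lemma sub_wf : hyp_wf X'.
Proof.
split.
- move=> d; apply: val_inj; rewrite sub_opp.
  have /andP[dH kd] := valP d; have /andP[dH' kd'] := subH_proof d.
  have [lf|nl] := boolP (core_leaf (src (opp (subH d)))).
    have oI : opp d = iotaH d by apply: val_inj; rewrite sub_opp lf sub_iotaH.
    by rewrite oI subH_iota lf sub_iotaH (hg_iHK wX).
  rewrite (subH_opp nl) (by_oppK wT') subH_src (negPf (subV_nleaf _)) sub_opp (negPf nl).
  by have [_ _ _ -> _] := lift_oppP dH kd'.
- by move=> v; apply: val_inj; rewrite !sub_iotaV (hg_iVK wX).
- by move=> d; apply: val_inj; rewrite !sub_iotaH (hg_iHK wX).
- by move=> d; apply: val_inj; rewrite sub_iotaV -[LHS]/(src (val (iotaH d))) sub_iotaH (hg_srcI wX).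
- move=> d; apply: val_inj; rewrite sub_iotaH !sub_opp subH_iota sub_iotaH.
  have /andP[dH kd] := valP d; have /andP[dH' kd'] := subH_proof d.
  by case: ifP => // _; have [_ _ _ _ [-> _]] := lift_oppP dH kd'.
Qed.

Lemma core_leafP (t : vert T') : core_leaf t -> [/\ blueV t, by_gen t = 0 &
    exists d : half T', [/\ src d = t, ~~ blueH d, ~~ core_leaf (src (opp d)) &
               forall d' : half T', src d' = t -> d' = d]].
Proof.
move=> /andP[nexc /and3P[/eqP g0 /eqP deg V1]]; have [_ _ c1 _ c2] := core_closed_by rt oT.
have bt : blueV t by apply/negPn/negP => /c1[_]; rewrite deg.
have [d dt du] := degree1P deg; split=> //; exists d; split=> //.
  case: c2 => [c2|[V1' _ _]]; last by rewrite V1' in V1.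
  by have [d0 d0t] := c2 t bt g0; rewrite (du d0 d0t).
apply/negP => /andP[_ lf]; have /and3P[_ /eqP deg2 _] := lf.
have [e es eu] := degree1P deg2; case/negP: nexc; apply/forallP => v.
have [|f fo|V _] := adjacent_leaves (by_oppK wT') (d := d) (proj1 trT').
- by rewrite dt.
- by rewrite (eu f fo) -(eu (opp d)).
case: (V v) => -> //; rewrite dt /genus0_leaf g0 deg V1 eqxx.
by [].
Qed.

Lemma sub_anti (d : half X') : anti_inv d = core_leaf (src (opp (subH d))).
Proof.
rewrite /anti_inv /is_open -!(inj_eq val_inj) sub_iotaH sub_opp.
have /andP[dH kd] := valP d; have /andP[dH' kd'] := subH_proof d.
case: ifP => lf.
  rewrite eqxx andbT -(dc_bH cX); have [_ _ [e [es ye _ eu]]] := core_leafP lf.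
  have : ~~ blueH (opp (subH d)) by rewrite (eu _ erefl).
  by rewrite (by_bopp wT').
apply/negP => /andP[_ /eqP E]; have [PE _ _ _ _] := lift_oppP dH kd'.
have := core_nopen rt oT (subH d); rewrite /is_open -(inj_eq val_inj) (core_oppE rt oT).
by rewrite SubK -PE -E (dc_iH cX) eqxx.
Qed.

Lemma sub_dcover : @dcover X' T' core_leaf subV subH.
Proof.
split.
- exact: subH_src.
- by move=> d; rewrite sub_anti => nl; rewrite subH_opp.
- by move=> d; rewrite sub_anti.
- move=> v w /(congr1 val); rewrite !SubK => /(dc_V cX)[E|E]; [left|right]; apply: val_inj => //.
  by rewrite sub_iotaV.
- by move=> v; apply: val_inj; rewrite !SubK sub_iotaV (dc_iV cX).
- move=> d e /(congr1 val); rewrite !SubK => /(dc_H cX)[E|E]; [left|right]; apply: val_inj => //.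
  by rewrite sub_iotaH.
- exact: subH_iota.
- move=> t nl; have [v vt] := dc_imV cX (isT : ~~ pred0 (val t)).
  have kv : K v by rewrite hg_keptP; apply/existsP; exists t; rewrite vt eqxx.
  by exists (Sub v kv); apply: val_inj; rewrite !SubK.
- exact: subV_nleaf.
- move=> d nl; have [h hd] := dc_imH cX (isT : ~~ pred0 (src (val d))).
  have /andP[dH kd] := valP d.
  have P : (h \in H.2) && K (src h).
    rewrite memH hd dH hg_keptP; apply/existsP; exists (src d); rewrite nl andbT.
    by rewrite core_srcE -hd PH_src.
  by exists (Sub h P : half X'); apply: val_inj; rewrite !SubK.
- by move=> v; rewrite -(inj_eq val_inj) sub_iotaV -(dc_bV cX).
- by move=> v; rewrite -(inj_eq val_inj) sub_iotaH -(dc_bH cX).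
- by move=> v; rewrite -[RHS]/(hg_gen (val v)) -(dc_gen cX).
- exact: core_leafP.
Qed.

End CoverCore.

Lemma card0_void (I : finType) (x : I) : #|I| = 0 -> False.
Proof. by move=> I0; have := max_card (pred1 x); rewrite I0 card1. Qed.

Section CoverCore2.

Variables (T : bytree) (r : vert T) (up : vert T -> half T) (rk : vert T -> nat).
Hypotheses (rt : orooted r up rk) (oT : open_by T).
Variables (X : hgraph) (PV : vert X -> vert T) (PH : half X -> half T).
Hypotheses (wX : hyp_wf X) (cX : dcover (pred0 : pred (vert T)) PV PH).

Let wT := oT_wf oT.
Local Notation core := (core r up).
Local Notation T' := (by_sub core).
Local Notation X' := (hg_smooth (pullback PV PH core)).

Let wT' : by_wf T' := core_wf rt oT.
Let trT' : is_tree T' := core_tree rt oT.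
Let wX' : hyp_wf X' := sub_wf rt oT wX cX.
Let c' := sub_dcover rt oT wX cX.
Let leafE := core_leafE rt oT.

Lemma sub_nopen (d : half X') : ~~ is_open d.
Proof. by rewrite -(dc_openE c') (core_nopen rt oT). Qed.

Lemma lone_core_leaf (t : vert T') : by_lone_vertex T' -> ~~ genus0_leaf t.
Proof. by move=> [V1 _ _]; rewrite /genus0_leaf V1 !andbF. Qed.

Lemma fibre_countV : #|vert X'| + \sum_(t : vert T') core_leaf t =
  \sum_(t : vert T') (1 + ~~ blueV t).
Proof.
rewrite -sum1_card (partition_big (subV rt oT wX cX) xpredT) //= -big_split /=.
by apply: eq_bigr => t _; exact: (fibre_cardV c').
Qed.

Lemma fibre_countH : #|half X'| + \sum_(d : half T') 2 * core_leaf (src d) =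
  \sum_(d : half T') (1 + ~~ blueH d).
Proof.
rewrite -sum1_card (partition_big (subH rt oT wX cX) xpredT) //= -big_split /=.
by apply: eq_bigr => t _; exact: (fibre_cardH c').
Qed.

Lemma sub_lone : lone_vertex X' <-> by_lone_vertex T'.
Proof.
split=> [[V1 H0 g0]|lone].
  have nl (t : vert T') : ~~ core_leaf t.
    apply/negP => lt; have [_ _ [d [dt _ _ _]]] := dc_L c' lt; rewrite -dt in lt.
    have [h _ _] := dc_leaf wT' c' lt.
    by case: (card0_void h H0).
  have [x _] : exists x, x \in vert X' by apply/card_gt0P; rewrite V1.
  split.
  - rewrite -(card1 (subV rt oT wX cX x)); apply: eq_card => t; rewrite [RHS]inE.
    have [v <-] := dc_imV c' (nl t); apply/esym/eqP; congr subV; exact: card1_eq.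
  - apply/eqP; rewrite -leqn0 leqNgt; apply/negP => /card_gt0P[d _].
    have [h _] := dc_imH c' (nl (src d)).
    by case: (card0_void h H0).
  - move=> t; have [v <-] := dc_imV c' (nl t); rewrite (dc_bV c') (dc_gen c') g0.
    by split=> //; apply/eqP; exact: card1_eq.
have [V1 H0 bg] := lone.
have nl (t : vert T') : core_leaf t = false by rewrite /core_leaf (negPf (lone_core_leaf t lone)) andbF.
split.
- have := fibre_countV; rewrite big1 => [|t _]; last by rewrite nl.
  rewrite addn0 => ->; rewrite (eq_bigr (fun=> 1)) ?sum1_card // => t _.
  by have [-> _] := bg t.
- apply/eqP; rewrite -leqn0 leqNgt; apply/negP => /card_gt0P[h _].
  by case: (card0_void (subH rt oT wX cX h) H0).
- by move=> v; rewrite -(dc_gen c'); have [] := bg (subV rt oT wX cX v).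
Qed.

Lemma sub_exceptional : exceptional r up -> exceptional_circle X'.
Proof.
move=> exc; have [[/set0Pn[t _] _] _] := trT'; have lf t0 := forallP exc t0.
have [_ _ c1 _ c2] := core_closed_by rt oT.
have /and3P[/eqP g0 /eqP deg V1] := lf t; have [d dt du] := degree1P deg.
have /and3P[_ /eqP deg2 _] := lf (src (opp d)); have [e es eu] := degree1P deg2.
have {}c2 : by_cond2 T' by case: c2 => // -[V1']; rewrite V1' in V1.
have [|f fo|V E] := adjacent_leaves (by_oppK wT') (d := d) (proj1 trT').
- by rewrite dt.
- by rewrite (eu f fo) -(eu (opp d)).
have yd : ~~ blueH d.
  have bt : blueV t by apply/negPn/negP => /c1[_]; rewrite deg.
  by have [d' d't yd'] := c2 t bt g0; rewrite -(du d' d't).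
have yel (f : half T') : ~~ blueH f by case: (E f) => ->; rewrite ?(by_bopp wT').
have bl (v : vert T') : blueV v.
  by apply/negPn/negP => /c1[_]; have /and3P[_ /eqP-> _] := lf v.
have nop := core_nopen rt oT d.
have ne : src (opp d) != src d.
  apply: contra nop => /eqP s; have [_ inj] := core_simple rt oT; apply/eqP; apply: inj.
  change ((src (opp d), src (opp (opp d))) = (src d, src (opp d))).
  by rewrite (by_oppK wT') s.
have cV : #|vert T'| = 2.
  transitivity #|[set src d; src (opp d)]|; last by rewrite cards2 eq_sym ne.
  by rewrite -cardsT; apply: eq_card => v; rewrite !inE; case: (V v) => ->; rewrite eqxx ?orbT.
have cH : #|half T'| = 2.
  transitivity #|[set d; opp d]|; last by rewrite cards2 eq_sym nop.
  by rewrite -cardsT; apply: eq_card => v; rewrite !inE; case: (E v) => ->; rewrite eqxx ?orbT.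
have nl (t0 : vert T') : core_leaf t0 = false by rewrite /core_leaf exc.
have nfix (h : half X') : iotaH h != h by rewrite -(dc_bH c').
split.
- have := fibre_countV; rewrite big1 => [|t0 _]; last by rewrite nl.
  rewrite addn0 => ->; rewrite (eq_bigr (fun=> 1)) ?sum1_card // => t0 _.
  by rewrite bl.
- have := fibre_countH; rewrite big1 => [|t0 _]; last by rewrite nl.
  rewrite addn0 => ->; rewrite (eq_bigr (fun=> 2)) => [|f _]; last by rewrite yel.
  by rewrite sum_nat_const cH.
- move=> v; have := lf (subV rt oT wX cX v) => /and3P[/eqP gv /eqP degv _].
  have fv : iotaV v = v by apply/eqP; rewrite -(dc_bV c') bl.
  split=> //; first by rewrite -(dc_gen c').
  have [f fs fu] := degree1P degv; have [h hf hv] := lift_at wX' c' fs.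
  transitivity #|[set h; iotaH h]|; last by rewrite cards2 eq_sym nfix.
  apply: eq_card => h'; rewrite [LHS]inE [RHS]in_set2; apply/eqP/orP => [h'v|[/eqP->|/eqP->]] //.
    have : subH rt oT wX cX h' = f by apply: fu; rewrite (dc_src c') h'v.
    by rewrite -hf => /esym/(dc_H c')[->|->]; rewrite eqxx; auto.
  by rewrite (hg_srcI wX') hv.
- move=> h; split; [exact: sub_nopen | exact/eqP |].
  have := dc_antiE c' h; rewrite nl /anti_inv sub_nopen /= => /eqP.
  by [].
Qed.

Lemma sub_closed_hyp : closed_hyp X'.
Proof.
have [_ nop c1 c3 c2] := core_closed_by rt oT.
have [t0 bt0] := closed_blue_exists wT' trT' nop c1.
split.
- by split=> //; exact: (dcover_connected wX' wT' c' trT' bt0).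
- exact: sub_nopen.
- by split; [exact: (dcover_hyp_cond1 c' c1) | exact: (dcover_hyp_cond3 wX' c' c3)].
- exact: (dcover_top_tree wX' wT' c' c1 trT').
- have [exc|nexc] := boolP (exceptional r up); first by constructor 3; exact: sub_exceptional.
  case: c2 => [c2|lone]; last by constructor 2; apply/sub_lone.
  constructor 1; apply: (dcover_hyp_cond2 wX' c' c1 c2) => v g0 bv; apply/negP => deg.
  by have := dc_nL c' v; rewrite /core_leaf nexc leafE g0 deg.
Qed.

End CoverCore2.

Section HgCore.

Variables (T : bytree) (r : vert T) (up : vert T -> half T) (rk : vert T -> nat).
Hypotheses (rt : orooted r up rk) (oT : open_by T).
Variables (G : hgraph) (pV : vert G -> vert T) (pH : half G -> half T).
Hypotheses (oG : open_hyp G) (c : dcover (fun t : vert T => genus0_leaf t) pV pH).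

Let oK := or_oppK rt.
Let wT := oT_wf oT.
Local Notation core := (core r up).
Local Notation coreV := (coreV r up).
Local Notation coreH := (coreH r up).
Local Notation special := (special r up).
Local Notation T' := (by_sub core).

Lemma open_hyp_wf : hyp_wf G. Proof. by case: oG => [[]]. Qed.
Let wG := open_hyp_wf.

Let PV := halveV pV pH.
Let PH := halveH pH.
Let wX : hyp_wf (halve G) := halve_wf wG.
Let cX : @dcover (halve G) T pred0 PV PH := dcover_extend wG wT c.

Definition hcore : subspace G := pullback pV pH core.

Lemma leaf_half (d : half T) : genus0_leaf (src d) -> ~~ blueH d /\ ~~ is_open d.
Proof.
move=> l; have [_ _ [d' [_ yd nl du]]] := dc_L c l; rewrite -(du d erefl) in yd nl.
by split=> //; apply: contra nl => /eqP->.
Qed.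

(** It lies over the yellow edge to a genus 0 leaf, and yellow edges other than the open one are
    never removed. *)
Lemma anti_core a : anti_inv a -> pH a \in coreH.
Proof.
move=> /(dc_anti c)/leaf_half[]; rewrite (oT_bopp oT) (is_open_opp oK).
exact: (yellow_core rt oT).
Qed.

Lemma hg_lift_core : hg_lift hcore = pullback PV PH core.
Proof.
congr (_, _); apply/setP.
  case=> [v|m]; rewrite !inE //=.
  have -> : sval m = anti_edge (mid_rep m) by rewrite -[m in LHS]mid_repK.
  rewrite /anti_edge; have aH := anti_core (valP (mid_rep m)).
  have -> : [set val (mid_rep m); opp (val (mid_rep m))] \subset [set h | pH h \in coreH].
    apply/subsetP => h; rewrite in_set2 => /orP[] /eqP->; rewrite inE ?(pH_anti_opp c);
      exact: aH.
  have oH : opp (pH (val (mid_rep m))) \in core.2 by rewrite (coreH_opp rt).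
  by have [] := core_closed_union rt oH; rewrite inE.
case=> [d|a]; rewrite [LHS]inE [RHS]inE /= ?inE //.
by have := coreH_opp rt (pH (val a)); rewrite !inE => ->.
Qed.

Lemma hg_sub_core : hg_sub hcore = hg_smooth (pullback PV PH core).
Proof. by rewrite /hg_sub hg_lift_core. Qed.

Lemma hcore_closed_union : closed_union hcore.
Proof.
move=> d; rewrite inE => dH; have [sV oH nop] := core_closed_union rt dH.
split; [by rewrite inE -(dc_src c) | rewrite inE | by rewrite -(dc_openE c)].
have [/andP[_ /eqP <-]|na] := boolP (anti_inv d); first by rewrite (dc_iH c).
by rewrite -(dc_opp c).
Qed.

Lemma hcore_connected_in : connected_in hcore.
Proof.
have [t tu] := top_leaf rt.
have bt : blueV t.
  apply/negPn/negP => /(oT_c1 oT)[_]; rewrite ltnNge.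
  by rewrite (leq_trans (degree_le1 tu)).
apply: (dcover_connected_in wG wT c (H := core) _ _ (t0 := t)) => //.
- by move=> d /(core_closed_union rt)[].
- exact: (core_connected_in rt).
- rewrite inE; apply/negP => /andP[sp /eqP tr].
  have [d1 [d1r _ nop _]] := specialP rt sp.
  have := nop; rewrite (tu d1) ?tr // (up_open rt) eqxx.
  by [].
- move=> lt; have [_ _ [d [dt _ _ _]]] := dc_L c lt; exists d => //.
  by rewrite -dt in lt; have [yd nop] := leaf_half lt; exact: (yellow_core rt oT yd nop).
Qed.

Lemma hcore_subgraph : closed_hyp_subgraph hcore.
Proof.
split.
- by split; [exact: hcore_closed_union | exact: hcore_connected_in].
- by move=> v; rewrite !inE (dc_iV c).
- by move=> d; rewrite !inE (dc_iH c).
- by rewrite hg_sub_core; exact: (sub_closed_hyp rt oT wX cX).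
- rewrite hg_sub_core => /(sub_lone rt oT wX cX)/(lone_core_genus rt oT) g0.
  by case: oG => [[_ cG] _ _ _ _]; rewrite (dcover_genus rt oT wG cG c).
Qed.

(** In the special case a vertex of [H] over [r] is fixed and of genus 0, and its only possible
    half-edge in [H] is the invariant one over the blue edge. So it has degree at most 1: it stays a
    vertex, violates [hyp_cond2], is not on the exceptional circle, and is not alone because the
    genus of [G] is not 0. *)
Lemma hcore_max H : closed_hyp_subgraph H -> sub_le H hcore.
Proof.
move=> [[cl _] iV _ [_ _ _ _ cs] lone].
have nopH d : d \in H.2 -> ~~ is_open (pH d) by move=> /cl[_ _]; rewrite (dc_openE c).
have [sp|nsp] := boolP special; last first.
  split; apply/subsetP => x; rewrite inE; first by rewrite inE (negPf nsp).
  by move=> xH; rewrite (nspecial_core _ nsp) nopH.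
have [d1 [d1r bd1 nop1 du]] := specialP rt sp.
have /and5P[br /eqP gr _ _ _] := sp.
have rH v : v \in H.1 -> pV v != r.
  move=> vH; apply/eqP => vr.
  have fv : iotaV v = v by apply/eqP; rewrite -(dc_bV c) vr.
  have degv : degree_in (hg_lift H) (inl v : vert (halve G)) <= 1.
    rewrite /degree_in; case: (pickP [pred d | (d \in H.2) && (src d == v)]) => [h /andP[hH /eqP hv]|none].
      rewrite -(cards1 (inl h : half (halve G))); apply/subset_leq_card/subsetP.
      case=> [d|a]; rewrite !inE //=; last by rewrite andbF.
      case/andP=> dH /eqP[dv].
      have one e : e \in H.2 -> src e = v -> pH e = d1.
        move=> eH ev; case: (du (pH e)) => //; first by rewrite (dc_src c) ev.
        by move=> E; have := nopH e eH; rewrite E (up_open rt) eqxx.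
      have : pH h = pH d by rewrite (one h) // (one d).
      case/(dc_H c) => ->; first by rewrite eqxx.
      have /eqP -> : iotaH h == h by rewrite -(dc_bH c) (one h).
      by rewrite eqxx.
    rewrite (_ : [set d in _ | _] = set0) ?cards0 //; apply/setP => -[d|a]; rewrite !inE /= ?andbF //.
    exact: none.
  have nrem : ~~ hg_removable (hg_lift H) (inl v : vert (halve G)).
    by rewrite /hg_removable; move: degv; case: (degree_in _ _) => [|[]] //; rewrite andbF.
  have vL : (inl v : vert (halve G)) \in (hg_lift H).1 by rewrite inE.
  have kv : hg_kept (hg_lift H) (inl v : vert (halve G)).
    rewrite /hg_kept vL /= ifN //; apply/negP => /forall_inP/(_ _ vL).
    by rewrite (negPf nrem).
  pose x : vert (hg_sub H) := Sub (inl v : vert (halve G)) kv.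
  have gx : hg_gen x = 0 by rewrite /= -(dc_gen c) vr.
  have dx : degree x <= 1 by have := smooth_degree x; rewrite SubK => ->.
  case: cs => [/(_ x gx)|/lone g0|[_ _ /(_ x)[_ _ dx2] _]].
  - by rewrite ltnNge (leq_trans dx).
  - have cG : connected G by case: oG => [[]].
    rewrite (dcover_genus rt oT wG cG c) in g0.
    by have := noloop rt nop1; rewrite d1r (genus0_lone rt oT g0 (src _)) eqxx.
  - by rewrite dx2 in dx.
have inV v : v \in H.1 -> pV v \in coreV by move=> /rH; rewrite inE sp.
split; apply/subsetP => x; rewrite inE => xH; first exact: inV.
have [sH oH nop] := cl _ xH; rewrite inE (nopH x xH) (dc_src c) inV //=.
have [ax|nax] := boolP (anti_inv x); last by rewrite (dc_opp c nax) (dc_src c) inV //; have [] := cl _ oH.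
by have := anti_core ax; rewrite inE => /and3P[].
Qed.

Lemma hcore_is_core : hg_core hcore.
Proof.
have mx : maximal_sub (@closed_hyp_subgraph G) hcore.
  split=> [|H cH [le1 le2]]; first exact: hcore_subgraph.
  have [le1' le2'] := hcore_max cH; case: H cH le1 le2 le1' le2' => a b /= _ l1 l2 l1' l2'.
  by congr (_, _); apply/eqP; rewrite eqEsubset ?l1 ?l1' ?l2 ?l2'.
split=> // H [cH mH]; rewrite (mH hcore) //; first exact: hcore_subgraph.
exact: hcore_max.
Qed.

Lemma hg_core_eq H : hg_core H -> H = hcore.
Proof. by case=> _ uq; apply/esym/uq; case: hcore_is_core. Qed.

Lemma hcore_dcover : exists qV qH, dcover (G := hg_sub hcore) (@core_leaf T r up) qV qH.
Proof. by rewrite hg_sub_core; do 2!eexists; exact: (sub_dcover rt oT wX cX). Qed.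

Lemma hcore_wf : hyp_wf (hg_sub hcore).
Proof. by rewrite hg_sub_core; exact: (sub_wf rt oT wX cX). Qed.

End HgCore.

(** The cores upstairs are double covers of the cores below, so the two directions are the two
    uniqueness statements [dcover_base_iso] and [dcover_unique]. *)
Lemma dcover_equiv (G G' : hgraph) (T T' : bytree) pV pH pV' pH' :
    open_hyp G -> open_hyp G' -> open_by T -> open_by T' ->
    dcover (G := G) (fun t : vert T => genus0_leaf t) pV pH ->
    dcover (G := G') (fun t : vert T' => genus0_leaf t) pV' pH' ->
  hg_equiv G G' <-> by_equiv T T'.
Proof.
move=> oG oG' oT oT' c c'.
have [r [up [rk rt]]] := open_by_rooted oT; have [r' [up' [rk' rt']]] := open_by_rooted oT'.
have [qV [qH q]] := hcore_dcover rt oT oG c; have [qV' [qH' q']] := hcore_dcover rt' oT' oG' c'.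
have w := hcore_wf rt oT oG c; have w' := hcore_wf rt' oT' oG' c'.
have [wt wt'] := (core_wf rt oT, core_wf rt' oT').
split.
  move=> [H [H' [cH cH' iso]]]; apply/(by_equivE rt oT rt' oT').
  rewrite (hg_core_eq rt oT oG c cH) (hg_core_eq rt' oT' oG' c' cH') in iso.
  have [sV [sH s]] := dcover_comp_total iso q'.
  exact: dcover_base_iso w wt wt' q s.
move=> /(by_equivE rt oT rt' oT')[fV [fH iso]].
exists (hcore r up pV pH), (hcore r' up' pV' pH'); split.
- exact: (hcore_is_core rt oT oG c).
- exact: (hcore_is_core rt' oT' oG' c').
apply: dcover_unique (core_tree rt' oT') wt' w w' (dcover_comp_base q iso _) q' => t.
rewrite /core_leaf (genus0_leaf_iso iso); congr (~~ _ && _).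
have lE := genus0_leaf_iso iso; have [[[g gK fK] _] _ _ _ _] := iso.
by apply/forallP/forallP => H x; [rewrite -lE | rewrite -[x]fK lE].
Qed.

Lemma T_of_G_equiv : preserves_equiv open_hyp hg_equiv by_equiv T_of_G.
Proof.
move=> G G' oG oG'; have [oT [pV [pH c]]] := open_hyp_by oG.
have [oT' [pV' [pH' c']]] := open_hyp_by oG'.
exact: (dcover_equiv oG oG' oT oT' c c').
Qed.

Lemma G_of_T_equiv : preserves_equiv open_by by_equiv hg_equiv G_of_T.
Proof.
move=> T T' oT oT'; have [wG c] := glue_open_dcover oT; have [wG' c'] := glue_open_dcover oT'.
have [oG oG'] := (dcover_open_hyp wG oT c, dcover_open_hyp wG' oT' c').
exact: (iff_sym (dcover_equiv oG oG' oT oT' c c')).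
Qed.

(** * The cluster picture of an open BY tree *)

(** Elements at the same position in the enumerations of corresponding fibres are matched. The empty
    case is separate because [nth] needs a default element. *)
Lemma fibre_bijection (A B I : finType) (f : A -> I) (g : B -> I) :
    (forall i, #|[set a | f a == i]| = #|[set b | g b == i]|) ->
  exists2 h : A -> B, bijective h & forall a, g (h a) = f a.
Proof.
move=> E; have AB : #|A| = #|B|.
  have cs (Z : finType) (k : Z -> I) : #|Z| = \sum_i #|[set a | k a == i]|.
    rewrite -sum1_card (partition_big k xpredT) //=; apply: eq_bigr => i _.
    by rewrite -sum1_card; apply: eq_bigl => a; rewrite inE.
  by rewrite (cs A f) (cs B g); apply: eq_bigr.
case: (pickP (fun _ : B => true)) => [b0 _|B0]; last first.
  have A0 (a : A) : False.
    by have : 0 < #|B|; [rewrite -AB; apply/card_gt0P; exists a | rewrite eq_card0].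
  have B0' (b : B) : False by have := B0 b.
  exists (fun a => match A0 a return B with end) => [|a]; last by case: (A0 a).
  by exists (fun b => match B0' b return A with end) => x; [case: (A0 x) | case: (B0' x)].
pose ef i := enum [set a | f a == i]; pose eg i := enum [set b | g b == i].
have sz i : size (ef i) = size (eg i) by rewrite -!cardE.
pose h a := nth b0 (eg (f a)) (index a (ef (f a))).
have ina a : a \in ef (f a) by rewrite mem_enum inE.
have lt a : index a (ef (f a)) < size (eg (f a)) by rewrite -sz index_mem.
have gh a : g (h a) = f a.
  by have := mem_nth b0 (lt a); rewrite mem_enum inE => /eqP.
exists h => //; apply: inj_card_bij; last by rewrite AB.
move=> a a' hE; have fE : f a = f a' by rewrite -!gh hE.
move: hE; rewrite /h fE => /eqP; rewrite nth_uniq ?enum_uniq ?lt //; last by rewrite -fE lt.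
by move=> /eqP; apply: index_inj; rewrite ?ina // -fE ina.
Qed.

(** * The order of a tree rooted at infinity *)

Definition ancestor (T : graph) (up : vert T -> half T) : rel (vert T) :=
  fconnect (parent up).

Section Ancestors.

Variables (T : graph) (r : vert T) (up : vert T -> half T) (rk : vert T -> nat).
Hypothesis rt : orooted r up rk.
Implicit Types (d e : half T) (u v w : vert T).

Local Notation par := (parent up).

Local Notation anc := (ancestor up).

Lemma ancP u v : reflect (exists n, iter n par u = v) (anc u v).
Proof.
apply: (iffP idP) => [uv|[n <-]]; last exact: fconnect_iter.
by exists (findex par u v); exact: iter_findex.
Qed.

Lemma anc_refl v : anc v v. Proof. exact: connect0. Qed.

Lemma anc_trans : transitive anc.
Proof. by move=> v u w; exact: connect_trans. Qed.

Lemma anc_par v : anc v (par v). Proof. exact: fconnect1. Qed.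

Lemma anc_step u v : anc u v = (u == v) || anc (par u) v.
Proof.
apply/idP/orP => [/ancP[[|n] E]|[/eqP->|h]]; first by left; apply/eqP.
- by right; apply/ancP; exists n; rewrite -iterSr.
- exact: anc_refl.
- exact: anc_trans (anc_par u) h.
Qed.

Lemma anc_root v : anc v r.
Proof. by apply/ancP; exact: (fiter_par_root rt). Qed.

Lemma anc_of_root v : anc r v = (v == r).
Proof.
apply/idP/eqP => [/ancP[n <-]|->]; last exact: anc_refl.
by elim: n => //= n ->; exact: (par_root rt).
Qed.

Lemma anc_rk u v : anc u v -> u = v \/ rk v < rk u.
Proof.
case/ancP=> n; elim: n u => [|n IH] u; first by left.
rewrite iterSr; have [->|ur] := eqVneq u r; first by rewrite (par_root rt) => /IH.
by case/IH=> [<-|lt]; right; [exact: (or_rk rt) | exact: ltn_trans lt (or_rk rt ur)].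
Qed.

Lemma anc_anti u v : anc u v -> anc v u -> u = v.
Proof.
move=> /anc_rk[//|lt] /anc_rk[//|lt'].
by have := ltn_trans lt lt'; rewrite ltnn.
Qed.

Lemma anc_linear u v w : anc u v -> anc u w -> anc v w \/ anc w v.
Proof.
case/ancP=> n <-; case/ancP=> m <-; have [le|lt] := leqP n m.
  by left; apply/ancP; exists (m - n); rewrite -iterD subnK.
by right; apply/ancP; exists (n - m); rewrite -iterD subnK // ltnW.
Qed.

Lemma anc_below_neq c v : c != r -> par c = v -> ~~ anc v c.
Proof.
move=> cr <-; apply/negP => /anc_rk[E|lt]; first by have := par_neq rt cr; rewrite E eqxx.
by have := ltn_trans lt (or_rk rt cr); rewrite ltnn.
Qed.

Lemma anc_child u v : anc u v -> u != v ->
  exists c, [/\ c != r, par c = v & anc u c].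
Proof.
case/ancP=> n; elim: n u => [|n IH] u; first by move=> /= ->; rewrite eqxx.
rewrite iterSr => E uv; have [pE|pv] := eqVneq (par u) v.
  exists u; rewrite anc_refl; split=> //.
  by apply: contraNneq uv => ur; rewrite -pE ur (par_root rt).
have [c [cr pc uc]] := IH _ E pv; exists c; split=> //.
exact: anc_trans (anc_par u) uc.
Qed.

Lemma child_uniq u v c c' : c != r -> par c = v -> anc u c ->
  c' != r -> par c' = v -> anc u c' -> c = c'.
Proof.
move=> cr pc uc c'r pc' uc'; case: (anc_linear uc uc') => h.
  move: h; rewrite anc_step pc => /orP[/eqP //|vc'].
  by rewrite (negPf (anc_below_neq c'r pc')) in vc'.
move: h; rewrite anc_step pc' => /orP[/eqP //|vc'].
by rewrite (negPf (anc_below_neq cr pc)) in vc'.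
Qed.

Let prel := [rel x y : half T | ~~ is_open x && (src (opp x) == src y)].

(** A step goes to the parent or to a child. After a step to the parent the remaining ancestors are
    still ancestors of the new vertex, and a child has all the ancestors of its parent; the last
    vertex is the root. *)
Lemma path_to_infty_anc d p : path prel d p -> is_open (last d p) ->
  forall w, anc (src d) w -> w \in map src (d :: p).
Proof.
elim: p d => [|e p IH] d /=.
  by rewrite (or_open rt) => _ /eqP-> w; rewrite (or_src rt) anc_of_root inE.
case/andP=> /andP[nop /eqP de] pth lst w dw.
have sub : anc (src e) w -> w \in src d :: map src (e :: p).
  by move=> /(IH e pth lst) h; rewrite inE h orbT.
case: (or_up rt d) => dE; last first.
  have pE : par (src e) = src d by rewrite /parent -de -dE (or_oppK rt).
  by apply: sub; rewrite anc_step pE dw orbT.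
move: dw; rewrite anc_step => /orP[/eqP->|]; first by rewrite inE eqxx.
by rewrite /parent -dE de; exact: sub.
Qed.

Lemma canonical_path v : exists p, [/\ path_to_infty v p, uniq (map src p)
  & forall w, (w \in map src p) = anc v w].
Proof.
have [n] := ubnP (rk v); elim: n v => // n IH v ltn.
have [->|vr] := eqVneq v r.
  exists [:: up r]; split=> //=; first by rewrite (or_src rt) eqxx (up_open rt) eqxx.
  by move=> w; rewrite inE (or_src rt) anc_of_root.
have [|p [pth up_ mem]] := IH (par v); first exact: leq_trans (or_rk rt vr) _.
exists (up v :: p); split=> /=.
- case: p pth {up_ mem} => //= d p /and3P[/eqP ds pth lst].
  by rewrite (or_src rt) eqxx (up_open rt) vr pth lst ds eqxx.
- rewrite up_ andbT mem (or_src rt); exact: anc_below_neq.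
- by move=> w; rewrite inE mem (or_src rt) (anc_step v) [w == v]eq_sym.
Qed.

(** The chain of parents visits exactly the ancestors, each once, and every path to infinity visits
    all of them; hence a shortest one visits nothing else. *)
Lemma vleE v w : vle v w = anc v w.
Proof.
have [p [pth up_ mem]] := canonical_path v.
have anc_sub q : path_to_infty v q -> {subset map src p <= map src q}.
  case: q => // d q /and3P[/eqP dv pq lq] x; rewrite mem -dv.
  exact: path_to_infty_anc.
have min q : path_to_infty v q -> size p <= size q.
  by move=> /anc_sub sub; rewrite -(size_map src p) -(size_map src q) uniq_leq_size.
apply/existsP/idP => [[n /existsP[q /andP[/andP[pq /forallP short] wq]]]|vw].
  have sE : size q <= size p.
    rewrite leqNgt; apply/negP => lt; have /forallP/(_ (in_tuple p)) := short (Ordinal lt).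
    by rewrite pth.
  have := uniq_min_size up_ (anc_sub q pq); rewrite !size_map => /(_ sE)[_ sub].
  by rewrite -mem sub.
have lt : size p < #|vert T|.+1.
  by rewrite ltnS -(size_map src) -(card_uniqP up_) max_card.
exists (Ordinal lt); apply/existsP; exists (in_tuple p); rewrite /= mem vw andbT.
rewrite /shortest_to_infty pth; apply/forallP => m; apply/forallP => q; apply/negP => /min.
by rewrite size_tuple leqNgt ltn_ord.
Qed.

End Ancestors.

Section RootedHalves.

Variables (T : bytree) (r : vert T) (up : vert T -> half T) (rk : vert T -> nat).
Hypothesis rt : orooted r up rk.

Definition children (v : vert T) : {set vert T} := [set c | (c != r) && (parent up c == v)].

Lemma halves_at v : [set d : half T | src d == v] =
  up v |: [set opp (up c) | c in children v].
Proof.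
apply/setP => d; rewrite !inE; apply/eqP/orP => [dv|[/eqP->|/imsetP[c]]].
- case: (or_up rt d) => dE; first by left; rewrite dE dv.
  have [or|nr] := eqVneq (src (opp d)) r.
    have : is_open (opp d) by rewrite dE or (up_open rt).
    rewrite /is_open (or_oppK rt) => /eqP E; left; rewrite -dv {1}E {1}dE.
    by rewrite [in src d]E.
  right; apply/imsetP; exists (src (opp d)); last by rewrite -dE (or_oppK rt).
  by rewrite inE nr /parent -dE (or_oppK rt) dv eqxx.
- exact: (or_src rt).
- by rewrite inE => /andP[cr /eqP <-] ->.
Qed.

Lemma up_notin_children v : up v \notin [set opp (up c) | c in children v].
Proof.
apply/negP => /imsetP[c]; rewrite inE => /andP[cr /eqP pc] E.
by have := opp_up_neq rt cr; rewrite -/(parent up c) pc -E eqxx.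
Qed.

Lemma opp_up_inj : injective (fun c => opp (up c)).
Proof. by move=> c c' /(inv_inj (or_oppK rt))/(up_inj rt). Qed.

Lemma degree_children v : degree v = 1 + #|children v|.
Proof.
by rewrite /degree halves_at cardsU1 up_notin_children card_imset //; exact: opp_up_inj.
Qed.

Hypothesis wT : by_wf T.

Lemma blue_degree_children v : blue_degree v =
  blueH (up v) + #|[set c in children v | blueH (up c)]|.
Proof.
have -> : blue_degree v = #|[set d in [set d : half T | src d == v] | blueH d]|.
  by apply: eq_card => d; rewrite !inE.
rewrite halves_at setIdE setIUl; have -> : [set opp (up c) | c in children v] :&: [set d | blueH d]
    = [set opp (up c) | c in [set c in children v | blueH (up c)]].
  apply/setP => d; rewrite in_setI inE; apply/andP/imsetP => [[/imsetP[c cv ->]]|[c]].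
    by rewrite (by_bopp wT) => b; exists c => //; rewrite inE cv.
  by rewrite inE => /andP[cv b] ->; rewrite (by_bopp wT); split=> //; apply: imset_f.
have [b|nb] := boolP (blueH (up v)).
  have -> : [set up v] :&: [set d | blueH d] = [set up v].
    by apply/setIidPl; rewrite sub1set inE.
  rewrite cardsU1 card_imset; last exact: opp_up_inj.
  rewrite (_ : _ \notin _ = true) //; apply/negP => /imsetP[c]; rewrite inE => /andP[cv _] E.
  by have /negP := up_notin_children v; apply; rewrite E; apply: imset_f.
have -> : [set up v] :&: [set d | blueH d] = set0.
  by apply/setP => d; rewrite !inE; apply/negP => /andP[/eqP->]; rewrite (negPf nb).
by rewrite set0U card_imset //; exact: opp_up_inj.
Qed.

Lemma edge_col_orooted b u v : edge_col b u v =
  ((parent up u == v) && (blueH (up u) == b)) || ((parent up v == u) && (blueH (up v) == b)).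
Proof.
apply/existsP/orP => [[d /and3P[/eqP <- /eqP <- db]]|[/andP[/eqP <- ub]|/andP[/eqP <- vb]]].
- case: (or_up rt d) => dE; [left | right].
    by rewrite /parent -dE eqxx db.
  by rewrite /parent -dE (or_oppK rt) eqxx (by_bopp wT) db.
- by exists (up u); rewrite (or_src rt) !eqxx ub.
- by exists (opp (up v)); rewrite (or_oppK rt) (or_src rt) !eqxx (by_bopp wT) vb.
Qed.

End RootedHalves.

Lemma orooted_iso (T T' : bytree) r up rk r' up' rk' (f : vert T -> vert T') :
    @orooted T r up rk -> @orooted T' r' up' rk' -> by_wf T -> by_wf T' -> bijective f ->
    (forall v, by_gen (f v) = by_gen v) -> (forall v, blueV (f v) = blueV v) ->
    (forall v, parent up' (f v) = f (parent up v)) ->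
    (forall v, blueH (up' (f v)) = blueH (up v)) ->
  exists fH, by_iso_on f fH.
Proof.
move=> rt rt' wT wT' bf gE bE pE uE.
apply: simple_iso => //.
- by split; [exact: (or_oppK rt) | exact: (orooted_simple rt)].
- by split; [exact: (or_oppK rt') | exact: (orooted_simple rt')].
move=> b u v; rewrite (edge_col_orooted rt wT) (edge_col_orooted rt' wT').
by rewrite !pE !uE !(inj_eq (bij_inj bf)).
Qed.

Lemma orooted_transport (T T' : bytree) r up rk fV fH gV : @orooted T r up rk ->
  @by_iso_on T T' fV fH -> cancel fV gV -> cancel gV fV ->
  orooted (fV r) (fH \o up \o gV) (rk \o gV).
Proof.
move=> rt [[bV bH] sE oE _ _] gK fK; have [gH gHK fHK] := bH.
split=> /=.
- by move=> d; rewrite -[d]fHK !oE (or_oppK rt).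
- by move=> v; rewrite sE (or_src rt) fK.
- by move=> d; rewrite gK -[d]fHK /is_open oE !(inj_eq (bij_inj bH)) -(or_open rt).
- move=> d; rewrite -[d]fHK oE !sE !gK.
  by case: (or_up rt (gH d)) => E; [left | right]; congr fH.
- move=> v vr; rewrite oE sE gK; apply: (or_rk rt).
  by apply: contraNneq vr => <-; rewrite fK.
Qed.

Section TreePicture.

Variables (T : bytree) (r : vert T) (up : vert T -> half T) (rk : vert T -> nat).
Hypotheses (rt : orooted r up rk) (oT : open_by T).

Let wT := oT_wf oT.
Local Notation par := (parent up).
Local Notation anc := (ancestor up).
Local Notation ch := (children r up).
Local Notation X := (root_type T).

Definition home (x : X) : vert T := tag (val x).

(** The formula of [roots_at] would give 2 at a yellow vertex, which carries no roots. *)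
Definition weight (v : vert T) : nat := if blueV v then roots_at v else 0.

Lemma card_home v : #|[set x | home x == v]| = weight v.
Proof.
rewrite /weight; case: ifP => bv; last first.
  apply/eqP; rewrite cards_eq0; apply/eqP/setP => x; rewrite !inE; apply/negP => /eqP xv.
  by have := valP x; rewrite -/(home x) xv bv.
pose f (i : 'I_(roots_at v)) : X := Sub (existT (fun v => 'I_(roots_at v)) v i) bv.
rewrite -[RHS]card_ord -cardsT -(card_imset _ (f := f)).
  apply: eq_card => x; rewrite inE; apply/eqP/imsetP => [xv|[i _ ->]] //.
  case: x xv => -[u i] bu /= xv; rewrite /home /= in xv; subst u; exists i; rewrite ?inE //.
  exact: val_inj.
by move=> i j /(congr1 val)/eqP; rewrite -tag_eqE /tag_eq /= eqxx tagged_asE => /eqP.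
Qed.

Lemma mem_cluster_at x v : (x \in cluster_at v) = anc (home x) v.
Proof. by rewrite inE (vleE rt). Qed.

Definition csize v := #|cluster_at (T := T) v|.

Lemma csize_sum v : csize v = \sum_(u | anc u v) weight u.
Proof.
rewrite /csize -sum1_card (partition_big home (fun u => anc u v)) /=.
  apply: eq_bigr => u uv; rewrite -card_home -sum1_card; apply: eq_bigl => x.
  by rewrite mem_cluster_at inE; case: (home x =P u) => [->|]; rewrite ?uv ?andbF.
by move=> x; rewrite mem_cluster_at.
Qed.

Lemma csize_children v : csize v = weight v + \sum_(c in ch v) csize c.
Proof.
rewrite csize_sum (bigD1 v) ?anc_refl //=; congr (_ + _).
under [RHS]eq_bigr => c _ do rewrite csize_sum.
rewrite (exchange_big_dep (fun u => anc u v && (u != v))) /=.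
  apply: eq_bigr => u /andP[uv une]; have [c [cr pc uc]] := anc_child rt uv une.
  rewrite (big_pred1 c) // => c'; rewrite inE.
  apply/andP/eqP => [[/andP[c'r /eqP pc'] uc']|->]; last by rewrite cr pc eqxx.
  exact: (child_uniq rt c'r pc' uc' cr pc uc).
move=> c u; rewrite inE => /andP[cr /eqP pc] uc; apply/andP; split.
  by rewrite -pc; exact: (anc_trans uc (anc_par up c)).
apply: contraTneq uc => ->; exact: (anc_below_neq rt).
Qed.

Lemma child_rk v c : c \in ch v -> rk v < rk c.
Proof. by rewrite inE => /andP[cr /eqP <-]; exact: (or_rk rt). Qed.

Lemma rk_ind (P : vert T -> Prop) : (forall v, (forall c, c \in ch v -> P c) -> P v) ->
  forall v, P v.
Proof.
move=> IH v; have [m rkm] : exists m, forall v, rk v <= m.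
  by exists (\max_v rk v) => w; exact: leq_bigmax.
have [n] := ubnP (m - rk v); elim: n v => // n IHn v ltn; apply: IH => c cv; apply: IHn.
by have := child_rk cv; have := rkm c; move: ltn; lia.
Qed.

Lemma up_blue_src v : blueH (up v) -> blueV v.
Proof. by move=> /(blue_src (oT_c1 oT)); rewrite (or_src rt). Qed.

Lemma blue_balance v : blueV v ->
  roots_at v + (blueH (up v) + #|[set c in ch v | blueH (up c)]|) = 2 * by_gen v + 2.
Proof.
by move=> bv; rewrite -(blue_degree_children rt wT) /roots_at subnK //; exact: (oT_c3 oT).
Qed.

Lemma child_blue v c : c \in ch v -> blueH (up c) -> blueV v.
Proof.
rewrite inE => /andP[_ /eqP <-] b; rewrite /parent; apply: (blue_src (oT_c1 oT)).
by rewrite (by_bopp wT).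
Qed.

(** Induction from the leaves. At a blue vertex the roots and the blue half-edges together number
    [2 * by_gen v + 2], an even number, so the parity passes from the children to [up v]; at a
    yellow vertex nothing is odd. As to positivity, a blue vertex without roots has at least two
    blue half-edges, hence a child, and a yellow one has at least two children. *)
Lemma csize_odd_gt0 v : odd (csize v) = blueH (up v) /\ 0 < csize v.
Proof.
elim/rk_ind: v => v IH; rewrite csize_children.
have oddS : odd (\sum_(c in ch v) csize c) = odd #|[set c in ch v | blueH (up c)]|.
  rewrite -sum1dep_card big_mkcondr /=.
  apply: (big_ind2 (fun x y => odd x = odd y)) => // [x1 x2 y1 y2|c cv].
    by rewrite !oddD => -> ->.
  by have [-> _] := IH c cv; case: blueH.
have geS : #|ch v| <= \sum_(c in ch v) csize c.
  by rewrite -sum1_card; apply: leq_sum => c cv; have [] := IH c cv.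
rewrite /weight oddD oddS; have [bv|yv] := boolP (blueV v).
  have E := blue_balance bv; split.
    have : odd (2 * by_gen v + 2) = false.
      by rewrite -[X in _ + X]/(2 * 1) -mulnDr mul2n odd_double.
    rewrite -E !oddD oddb.
    by case: (odd (roots_at v)); case: (odd #|_|); case: (blueH (up v)).
  rewrite addn_gt0; case: (posnP (roots_at v)) => //= r0; apply: leq_trans geS.
  rewrite r0 in E; have : 0 < #|[set c in ch v | blueH (up c)]|.
    by move: E; case: (blueH (up v)) => /=; lia.
  move=> h; apply: leq_trans h _; apply/subset_leq_card/subsetP => c.
  by rewrite inE => /andP[].
split.
  have -> : blueH (up v) = false by apply: contraNF yv => /up_blue_src.
  rewrite (_ : [set c in ch v | _] = set0) ?cards0 //; apply/setP => c; rewrite !inE.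
  apply/negP => /andP[cv b]; move: yv; rewrite (@child_blue v c) //.
  by rewrite inE.
apply: leq_trans geS; have [_ deg _] := oT_c1 oT yv.
by move: deg; rewrite (degree_children rt); lia.
Qed.

Lemma csize_gt0 v : 0 < csize v. Proof. by have [] := csize_odd_gt0 v. Qed.

Lemma csize_odd v : odd (csize v) = blueH (up v). Proof. by have [] := csize_odd_gt0 v. Qed.

Lemma csize_root : csize r = #|X|.
Proof.
by rewrite /csize -cardsT; apply: eq_card => x; rewrite mem_cluster_at (anc_root rt) inE.
Qed.

(** The sizes could agree only if [v] had no roots and [c] as its only child. A yellow vertex has
    two children. A blue one would have genus 0 and both its half-edges blue, against [by_cond2].
    This is what makes distinct vertices give distinct clusters. *)
Lemma csize_child v c : c \in ch v -> csize c < csize v.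
Proof.
move=> cv; rewrite (csize_children v) (bigD1 c) //= addnCA -[X in X < _]addn0 ltn_add2l.
rewrite addn_gt0; have [w0|//] := posnP (weight v).
suff [c' c'v cc'] : exists2 c', c' \in ch v & c' != c.
  by rewrite (bigD1 c') /= ?c'v // addn_gt0 csize_gt0.
case: (pickP [pred c' | (c' \in ch v) && (c' != c)]) => [c' /andP[]|none]; first by exists c'.
have chE : ch v = [set c].
  apply/setP => x; rewrite in_set1; have := none x; rewrite /=.
  by have [->|_] := eqVneq x c; rewrite ?cv // andbT.
have [bv|yv] := boolP (blueV v); last first.
  have [_ deg _] := oT_c1 oT yv.
  by move: deg; rewrite (degree_children rt) chE cards1.
rewrite /weight bv in w0; have E := blue_balance bv; rewrite w0 chE in E.
have le1 : #|[set c0 in [set c] | blueH (up c0)]| <= 1.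
  by rewrite -(cards1 c); apply/subset_leq_card/subsetP => x; rewrite inE => /andP[].
have bup : blueH (up v) by move: E le1; case: (blueH (up v)) => //=; lia.
have gv : by_gen v = 0 by move: E le1; rewrite bup /=; lia.
have buc : blueH (up c).
  have : 0 < #|[set c0 in [set c] | blueH (up c0)]| by move: E; rewrite bup; lia.
  by case/card_gt0P=> x; rewrite !inE => /andP[/eqP->].
have c2 : by_cond2 T.
  case: (oT) => _ _ _ _ [//|[V1 _ _]].
  by move: cv; rewrite inE => /andP[/eqP[]]; exact: card1_eq.
have [d dv yd] := c2 v bv gv.
have : d \in [set d : half T | src d == v] by rewrite inE dv.
rewrite (halves_at rt) chE !inE => /orP[/eqP dE|/imsetP[x]].
  by rewrite dE bup in yd.
by rewrite inE => /eqP-> dE; rewrite dE (by_bopp wT) buc in yd.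
Qed.

Lemma csize_anc u v : anc u v -> u != v -> csize u < csize v.
Proof.
case/ancP=> n; elim: n u => [|n IH] u; first by move=> /= ->; rewrite eqxx.
rewrite iterSr => E uv; have ur : u != r.
  apply: contraNneq uv => ur; move: E; rewrite ur (par_root rt) => /esym vE.
  have : anc r v by apply/ancP; exists n.
  by rewrite (anc_of_root rt) => /eqP->.
have lt : csize u < csize (par u) by apply: csize_child; rewrite inE ur eqxx.
have [pE|pv] := eqVneq (par u) v; first by rewrite -pE.
exact: ltn_trans lt (IH _ E pv).
Qed.

Lemma cluster_at_sub u v : (cluster_at u \subset cluster_at v) = anc u v.
Proof.
apply/subsetP/idP => [sub|uv x]; last first.
  by rewrite !mem_cluster_at => xu; exact: anc_trans xu uv.
have /card_gt0P[x xu] := csize_gt0 u; have xv := sub x xu.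
rewrite !mem_cluster_at in xu xv; case: (anc_linear xu xv) => // vu.
have [->|ne] := eqVneq v u; first exact: anc_refl.
have := csize_anc vu ne; rewrite ltnNge => /negP[]; apply: subset_leq_card.
exact/subsetP.
Qed.

Lemma cluster_at_inj : injective (@cluster_at T).
Proof.
by move=> u v E; apply: (anc_anti rt); rewrite -cluster_at_sub E.
Qed.

(** An even size is at least 2. If the size is odd, a positive genus forces at least
    [2 * by_gen v + 1] points, and genus 0 forces a yellow edge to a child, whose cluster has even
    size. So vertices give proper clusters. *)
Lemma csize_gt1 v : #|X| != 1 -> 1 < csize v.
Proof.
move=> X1; have [b|y] := boolP (blueH (up v)); last first.
  by have := csize_odd v; rewrite (negPf y); have := csize_gt0 v; case: (csize v) => [|[]].
have bv := up_blue_src b; have E := blue_balance bv; rewrite b /= in E.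
have [g0|gn] := eqVneq (by_gen v) 0; last first.
  rewrite csize_children /weight bv.
  have : #|[set c in ch v | blueH (up c)]| <= \sum_(c in ch v) csize c.
    apply: leq_trans (_ : #|ch v| <= _).
      by apply/subset_leq_card/subsetP => c; rewrite inE => /andP[].
    by rewrite -sum1_card; apply: leq_sum => c _; exact: csize_gt0.
  by move: E gn; lia.
case: (oT) => _ _ _ _ [c2|[V1 _ _]]; last first.
  have vr : v = r by exact: card1_eq.
  have := csize_gt0 v; rewrite leq_eqVlt => /orP[/eqP E1|//].
  by move: X1; rewrite -csize_root -vr -E1.
have [d dv yd] := c2 v bv g0.
have : d \in [set d : half T | src d == v] by rewrite inE dv.
rewrite (halves_at rt) !inE => /orP[/eqP dE|/imsetP[c cv dE]].
  by rewrite dE b in yd.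
apply: ltn_trans (csize_child cv).
have : odd (csize c) = false by rewrite csize_odd; apply: negbTE; rewrite -(by_bopp wT) -dE.
by have := csize_gt0 c; case: (csize c) => [|[]].
Qed.

Lemma C_of_T_picture : cluster_picture (C_of_T T).
Proof.
have inC v : cluster_at v \in clusters (C_of_T T).
  by apply/setUP; left; apply/imsetP; exists v.
have in1 x : [set x] \in clusters (C_of_T T) by apply/setUP; right; apply/imsetP; exists x.
split=> //.
- apply/negP => /setUP[/imsetP[v _ E]|/imsetP[x _ E]].
    by have := csize_gt0 v; rewrite /csize -E cards0.
  by have := set11 x; rewrite -E inE.
- have -> : [set: X] = cluster_at r; last exact: inC.
  by apply/setP => x; rewrite mem_cluster_at (anc_root rt) inE.
have sing (x : X) (t : {set X}) : [\/ [disjoint [set x] & t], [set x] \subset t | t \subset [set x]].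
  have [xt|xt] := boolP (x \in t); first by constructor 2; rewrite sub1set.
  by constructor 1; rewrite disjoints1.
move=> s t /setUP[/imsetP[u _ ->]|/imsetP[x _ ->]] //.
case/setUP=> [/imsetP[v _ ->]|/imsetP[x _ ->]]; last first.
  case: (sing x (cluster_at u)) => h; [constructor 1 | constructor 3 | constructor 2] => //.
  by rewrite disjoint_sym.
have [uv|nuv] := boolP (anc u v); first by constructor 2; rewrite cluster_at_sub.
have [vu|nvu] := boolP (anc v u); first by constructor 3; rewrite cluster_at_sub.
constructor 1; rewrite -setI_eq0; apply/eqP/setP => x; rewrite in_setI !mem_cluster_at in_set0.
apply/negP => /andP[xu xv]; case: (anc_linear xu xv) => h.
  by rewrite h in nuv.
by rewrite h in nvu.
Qed.

End TreePicture.

(** * The BY tree of a cluster picture *)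

Section Picture.

Variable C : picture.
Hypothesis hC : cluster_picture C.
Local Notation Sig := (clusters C).
Implicit Types (s t u p : {set pts C}) (x : pts C).

Lemma cp_setT : setT \in Sig. Proof. by case: hC. Qed.

Lemma cp_set1 x : [set x] \in Sig. Proof. by case: hC. Qed.

Lemma cp_neq0 s : s \in Sig -> exists x, x \in s.
Proof.
by case: hC => h0 _ _ _ sC; apply/set0Pn; apply: contraNneq h0 => <-.
Qed.

Lemma cp_gt0 s : s \in Sig -> 0 < #|s|.
Proof. by move=> /cp_neq0 ?; apply/card_gt0P. Qed.

Lemma cp_nested s t x : s \in Sig -> t \in Sig -> x \in s -> x \in t ->
  s \subset t \/ t \subset s.
Proof.
case: hC => _ _ _ lam sC tC xs xt; case: (lam s t sC tC); [|by left|by right].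
by move=> /disjoint_setI0 E; have := in_setI x s t; rewrite E inE xs xt.
Qed.

Lemma childP s p : reflect [/\ s \in Sig, p \in Sig, s \proper p &
  forall t, t \in Sig -> s \proper t -> t \proper p -> False] (child s p).
Proof.
apply: (iffP and4P) => [[sC pC sp /forall_inP h]|[sC pC sp h]]; split=> //.
  by move=> t /h; rewrite negb_and => /orP[/negP ?|/negP ?].
by apply/forall_inP => t tC; apply/negP => /andP[]; exact: h.
Qed.

Lemma child_below s p u : child s p -> u \in Sig -> s \proper u -> p \subset u.
Proof.
case/childP=> sC pC sp h uC su; have [x xs] := cp_neq0 sC.
have xp := subsetP (proper_sub sp) x xs; have xu := subsetP (proper_sub su) x xs.
case: (cp_nested pC uC xp xu) => // up.
have [->//|ne] := eqVneq u p.
by case: (h u uC su); rewrite properEneq ne.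
Qed.

Lemma child_uniqp s p p' : child s p -> child s p' -> p = p'.
Proof.
move=> h h'; apply/eqP; rewrite eqEsubset.
have /childP[_ pC sp _] := h; have /childP[_ pC' sp' _] := h'.
by rewrite (child_below h pC' sp') (child_below h' pC sp).
Qed.

Lemma parent_exists s : s \in Sig -> s != setT -> exists p, child s p.
Proof.
move=> sC sT; have P0 : (setT \in Sig) && (s \proper setT).
  by rewrite cp_setT properEneq sT subsetT.
have [p /andP[pC sp] pmin] := @arg_minnP _ setT (fun p => (p \in Sig) && (s \proper p))
  (fun p => #|p|) P0.
exists p; apply/childP; split=> // t tC st tp.
have := pmin t; rewrite tC st => /(_ isT); rewrite leqNgt.
by rewrite (proper_card tp).
Qed.

Lemma child_exists s x : s \in Sig -> 1 < #|s| -> x \in s ->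
  exists2 t, child t s & x \in t.
Proof.
move=> sC s1 xs; have P0 : [&& [set x] \in Sig, x \in [set x] & [set x] \proper s].
  rewrite cp_set1 set11 properEcard sub1set xs cards1.
  exact: s1.
have [t /and3P[tC xt ts] tmax] := @arg_maxnP _ [set x]
  (fun t => [&& t \in Sig, x \in t & t \proper s]) (fun t => #|t|) P0.
exists t => //; apply/childP; split=> // u uC tu us.
have := tmax u; rewrite uC us (subsetP (proper_sub tu)) // => /(_ isT).
by rewrite /= leqNgt (proper_card tu).
Qed.

Lemma child_inter s t t' x : child t s -> child t' s -> x \in t -> x \in t' -> t = t'.
Proof.
move=> /childP[tC sC ts h] /childP[tC' _ ts' h'] xt xt'.
apply/eqP/contraT => ne; case: (cp_nested tC tC' xt xt') => sub.
  by case: (h t' tC') => //; rewrite properEneq ne.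
by case: (h' t tC) => //; rewrite properEneq eq_sym ne.
Qed.

Lemma card_children s : s \in Sig -> 1 < #|s| -> #|s| = \sum_(t | child t s) #|t|.
Proof.
move=> sC s1; under [RHS]eq_bigr => t _ do rewrite -sum1_card.
rewrite (exchange_big_dep (fun x => x \in s)) /=; last first.
  by move=> t x /childP[_ _ /proper_sub/subsetP ts _]; exact: ts.
rewrite -sum1_card; apply: eq_bigr => x xs; have [t ts xt] := child_exists sC s1 xs.
rewrite sum1_card (eq_card (_ : _ =i [set t])) ?cards1 // => t'.
rewrite in_set1; apply/andP/eqP => [[ts' xt']|->] //.
exact: child_inter ts' ts xt' xt.
Qed.

Lemma odd_card_children s : s \in Sig -> 1 < #|s| -> odd #|s| = odd #|odd_children s|.
Proof.
move=> sC s1; rewrite (card_children sC s1) -sum1dep_card.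
rewrite [in RHS]big_mkcondr; elim/big_rec2: _ => // t n m _ E.
by rewrite !oddD E; case: (odd #|t|).
Qed.

Lemma proper_clusterP s : s \in Sig -> 1 < #|s| -> proper_cluster s.
Proof. by move=> sC s1; rewrite /proper_cluster sC s1. Qed.

Lemma child_card s p : child s p -> #|s| < #|p|.
Proof. by case/childP=> _ _ /proper_card. Qed.

Lemma child_gt1 s p : child s p -> 1 < #|p|.
Proof.
move=> sp; have /childP[sC _ _ _] := sp.
by apply: leq_trans (child_card sp); rewrite ltnS cp_gt0.
Qed.

Lemma child_proper s p : child s p -> proper_cluster p.
Proof. by move=> sp; apply: proper_clusterP (child_gt1 sp); case/childP: sp. Qed.

Lemma setT_proper : proper_cluster [set: pts C].
Proof.
rewrite /proper_cluster cp_setT cardsT; have := cp_gt0 cp_setT; rewrite cardsT.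
by case: #|_| => [|[|]].
Qed.

Lemma proper_gt1 s : #|pts C| != 1 -> proper_cluster s -> 1 < #|s|.
Proof. by move=> X1 /andP[_ /orP[//|/andP[_]]]; rewrite (negPf X1). Qed.

Lemma pts_gt1 s p : child s p -> #|pts C| != 1.
Proof.
by move=> /child_gt1 p1; have := max_card p; case: #|pts C| p1 => [|[|]] //; case: #|p| => [|[|]].
Qed.

Local Notation T := (T_of_C C).

Definition topv : vert T := (Sub setT setT_proper : cvert C).

Lemma val_topv : val topv = setT. Proof. by []. Qed.

Lemma T_of_C_wf : by_wf T.
Proof.
split; first by case=> [[e b]|v] //=; rewrite negbK.
by case=> [[e b]|v].
Qed.

Lemma cvert_in (v : cvert C) : val v \in Sig. Proof. by have /andP[] := valP v. Qed.

Lemma topvE (v : vert T) : (v == topv) = (val v == setT).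
Proof. by rewrite -(inj_eq val_inj) val_topv. Qed.

(** A cluster other than the whole set is the child of exactly one cluster, its parent in the tree;
    the size of the complement serves as rank. *)
Lemma cluster_rooted : exists up rk, @orooted T topv up rk /\
  forall v : vert T, blueH (up v) = odd #|val v| /\ (v != topv -> child (val v) (val (parent up v))).
Proof.
have top_t : val (topv : cvert C) == setT by rewrite val_topv.
pose o : half T := inr (Sub topv top_t : ctop C).
have /fin_all_exists[up upP] (v : vert T) : exists d : half T, src d = v /\
    if v == topv then d = o else exists2 e : cedge C, d = inl (e, false) & (val e).1 = v.
  have [->|vt] := eqVneq v topv; first by exists o.
  have [p vp] : exists p, child (val v) p.
    by apply: parent_exists; [exact: cvert_in | rewrite -topvE].
  have P : child (val (v, Sub p (child_proper vp) : cvert C).1) (val (v, Sub p (child_proper vp) : cvert C).2).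
    by [].
  by exists (inl (Sub (v, Sub p (child_proper vp) : cvert C) P, false)); split=> //; eexists.
have ctopE (t : ctop C) : inr t = o.
  by congr inr; apply/val_inj/val_inj/eqP; exact: valP t.
have cedgeE (e e' : cedge C) : (val e).1 = (val e').1 -> e = e'.
  move=> E; have h := valP e; have h' := valP e'; apply: val_inj.
  case: (val e) (val e') E h h' => [v w] [v' w'] /= -> h h'.
  by congr (_, _); apply: val_inj; exact: child_uniqp h h'.
have upT : up topv = o by have [_] := upP topv; rewrite eqxx.
have upE (v : vert T) : v != topv -> exists2 e : cedge C, up v = inl (e, false) & (val e).1 = v.
  by move=> vt; have [_] := upP v; rewrite (negPf vt).
have notT (e : cedge C) : (val e).1 != topv.
  rewrite topvE; apply/eqP => E; have /childP[_ _] := valP e.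
  by rewrite E => /proper_card; rewrite cardsT ltnNge max_card.
have upe (e : cedge C) : up (val e).1 = inl (e, false).
  by have [e' -> E] := upE _ (notT e); rewrite (cedgeE _ _ E).
exists up, (fun v : vert T => #|pts C| - #|val v|); split; last first.
  move=> v; have [->|vt] := eqVneq v topv; first by rewrite upT.
  have [e ue ev] := upE v vt; rewrite /parent ue /= ev; split=> // _.
  by have := valP e; rewrite ev.
split.
- exact: (by_oppK T_of_C_wf).
- by move=> v; have [] := upP v.
- move=> d; rewrite upT; case: d => [[e b]|t]; rewrite /is_open /=.
    by transitivity false => //; apply/negbTE/eqP => -[]; case: b.
  by rewrite ctopE !eqxx.
- case=> [[e b]|t]; last by left; rewrite ctopE /= upT.
  by case: b; [right | left]; rewrite /= upe.
- move=> v vt; have [e ue ev] := upE v vt; rewrite ue /=.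
  have := valP e; rewrite ev => /child_card lt; have := max_card (val (val e).2).
  by move: lt => /= lt le; rewrite ltn_sub2l // (leq_trans lt).
Qed.

Section Rooted.

Variables (up : vert T -> half T) (rk : vert T -> nat).
Hypothesis rt : orooted topv up rk.
Hypothesis upP : forall v : vert T, blueH (up v) = odd #|val v| /\
  (v != topv -> child (val v) (val (parent up v))).

Local Notation par := (parent up).
Local Notation anc := (ancestor up).
Local Notation ch := (children topv up).

Lemma up_odd (v : vert T) : blueH (up v) = odd #|val v|. Proof. by have [] := upP v. Qed.

Lemma par_child (v : vert T) : v != topv -> child (val v) (val (par v)).
Proof. by have [] := upP v. Qed.

Lemma child_not_top (c : vert T) p : child (val c) p -> c != topv.
Proof.
move=> /childP[_ _ /proper_card lt _]; rewrite topvE; apply: contraTneq lt => ->.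
by rewrite cardsT -leqNgt max_card.
Qed.

Lemma mem_children (c v : vert T) : (c \in ch v) = child (val c) (val v).
Proof.
rewrite inE; apply/andP/idP => [[ct /eqP <-]|cv]; first exact: par_child.
have ct := child_not_top cv; rewrite ct; split=> //; apply/eqP/val_inj.
exact: child_uniqp (par_child ct) cv.
Qed.

Lemma ancE (v w : vert T) : anc v w = (val v \subset val w).
Proof.
apply/idP/idP => [/ancP[n <-]|].
  elim: n v => [|n IH] v //; rewrite iterSr; have [->|vt] := eqVneq v topv.
    by rewrite (par_root rt).
  by apply: subset_trans (IH _); have /childP[_ _ /proper_sub] := par_child vt.
have [n] := ubnP (rk v); elim: n v => // n IH v ltn vw.
have [->|ne] := eqVneq v w; first exact: anc_refl.
have vt : v != topv.
  apply: contraNneq ne => E; apply/eqP/val_inj/eqP; rewrite eqEsubset vw.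
  by rewrite E subsetT.
rewrite anc_step IH ?orbT //; first exact: leq_trans (or_rk rt vt) _.
apply: child_below (par_child vt) (cvert_in w) _.
by rewrite properEneq vw (inj_eq val_inj) ne.
Qed.

Lemma home_exists x : exists v : vert T, x \in val v /\
  forall w : vert T, x \in val w -> val v \subset val w.
Proof.
have P0 : x \in val topv by rewrite val_topv inE.
have [v xv vmin] := @arg_minnP _ topv (fun v : vert T => x \in val v) (fun v => #|val v|) P0.
exists v; split=> // w xw; case: (cp_nested (cvert_in v) (cvert_in w) xv xw) => // wv.
have := vmin w xw => le; have [-> //|ne] := eqVneq (val w) (val v).
by have := proper_card (_ : val w \proper val v); rewrite properEneq ne wv ltnNge le => /(_ isT).
Qed.

Lemma home_child x (v : vert T) : #|pts C| != 1 ->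
  (x \in val v /\ forall w : vert T, x \in val w -> val v \subset val w) <-> child [set x] (val v).
Proof.
move=> X1; have v1 : 1 < #|val v| := proper_gt1 X1 (valP v).
split=> [[xv vmin]|xv]; last first.
  have /childP[_ _ sub _] := xv; split; first by rewrite -sub1set proper_sub.
  move=> w xw; apply: child_below xv (cvert_in w) _.
  by rewrite properEcard sub1set xw cards1 proper_gt1 // (valP w).
have [t tv xt] := child_exists (cvert_in v) v1 xv.
suff <- : t = [set x] by [].
have /childP[tC _ tpv _] := tv; apply/eqP; rewrite eq_sym eqEcard sub1set xt cards1 /= leqNgt.
apply/negP => t1; have := vmin (Sub t (proper_clusterP tC t1)); rewrite SubK => /(_ xt).
by move=> vt; have := properP tpv; case=> _ [y yv]; rewrite (subsetP vt).
Qed.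

Definition singles (s : {set pts C}) : {set pts C} := [set x | child [set x] s].

Lemma card_odd_children (v : vert T) : #|pts C| != 1 ->
  #|odd_children (val v)| = #|[set c in ch v | blueH (up c)]| + #|singles (val v)|.
Proof.
move=> X1; have -> : odd_children (val v) =
    [set val c | c in [set c in ch v | blueH (up c)]] :|: [set [set x] | x in singles (val v)].
  apply/setP => t; rewrite in_setU inE; apply/andP/orP => [[tv ot]|[/imsetP[c]|/imsetP[x]]].
  - have /childP[tC _ _ _] := tv; have [t1|t1] := ltnP 1 #|t|.
      left; apply/imsetP; exists (Sub t (proper_clusterP tC t1)); last by rewrite SubK.
      by rewrite inE mem_children up_odd SubK tv.
    right; have /cards1P[x tE] : #|t| == 1 by rewrite eqn_leq t1 cp_gt0.
    by apply/imsetP; exists x => //; rewrite inE -tE.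
  - by rewrite inE mem_children up_odd => /andP[cv oc] ->.
  - by rewrite inE => xv ->; rewrite cards1.
rewrite cardsU (_ : _ :&: _ = set0) ?cards0 ?subn0; last first.
  apply/setP => t; rewrite in_setI in_set0; apply/negP => /andP[/imsetP[c _ ->] /imsetP[x _ E]].
  by have := proper_gt1 X1 (valP c); rewrite E cards1.
by rewrite !card_imset //; [exact: set1_inj | exact: val_inj].
Qed.

Lemma ubereven1 s : #|pts C| = 1 -> ubereven s = false.
Proof. by rewrite /ubereven => ->. Qed.

Lemma ubereven_no s : ubereven s -> odd_children s = set0.
Proof. by case/andP=> _ /eqP. Qed.

Lemma nubereven_odd s : #|pts C| != 1 -> ~~ ubereven s -> 0 < #|odd_children s|.
Proof. by move=> X1; rewrite /ubereven X1 card_gt0. Qed.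

(** The number of odd children is 2g + 1 or 2g + 2, and its parity is that of the cluster. *)
Lemma genus_balance (v : vert T) : #|pts C| != 1 -> blueV v ->
  2 * by_gen v + 2 = #|odd_children (val v)| + odd #|val v|.
Proof.
move=> X1 bv; rewrite /= /cluster_genus (negPf bv) /genus_of_size.
rewrite odd_card_children ?cvert_in ?(proper_gt1 X1 (valP v)) //.
by have := nubereven_odd X1 bv; move: #|_| => n; lia.
Qed.

Lemma one_point : #|pts C| = 1 -> forall v : vert T, v = topv.
Proof.
move=> X1 v; apply/eqP; rewrite topvE eqEcard subsetT cardsT X1.
exact: cp_gt0 (cvert_in v).
Qed.

Lemma one_point_gen : #|pts C| = 1 -> forall v : vert T, by_gen v = 0.
Proof.
move=> X1 v; rewrite /= /cluster_genus ubereven1 // /genus_of_size.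
rewrite (_ : odd_children _ = set0) ?cards0 //; apply/setP => t; rewrite !inE.
by apply/negP => /andP[/pts_gt1]; rewrite X1.
Qed.

Lemma one_point_half : #|pts C| = 1 -> forall d : half T, d = up topv.
Proof. by move=> X1; apply: (lone_half rt); exact: one_point. Qed.

Lemma yellow_cluster (v : vert T) : ~~ blueV v ->
  [/\ #|pts C| != 1, forall t, child t (val v) -> ~~ odd #|t| & odd #|val v| = false].
Proof.
rewrite negbK => uv; have X1 : #|pts C| != 1 by case/andP: uv.
split=> // [t tv|]; last first.
  by rewrite odd_card_children ?cvert_in ?(proper_gt1 X1 (valP v)) // ubereven_no ?cards0.
by apply/negP => ot; have := ubereven_no uv => /setP/(_ t); rewrite !inE tv ot.
Qed.

Lemma two_children (v : vert T) t : child t (val v) ->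
  exists2 t', child t' (val v) & t' != t.
Proof.
move=> tv; have /childP[tC vC /properP[_ [y yv yt]] _] := tv.
have [t' t'v yt'] := child_exists vC (child_gt1 tv) yv; exists t' => //.
by apply: contraNneq yt => <-.
Qed.

Lemma T_of_C_open : open_by T.
Proof.
have wT := T_of_C_wf; split.
- by split=> //; exact: (orooted_tree rt).
- apply/eqP/cards1P; exists (up topv); apply/setP => d.
  by rewrite !inE (or_open rt).
- move=> v yv; have [X1 ev ov] := yellow_cluster yv.
  have even_c c : c \in ch v -> blueH (up c) = false.
    by rewrite mem_children up_odd => /ev/negPf.
  split.
  + by move: yv; rewrite /= negbK /cluster_genus => ->.
  (* All children of an ubereven cluster are even, hence proper, and there are at least two of them;
     the half-edge towards infinity is the third. *)
  + rewrite (degree_children rt) ltnS.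
    have v1 := proper_gt1 X1 (valP v); have [x xv] := cp_neq0 (cvert_in v).
    have [t tv xt] := child_exists (cvert_in v) v1 xv; have [t' t'v ne] := two_children tv.
    have pr u : child u (val v) -> exists2 c, c \in ch v & val c = u.
      move=> uv; have /childP[uC _ _ _] := uv; have u1 : 1 < #|u|.
        by have := ev u uv; have := cp_gt0 uC; case: #|u| => [|[]].
      by exists (Sub u (proper_clusterP uC u1)); rewrite ?mem_children SubK.
    have [c cv cE] := pr t tv; have [c' c'v c'E] := pr t' t'v.
    have <- : #|[set c; c']| = 2.
      by rewrite cards2 -(inj_eq val_inj) cE c'E eq_sym ne.
    by apply/subset_leq_card/subsetP => z; rewrite in_set2 => /orP[] /eqP->.
  + move=> d dv; have : d \in [set d : half T | src d == v] by rewrite inE dv.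
    rewrite (halves_at rt) !inE => /orP[/eqP->|/imsetP[c cv ->]].
      by rewrite up_odd ov.
    by rewrite (by_bopp wT) even_c.
- move=> v; rewrite (blue_degree_children rt wT).
  have [X1|X1] := eqVneq #|pts C| 1.
    rewrite (_ : [set c in _ | _] = set0) ?cards0 ?addn0; first by case: (blueH _); lia.
    apply/setP => c; rewrite [in RHS]inE; apply/negP; rewrite inE mem_children => /andP[/pts_gt1].
    by rewrite X1.
  have [bv|yv] := boolP (blueV v); last first.
    have [_ ev ov] := yellow_cluster yv; rewrite up_odd ov.
    rewrite (_ : [set c in _ | _] = set0) ?cards0 //; apply/setP => c; rewrite [in RHS]inE.
    by apply/negP; rewrite inE mem_children up_odd => /andP[/ev/negPf->].
  rewrite (genus_balance X1 bv) up_odd addnC leq_add2r card_odd_children //.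
  exact: leq_addr.
- have [X1|X1] := eqVneq #|pts C| 1.
    right; split.
    + rewrite -(card1 (topv : vert T)); apply: eq_card => v; rewrite [RHS]inE.
      by rewrite (one_point X1 v) eqxx.
    + by move=> v; rewrite one_point_gen //= ubereven1.
    + split.
        rewrite -(card1 (up topv)); apply: eq_card => d; rewrite [RHS]inE.
        by rewrite (one_point_half X1 d) eqxx.
      by move=> d; rewrite (one_point_half X1 d) (up_open rt) eqxx up_odd val_topv cardsT X1.
  (* An even cluster has a yellow half-edge towards infinity. An odd one of genus 0 has exactly one
     odd child; any other child is even, hence proper and joined by a yellow edge. *)
  left=> v bv g0; have E := genus_balance X1 bv; rewrite g0 in E.
  have [ov|ev] := boolP (odd #|val v|); last first.
    by exists (up v); rewrite ?(or_src rt) // up_odd.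
  have v1 := proper_gt1 X1 (valP v).
  have {E}E : #|odd_children (val v)| = 1 by move: #|odd_children _| E => n; rewrite ov /=; lia.
  have : 0 < #|odd_children (val v)| by rewrite E.
  case/card_gt0P=> t; rewrite inE => /andP[tv ot]; have [t' t'v ne] := two_children tv.
  have et' : ~~ odd #|t'|.
    apply/negP => ot'; have : 1 < #|odd_children (val v)|.
      have <- : #|[set t; t']| = 2 by rewrite cards2 eq_sym ne.
      by apply/subset_leq_card/subsetP => z; rewrite !inE => /orP[] /eqP->; rewrite ?tv ?ot ?t'v ?ot'.
    by rewrite E.
  have /childP[tC' _ _ _] := t'v; have t'1 : 1 < #|t'|.
    by have := cp_gt0 tC'; move: et'; case: #|t'| => [|[]].
  pose c : vert T := Sub t' (proper_clusterP tC' t'1).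
  have cv : c \in ch v by rewrite mem_children SubK.
  exists (opp (up c)); last by rewrite (by_bopp wT) up_odd SubK.
  by move: cv; rewrite inE => /andP[_ /eqP].
Qed.

(** The odd children are the proper ones, which give the blue edges to children, and single points.
    By [genus_balance] there are as many of the latter as roots; they are the points for which [v]
    is the smallest proper cluster around them. *)
Lemma cluster_roots (v : vert T) : blueV v ->
  roots_at v = #|[set x | (x \in val v) && [forall w : vert T, (x \in val w) ==> (val v \subset val w)]]|.
Proof.
have wT := T_of_C_wf; move=> bv; rewrite /roots_at (blue_degree_children rt wT).
have [X1|X1] := eqVneq #|pts C| 1.
  rewrite one_point_gen // up_odd (_ : [set c in _ | _] = set0) ?cards0 ?addn0; last first.
    apply/setP => c; rewrite [in RHS]inE; apply/negP; rewrite inE mem_children => /andP[/pts_gt1].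
    by rewrite X1.
  rewrite (one_point X1 v) val_topv cardsT X1 /=.
  rewrite (_ : [set x | _] = setT) ?cardsT ?X1 //; apply/setP => x; rewrite !inE.
  by apply/forallP => w; rewrite (one_point X1 w) subxx implybT.
rewrite (genus_balance X1 bv) up_odd card_odd_children //.
have -> : [set x | (x \in val v) && [forall w : vert T, (x \in val w) ==> (val v \subset val w)]]
    = singles (val v).
  apply/setP => x; rewrite !inE; apply/andP/idP => [[xv /forallP h]|].
    by apply/(home_child x v X1); split=> // w; apply/implyP.
  by move=> /(home_child x v X1)[xv h]; split=> //; apply/forallP => w; apply/implyP/h.
by lia.
Qed.

Lemma yellow_no_home (v : vert T) x : ~~ blueV v ->
  ~ (x \in val v /\ forall w : vert T, x \in val w -> val v \subset val w).
Proof.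
move=> yv; have [X1 ev _] := yellow_cluster yv; move=> /(home_child x v X1)/ev.
by rewrite cards1.
Qed.

(** The home of a point is the smallest proper cluster containing it. Each vertex has as many roots
    as there are points with this home, so roots and points can be matched, and then [cluster_at v]
    goes to the cluster [val v]. *)
Lemma C_of_T_of_C : cp_iso (C_of_T T) C.
Proof.
have /fin_all_exists[hm hmP] := home_exists.
have hmE x v : hm x = v <-> x \in val v /\ forall w : vert T, x \in val w -> val v \subset val w.
  have [xh hmin] := hmP x; split=> [<- //|[xv vmin]].
  by apply/val_inj/eqP; rewrite eqEsubset hmin ?vmin.
have [|h bh hE] := @fibre_bijection (root_type T) (pts C) (vert T) (@home T) hm.
  move=> v; rewrite card_home /weight; case: ifP => [bv|/negbT yv].
    rewrite cluster_roots //; apply: eq_card => x; rewrite !inE.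
    apply/andP/eqP => [[xv /forallP vmin]|/hmE[xv vmin]].
      by apply/hmE; split=> // w; apply/implyP.
    by split=> //; apply/forallP => w; apply/implyP/vmin.
  apply/esym/eqP; rewrite cards_eq0; apply/eqP/setP => x; rewrite !inE.
  by apply/eqP => /hmE; exact: yellow_no_home.
exists h => //.
have him (v : vert T) : h @: (cluster_at v) = val v.
  apply/setP => y; have [g gK fK] := bh; rewrite -[y]fK mem_imset; last exact: bij_inj.
  rewrite (mem_cluster_at rt) -hE fK ancE; have [yh hmin] := hmP y.
  by apply/idP/idP => [/subsetP/(_ y yh)|/hmin].
apply/setP => s; apply/imsetP/idP => [[s0 /setUP[/imsetP[v _ ->]|/imsetP[x _ ->]] ->]|sC].
- by rewrite him cvert_in.
- by rewrite imset_set1 cp_set1.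
have [s1|s1] := ltnP 1 #|s|.
  pose v : vert T := Sub s (proper_clusterP sC s1).
  exists (cluster_at v); last by rewrite him SubK.
  by apply/setUP; left; apply/imsetP; exists v.
have /cards1P[x sE] : #|s| == 1 by rewrite eqn_leq s1 cp_gt0.
have [g gK fK] := bh; exists [set g x]; last by rewrite imset_set1 fK.
by apply/setUP; right; apply/imsetP; exists (g x).
Qed.

End Rooted.

End Picture.

(** * The correspondence between BY trees and cluster pictures *)

Section AncestorIso.

Variables (T T' : bytree) (r : vert T) (r' : vert T').
Variables (up : vert T -> half T) (up' : vert T' -> half T').
Variables (rk : vert T -> nat) (rk' : vert T' -> nat).
Hypotheses (rt : orooted r up rk) (rt' : orooted r' up' rk').
Variable f : vert T -> vert T'.
Hypotheses (bij_f : bijective f)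
  (anc_f : forall v w, ancestor up' (f v) (f w) = ancestor up v w).

Lemma anc_iso_root : f r = r'.
Proof.
have [g gK fK] := bij_f.
by apply: (anc_anti rt'); [exact: (anc_root rt') | rewrite -(fK r') anc_f; exact: (anc_root rt)].
Qed.

Lemma anc_iso_par v : parent up' (f v) = f (parent up v).
Proof.
have [->|vr] := eqVneq v r; first by rewrite (par_root rt) anc_iso_root (par_root rt').
have [g gK fK] := bij_f; have fr : f v != r'.
  by rewrite -anc_iso_root (inj_eq (can_inj gK)).
have step u : ancestor up v u -> v != u -> ancestor up (parent up v) u.
  by rewrite (anc_step up) => /orP[/eqP->|//]; rewrite eqxx.
apply: (anc_anti rt').
  have : ancestor up' (f v) (f (parent up v)) by rewrite anc_f anc_par.
  rewrite (anc_step up') (inj_eq (can_inj gK)) => /orP[/eqP E|//].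
  by have := par_neq rt vr; rewrite -E eqxx.
rewrite -(fK (parent up' (f v))) anc_f; apply: step.
  by rewrite -anc_f fK anc_par.
by apply: contraNneq (par_neq rt' fr) => {2}->; rewrite fK.
Qed.

Hypotheses (oT : open_by T) (oT' : open_by T').
Hypothesis weight_f : forall v, weight (f v) = weight v.

Lemma weight_iso_csize v : csize (f v) = csize v.
Proof.
rewrite (csize_sum rt') (csize_sum rt) (reindex f) /=; last exact: onW_bij.
by apply: eq_big => [u|u _]; rewrite ?anc_f ?weight_f.
Qed.

Lemma weight_iso_up v : blueH (up' (f v)) = blueH (up v).
Proof. by rewrite -(csize_odd rt' oT') -(csize_odd rt oT) weight_iso_csize. Qed.

End AncestorIso.

Lemma weight_iso_on (T T' : bytree) fV fH (v : vert T) : @by_iso_on T T' fV fH ->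
  weight (fV v) = weight v.
Proof.
move=> [[bf bfH] sE _ gE [bE bHE]]; rewrite /weight bE /roots_at gE; case: ifP => // _.
congr (_ - _); rewrite /blue_degree -(card_imset _ (bij_inj bfH)); apply: eq_card => d.
have [gH fHK gHK] := bfH; rewrite -[d]gHK mem_imset; last exact: can_inj fHK.
by rewrite !inE sE bHE (inj_eq (bij_inj bf)).
Qed.

Section Weight.

Variables (T : bytree) (r : vert T) (up : vert T -> half T) (rk : vert T -> nat).
Hypotheses (rt : orooted r up rk) (oT : open_by T).

(** The value 0 marks the yellow vertices. Colour and genus of a vertex are thus functions of its
    weight and of the colours of its edges. *)
Lemma blue_count v :
  weight v + (blueH (up v) + #|[set c in children r up v | blueH (up c)]|)
  = if blueV v then 2 * by_gen v + 2 else 0.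
Proof.
rewrite /weight; case: ifP => [bv|yv]; first exact: (blue_balance rt oT bv).
have -> : blueH (up v) = false by apply: contraFF yv; exact: (up_blue_src rt oT).
rewrite add0n; apply/eqP; rewrite cards_eq0; apply/eqP/setP => c; rewrite [in RHS]inE.
by apply/negP; rewrite inE => /andP[cv /(child_blue oT cv)]; rewrite yv.
Qed.

End Weight.

Lemma weight_iso (T T' : bytree) r up rk r' up' rk' (f : vert T -> vert T') :
    @orooted T r up rk -> @orooted T' r' up' rk' -> open_by T -> open_by T' ->
    bijective f -> (forall v w, ancestor up' (f v) (f w) = ancestor up v w) ->
    (forall v, weight (f v) = weight v) -> by_iso T T'.
Proof.
move=> rt rt' oT oT' bf af wf; have upf := weight_iso_up rt rt' bf af oT oT' wf.
have cnt v : (if blueV (f v) then 2 * by_gen (f v) + 2 else 0) =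
    if blueV v then 2 * by_gen v + 2 else 0.
  rewrite -(blue_count rt' oT') -(blue_count rt oT) wf upf; congr (_ + (_ + _)).
  rewrite -(card_imset _ (bij_inj bf)); apply: eq_card => c.
  have [g gK fK] := bf; rewrite -[c]fK mem_imset; last exact: bij_inj.
  by rewrite !inE -!/(_ \in children _ _ _) upf -{1}(anc_iso_root rt rt' bf af) (anc_iso_par rt rt' bf af) !(inj_eq (bij_inj bf)).
have bV v : blueV (f v) = blueV v by have := cnt v; case: blueV; case: blueV => //; lia.
have gV v : by_gen (f v) = by_gen v.
  have := cnt v; rewrite bV; case: ifP => [_|/negbT y _]; first by lia.
  have y' : ~~ blueV (f v) by rewrite bV.
  by have [_ _ /(_ _ y')[-> _ _] _ _] := oT'; have [_ _ /(_ _ y)[-> _ _] _ _] := oT.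
have [||fH h] := orooted_iso rt rt' (oT_wf oT) (oT_wf oT') bf gV bV.
- by move=> v; exact: (anc_iso_par rt rt' bf af).
- by move=> v; exact: upf.
by exists f, fH.
Qed.

Section CtoT.

Variables (C : picture) (hC : cluster_picture C).
Variables (up : vert (T_of_C C) -> half (T_of_C C)) (rk : vert (T_of_C C) -> nat).
Hypothesis rt : orooted (topv hC) up rk.
Hypothesis upP : forall v : vert (T_of_C C), blueH (up v) = odd #|val v| /\
  (v != topv hC -> child (val v) (val (parent up v))).

Lemma weight_T_of_C (v : vert (T_of_C C)) : weight v =
  #|[set x | (x \in val v) && [forall w : vert (T_of_C C), (x \in val w) ==> (val v \subset val w)]]|.
Proof.
rewrite /weight; case: ifP => [bv|/negbT yv]; first exact: (cluster_roots rt upP bv).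
apply/esym/eqP; rewrite cards_eq0; apply/eqP/setP => x; rewrite [RHS]inE; apply/negP.
rewrite inE => /andP[xv /forallP h]; apply: (yellow_no_home hC yv (x := x)).
by split=> // w; apply/implyP.
Qed.

End CtoT.

Lemma T_of_C_iso (C C' : picture) : cluster_picture C -> cluster_picture C' ->
  cp_iso C C' -> by_iso (T_of_C C) (T_of_C C').
Proof.
move=> hC hC' [h [k hK kH] hS].
have [up [rk [rt upP]]] := cluster_rooted hC; have [up' [rk' [rt' upP']]] := cluster_rooted hC'.
have hkS (s : {set pts C'}) : h @: (k @: s) = s.
  by rewrite -imset_comp (eq_imset (g := id)) ?imset_id // => x; exact: kH.
have khS (s : {set pts C}) : k @: (h @: s) = s.
  by rewrite -imset_comp (eq_imset (g := id)) ?imset_id // => x; exact: hK.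
have cX : #|pts C'| = #|pts C| by rewrite -(bij_eq_card (Bijective hK kH)).
have pr (s : {set pts C}) : proper_cluster (h @: s) = proper_cluster s.
  rewrite /proper_cluster cX card_imset; last exact: can_inj hK.
  by rewrite -hS mem_imset //; exact: (can_inj (g := fun s : {set pts C'} => k @: s) khS).
have prf (v : vert (T_of_C C)) : proper_cluster (h @: val v) by rewrite pr (valP v).
have prg (v : vert (T_of_C C')) : proper_cluster (k @: val v) by rewrite -pr hkS (valP v).
pose f (v : vert (T_of_C C)) : vert (T_of_C C') := (Sub (h @: val v) (prf v) : cvert C').
pose g (v : vert (T_of_C C')) : vert (T_of_C C) := (Sub (k @: val v) (prg v) : cvert C).
have fK : cancel f g by move=> v; apply: val_inj; rewrite /= khS.
have gK : cancel g f by move=> v; apply: val_inj; rewrite /= hkS.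
have sub (v w : vert (T_of_C C)) : (val (f v) \subset val (f w)) = (val v \subset val w).
  apply/idP/idP => /(imsetS _) sub; last exact: sub.
  by have := sub _ k; rewrite !khS.
apply: (weight_iso rt rt' (T_of_C_open rt upP) (T_of_C_open rt' upP') (f := f)).
- by exists g.
- by move=> v w; rewrite (ancE rt' upP') (ancE rt upP) sub.
move=> v; rewrite (weight_T_of_C rt' upP') (weight_T_of_C rt upP).
rewrite -(card_imset _ (can_inj hK)); apply: eq_card => y.
rewrite -[y]kH mem_imset ?[in LHS]inE ?[in RHS]inE; last exact: can_inj hK.
rewrite mem_imset; last exact: can_inj hK.
congr (_ && _); apply/forallP/forallP => H w; apply/implyP => xw.
  have := H (f w); rewrite sub; move/implyP; apply; rewrite mem_imset //; exact: can_inj hK.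
by rewrite -(gK w) sub; apply: (implyP (H (g w))); rewrite -(mem_imset _ _ (can_inj hK)) hkS.
Qed.

Lemma C_of_T_iso (T T' : bytree) : open_by T -> open_by T' ->
  by_iso T T' -> cp_iso (C_of_T T) (C_of_T T').
Proof.
move=> oT oT' [f [fH iso]]; have [r [up [rk rt]]] := open_by_rooted oT.
have [[bf bfH] _ _ _ _] := iso; have [g fK gK] := bf.
have rt' := orooted_transport rt iso fK gK; set up' := (_ \o g) in rt'.
have parf v : parent up' (f v) = f (parent up v).
  by case: iso => _ sE oE _ _; rewrite /parent /up' /= fK oE sE.
have ancf v w : ancestor up' (f v) (f w) = ancestor up v w.
  have itf n : iter n (parent up') (f v) = f (iter n (parent up) v).
    by elim: n => //= n ->.
  by apply/ancP/ancP => -[n E]; exists n; [apply: (can_inj fK); rewrite -itf | rewrite itf E].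
have wf v := weight_iso_on v iso.
have [|h bh hE] := @fibre_bijection (root_type T) (root_type T') (vert T') (f \o @home T) (@home T').
  move=> v; rewrite card_home -(gK v) wf -card_home; apply: eq_card => x.
  by rewrite !inE /= (inj_eq (can_inj fK)).
exists h => //; have him v : h @: cluster_at v = cluster_at (f v).
  apply/setP => y; have [k hK kH] := bh; rewrite -[y]kH mem_imset; last exact: can_inj hK.
  by rewrite (mem_cluster_at rt) (mem_cluster_at rt') hE ancf.
apply/setP => s; apply/imsetP/setUP.
  case=> t /setUP[/imsetP[v _ ->]|/imsetP[x _ ->]] ->.
    by rewrite him; left; apply/imsetP; exists (f v).
  by rewrite imset_set1; right; apply/imsetP; exists (h x).
have [k hK kH] := bh; case=> /imsetP[].
  move=> v _ ->; exists (cluster_at (g v)); last by rewrite him gK.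
  by apply/setUP; left; apply/imsetP; exists (g v).
move=> x _ ->; exists [set k x]; last by rewrite imset_set1 kH.
by apply/setUP; right; apply/imsetP; exists (k x).
Qed.

Lemma T_of_C_of_T (T : bytree) : open_by T -> by_iso (T_of_C (C_of_T T)) T.
Proof.
move=> oT; have [r [up [rk rt]]] := open_by_rooted oT.
set C := C_of_T T; have hC : cluster_picture C := C_of_T_picture rt oT.
have [up' [rk' [rt' upP']]] := cluster_rooted hC.
have inC v : cluster_at v \in clusters C by apply/setUP; left; apply/imsetP; exists v.
have pr v : proper_cluster (cluster_at v : {set pts C}).
  rewrite /proper_cluster inC /=; have [X1|X1] := eqVneq #|pts C| 1.
    by have := csize_gt0 rt oT v; rewrite /csize; case: #|_| => [|[]].
  by rewrite (csize_gt1 rt oT).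
pose f v : vert (T_of_C C) := (Sub (cluster_at v) (pr v) : cvert C).
have f_inj : injective f by move=> u v [/(cluster_at_inj rt oT)].
have f_surj (s : vert (T_of_C C)) : exists v, f v = s.
  have /andP[sC s1] := valP s; have /setUP[/imsetP[v _ E]|/imsetP[x _ E]] := sC.
    by exists v; apply: val_inj; rewrite E.
  (* A single point is a proper cluster only if the picture has just one point; then it is the
     cluster of the root. *)
  exists r; apply/val_inj/eqP; rewrite eq_sym eqEcard E.
  move: s1; rewrite E cards1 /= => /eqP X1.
  have -> : cluster_at r = [set: pts C].
    by apply/setP => y; rewrite (mem_cluster_at rt) (anc_root rt) inE.
  by rewrite subsetT cardsT X1.
have [g gK] : exists g, cancel g f by exact: (fin_all_exists f_surj).
have fK : cancel f g by move=> v; apply: f_inj; rewrite gK.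
apply: by_iso_sym; apply: (weight_iso rt rt' oT (T_of_C_open rt' upP') (f := f)).
- by exists g.
- by move=> v w; rewrite (ancE rt' upP') (cluster_at_sub rt oT).
move=> v; rewrite (weight_T_of_C rt' upP') -card_home; apply: eq_card => x; rewrite !inE.
apply/andP/eqP => [[xv /forallP h]|<-].
  apply: (anc_anti rt); first by rewrite -(mem_cluster_at rt) inE.
  rewrite -(cluster_at_sub rt oT); apply: (implyP (h (f (home x)))).
  by rewrite /= (mem_cluster_at rt) anc_refl.
split; first by have := anc_refl up (home x); rewrite -(mem_cluster_at rt) inE.
apply/forallP => w; apply/implyP; rewrite -(gK w) /= (mem_cluster_at rt).
by rewrite (cluster_at_sub rt oT).
Qed.

Theorem by_cp_bijections :
  inverse_bijections cluster_picture cp_iso open_by by_iso T_of_C C_of_T.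
Proof.
split.
- split=> [C hC|T oT].
    by have [up [rk [rt upP]]] := cluster_rooted hC; exact: (T_of_C_open rt upP).
  by have [r [up [rk rt]]] := open_by_rooted oT; exact: (C_of_T_picture rt oT).
- exact: T_of_C_iso.
- exact: C_of_T_iso.
- by move=> C hC; have [up [rk [rt upP]]] := cluster_rooted hC; exact: (C_of_T_of_C rt upP).
- exact: T_of_C_of_T.
Qed.

Lemma C_of_T_genus : preserves_genus open_by by_genus cp_genus C_of_T.
Proof.
move=> T oT; have [r [up [rk rt]]] := open_by_rooted oT.
rewrite /cp_genus /genus_of_size -(csize_root rt) (csize_sum rt).
have -> : \sum_(u | ancestor up u r) weight u = \sum_(u : vert T | blueV u) roots_at u.
  by rewrite [RHS]big_mkcond; apply: eq_bigl => v; rewrite (anc_root rt).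
by have := sum_roots rt oT; move: (\sum_(v | _) _) => n; case: (blueH _) => /= E; lia.
Qed.

Lemma cp_iso_card (C C' : picture) : cp_iso C C' -> #|pts C| = #|pts C'|.
Proof. by case=> f bf _; exact: bij_eq_card bf. Qed.

Lemma T_of_C_genus : preserves_genus cluster_picture cp_genus by_genus T_of_C.
Proof.
move=> C hC; have [[op _] _ _ iso _] := by_cp_bijections.
by rewrite -(C_of_T_genus (op C hC)) /cp_genus (cp_iso_card (iso C hC)).
Qed.

(** * Equivalence of cluster pictures and splits *)

Section ImsetBij.

Variables (A B : finType) (h : A -> B) (k : B -> A).
Hypotheses (hK : cancel h k) (kH : cancel k h).
Implicit Types (s t : {set A}).

Lemma imset_bijK s : k @: (h @: s) = s.
Proof. by rewrite -imset_comp (eq_imset (g := id)) ?imset_id. Qed.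

Lemma imset_bijC s : h @: (~: s) = ~: (h @: s).
Proof. by rewrite !(can2_imset_pre _ hK kH) preimsetC. Qed.

Lemma imset_bijT : h @: setT = setT.
Proof. by apply/setP => y; rewrite -(kH y) mem_imset ?inE //; exact: can_inj hK. Qed.

Lemma imset_bijS s t : (h @: s \subset h @: t) = (s \subset t).
Proof.
by apply/idP/idP => [/(imsetS k)|/imsetS //]; rewrite !imset_bijK.
Qed.

Lemma imset_bij_eq s t : (h @: s == h @: t) = (s == t).
Proof. by rewrite !eqEsubset !imset_bijS. Qed.

End ImsetBij.

Lemma imset_disjoint_inj (A B : finType) (f : A -> B) (s t : {set A}) : injective f ->
  [disjoint s & t] -> [disjoint f @: s & f @: t].
Proof.
move=> fi d; apply/pred0P => y; apply/negP => /andP[/imsetP[x xs ->]].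
by rewrite /= mem_imset // (disjointFr d xs).
Qed.

Lemma cp_isoP (C C' : picture) : cp_iso C C' <-> exists (h : pts C -> pts C') (k : pts C' -> pts C),
  [/\ cancel h k, cancel k h & forall s : {set pts C}, (h @: s \in clusters C') = (s \in clusters C)].
Proof.
split=> [[h [k hK kH] hS]|[h [k [hK kH hS]]]].
  exists h, k; split=> // s; rewrite -hS mem_imset //.
  exact: (can_inj (g := fun s : {set pts C'} => k @: s) (imset_bijK hK)).
exists h; first by exists k.
apply/setP => s; rewrite -[s](imset_bijK kH) hS mem_imset //.
exact: (can_inj (g := fun s : {set pts C'} => k @: s) (imset_bijK hK)).
Qed.

Lemma cp_iso_refl C : cp_iso C C.
Proof. by exists id; [exists id | rewrite (eq_imset (g := id)) ?imset_id // => s; exact: imset_id]. Qed.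

Lemma cp_iso_sym C C' : cp_iso C C' -> cp_iso C' C.
Proof.
move=> /cp_isoP[h [k [hK kH hS]]]; apply/cp_isoP; exists k, h; split=> // s.
by rewrite -hS (imset_bijK kH).
Qed.

Lemma cp_iso_trans C1 C2 C3 : cp_iso C1 C2 -> cp_iso C2 C3 -> cp_iso C1 C3.
Proof.
move=> /cp_isoP[h [k [hK kH hS]]] /cp_isoP[h' [k' [hK' kH' hS']]]; apply/cp_isoP.
exists (h' \o h), (k \o k'); split; [exact: can_comp | exact: can_comp | move=> s].
by rewrite imset_comp hS' hS.
Qed.

Section IsoTransport.

Variables (C C' : picture) (h : pts C -> pts C') (k : pts C' -> pts C).
Hypotheses (hK : cancel h k) (kH : cancel k h).
Hypothesis hS : forall s : {set pts C}, (h @: s \in clusters C') = (s \in clusters C).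

Lemma iso_child (s t : {set pts C}) : child (h @: s) (h @: t) = child s t.
Proof.
rewrite /child !hS !properE !(imset_bijS hK); congr [&& _, _, _ & _].
apply/forall_inP/forall_inP => H u uC.
  by have := H (h @: u); rewrite hS !properE !(imset_bijS hK); apply.
have := H (k @: u); rewrite -hS (imset_bijK kH) => /(_ uC).
by rewrite -[u](imset_bijK kH) !properE !(imset_bijS hK) (imset_bijK hK).
Qed.

Lemma iso_picture : cluster_picture C -> cluster_picture C'.
Proof.
move=> [h0 hT h1 lam]; split.
- by rewrite -(imset0 h) hS.
- by rewrite -(imset_bijT hK kH) hS.
- by move=> y; rewrite -(kH y) -imset_set1 hS.
move=> s t; rewrite -[s](imset_bijK kH) -[t](imset_bijK kH) !hS !(imset_bijS hK) => sC tC.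
case: (lam _ _ sC tC) => [d|d|d]; [constructor 1 | by constructor 2 | by constructor 3].
exact: (imset_disjoint_inj (can_inj hK)).
Qed.

End IsoTransport.

Lemma cp_iso_picture C C' : cp_iso C C' -> cluster_picture C -> cluster_picture C'.
Proof. by move=> /cp_isoP[h [k [hK kH hS]]]; exact: (iso_picture hK kH hS). Qed.

Section AddPoint.

Variable C : picture.

Lemma add_point_cluster (s : {set pts (add_point C)}) : (s \in clusters (add_point C)) =
  [|| s == setT, s == [set None] | (None \notin s) && (Some @^-1: s \in clusters C)].
Proof.
rewrite in_setU in_set2 orbC orbA; congr (_ || _).
apply/imsetP/andP => [[t tC ->]|[sN sC]].
  split; first by apply/imsetP => -[].
  suff -> : Some @^-1: (Some @: t) = t by []; apply/setP => x; rewrite inE mem_imset //; exact: Some_inj.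
exists (Some @^-1: s) => //; apply/setP => -[x|]; first by rewrite mem_imset ?inE //; exact: Some_inj.
by rewrite (negPf sN); apply/esym/imsetP => -[].
Qed.

Lemma Some_preimset (t : {set pts C}) : Some @^-1: (Some @: t) = t.
Proof. by apply/setP => x; rewrite inE mem_imset //; exact: Some_inj. Qed.

Lemma None_notin (t : {set pts C}) : None \notin Some @: t.
Proof. by apply/imsetP => -[]. Qed.

Lemma add_point_picture : cluster_picture C -> cluster_picture (add_point C).
Proof.
move=> [h0 hT h1 lam]; split.
- rewrite add_point_cluster (_ : Some @^-1: set0 = set0) ?(negPf h0) ?andbF ?orbF; last by apply/setP => x; rewrite !inE.
  by apply/negP => /orP[] /eqP/setP/(_ None); rewrite !inE.
- by rewrite add_point_cluster eqxx.
- case=> [x|]; last by rewrite add_point_cluster eqxx orbT.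
  rewrite add_point_cluster !inE /= (_ : Some @^-1: _ = [set x]) ?h1 ?orbT //.
  by apply/setP => y; rewrite !inE.
move=> s t; rewrite !add_point_cluster => /or3P[/eqP->|/eqP->|/andP[sN sC]].
- by constructor 3; exact: subsetT.
- case: (boolP (None \in t)) => Nt; first by constructor 2; rewrite sub1set.
  by constructor 1; rewrite disjoints1.
case/or3P=> [/eqP->|/eqP->|/andP[tN tC]].
- by constructor 2; exact: subsetT.
- by constructor 1; rewrite disjoint_sym disjoints1.
have E (u : {set pts (add_point C)}) : None \notin u -> u = Some @: (Some @^-1: u).
  by move=> uN; apply/setP => -[x|]; [rewrite mem_imset ?inE //; exact: Some_inj | rewrite (negPf uN) (negPf (None_notin _))].
case: (lam _ _ sC tC) => [d|d|d].
- constructor 1; rewrite (E _ sN) (E _ tN); exact: (imset_disjoint_inj (@Some_inj _) d).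
- by constructor 2; rewrite (E _ sN) (E _ tN) imsetS.
by constructor 3; rewrite (E _ sN) (E _ tN) imsetS.
Qed.

End AddPoint.

Lemma add_point_iso C C' : cp_iso C C' -> cp_iso (add_point C) (add_point C').
Proof.
move=> /cp_isoP[h [k [hK kH hS]]]; apply/cp_isoP; exists (omap h), (omap k).
have oK : cancel (omap h) (omap k) by case=> //= x; rewrite hK.
have ok : cancel (omap k) (omap h) by case=> //= x; rewrite kH.
split=> // s; rewrite !add_point_cluster; congr [|| _, _ | ~~ _ && _].
- by rewrite -(imset_bijT oK ok) (imset_bij_eq oK).
- have {1}-> : [set None] = omap h @: [set None] by rewrite imset_set1.
  by rewrite (imset_bij_eq oK).
- by have {1}-> : None = omap h None by []; rewrite mem_imset //; exact: can_inj oK.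
rewrite -hS; suff -> : Some @^-1: (omap h @: s) = h @: (Some @^-1: s) by [].
apply/setP => y; rewrite -(kH y) inE !mem_imset; last exact: can_inj hK.
  by rewrite inE -[Some (h (k y))]/(omap h (Some (k y))) mem_imset //; exact: can_inj oK.
Qed.

Lemma even_size_genus C : ~~ odd #|pts C| -> 0 < #|pts C| -> #|pts C| = 2 * cp_genus C + 2.
Proof. by rewrite /cp_genus /genus_of_size; lia. Qed.

Lemma odd_size_genus C : odd #|pts C| -> #|pts C| = 2 * cp_genus C + 1.
Proof. by rewrite /cp_genus /genus_of_size; lia. Qed.

Lemma move_transport C C1 D : cluster_picture C1 -> cp_move C C1 -> cp_iso C D ->
  exists D1, [/\ cp_move D D1, cluster_picture D1 & cp_iso C1 D1].
Proof.
move=> hC1 mv iso; have cD := cp_iso_card iso.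
have gD : cp_genus D = cp_genus C by rewrite /cp_genus cD.
case: mv hC1 => [s sX e|s sX s2 ch e|C1' e iso1|C1' e iso1] hC1.
- have [h [k [hK kH hS]]] := (cp_isoP C D).1 iso.
  have iso1 : cp_iso (Picture (~: s |: clusters C)) (Picture (~: (h @: s) |: clusters D)).
    apply/cp_isoP; exists h, k; split=> // t.
    by rewrite !in_setU !in_set1 hS -(imset_bijC hK kH) (imset_bij_eq hK).
  exists (Picture (~: (h @: s) |: clusters D)); split=> //; last exact: cp_iso_picture iso1 hC1.
  by apply: Move_i; rewrite -?(imset_bijT hK kH) ?(iso_child hK kH hS) // gD -cD.
- have [h [k [hK kH hS]]] := (cp_isoP C D).1 iso.
  have iso1 : cp_iso (Picture (clusters C :\ s)) (Picture (clusters D :\ h @: s)).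
    apply/cp_isoP; exists h, k; split=> // t.
    by rewrite !in_setD1 hS (imset_bij_eq hK).
  exists (Picture (clusters D :\ h @: s)); split=> //; last exact: cp_iso_picture iso1 hC1.
  apply: Move_ii.
  + by rewrite -(imset_bijT hK kH) (iso_child hK kH hS).
  + by rewrite card_imset //; exact: can_inj hK.
  + rewrite -ch -(card_imset _ (imset_inj (can_inj hK))); apply: eq_card => t.
    rewrite -[t](imset_bijK kH) mem_imset; last exact: imset_inj (can_inj hK).
    by rewrite !inE -(imset_bijT hK kH) (iso_child hK kH hS).
  + by rewrite gD -cD.
- exists C1'; split=> //; last exact: cp_iso_refl.
  apply: Move_iii; first by rewrite gD -cD.
  exact: cp_iso_trans (add_point_iso (cp_iso_sym iso)) iso1.
exists C1'; split=> //; last exact: cp_iso_refl.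
apply: Move_iv; first by rewrite gD -cD.
exact: cp_iso_trans iso1 iso.
Qed.

Lemma moves_transport C C1 D : cp_moves C C1 -> cp_iso C D ->
  exists2 D1, cp_moves D D1 & cp_iso C1 D1.
Proof.
move=> mv iso; elim: mv => [|C1' C2 _ [D1 mD1 iD1] mv hC2]; first by exists D => //; exact: Moves_refl.
have [D2 [mD2 hD2 iD2]] := move_transport hC2 mv iD1.
by exists D2 => //; exact: Moves_step mD1 mD2 hD2.
Qed.

Lemma moves_trans C1 C2 C3 : cp_moves C1 C2 -> cp_moves C2 C3 -> cp_moves C1 C3.
Proof. by move=> m12; elim=> // D E _ IH mv hE; exact: Moves_step IH mv hE. Qed.

Lemma reach_iso C C' : cp_iso C C' -> cp_reach C C'.
Proof. by move=> iso; exists C => //; exact: Moves_refl. Qed.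

Lemma reach_trans C1 C2 C3 : cp_reach C1 C2 -> cp_reach C2 C3 -> cp_reach C1 C3.
Proof.
move=> [D1 m1 i1] [D2 m2 i2]; have [E mE iE] := moves_transport m2 (cp_iso_sym i1).
by exists E; [exact: moves_trans m1 mE | exact: cp_iso_trans (cp_iso_sym iE) i2].
Qed.

Lemma reach_move C C' : cp_move C C' -> cluster_picture C' -> cp_reach C C'.
Proof.
move=> mv hC'; exists C'; last exact: cp_iso_refl.
exact: Moves_step (Moves_refl C) mv hC'.
Qed.

(** To pass from one picture to another through normal forms, the way to the second normal form has
    to be travelled backwards; so every step is proved together with its reversal. *)
Definition interreach C C' := cp_reach C C' /\ cp_reach C' C.

Lemma interreach_trans C1 C2 C3 : interreach C1 C2 -> interreach C2 C3 -> interreach C1 C3.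
Proof.
by move=> [a b] [c d]; split; [exact: reach_trans a c | exact: reach_trans d b].
Qed.

Lemma interreach_sym C C' : interreach C C' -> interreach C' C.
Proof. by case. Qed.

Lemma interreach_iso C C' : cp_iso C C' -> interreach C C'.
Proof. by move=> iso; split; apply: reach_iso => //; exact: cp_iso_sym. Qed.

Lemma interreach_refl C : interreach C C.
Proof. exact/interreach_iso/cp_iso_refl. Qed.

Lemma interreach_add_point C : cluster_picture C -> odd #|pts C| -> interreach C (add_point C).
Proof.
move=> hC oC; split.
  apply: reach_move (add_point_picture hC); apply: Move_iii (cp_iso_refl _).
  exact: odd_size_genus.
apply: reach_move hC; apply: Move_iv (cp_iso_refl _).
by apply: even_size_genus; rewrite card_option //= negbK.
Qed.

(** * Complements of maximal clusters and the normal form *)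

Definition add_compl C (s : {set pts C}) : picture := Picture (~: s |: clusters C).

Section AddComplement.

Variable C : picture.
Hypothesis hC : cluster_picture C.
Variable s : {set pts C}.
Hypothesis sX : child s setT.

Let sC : s \in clusters C. Proof. by case/and4P: sX. Qed.

Let sT : s != setT.
Proof. by case/and4P: sX => _ _ + _; rewrite properT. Qed.

Let s_between t : t \in clusters C -> s \subset t -> t = s \/ t = setT.
Proof.
move=> tC st; have [->|ne] := eqVneq t s; first by left.
right; apply/eqP; apply: contraTT sX => tT; apply/negP => /childP[_ _ _ /(_ t tC)].
by rewrite properEneq eq_sym ne st properT tT => /(_ isT isT).
Qed.

Let s_cases t : t \in clusters C -> [\/ t \subset ~: s, t \subset s | t = setT].
Proof.
move=> tC; have [_ _ _ lam] := hC; case: (lam t s tC sC) => [|ts|st].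
- by rewrite disjoints_subset; constructor 1.
- by constructor 2.
by case: (s_between tC st) => ->; [constructor 2 | constructor 3].
Qed.

Let sn0 : s != set0. Proof. by apply/set0Pn; exact: (cp_neq0 hC sC). Qed.

Let sCn0 : ~: s != set0. Proof. by rewrite -setCT (inj_eq (@setC_inj _)). Qed.

Let sCT : ~: s != setT. Proof. by rewrite -setC0 (inj_eq (@setC_inj _)). Qed.

(** As [s] is maximal below the whole set, any other cluster lies in [s] or misses it, unless it is
    the whole set. So it is disjoint from the complement of [s] or nested with it. *)
Lemma add_compl_picture : cluster_picture (add_compl s).
Proof.
have [h0 hT h1 lam] := hC; split.
- by rewrite in_setU1 negb_or h0 andbT eq_sym; exact: sCn0.
- by rewrite in_setU1 hT orbT.
- by move=> x; rewrite in_setU1 h1 orbT.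
have one t : t \in clusters C -> [\/ [disjoint t & ~: s], t \subset ~: s | ~: s \subset t].
  case/s_cases=> [ts|ts|->]; first by constructor 2.
    by constructor 1; rewrite disjoints_subset setCK.
  by constructor 3; exact: subsetT.
move=> t u; rewrite !in_setU1 => /orP[/eqP->|tC] /orP[/eqP->|uC].
- by constructor 2.
- by case: (one u uC) => d; [constructor 1; rewrite disjoint_sym | constructor 3 | constructor 2].
- exact: one.
exact: lam.
Qed.

Lemma add_compl_child (t : {set pts C}) :
  @child (add_compl s) t setT = (t == s) || (t == ~: s).
Proof.
apply/childP/orP => [[]|].
  rewrite in_setU1 => /orP[/eqP->|tC] _ tT tmax; first by right.
  case: (s_cases tC) => [ts|ts|E]; last by rewrite E properxx in tT.
    have [->|ne] := eqVneq t (~: s); first by right.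
    by case: (tmax (~: s)); rewrite ?in_setU1 ?eqxx // ?properT // properEneq ne.
  have [->|ne] := eqVneq t s; first by left.
  by case: (tmax s); rewrite ?in_setU1 ?sC ?orbT // ?properT // properEneq ne.
have TC : setT \in clusters (add_compl s) by rewrite in_setU1 (cp_setT hC) orbT.
case=> /eqP->; split=> //; rewrite ?in_setU1 ?eqxx ?sC ?orbT //.
- by rewrite properT.
- move=> u; rewrite in_setU1 => /orP[/eqP->|uC] su uT.
    have [x xs] := set0Pn _ sn0; have := subsetP (proper_sub su) x xs.
    by rewrite inE xs.
  case: (s_between uC (proper_sub su)) => E; first by rewrite E properxx in su.
  by rewrite E properxx in uT.
- by rewrite properT.
move=> u; rewrite in_setU1 => /orP[/eqP->|uC] su uT; first by rewrite properxx in su.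
case: (s_cases uC) => [us|us|E]; last by rewrite E properxx in uT.
  by have := proper_sub_trans su us; rewrite properxx.
have := subset_trans (proper_sub su) us; move/subsetP => sub.
case/negP: sT; rewrite -subTset; apply/subsetP => x _.
by move: (sub x); rewrite inE; case: (x \in s) => // /(_ isT).
Qed.

(** Move (i) adds the complement. Afterwards the whole set has exactly the children [s] and [~: s],
    so that move (ii) can remove it again. *)
Lemma interreach_add_compl : ~~ odd #|pts C| -> interreach C (add_compl s).
Proof.
move=> eC; have X0 : 0 < #|pts C|.
  by have [x _] := cp_neq0 hC sC; apply/card_gt0P; exists x.
have eX := even_size_genus eC X0; split.
  by apply: reach_move add_compl_picture; exact: Move_i.
have [cC|cC] := boolP (~: s \in clusters C).
  rewrite (_ : add_compl s = C); first by case: (interreach_refl C).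
  rewrite /add_compl (_ : ~: s |: _ = clusters C); first by case: (C).
  by apply/setUidPr; rewrite sub1set.
have CE : Picture (clusters (add_compl s) :\ ~: s) = C by rewrite /= setU1K //; case: (C).
rewrite -[X in cp_reach _ X]CE; apply: reach_move; last by rewrite CE.
have sn : s != ~: s.
  apply/eqP => E; have [x xs] := set0Pn _ sn0; have := xs; rewrite {1}E inE xs //.
apply: Move_ii => //.
- by rewrite add_compl_child eqxx orbT.
(* Move (ii) removes only clusters with at least two points; a complement with one point is a
   cluster of [C] anyway. *)
- rewrite ltnNge; apply: contra cC => c1; have : 0 < #|~: s| by rewrite card_gt0; exact: sCn0.
  move=> c0; have /cards1P[x ->] : #|~: s| == 1 by rewrite eqn_leq c1.
  exact: cp_set1 hC x.
rewrite (_ : [set t | _] = [set s; ~: s]) ?cards2 ?sn //.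
by apply/setP => t; rewrite inE add_compl_child in_set2.
Qed.

End AddComplement.

Definition is_split C (s : {set pts C}) : bool := (s \in clusters C) || (~: s \in clusters C).

Lemma is_split_add_compl C (s t : {set pts C}) : s \in clusters C ->
  @is_split (add_compl s) t = is_split t.
Proof.
move=> sC; rewrite /is_split !in_setU1 (inj_eq (@setC_inj _)).
have [->|_] := eqVneq t (~: s); first by rewrite setCK sC !orbT.
by have [->|_] := eqVneq t s; rewrite ?sC.
Qed.

(* The picture with the same splits in which [x] becomes the point at infinity. *)
Definition normal C (x : pts C) : picture :=
  Picture [set s : {set pts C} |
    [|| s == setT, s == [set x] | [&& s != set0, x \notin s & is_split s]]].

Lemma eq_normal (X : finType) (S S' : {set {set X}}) (x : X) :
  (forall s, @is_split (Picture S) s = @is_split (Picture S') s) ->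
  @normal (Picture S) x = @normal (Picture S') x.
Proof. by move=> E; congr Picture; apply/setP => s; rewrite !inE E. Qed.

(** Induction on the number of clusters containing [x]. The child of the whole set around [x] is
    exchanged for its complement, which changes no split and lowers this number. Once that child is
    the point [x] itself, adding its complement yields the normal form. *)
Lemma interreach_normal_aux (X : finType) (S : {set {set X}}) (x : X) :
  cluster_picture (Picture S) -> ~~ odd #|X| -> interreach (Picture S) (@normal (Picture S) x).
Proof.
move=> hC eC.
have [n] := ubnP #|[set s in S | x \in s]|; elim: n S hC => // n IH S hC ltn.
have X1 : 1 < #|[set: X]|.
  rewrite cardsT; have : 0 < #|X| by apply/card_gt0P; exists x.
  by move: eC; case: #|X| => [|[]].
have [s sX xs] := child_exists hC (cp_setT hC) X1 (in_setT x).
have sC : s \in S by case/and4P: sX.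
have i1 := interreach_add_compl hC sX eC; have h1 := add_compl_picture hC sX.
apply: interreach_trans (i1) _.
have [E|nE] := eqVneq s [set x].
  suff -> : @normal (Picture S) x = add_compl s by exact: interreach_refl.
  congr Picture; apply/setP => t; rewrite in_setU1 inE.
  have [->|tT] /= := eqVneq t setT; first by rewrite (cp_setT hC) orbT.
  have [->|tx] /= := eqVneq t [set x]; first by rewrite -E sC orbT.
  have [->|t0] /= := eqVneq t set0.
    have [/negPf-> _ _ _] := hC; rewrite orbF; apply/esym/negbTE.
    by rewrite eq_sym -setCT (inj_eq (@setC_inj _)); case/and4P: sX => _ _; rewrite properT.
  have only u : u \in S -> x \in u -> u = setT \/ u = [set x].
    move=> uS xu; have [->|ne] := eqVneq u [set x]; [by right | left].
    apply/eqP; apply: contraTT sX => uT; apply/negP => /childP[_ _ _ /(_ u uS)].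
    by rewrite E properT uT properEneq eq_sym ne sub1set xu => /(_ isT isT).
  rewrite /is_split /= E; have [xt|xt] /= := boolP (x \in t).
    rewrite (_ : (t \in S) = false) ?orbF; last first.
      by apply/negP => /only/(_ xt)[] tE; rewrite tE eqxx in tT tx.
    by apply/esym/negbTE; apply: contraTneq xt => ->; rewrite !inE eqxx.
  have [tS|tS] := boolP (t \in S); first by rewrite orbT.
  rewrite orbF; apply/idP/eqP => [tC|->]; last by rewrite setCK -E.
  have := only _ tC; rewrite inE xt => /(_ isT)[] tE; last by rewrite -tE setCK.
  by move: t0; rewrite -[t]setCK tE setCT eqxx.
(* [S2] is [S] with [s] exchanged for its complement. There the complement is a child of the whole
   set, so putting [s] back is again an instance of [interreach_add_compl]. *)
set S1 := clusters (add_compl s); pose S2 := S1 :\ s.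
have s1 : [set x] != s by rewrite eq_sym.
have h2 : cluster_picture (Picture S2).
  have [h0 hT h3 lam] := h1; split.
  - by rewrite in_setD1 negb_and h0 orbT.
  - by rewrite in_setD1 hT andbT eq_sym -properT; case/and4P: sX.
  - move=> y; rewrite in_setD1 h3 andbT; apply: contraNneq s1 => yE.
    by move: xs; rewrite -yE inE => /eqP->.
  by move=> t u /setD1P[_ tS] /setD1P[_ uS]; exact: lam.
have sCn : ~: s != s by apply/eqP => /setP/(_ x); rewrite inE xs.
have sCX : @child (Picture S2) (~: s) setT.
  have : @child (add_compl s) (~: s) setT by rewrite add_compl_child // eqxx orbT.
  case/childP=> a b c d; apply/childP; split=> //.
  - by rewrite in_setD1 sCn.
  - by case: h2.
  by move=> u /setD1P[_ uS]; exact: d.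
have i2 := interreach_add_compl h2 sCX eC.
have E2c : ~: (~: s) |: S2 = ~: s |: S by rewrite setCK setD1K // in_setU1 sC orbT.
rewrite /add_compl /= E2c in i2; apply: interreach_trans (interreach_sym i2) _.
have -> : @normal (Picture S) x = @normal (Picture S2) x.
  apply: eq_normal => t.
  have sC2 : ~: s \in clusters (Picture S2) by rewrite in_setD1 sCn setU11.
  transitivity (@is_split (add_compl s) t); first by rewrite (@is_split_add_compl (Picture S)).
  by rewrite -(@is_split_add_compl (Picture S2) (~: s) t sC2) /is_split /= E2c.
have lt2 : #|[set u in S2 | x \in u]| < #|[set u in S | x \in u]|; last first.
  by apply: IH h2 (leq_trans lt2 _); rewrite -ltnS.
apply/proper_card/properP; split.
  apply/subsetP => t; rewrite !inE => /andP[/andP[_ /orP[/eqP->|->//]]].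
  by rewrite inE xs.
by exists s; rewrite !inE ?eqxx ?sC ?xs.
Qed.

Lemma interreach_normal C (x : pts C) : cluster_picture C -> ~~ odd #|pts C| ->
  interreach C (normal x).
Proof. by case: C x => X S x; exact: interreach_normal_aux. Qed.

Definition split_iso (C C' : picture) : Prop :=
  exists (h : pts C -> pts C') (k : pts C' -> pts C),
    [/\ cancel h k, cancel k h & forall s : {set pts C}, is_split (h @: s) = is_split s].

Lemma cp_iso_split C C' : cp_iso C C' -> split_iso C C'.
Proof.
move=> /cp_isoP[h [k [hK kH hS]]]; exists h, k; split=> // s.
by rewrite /is_split -(imset_bijC hK kH) !hS.
Qed.

Lemma split_iso_refl C : split_iso C C.
Proof. exact/cp_iso_split/cp_iso_refl. Qed.

Lemma split_iso_sym C C' : split_iso C C' -> split_iso C' C.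
Proof.
by move=> [h [k [hK kH hS]]]; exists k, h; split=> // s; rewrite -hS (imset_bijK kH).
Qed.

Lemma split_iso_trans C1 C2 C3 : split_iso C1 C2 -> split_iso C2 C3 -> split_iso C1 C3.
Proof.
move=> [h [k [hK kH hS]]] [h' [k' [hK' kH' hS']]].
exists (h' \o h), (k \o k'); split; [exact: can_comp | exact: can_comp | move=> s].
by rewrite imset_comp hS' hS.
Qed.

Lemma split_iso_normal C C' (h : pts C -> pts C') k (x : pts C) :
  cancel h k -> cancel k h -> (forall s : {set pts C}, is_split (h @: s) = is_split s) ->
  cp_iso (normal x) (normal (h x)).
Proof.
move=> hK kH hS; apply/cp_isoP; exists h, k; split=> // s.
rewrite !inE hS -(imset_bijT hK kH) -imset_set1 -(imset0 h) !(imset_bij_eq hK).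
by rewrite mem_imset //; exact: can_inj hK.
Qed.

Definition completion C : picture := if odd #|pts C| then add_point C else C.

Lemma interreach_completion C : cluster_picture C -> interreach C (completion C).
Proof.
rewrite /completion => hC; case: ifP => oC; last exact: interreach_refl.
exact: interreach_add_point.
Qed.

Lemma completion_picture C : cluster_picture C -> cluster_picture (completion C).
Proof. by rewrite /completion => hC; case: ifP => // _; exact: add_point_picture. Qed.

Lemma completion_even C : ~~ odd #|pts (completion C)|.
Proof. by rewrite /completion; case: ifP => [oC|->//]; rewrite card_option /= oC. Qed.

Lemma completion_iso C C' : cp_iso C C' -> cp_iso (completion C) (completion C').
Proof.
rewrite /completion => iso; rewrite (cp_iso_card iso); case: ifP => // _.
exact: add_point_iso.
Qed.

Lemma split_reach C C' : cluster_picture C -> cluster_picture C' ->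
  split_iso (completion C) (completion C') -> cp_reach C C'.
Proof.
move=> hC hC' [h [k [hK kH hS]]].
have hD := completion_picture hC; have hD' := completion_picture hC'.
have [x _] := cp_neq0 hD (cp_setT hD).
have [r1 _] := interreach_completion hC; have [_ r1'] := interreach_completion hC'.
have [r2 _] := interreach_normal x hD (completion_even C).
have [_ r2'] := interreach_normal (h x) hD' (completion_even C').
apply: reach_trans r1 (reach_trans r2 (reach_trans _ (reach_trans r2' r1'))).
exact/reach_iso/(split_iso_normal x hK kH hS).
Qed.

Lemma completion_id C : #|pts C| = 2 * cp_genus C + 2 -> completion C = C.
Proof. by rewrite /completion => E; rewrite ifN //; lia. Qed.

Lemma completion_add_point C : #|pts C| = 2 * cp_genus C + 1 -> completion C = add_point C.
Proof. by rewrite /completion => E; rewrite ifT //; lia. Qed.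

Lemma completion_even_id C : ~~ odd #|pts C| -> completion C = C.
Proof. by rewrite /completion => /negPf->. Qed.

Lemma two_children_compl C (s : {set pts C}) : cluster_picture C -> child s setT ->
  #|[set s' : {set pts C} | child s' setT]| = 2 -> ~: s \in clusters C.
Proof.
move=> hC sX /eqP/cards2P[a [b [ab E]]].
have [y ys] : exists y, y \notin s.
  by case/childP: sX => _ _ /properP[_ [y _ ys]] _; exists y.
have X1 : 1 < #|[set: pts C]| := child_gt1 hC sX.
have [u uX yu] := child_exists hC (cp_setT hC) X1 (in_setT y).
have us : u != s by apply: contraNneq ys => <-.
have only w : child w setT -> w = s \/ w = u.
  have memE v : child v setT = (v == a) || (v == b) by rewrite -in_set2 -E inE.
  move: sX uX us; rewrite !memE => /orP[]/eqP-> /orP[]/eqP->; rewrite ?eqxx // => _ /orP[]/eqP->; by [left | right].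
suff -> : ~: s = u by case/and4P: uX.
apply/setP => z; rewrite inE; apply/idP/idP => [zs|zu].
  have [w wX zw] := child_exists hC (cp_setT hC) X1 (in_setT z).
  by case: (only w wX) zw zs => -> // ->.
by apply: contra us => zs; apply/eqP; exact: (child_inter hC uX sX zu zs).
Qed.

Lemma split_iso_add_compl C (s : {set pts C}) : s \in clusters C -> split_iso C (add_compl s).
Proof.
by move=> sC; exists id, id; split=> // t; rewrite imset_id is_split_add_compl.
Qed.

(** Move (ii) keeps the splits because, with exactly two children of the whole set, the complement
    of the removed cluster is the other child. Moves (iii) and (iv) relate a picture of odd size to
    its completion. *)
Lemma move_split C C' : cluster_picture C -> cp_move C C' -> split_iso (completion C) (completion C').
Proof.
move=> hC; case=> {C'} [s sX e|s sX s2 ch e|C' e iso|C' e iso].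
- rewrite (completion_id e) completion_id //.
  by apply: split_iso_add_compl; case/and4P: sX.
- rewrite (completion_id e) completion_id //; apply: split_iso_sym.
  have sC : s \in clusters C by case/and4P: sX.
  have cC := two_children_compl hC sX ch; have [x xs] := cp_neq0 hC sC.
  have cC2 : ~: s \in clusters (Picture (clusters C :\ s)).
    by rewrite in_setD1 cC andbT; apply/eqP => /setP/(_ x); rewrite inE xs.
  have eta : Picture (clusters C) = C by case: (C).
  by have := split_iso_add_compl cC2; rewrite /add_compl /= setCK setD1K // eta.
- rewrite (completion_add_point e) completion_even_id; first exact: cp_iso_split.
  by rewrite -(cp_iso_card iso) card_option e; lia.
rewrite (completion_id e) completion_add_point; first exact: split_iso_sym (cp_iso_split iso).
apply: odd_size_genus; have := cp_iso_card iso; rewrite card_option e; lia.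
Qed.

Lemma moves_split C C' : cluster_picture C -> cp_moves C C' ->
  cluster_picture C' /\ split_iso (completion C) (completion C').
Proof.
move=> hC; elim=> [|C1 C2 _ [hC1 iso] mv hC2]; first by split=> //; exact: split_iso_refl.
by split=> //; exact: split_iso_trans iso (move_split hC1 mv).
Qed.

Lemma reach_split C C' : cluster_picture C -> cp_reach C C' ->
  split_iso (completion C) (completion C').
Proof.
move=> hC [C1 m i]; have [_ iso] := moves_split hC m.
exact: split_iso_trans iso (cp_iso_split (completion_iso i)).
Qed.

Lemma cp_equivE C C' : cluster_picture C -> cluster_picture C' ->
  cp_equiv C C' <-> split_iso (completion C) (completion C').
Proof.
move=> hC hC'; split=> [[r|r]|iso]; first exact: reach_split.
  exact/split_iso_sym/reach_split.
by left; exact: split_reach.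
Qed.

(** * Splits of the roots of a BY tree *)

(* [p] is the side of the edge of [d] containing [src d]. *)
Definition is_side (G : graph) (d : half G) (p : pred (vert G)) : Prop :=
  [/\ p (src d), ~~ p (src (opp d))
    & forall e, e != d -> e != opp d -> p (src e) = p (src (opp e))].

Lemma is_side_opp (G : graph) (d : half G) p : involutive (@opp G) ->
  is_side d p -> is_side (opp d) (predC p).
Proof.
move=> oK [p1 p2 p3]; split=> //=; first by rewrite oK negbK.
by move=> e ed eod; rewrite oK in eod; rewrite (p3 e eod ed).
Qed.

Lemma is_side_uniq (G : graph) (d : half G) p q : involutive (@opp G) -> connected G ->
  is_side d p -> is_side d q -> p =1 q.
Proof.
move=> oK [_ conn] [p1 p2 p3] [q1 q2 q3] v.
have /connectP[s pth ->] := conn (src d) v (in_setT _) (in_setT _).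
suff : p (src d) = q (src d) -> p (last (src d) s) = q (last (src d) s) by apply; rewrite p1 q1.
elim: s (src d) pth => //= w s IH u /andP[/existsP[e /and3P[_ /eqP eu /eqP ew]] pth] E.
apply: IH pth _; rewrite -ew -eu in E *.
have [->|ed] := eqVneq e d; first by rewrite (negPf p2) (negPf q2).
have [->|eod] := eqVneq e (opp d); first by rewrite oK p1 q1.
by rewrite -p3 // -q3.
Qed.

(** Such partitions are splits of every picture, whether or not an edge of the tree effects them, so
    they are treated apart. *)
Definition small (X : finType) (s : {set X}) : bool := (#|s| <= 1) || (#|~: s| <= 1).

Lemma small_bij (X Y : finType) (h : X -> Y) k (s : {set X}) : cancel h k -> cancel k h ->
  small (h @: s) = small s.
Proof. by move=> hK kH; rewrite /small -(imset_bijC hK kH) !card_imset //; exact: can_inj hK. Qed.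

Lemma smallC (X : finType) (s : {set X}) : small (~: s) = small s.
Proof. by rewrite /small setCK orbC. Qed.

Lemma small1 (X : finType) (x : X) : small [set x].
Proof. by rewrite /small cards1. Qed.

Lemma smallT (X : finType) : small [set: X].
Proof. by rewrite /small setCT cards0 orbT. Qed.

Lemma small_split C (s : {set pts C}) : cluster_picture C -> small s -> is_split s.
Proof.
move=> hD; have le1 (t : {set pts C}) : #|t| <= 1 -> (t \in clusters C) || (t == set0).
  case: (posnP #|t|) => [/cards0_eq->|t0 t1]; first by rewrite eqxx orbT.
  by have /cards1P[x ->] : #|t| == 1 by [rewrite eqn_leq t1]; rewrite (cp_set1 hD).
rewrite /is_split; case/orP=> /le1/orP[->|/eqP E]; rewrite ?orbT //.
  by rewrite E setC0 (cp_setT hD) orbT.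
by rewrite -[s]setCK E setC0 (cp_setT hD).
Qed.

Definition tree_split (K : bytree) (s : {set root_type K}) : Prop :=
  small s \/ exists (d : half K) (p : pred (vert K)),
    [/\ ~~ is_open d, is_side d p & s = [set x | p (home x)]].

Definition tree_split_iso (K K' : bytree) : Prop :=
  exists (h : root_type K -> root_type K') (k : root_type K' -> root_type K),
    [/\ cancel h k, cancel k h
      & forall s : {set root_type K}, tree_split (h @: s) <-> tree_split s].

Lemma by_iso_tree_split (K K' : bytree) : by_iso K K' -> tree_split_iso K K'.
Proof.
move=> [f [fH iso]]; have wf v := weight_iso_on v iso.
have [[[g fK gK] [gH fHK gHK]] sE oE _ _] := iso.
have [|h [k hK kH] hE] := @fibre_bijection (root_type K) (root_type K') (vert K') (f \o @home K) (@home K').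
  move=> v; rewrite card_home -(gK v) wf -card_home; apply: eq_card => x.
  by rewrite !inE /= (inj_eq (can_inj fK)).
exists h, k; split=> // s; rewrite /tree_split (small_bij _ hK kH); split.
  case=> [|[d [p [nop [p1 p2 p3] E]]]]; [by left | right].
  exists (gH d), (p \o f); split.
  - by rewrite /is_open -(inj_eq (can_inj fHK)) -oE !gHK.
  - split=> /=; rewrite -?sE -?oE ?gHK // => e ed eod; rewrite -!sE -oE; apply: p3.
      by apply: contraNneq ed => <-; rewrite fHK.
    by apply: contraNneq eod => E'; rewrite -(inj_eq (can_inj fHK)) -oE gHK E'.
  by apply/setP => x; move/setP: E => /(_ (h x)); rewrite mem_imset ?inE ?hE //; exact: can_inj hK.
case=> [|[d [p [nop [p1 p2 p3] E]]]]; [by left | right].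
exists (fH d), (p \o g); split.
- by rewrite /is_open oE (inj_eq (can_inj fHK)).
- split=> /=; rewrite ?oE ?sE ?fK // => e ed eod.
  rewrite -(gHK e) oE !sE !fK; apply: p3.
    by apply: contraNneq ed => <-; rewrite gHK.
  by apply: contraNneq eod => E'; rewrite -E' gHK.
apply/setP => y; rewrite -[y]kH mem_imset; last exact: can_inj hK.
by rewrite E !inE /= hE fK.
Qed.

Section RootedSides.

Variables (T : bytree) (r : vert T) (up : vert T -> half T) (rk : vert T -> nat).
Hypotheses (rt : orooted r up rk) (oT : open_by T).

Local Notation par := (parent up).
Local Notation anc := (ancestor up).

Lemma anc_side v : v != r -> is_side (up v) (anc ^~ v).
Proof.
move=> vr; split; rewrite /= ?(or_src rt) ?anc_refl //.
  exact: (anc_below_neq rt vr erefl).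
move=> e eu eou.
have step w : w != v -> anc w v = anc (par w) v by move=> wv; rewrite (anc_step up) (negPf wv).
case: (or_up rt e) => E.
  have ne : src e != v by apply: contraNneq eu => <-; rewrite -E.
  by rewrite (step _ ne) /parent -E.
have ne : src (opp e) != v.
  by apply: contraNneq eou => <-; rewrite -E (or_oppK rt).
by rewrite [RHS](step _ ne) /parent -E (or_oppK rt).
Qed.

Lemma nonopen_up (d : half T) : ~~ is_open d ->
  exists2 v, v != r & d = up v \/ opp d = up v.
Proof.
move=> nop; case: (or_up rt d) => E.
  by exists (src d); [rewrite -(up_open rt) -E | left].
exists (src (opp d)); last by right.
by rewrite -(up_open rt) -E (is_open_opp (or_oppK rt)).
Qed.

(** [D] will be the completed picture; its additional point, present when the open edge is blue, is
    placed at the root. *)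
Definition homes (D : picture) (hm : pts D -> vert T) : Prop :=
  (forall v, #|[set x | hm x == v]| = weight v + ((v == r) && blueH (up r))) /\
  forall s : {set pts D}, is_split s <-> small s \/
    exists2 v, v != r & s = [set x | anc (hm x) v] \/ ~: s = [set x | anc (hm x) v].

Let hC := C_of_T_picture rt oT.

Let reduce C (hm : pts C -> vert T) : cluster_picture C ->
    (forall s, s \in clusters C -> small s \/ exists2 v, v != r & s = [set x | anc (hm x) v]) ->
    (forall v, v != r -> [set x | anc (hm x) v] \in clusters C) ->
  forall s, @is_split C s <-> small s \/
    exists2 v, v != r & s = [set x | anc (hm x) v] \/ ~: s = [set x | anc (hm x) v].
Proof.
move=> hD h1 h2 s; split.
  by case/orP=> /h1; rewrite ?smallC => -[sm|[v vr E]]; [left | right; exists v; auto | left | right; exists v; auto].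
case=> [|[v vr [E|E]]]; first exact: small_split.
  by rewrite /is_split E h2.
by rewrite /is_split E h2 ?orbT.
Qed.

Lemma even_homes : ~~ blueH (up r) -> homes (D := C_of_T T) (@home T).
Proof.
move=> /negPf b; split=> [v|]; first by rewrite card_home b andbF addn0.
apply: reduce hC _ _.
  move=> s /setUP[/imsetP[v _ ->]|/imsetP[x _ ->]]; last by left; exact: small1.
  have [->|vr] := eqVneq v r; [left | right].
    rewrite (_ : cluster_at r = setT) ?smallT //.
    by apply/setP => x; rewrite (mem_cluster_at rt) (anc_root rt) inE.
  by exists v => //; apply/setP => x; rewrite (mem_cluster_at rt) inE.
move=> v _; apply/setUP; left; apply/imsetP; exists v => //.
by apply/setP => x; rewrite (mem_cluster_at rt) inE.
Qed.

Lemma odd_homes : blueH (up r) -> homes (D := add_point (C_of_T T)) (oapp (@home T) r).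
Proof.
move=> b; split.
  move=> v; rewrite b andbT -card_home -[in RHS](card_imset _ (@Some_inj _)).
  rewrite [LHS](cardsD1 None) inE [v == r]eq_sym [RHS]addnC; congr (_ + _); apply: eq_card => -[x|]; rewrite !inE.
    by rewrite mem_imset ?inE //; exact: Some_inj.
  by apply/esym/imsetP => -[].
have cluster_Some v : v != r -> [set x | anc (oapp (@home T) r x) v] = Some @: (cluster_at v).
  move=> vr; apply/setP => -[x|]; rewrite inE /=.
    by rewrite mem_imset ?(mem_cluster_at rt) //; exact: Some_inj.
  by rewrite (anc_of_root rt) (negPf vr); apply/esym/imsetP => -[].
apply: reduce (add_point_picture hC) _ _.
  move=> s; rewrite in_setU => /orP[/imsetP[t]|]; last first.
    by rewrite in_set2 => /orP[] /eqP->; left; rewrite ?smallT ?small1.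
  case/setUP=> [/imsetP[v _ ->]|/imsetP[x _ ->]] ->; last by left; rewrite imset_set1 small1.
  have [->|vr] := eqVneq v r; [left | right]; last by exists v; rewrite // cluster_Some.
  rewrite -smallC (_ : ~: _ = [set None]) ?small1 //; apply/setP => -[x|]; rewrite !inE.
    by rewrite mem_imset ?(mem_cluster_at rt) ?(anc_root rt) //; exact: Some_inj.
  by apply/imsetP => -[].
move=> v vr; rewrite cluster_Some //; apply/setUP; left; apply/imsetP; exists (cluster_at v) => //.
by apply/setUP; left; apply/imsetP; exists v.
Qed.

Lemma completion_homes : exists hm, homes (D := completion (C_of_T T)) hm.
Proof.
have oX : odd #|root_type T| = blueH (up r).
  by rewrite -(csize_root rt) (csize_odd rt oT).
rewrite /completion /= oX; case: ifP => [b|/negbT b].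
  by eexists; exact: odd_homes.
by eexists; exact: even_homes.
Qed.

End RootedSides.

Section CoreSplits.

Variables (T : bytree) (r : vert T) (up : vert T -> half T) (rk : vert T -> nat).
Hypotheses (rt : orooted r up rk) (oT : open_by T).

Local Notation par := (parent up).
Local Notation anc := (ancestor up).
Local Notation core := (core r up).
Local Notation coreH := (coreH r up).
Local Notation special := (special r up).
Local Notation dropped := (dropped r up).
Local Notation K := (by_sub core).

Let oK := or_oppK rt.

Lemma core_half_in (d : half K) : val d \in coreH /\ by_kept core (src (val d)).
Proof. by have /andP[] := valP d. Qed.

(** Only the edge of the core through the smoothed root needs an argument: it consists of two edges
    of [T], of which a side cuts at most one. *)
Lemma core_side (d : half K) p : is_side (val d) p -> is_side d (fun v : vert K => p (val v)).
Proof.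
move=> [p1 p2 p3]; have oE := core_oppE rt oT.
have KK := by_oppK (core_wf rt oT).
have kept_r : dropped -> by_kept core r = false by rewrite (keptE rt oT) eqxx => ->.
have srcE (e : half K) : val (src e) = src (val e) by [].
split; first exact: p1.
  have [dH kd] := core_half_in d; rewrite srcE oE.
  rewrite /core_opp; case: ifP => [/andP[dr /eqP sr]|_] //.
  have [_ eH er ene _] := core_through rt dH dr sr.
  rewrite -p3 ?er -?sr //; apply: contraTneq kd => E.
  by rewrite -E er kept_r.
move=> e ed eod; have [eH ke] := core_half_in e; have [dH kd] := core_half_in d.
rewrite !srcE oE.
have n1 : val e != val d by rewrite (inj_eq val_inj).
have n2 : val e != opp (val d).
  apply: contraNneq eod => E; apply/eqP/val_inj; rewrite oE /core_opp.
  case: ifP => // /andP[dr]; rewrite -E => /eqP sr.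
  by move: ke; rewrite sr kept_r.
rewrite /core_opp; case: ifP => [/andP[dr /eqP sr]|_]; last exact: p3.
have [_ fH fr fne fK] := core_through rt eH dr sr.
set f := other_half core (opp (val e)) in fH fr fne fK *.
rewrite [LHS]p3 // sr -fr p3 //.
  by apply: contraTneq kd => <-; rewrite fr kept_r.
apply: contraNneq eod => E; apply/eqP; rewrite -[e]KK; congr opp; apply: val_inj.
by rewrite oE /core_opp dr sr eqxx /= -/f E oK.
Qed.

(** A removable blue root has genus 0 and two blue edges in the core, so [by_cond3] excludes a
    third; the other cases are immediate. Hence the point at infinity, if there is one, sits at a
    vertex of the core. *)
Lemma dropped_yellow : dropped -> ~~ blueH (up r).
Proof.
case/orP=> [/and5P[_ _ //]|rem].
have nsp := removable_nspecial rem; have deg := degree_root rt nsp.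
move: rem => /and3P[/eqP g0 /eqP deg2 /forall_inP col]; rewrite deg2 in deg.
have [br|yr] := boolP (blueV r); last first.
  by have [_ _ yel] := oT_c1 oT yr; apply: yel; rewrite (or_src rt).
apply/negP => bu; have := oT_c3 oT r; rewrite g0 leqNgt => /negP; apply.
rewrite (_ : _.+1 = degree r); last by rewrite deg.
apply/subset_leq_card/subsetP => d; rewrite !inE => /eqP dr; rewrite dr eqxx /=.
have [->//|du] := eqVneq d (up r).
have dH : d \in core.2 by rewrite (nspecial_core _ nsp) (or_open rt).
by have := col d dH; rewrite dr eqxx br => /eqP.
Qed.

(** [k] says where the points of the picture go in the core. They stay at kept vertices; in the
    special case the point at [r] moves across the deleted blue edge. If [r] is smoothed it carries
    no point, by [dropped_weight], and its image is arbitrary. *)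
Lemma core_home : exists k : vert T -> vert K,
  (forall v, by_kept core v -> val (k v) = v) /\
  (special -> exists d, [/\ src d = r, blueH d, ~~ is_open d, val (k r) = src (opp d)
    & forall d', src d' = r -> d' = up r \/ d' = d]).
Proof.
have [w0 w0P] : exists w0 : vert K, special -> exists d,
    [/\ src d = r, blueH d, ~~ is_open d, val w0 = src (opp d)
      & forall d', src d' = r -> d' = up r \/ d' = d].
  have [sp|nsp] := boolP special; last by have [r' _] := core_root rt oT; exists r'.
  have [d [dr bd nop dr']] := specialP rt sp.
  have P : by_kept core (src (opp d)).
    by rewrite (keptE rt oT) negb_and -dr (noloop rt nop) orbT.
  by exists (Sub (src (opp d)) P) => _; exists d.
exists (fun v => insubd w0 v); split=> [v kv|sp].
  by rewrite insubdK.
have [d [dr bd nop E u]] := w0P sp; exists d; split=> //.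
by rewrite /insubd insubN //= (keptE rt oT) eqxx andbT negbK /dropped sp.
Qed.

Lemma core_blue_degree (v : vert K) : blue_degree (val v) =
  blue_degree v + #|[set d | [&& src d == val v, blueH d & d \notin coreH]]|.
Proof.
have -> : blue_degree v = #|[set d | [&& src d == val v, blueH d & d \in coreH]]|.
  rewrite /blue_degree -(card_imset _ val_inj); apply: eq_card => d.
  rewrite inE; apply/imsetP/and3P => [[e]|[/eqP dv bd dH]].
    rewrite inE => /andP[/eqP <- be] ->; split=> //.
    by have [] := core_half_in e.
  have P : (d \in core.2) && by_kept core (src d) by rewrite dH dv (valP v).
  exists (Sub d P : half K) => //; rewrite inE; apply/andP; split=> //; apply/eqP/val_inj; exact: dv.
rewrite /blue_degree; move: {v}(val v) coreH => v H; rewrite -(cardsID H).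
by congr (_ + _); apply: eq_card => d; rewrite !inE; case: (d \in H); rewrite /= ?andbT ?andbF.
Qed.

(** A dropped root has genus 0, so if blue it has two places. In the special case its one blue
    half-edge leaves one free; if it is blue and smoothed, both are taken. *)
Lemma dropped_weight : dropped -> weight r = special.
Proof.
move=> drop; have [sp|nsp] := boolP special.
  have [d [dr bd nop u]] := specialP rt sp; have /and5P[br /eqP g0 yu _ _] := sp.
  rewrite /weight br /roots_at g0 (_ : blue_degree r = 1) // -(cards1 d).
  apply: eq_card => e; rewrite !inE; apply/andP/eqP => [[/eqP er be]|->]; last by rewrite dr.
  by case: (u e er) => // E'; move: yu; rewrite -E' be.
move: drop; rewrite /dropped (negPf nsp) /= => rem.
have deg := degree_root rt nsp; have := dropped_yellow; rewrite /dropped rem orbT => /(_ isT) yu.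
move: rem => /and3P[/eqP g0 /eqP deg2 /forall_inP col]; rewrite /weight /roots_at g0.
case: ifP => // br; apply/eqP; rewrite subn_eq0 /= muln0 add0n -deg2.
apply/subset_leq_card/subsetP => d; rewrite inE => /andP[dH dr]; rewrite inE dr /=.
by have := col d dH; rewrite dr br => /eqP.
Qed.

(** Each blue half-edge lost by a vertex frees a place for one root. If it belonged to the deleted
    edge, the place goes to the point formerly at [r]; if it was the open edge, to the point at
    infinity. *)
Lemma core_weight (k : vert T -> vert K) :
  (forall v, by_kept core v -> val (k v) = v) ->
  (special -> exists d, [/\ src d = r, blueH d, ~~ is_open d, val (k r) = src (opp d)
    & forall d', src d' = r -> d' = up r \/ d' = d]) ->
  forall v : vert K, weight v =
    #|[set x : root_type T | k (home x) == v]| + ((val v == r) && blueH (up r)).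
Proof.
move=> k1 k2 v.
have kP := valP v; have k1v : k (val v) = v by apply: val_inj; rewrite k1.
have -> : #|[set x : root_type T | k (home x) == v]| = weight (val v) + (special && (k r == v)).
  have sub : [set x : root_type T | home x == val v] \subset [set x | k (home x) == v].
    by apply/subsetP => x; rewrite !inE => /eqP->; rewrite k1v.
  rewrite -(cardsID [set x | home x == val v]) (setIidPr sub) card_home; congr (_ + _).
  have E : [set x | k (home x) == v] :\: [set x | home x == val v] =
      [set x | [&& home x == r, home x != val v & k r == v]].
    apply/setP => x; rewrite !inE andbC; have [->|xr] /= := eqVneq (home x) r.
      by rewrite andbC.
    by rewrite -(inj_eq val_inj) k1 ?andbN // (keptE rt oT) (negPf xr) andbF.
  rewrite E; have [drop|ndrop] := boolP dropped; last first.
    rewrite (_ : [set x | _] = set0).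
      by rewrite cards0; move: ndrop; rewrite negb_or => /andP[/negPf-> _].
    apply/setP => x; rewrite !inE; apply/and3P => -[/eqP -> rv /eqP E'].
    by move: rv; rewrite -E' k1 ?eqxx // (keptE rt oT) (negPf ndrop).
  have vr : r != val v by move: kP; rewrite (keptE rt oT) drop eq_sym.
  have -> : #|[set x | [&& home x == r, home x != val v & k r == v]]| = weight r * (k r == v).
    rewrite -card_home; have [kr|kr] := eqVneq (k r) v.
      rewrite muln1; apply: eq_card => x; rewrite !inE andbT.
      by have [->|//] := eqVneq (home x) r.
    rewrite muln0; apply/eqP; rewrite cards_eq0; apply/eqP/setP => x; rewrite !inE.
    by rewrite !andbF.
  by rewrite (dropped_weight drop); case: special; case: (k r == v).
have bd := core_blue_degree v.
have -> : weight v = weight (val v) + #|[set d | [&& src d == val v, blueH d & d \notin coreH]]|.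
  rewrite /weight /=; case: ifP => [bv|/negbT yv].
    have := oT_c3 oT (val v); rewrite /roots_at bd /=.
    by move: (blue_degree v) (#|_|) (by_gen _) => a b c; rewrite -/(@by_gen K v); lia.
  apply/esym/eqP; rewrite cards_eq0; apply/eqP/setP => d; rewrite [RHS]inE; apply/negP; rewrite inE.
  case/and3P=> /eqP dv b _; have := blue_src (oT_c1 oT) b; rewrite dv => bv.
  by move: yv; rewrite bv.
rewrite -!addnA; congr (_ + _).
have [sp|nsp] := boolP special.
  have [d [dr bd' nop kr u]] := k2 sp; have /and5P[br /eqP g0 yu _ _] := sp.
  have vr : val v != r by move: kP; rewrite (keptE rt oT) /dropped sp.
  rewrite (negPf vr) addn0 /=.
  have -> : [set e | [&& src e == val v, blueH e & e \notin coreH]] =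
      if k r == v then [set opp d] else set0.
    apply/setP => e; transitivity ((e == opp d) && (k r == v)); last by case: ifP; rewrite !inE ?andbT ?andbF.
    rewrite inE; apply/and3P/andP => [[/eqP ev be]|[/eqP-> /eqP kv]].
      have nope : ~~ is_open e by apply: contra vr; rewrite (or_open rt) -ev => /eqP->; rewrite (or_src rt).
      rewrite !inE nope ev sp /= vr /= negbK => /eqP er.
      have [oE|oE] := u _ er; last by rewrite -oE oK eqxx -(inj_eq val_inj) kr -oE oK ev.
      by move: nope; rewrite -(is_open_opp oK) oE (up_open rt) eqxx.
    rewrite -kv kr (by_bopp (oT_wf oT)) bd'; split=> //.
    by rewrite !inE oK dr eqxx sp /= !andbF.
  by case: ifP; rewrite ?cards1 ?cards0.
rewrite add0n; transitivity #|(if (val v == r) && blueH (up r) then [set up r] else set0)|; last first.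
  by case: ifP; rewrite ?cards1 ?cards0.
congr #|pred_of_set _|; apply/setP => d.
transitivity ((d == up r) && ((val v == r) && blueH (up r))); last by case: ifP; rewrite !inE ?andbT ?andbF.
rewrite inE (nspecial_core _ nsp) negbK (or_open rt).
by have [->|] := eqVneq d (up r); rewrite ?andbF ?andbT //= (or_src rt) eq_sym.
Qed.

(** A vertex moved by [k] carries a point only in the special case, and then it moves across the
    deleted edge, which no half-edge of the core represents. *)
Lemma core_home_side (k : vert T -> vert K) :
  (forall v, by_kept core v -> val (k v) = v) ->
  (special -> exists d, [/\ src d = r, blueH d, ~~ is_open d, val (k r) = src (opp d)
    & forall d', src d' = r -> d' = up r \/ d' = d]) ->
  forall (d : half K) q u, is_side (val d) q ->
  0 < weight u + ((u == r) && blueH (up r)) -> q (val (k u)) = q u.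
Proof.
move=> k1 k2 d q u [_ _ q3]; have [ku _|] := boolP (by_kept core u); first by rewrite k1.
rewrite (keptE rt oT) negbK => /andP[dr /eqP ->].
rewrite (dropped_weight dr) eqxx (negPf (dropped_yellow dr)) addn0 lt0b => sp.
have [e [er be nop -> _]] := k2 sp; rewrite -q3 ?er //.
  apply: contraTneq dr => E; have [dH kd] := core_half_in d.
  by move: kd; rewrite -E er (keptE rt oT) eqxx andbT.
have [dH kd] := core_half_in d; apply: contraTneq dH => E.
by rewrite inE; apply/negP => /and3P[_ _]; rewrite -E inE sp er eqxx.
Qed.

End CoreSplits.

Section SplitsMatch.

Variables (T : bytree) (r : vert T) (up : vert T -> half T).

Local Notation par := (parent up).
Local Notation anc := (ancestor up).

Variables (D : picture) (hm : pts D -> vert T).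
Hypothesis hmP : homes r up hm.
Variables (K : bytree) (k : vert T -> vert K).
Hypotheses (oK : involutive (@opp K)) (cK : connected K).
Hypothesis weightK : forall v : vert K, weight v =
  #|[set x : root_type T | k (home x) == v]| + ((k r == v) && blueH (up r)).

Local Notation inhabited_at u := (0 < weight u + ((u == r) && blueH (up r))).

Hypothesis sideK : forall v, v != r ->
  (exists (d : half K) (p : pred (vert K)), [/\ ~~ is_open d, is_side d p
    & forall u, inhabited_at u -> p (k u) = anc u v])
  \/ (forall u, ~~ anc u v -> u = r) /\ weight r + blueH (up r) <= 1.
Hypothesis Kside : forall d : half K, exists2 v, v != r & exists2 p : pred (vert K), is_side d p
  & (forall u, inhabited_at u -> p (k u) = anc u v) \/
    (forall u, inhabited_at u -> p (k u) = ~~ anc u v).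

(** Applied to the core of [T] and again, with [k] the identity, to a tree to which an open edge is
    attached. [sideK] and [Kside] translate the edges of [T] and of [K] into each other as far as
    points see them. An edge of [T] without counterpart leaves at most one point on one side, so its
    split is small. *)
Lemma splits_match : exists (h : pts D -> root_type K) (g : root_type K -> pts D),
  [/\ cancel h g, cancel g h, forall x, home (h x) = k (hm x)
    & forall s : {set pts D}, tree_split (h @: s) <-> is_split s].
Proof.
have [hm1 hm2] := hmP.
have cards (A : finType) (f : A -> vert T) w :
    #|[set x | k (f x) == w]| = \sum_(u | k u == w) #|[set x | f x == u]|.
  rewrite -sum1_card (partition_big f (fun u => k u == w)) => [|x]; last by rewrite inE.
  apply: eq_bigr => u /eqP uw; rewrite -sum1_card; apply: eq_bigl => x.
  by rewrite !inE; case: (f x =P u) => [->|]; rewrite ?uw ?eqxx ?andbF.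
have [|h [g hK gK] hE] := @fibre_bijection (pts D) (root_type K) (vert K) (k \o hm) (@home K).
  move=> w; rewrite card_home weightK !cards.
  under eq_bigr => u _ do rewrite hm1; rewrite big_split /=; congr (_ + _).
    by apply: eq_bigr => u _; rewrite card_home.
  have [kr|kr] := eqVneq (k r) w.
    rewrite (bigD1 r) /= ?kr ?eqxx // big1 ?addn0 // => u /andP[_ /negPf->] //.
  rewrite big1 // => u /eqP uw; case: (u =P r) => // ur.
  by move: kr; rewrite -ur uw eqxx.
have inh x : inhabited_at (hm x).
  by rewrite -hm1; apply/card_gt0P; exists x; rewrite inE.
exists h, g; split=> // s.
have pre (t : {set pts D}) (p : pred (vert K)) (q : pred (vert T)) :
    (forall u, inhabited_at u -> p (k u) = q u) ->
    (h @: t = [set y | p (home y)]) <-> t = [set x | q (hm x)].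
  move=> pq; split=> [E|->]; apply/setP => x.
    by rewrite -(mem_imset _ _ (can_inj hK)) E !inE hE /= pq.
  by rewrite -(gK x) mem_imset ?inE ?hE /= ?pq //; exact: can_inj hK.
rewrite /tree_split (small_bij _ hK gK) hm2; split.
  case=> [|[d [p [nop sd E]]]]; [by left | right].
  have [v vr [p2 sd2 side]] := Kside d; exists v => //.
  have pp2 := is_side_uniq oK cK sd sd2; case: side => side.
    by left; apply: (pre s p (anc ^~ v) _).1 => // u iu; rewrite pp2 side.
  right; have -> : s = [set x | ~~ anc (hm x) v].
    by apply: (pre s p (fun u => ~~ anc u v) _).1 => // u iu; rewrite pp2 side.
  by apply/setP => x; rewrite !inE negbK.
case=> [|[v vr sv]]; first by left.
have [[d [p [nop sd side]]]|[only le1]] := sideK vr.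
  right; case: sv => sv.
    by exists d, p; split=> //; apply: (pre s p (anc ^~ v) side).2.
  exists (opp d), (predC p); split; [by rewrite (is_open_opp oK) | exact: is_side_opp|].
  apply: (pre s (predC p) (fun u => ~~ anc u v) _).2 => [u iu|]; first by rewrite /= side.
  by rewrite -[s]setCK sv; apply/setP => x; rewrite !inE.
left; suff sm : small [set x | anc (hm x) v] by case: sv => [->//|sv]; rewrite -smallC sv.
rewrite -smallC /small; apply/orP; left; apply: leq_trans le1.
have -> : blueH (up r) = (r == r) && blueH (up r) :> nat by rewrite eqxx.
rewrite -hm1; apply/subset_leq_card/subsetP => x; rewrite !inE.
by move=> /only->.
Qed.

End SplitsMatch.

Lemma core_splits (T : bytree) r up rk : @orooted T r up rk -> open_by T ->
  exists (h : pts (completion (C_of_T T)) -> root_type (by_sub (core r up))) g,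
  [/\ cancel h g, cancel g h & forall s : {set pts (completion (C_of_T T))}, tree_split (h @: s) <-> is_split s].
Proof.
move=> rt oT; have [hm hmP] := completion_homes rt oT.
have [k [k1 k2]] := core_home rt oT.
have tK := core_tree rt oT; have wK := core_wf rt oT.
have [|||h [g [hK gK _ hS]]] := @splits_match T r up _ hm hmP _ k (by_oppK wK) tK.1; last by exists h, g.
- move=> v; rewrite (core_weight rt oT k1 k2); congr (_ + _).
  have [b|] := boolP (blueH (up r)); last by rewrite !andbF.
  rewrite !andbT -(inj_eq val_inj) k1 1?eq_sym // (keptE rt oT) eqxx andbT.
  by apply: contraL b; exact: (dropped_yellow rt oT).
(* The edge below a special root is the deleted one. All vertices other than [r] lie beyond it, and
   [r] carries just one point. *)
- move=> v vr; have [/andP[sp /eqP pv]|nspv] := boolP (special r up && (parent up v == r)).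
    right; have dr : dropped r up by rewrite /dropped sp.
    rewrite (dropped_weight rt oT dr) sp (negPf (dropped_yellow rt oT dr)); split=> // u.
    apply: contraNeq => ur; have [c [cr pc uc]] := anc_child rt (anc_root rt u) ur.
    have [d [_ _ _ uq]] := specialP rt sp.
    have at_r w : w != r -> parent up w = r -> opp (up w) = d.
      move=> wr pw; case: (uq _ pw) => // E.
      by move: (up_open rt r); rewrite -E (is_open_opp (or_oppK rt)) (up_open rt) (negPf wr) eqxx.
    suff -> : v = c by [].
    by apply: (up_inj rt); rewrite -[up v](or_oppK rt) -[up c](or_oppK rt) (at_r c) ?(at_r v).
  left; have upH : up v \in coreH r up.
    rewrite !inE (up_open rt) vr (or_src rt) (negPf vr) andbF /=.
    by move: nspv; rewrite /parent.
  have P : (up v \in (core r up).2) && by_kept (core r up) (src (up v)).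
    by rewrite upH (or_src rt) (keptE rt oT) (negPf vr) andbF.
  pose d : half (by_sub (core r up)) := Sub (up v) P; have sd : is_side (val d) (ancestor up ^~ v) := anc_side rt vr.
  exists d, (fun w : vert (by_sub (core r up)) => ancestor up (val w) v); split.
  + exact: core_nopen rt oT d.
  + exact: (core_side rt oT sd).
  by move=> u iu; exact: (core_home_side rt oT k1 k2 sd iu).
move=> d; have [dH kd] := core_half_in d.
have [v vr E] := nonopen_up rt (coreH_nonopen dH); exists v => //; case: E => E.
  have sd : is_side (val d) (ancestor up ^~ v) by rewrite E; exact: (anc_side rt vr).
  exists (fun w : vert (by_sub (core r up)) => ancestor up (val w) v); first exact: (core_side rt oT sd).
  by left=> u iu; exact: (core_home_side rt oT k1 k2 sd iu).
have sd : is_side (val d) (predC (ancestor up ^~ v)).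
  by rewrite -[val d](or_oppK rt) E; apply: is_side_opp (or_oppK rt) _; exact: (anc_side rt vr).
exists (fun w : vert (by_sub (core r up)) => ~~ ancestor up (val w) v); first exact: (core_side rt oT sd).
by right=> u iu; exact: (core_home_side rt oT k1 k2 sd iu).
Qed.

Lemma by_equiv_split (T T' : bytree) : open_by T -> open_by T' -> by_equiv T T' ->
  split_iso (completion (C_of_T T)) (completion (C_of_T T')).
Proof.
move=> oT oT' eqv; have [r [up [rk rt]]] := open_by_rooted oT.
have [r' [up' [rk' rt']]] := open_by_rooted oT'.
have [f [f' [fK fK' fS]]] := by_iso_tree_split ((by_equivE rt oT rt' oT').1 eqv).
have [h [g [hK gK hS]]] := core_splits rt oT; have [h' [g' [hK' gK' hS']]] := core_splits rt' oT'.
exists (g' \o f \o h), (g \o f' \o h'); split=> [x|x|s].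
- by rewrite /= gK' fK hK.
- by rewrite /= gK fK' hK'.
have E : h' @: ((g' \o f \o h) @: s) = f @: (h @: s).
  by rewrite -!imset_comp; apply: eq_imset => x; rewrite /= gK'.
apply/idP/idP => sp.
  by apply: (hS s).1; apply: (fS _).1; rewrite -E; exact: (hS' _).2.
by apply: (hS' _).1; rewrite E; apply: (fS _).2; exact: (hS _).2.
Qed.

Lemma option_bij (A B : finType) (h : option A -> option B) g : cancel h g -> cancel g h ->
  h None = None -> exists (f : A -> B) (f' : B -> A),
  [/\ cancel f f', cancel f' f & forall a, h (Some a) = Some (f a)].
Proof.
move=> hK gK hN; have gN : g None = None by rewrite -hN hK.
have /fin_all_exists[f fE] (a : A) : exists b, h (Some a) = Some b.
  by case E: (h (Some a)) => [b|]; [exists b | have := hK (Some a); rewrite E gN].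
have /fin_all_exists[f' fE'] (b : B) : exists a, g (Some b) = Some a.
  by case E: (g (Some b)) => [a|]; [exists a | have := gK (Some b); rewrite E hN].
exists f, f'; split=> // x; apply: Some_inj.
  by rewrite -fE' -fE hK.
by rewrite -fE -fE' gK.
Qed.

(** A split of the completion is recorded as a cluster by its side away from the point [None] at
    infinity. So the splits, with this point marked, give back the picture. *)
Lemma is_split_Some C (t : {set pts C}) : cluster_picture C -> t != set0 ->
  @is_split (add_point C) (Some @: t) = (t \in clusters C).
Proof.
move=> hC t0; rewrite /is_split !add_point_cluster Some_preimset None_notin.
rewrite !in_setC None_notin /= orbF.
have -> : (Some @: t == setT) = false.
  by apply/eqP => /setP/(_ None); rewrite (negPf (None_notin _)) inE.
have -> : (Some @: t == [set None]) = false.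
  by apply/eqP => /setP/(_ None); rewrite (negPf (None_notin _)) inE eqxx.
have -> /= : (~: (Some @: t) == setT) = false.
  by rewrite -setC0 (inj_eq (@setC_inj _)) imset_eq0 (negPf t0).
have [tC|tC] //= := boolP (t \in clusters C); apply/negbTE/eqP => E.
case/negP: tC; suff -> : t = setT by exact: cp_setT hC.
apply/setP => x; move/setP: E => /(_ (Some x)); rewrite !inE mem_imset; last exact: Some_inj.
by move/negbFE.
Qed.

Lemma add_point_split_iso C C' (h : option (pts C) -> option (pts C')) g :
  cluster_picture C -> cluster_picture C' -> cancel h g -> cancel g h -> h None = None ->
  (forall s : {set option (pts C)}, @is_split (add_point C') (h @: s) = @is_split (add_point C) s) ->
  cp_iso C C'.
Proof.
move=> hC hC' hK gK hN hS; have [f [f' [fK fK' fE]]] := option_bij hK gK hN.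
apply/cp_isoP; exists f, f'; split=> // t.
have [->|t0] := eqVneq t set0.
  by rewrite imset0; have [/negPf-> _ _ _] := hC; have [/negPf-> _ _ _] := hC'.
rewrite -(is_split_Some hC t0) -hS -is_split_Some ?imset_eq0 //; congr is_split.
by rewrite -!imset_comp; apply: eq_imset => x; rewrite /= fE.
Qed.

(** * Reconstructing a core from its splits *)

Definition attach_graph (K : graph) (v0 : vert K) : graph :=
  {| vert := vert K; half := option (half K); src := oapp src v0; opp := omap opp |}.

(** The blue open edge takes the place of one root at [v0]. The picture of the new tree has odd
    size, and completing it puts that root back as the point at infinity. *)
Definition attach (K : bytree) (v0 : vert K) : bytree :=
  {| by_graph := attach_graph v0;
     by_gen := fun v : vert (attach_graph v0) => @by_gen K v;
     blueV := fun v : vert (attach_graph v0) => @blueV K v;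
     blueH := fun d : half (attach_graph v0) => oapp (@blueH K) true d |}.

Section Attach.

Variables (K : bytree) (v0 : vert K).
Hypotheses (cK : closed_by K) (w0 : 0 < weight v0).

Local Notation A := (attach v0).

Let wK : by_wf K. Proof. by case: cK => [[]]. Qed.
Let tK : is_tree K. Proof. by case: cK => [[]]. Qed.
Let nopK (d : half K) : ~~ is_open d. Proof. by case: cK. Qed.

Let bv0 : @blueV K v0. Proof. by move: w0; rewrite /weight; case: blueV. Qed.

Let openA (d : half A) : is_open d = (d == None).
Proof.
case: d => [d|] //=; apply/negbTE; have := nopK d; apply: contra => /eqP[E].
by apply/eqP.
Qed.

Let wA : by_wf A.
Proof.
have [oK bK] := wK; split; first by case=> [d|] //=; rewrite oK.
by case=> [d|] //=; rewrite bK.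
Qed.

Lemma attach_blue_degree (v : vert K) : @blue_degree A v = blue_degree v + (v0 == v).
Proof.
rewrite /blue_degree addnC (cardsD1 (None : half A)) inE /= andbT; congr (_ + _).
rewrite -[RHS](card_imset _ (@Some_inj _)); apply: eq_card => -[d|]; rewrite !inE //=.
  by rewrite mem_imset ?inE //; exact: Some_inj.
by apply/esym/imsetP => -[].
Qed.

Lemma attach_weight (v : vert K) : weight v = @weight A v + (v0 == v).
Proof.
rewrite /weight /roots_at attach_blue_degree /=; have [<-|_] := eqVneq v0 v; last by rewrite !addn0.
rewrite bv0; move: w0; rewrite /weight bv0 /roots_at.
by move: (by_gen v0) (blue_degree v0) => a b; lia.
Qed.

Lemma attach_open_by : open_by A.
Proof.
have [_ _ c1 c3 c2] := cK.
split.
- split=> //; have [rk [rkr desc neq uniqu]] := tree_ranked (by_oppK wK) v0 tK.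
  apply: (@ranked_tree A (by_oppK wA) v0 rk); split.
  + by case=> [d|] //= /rkr.
  + by move=> v /desc[d dv lt]; exists (Some d).
  + by case=> [d|]; rewrite ?openA //= => _; apply: neq; exact: nopK.
  + by case=> [d|] [d'|] //=; rewrite ?ltnn // => e1 l1 l2; congr Some; exact: uniqu.
- rewrite (_ : [set d : half A | is_open d] = [set None]) ?cards1 //.
  by apply/setP => d; rewrite !inE openA.
- move=> v yv; have [g0 deg yel] := c1 v yv; split=> //.
    apply: leq_trans deg _; rewrite /degree -(card_imset _ (@Some_inj _)).
    apply/subset_leq_card/subsetP => d /imsetP[e]; rewrite inE => ev ->.
    by rewrite inE.
  case=> [d|] /=; first exact: yel.
  by move=> E; move: yv; rewrite -E /= bv0.
- move=> v; rewrite attach_blue_degree /=; have [<-|_] := eqVneq v0 v; last by rewrite addn0; exact: c3.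
  by move: w0; rewrite /weight bv0 /roots_at subn_gt0 addn1.
case: c2 => [c2|[V1 H0 bg]].
  left=> v bv g0; have [d dv yd] := c2 v bv g0; by exists (Some d).
right; split=> //.
have noH (d : half K) : False by have := card0_eq H0 d; rewrite inE.
split; first by rewrite card_option H0.
by case=> [d|//]; case: (noH d).
Qed.

Lemma attach_rooted : exists up rk, @orooted A v0 up rk /\ up v0 = None.
Proof.
have [r [up [rk rt]]] := open_by_rooted attach_open_by.
have E : up r = None.
  by apply/eqP; rewrite -openA (up_open rt) eqxx.
have rE : r = v0 by rewrite -(or_src rt r) E.
by rewrite rE in rt E; exists up, rk.
Qed.

Lemma attach_splits : exists (h : option (root_type A) -> root_type K) g,
  [/\ cancel h g, cancel g h, home (h None) = v0
    & forall s : {set option (root_type A)},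
        tree_split (h @: s) <-> @is_split (add_point (C_of_T A)) s].
Proof.
have [up [rk [rt up0]]] := attach_rooted; have oA := attach_open_by.
have b0 : @blueH A (up v0) by rewrite up0.
have hm := odd_homes rt oA b0.
have side (d : half K) p : @is_side A (Some d) p -> is_side d p.
  move=> [p1 p2 p3]; split=> // e ed eod.
  by apply: (p3 (Some e)).
have [|||h [g [hK gK hE hS]]] := @splits_match A v0 up _ _ hm K id (by_oppK wK) tK.1; last first.
- by exists h, g; split=> //; exact: (hE None).
- move=> d; have nopd : ~~ @is_open A (Some d) by rewrite openA.
  have [v vr [E|E]] := nonopen_up rt nopd; exists v => //.
    exists (ancestor up ^~ v); last by left.
    by apply: side; rewrite E; exact: (anc_side rt vr).
  exists (predC (ancestor up ^~ v)); last by right.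
  apply: side; rewrite -[Some d](or_oppK rt) E; apply: is_side_opp (or_oppK rt) _.
  exact: (anc_side rt vr).
- move=> v vr; left; have := up_open rt v; rewrite openA (negPf vr).
  have := anc_side rt vr; case: (up v) => // d sd _; exists d, (ancestor up ^~ v); split=> //.
  exact: side.
move=> v; rewrite up0 /= andbT attach_weight -card_home; congr (_ + _).
Qed.

End Attach.

(** The attached half-edge is the only open one, so it is preserved and the isomorphism restricts to
    the rest. *)
Lemma attach_iso (K K' : bytree) (v0 : vert K) (v0' : vert K') : closed_by K -> closed_by K' ->
  by_iso (attach v0) (attach v0') -> by_iso K K'.
Proof.
move=> cK cK' [f [fH [[bf [gH fHK gHK]] sE oE gE [bE bHE]]]].
have fN : fH None = None.
  case E: (fH None) => [d|] //; have := oE None; rewrite /= E => -[od].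
  by have [_ /(_ d)/eqP] := cK'.
have [h [h' [hK hK' hE]]] := option_bij fHK gHK fN.
exists f, h; split=> //.
- by split=> //; exists h'.
- by move=> d; have := sE (Some d); rewrite hE.
- by move=> d; have := oE (Some d); rewrite /= !hE => -[].
by split=> // d; have := bHE (Some d); rewrite hE.
Qed.

(** Two roots at the same vertex lie on the same side of every edge. *)
Lemma tree_split_tperm (K : bytree) (x y : root_type K) (s : {set root_type K}) :
  home x = home y -> tree_split (tperm x y @: s) <-> tree_split s.
Proof.
move=> xy; have tK := @tpermK _ x y.
have ht z : home (tperm x y z) = home z by case: tpermP => [->|->|].
rewrite /tree_split (small_bij _ tK tK).
split; (case=> [sm|[d [p [nop sd E]]]]; [by left | right; exists d, p; split=> //]).
  rewrite -[s](imset_bijK tK) E; apply/setP => z.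
  by rewrite -[z]tK mem_imset ?inE ?ht //; exact: perm_inj.
rewrite E; apply/setP => z; rewrite -[z]tK mem_imset ?inE ?ht //; exact: perm_inj.
Qed.

(** A bijection [H] that respects the splits of the cores need not come from a map of vertices.
    Attaching open edges at the homes of [x0] and [H x0] turns it into a bijection of completed
    pictures that fixes infinity, hence an isomorphism of pictures; [by_cp_bijections] returns an
    isomorphism of trees, from which the open edges are detached. *)
Lemma split_by_equiv (T T' : bytree) : open_by T -> open_by T' ->
  split_iso (completion (C_of_T T)) (completion (C_of_T T')) -> by_equiv T T'.
Proof.
move=> oT oT' [j [j' [jK jK' jS]]]; have [r [up [rk rt]]] := open_by_rooted oT.
have [r' [up' [rk' rt']]] := open_by_rooted oT'.
have [h1 [g1 [hK1 gK1 hS1]]] := core_splits rt oT; have [h2 [g2 [hK2 gK2 hS2]]] := core_splits rt' oT'.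
apply/(by_equivE rt oT rt' oT').
have cK := core_closed_by rt oT; have cK' := core_closed_by rt' oT'.
set K := by_sub _ in h1 g1 hK1 gK1 hS1 cK *; set K' := by_sub _ in h2 g2 hK2 gK2 hS2 cK' *.
pose H := h2 \o j \o g1; pose H' := h1 \o j' \o g2.
have HK : cancel H H' by move=> x; rewrite /H /H' /= hK2 jK gK1.
have HK' : cancel H' H by move=> x; rewrite /H /H' /= hK1 jK' gK2.
have HS (s : {set root_type K}) : tree_split (H @: s) <-> tree_split s.
  have E : H @: s = h2 @: (j @: (g1 @: s)).
    by rewrite -!imset_comp; apply: eq_imset.
  have E1 : h1 @: (g1 @: s) = s := imset_bijK gK1 s.
  rewrite E; split=> sp; last by apply: (hS2 _).2; rewrite jS; apply: (hS1 _).1; rewrite E1.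
  by rewrite -E1; apply: (hS1 _).2; rewrite -jS; exact: (hS2 _).1.
have hC := C_of_T_picture rt oT; have hD := completion_picture hC.
have [y _] := cp_neq0 hD (cp_setT hD); pose x0 := h1 y.
have pos (L : bytree) (x : root_type L) : 0 < weight (home x).
  by rewrite -card_home; apply/card_gt0P; exists x; rewrite inE.
have [a [b [aK bK aN aS]]] := attach_splits cK (pos _ x0).
have [a' [b' [aK' bK' aN' aS']]] := attach_splits cK' (pos _ (H x0)).
set A := attach _ in a b aK bK aN aS; set A' := attach _ in a' b' aK' bK' aN' aS'.
have oA : open_by A := attach_open_by cK (pos _ x0).
have oA' : open_by A' := attach_open_by cK' (pos _ (H x0)).
(* [a None] is only known to have the same home as [x0], and likewise for [a']. Exchanging the two
   roots, harmless by [tree_split_tperm], makes the points at infinity correspond. *)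
pose t := tperm (a None) x0; pose t' := tperm (a' None) (H x0).
have isoC : cp_iso (C_of_T A) (C_of_T A').
  have [[op cp] _ _ _ _] := by_cp_bijections.
  apply: (@add_point_split_iso (C_of_T A) (C_of_T A') (b' \o t' \o H \o t \o a) (b \o t \o H' \o t' \o a')).
  - exact: cp.
  - exact: cp.
  - by move=> x; rewrite /= bK' !tpermK HK !tpermK aK.
  - by move=> x; rewrite /= bK !tpermK HK' !tpermK aK'.
  - by rewrite /= !tpermL tpermR aK'.
  move=> s; have E : a' @: ((b' \o t' \o H \o t \o a) @: s) = t' @: (H @: (t @: (a @: s))).
    by rewrite -!imset_comp; apply: eq_imset => x; rewrite /= bK'.
  have eqv : tree_split (a' @: ((b' \o t' \o H \o t \o a) @: s)) <-> tree_split (a @: s).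
    rewrite E; split=> sp.
      by apply: (tree_split_tperm _ aN).1; apply: (HS _).1; apply: (tree_split_tperm _ aN').1.
    by apply: (tree_split_tperm _ aN').2; apply: (HS _).2; apply: (tree_split_tperm _ aN).2.
  apply/idP/idP => sp.
    by apply: (aS _).1; apply: eqv.1; exact: (aS' _).2.
  by apply: (aS' _).1; apply: eqv.2; exact: (aS _).2.
have isoA : by_iso A A'.
  have [[_ cp] iT _ _ inv] := by_cp_bijections.
  apply: by_iso_trans (by_iso_sym (inv A oA)) (by_iso_trans _ (inv A' oA')).
  by apply: iT isoC; exact: cp.
exact: (attach_iso cK cK' isoA).
Qed.

Lemma by_equiv_splitE (T T' : bytree) : open_by T -> open_by T' ->
  by_equiv T T' <-> cp_equiv (C_of_T T) (C_of_T T').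
Proof.
move=> oT oT'; have [[_ cp] _ _ _ _] := by_cp_bijections.
have eqv := cp_equivE (cp T oT) (cp T' oT').
by split=> [/(by_equiv_split oT oT')/eqv|/eqv/(split_by_equiv oT oT')].
Qed.

Lemma C_of_T_equiv : preserves_equiv open_by by_equiv cp_equiv C_of_T.
Proof. by move=> T T' oT oT'; exact: by_equiv_splitE. Qed.

Lemma T_of_C_equiv : preserves_equiv cluster_picture cp_equiv by_equiv T_of_C.
Proof.
move=> C C' hC hC'; have [[op cp] _ _ inv _] := by_cp_bijections.
have eqv := C_of_T_equiv (op C hC) (op C' hC').
have i := cp_iso_split (completion_iso (inv C hC)); have i' := cp_iso_split (completion_iso (inv C' hC')).
have e := cp_equivE hC hC'; have e' := cp_equivE (cp _ (op C hC)) (cp _ (op C' hC')).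
split=> [/e.1 s|/eqv.1/e'.1 s].
  by apply: eqv.2; apply: e'.2; exact: split_iso_trans i (split_iso_trans s (split_iso_sym i')).
by apply: e.2; exact: split_iso_trans (split_iso_sym i) (split_iso_trans s i').
Qed.

Theorem theorem1p2 :
  [/\ inverse_bijections open_hyp hg_iso open_by by_iso T_of_G G_of_T
      /\ inverse_bijections cluster_picture cp_iso open_by by_iso T_of_C C_of_T,
      preserves_genus open_hyp hg_genus by_genus T_of_G
      /\ preserves_genus open_by by_genus hg_genus G_of_T,
      preserves_genus cluster_picture cp_genus by_genus T_of_C
      /\ preserves_genus open_by by_genus cp_genus C_of_T,
      preserves_equiv open_hyp hg_equiv by_equiv T_of_G
      /\ preserves_equiv open_by by_equiv hg_equiv G_of_T
    & preserves_equiv cluster_picture cp_equiv by_equiv T_of_C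
      /\ preserves_equiv open_by by_equiv cp_equiv C_of_T].
Proof.
split; first exact: (conj hyp_by_bijections by_cp_bijections).
- exact: (conj T_of_G_genus G_of_T_genus).
- exact: (conj T_of_C_genus C_of_T_genus).
- exact: (conj T_of_G_equiv G_of_T_equiv).
exact: (conj T_of_C_equiv C_of_T_equiv).
Qed.
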